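(* Let $1<\beta<2$, $\nu>0$, $T>0$. Let $\mathcal H$ be a $\mathcal C^1$ function on $\mathbb T^2$ and $H(x,p)=\mathcal H(x)+|p|^\beta$ for $x\in\mathbb T^2$, $p\in\mathbb R^2$. Let $u_0$ and $m_T$ be smooth functions on $\mathbb T^2$, with $m_T\in\mathcal K$ bounded from below by a positive number. Let $\Phi$ be a monotone, nonlocal and smoothing operator (as defined in the context), so that there is a unique classical solution $(u,m)$, with $m>0$, of the continuous system $$\frac{\partial u}{\partial t}-\nu\Delta u+H(x,\nabla u)=\Phi[m(t,\cdot)](x),\qquad \frac{\partial m}{\partial t}+\nu\Delta m+\mathrm{div}\Bigl(m\,\frac{\partial H}{\partial p}(x,\nabla u)\Bigr)=0\qquad\text{in }(0,T)\times\mathbb T^2,$$ $$u(0,x)=u_0(x),\qquad m(T,x)=m_T(x)\qquad \text{in }\mathbb T^2.$$ Let $(\Phi_h)_h$ be discrete operators satisfying properties $(\Phi_{h1})$, $(\Phi_{h2})$, $(\Phi_{h3})$, $(\Phi_{h4})$ written out in the context. For each $h$ and $\Delta t$, let $(u^n)_{0\le n\le N_T}$, $(m^n)_{0\le n\le N_T}$ be the solution of the discrete system described in the context (with this $\mathcal H,\beta,\nu,u_0,m_T,\Phi_h$), and let $u_h$ (resp. $m_h$) be the piecewise trilinear function in $\mathcal C([0,T]\times\mathbb T^2)$ obtained by interpolating the values $u^n_{i,j}$ (resp. $m^n_{i,j}$) at the nodes $(t_n,x_{i,j})$ of the space-time grid. Then, as $h$ and $\Delta t$ tend to $0$, the functions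 $u_h$ converge to $u$ uniformly and in $L^2(0,T;W^{1,2}(\mathbb T^2))$, and the functions $m_h$ converge to $m$ in $L^2((0,T)\times\mathbb T^2)$.
   Context: $\mathbb T^2=[0,1]^2$ is the two-dimensional unit torus (all functions are periodic). $\mathcal K$ is the set of probability densities on $\mathbb T^2$: nonnegative integrable $m$ with $\int_{\mathbb T^2}m=1$. Assumptions on $\Phi$. ''Monotone'' means: for all probability measures $m,\tilde m$ on $\mathbb T^2$, $\int(\Phi[m](x)-\Phi[\tilde m](x))(dm(x)-d\tilde m(x))\le 0$ implies $m=\tilde m$. ''Nonlocal and smoothing'' means: $\Phi$ continuously maps the set of probability measures on $\mathbb T^2$ (with the weak * topology) to a bounded subset of the space $Lip(\mathbb T^2)$ of Lipschitz functions, and maps continuously $C^{k,\alpha}(\mathbb T^2)$ to $C^{k+1,\alpha}(\mathbb T^2)$ for all $k\in\mathbb N$, $0\le\alpha<1$. Grid. $N_T, N_h$ are positive integers, $\Delta t=T/N_T$, $t_n=n\Delta t$, $h=1/N_h$; $\mathbb T_h^2$ is the uniform grid on $\mathbb T^2$ with step $h$ and nodes $x_{i,j}=(ih,jh)$, $0\le i,j<N_h$. Grid functions $z=(z_{i,j})$ are extended with indices modulo $N_h$. $(y,z)_2=\sum_{0\le i,j<N_h}y_{i,j}z_{i,j}$. $\mathcal K_h=\{(m_{i,j}):\ h^2\sum_{i,j}m_{i,j}=1,\ m_{i,j}\ge0\}$. Finite differences. $(D_1^+u)_{i,j}=(u_{i+1,j}-u_{i,j})/h$, $(D_2^+u)_{i,j}=(u_{i,j+1}-u_{i,j})/h$,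 $[D_hu]_{i,j}=\bigl((D_1^+u)_{i,j},(D_1^+u)_{i-1,j},(D_2^+u)_{i,j},(D_2^+u)_{i,j-1}\bigr)\in\mathbb R^4$, $(\Delta_hu)_{i,j}=-\frac1{h^2}(4u_{i,j}-u_{i+1,j}-u_{i-1,j}-u_{i,j+1}-u_{i,j-1})$. Numerical Hamiltonian. For $x\in\mathbb T^2$, $q\in\mathbb R^4$: $g(x,q)=\mathcal H(x)+\bigl((q_1^-)^2+(q_2^+)^2+(q_3^-)^2+(q_4^+)^2\bigr)^{\beta/2}$, where $r^+=\max(r,0)$, $r^-=\max(-r,0)$. Transport operator. With $g_k(u)_{i,j}=\frac{\partial g}{\partial q_k}(x_{i,j},[D_hu]_{i,j})$, $$\mathcal T_{i,j}(u,m)=\frac1h\Bigl(m_{i,j}g_1(u)_{i,j}-m_{i-1,j}g_1(u)_{i-1,j}+m_{i+1,j}g_2(u)_{i+1,j}-m_{i,j}g_2(u)_{i,j}+m_{i,j}g_3(u)_{i,j}-m_{i,j-1}g_3(u)_{i,j-1}+m_{i,j+1}g_4(u)_{i,j+1}-m_{i,j}g_4(u)_{i,j}\Bigr).$$ Discrete system. For $0\le i,j<N_h$, $0\le n<N_T$: $$\frac{u^{n+1}_{i,j}-u^n_{i,j}}{\Delta t}-\nu(\Delta_hu^{n+1})_{i,j}+g(x_{i,j},[D_hu^{n+1}]_{i,j})=(\Phi_h[m^n])_{i,j},$$ $$\frac{m^{n+1}_{i,j}-m^n_{i,j}}{\Delta t}+\nu(\Delta_hm^n)_{i,j}+\mathcal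 T_{i,j}(u^{n+1},m^n)=0,$$ with $u^0_{i,j}=u_0(x_{i,j})$, $m^{N_T}_{i,j}=\frac1{h^2}\int_{|x-x_{i,j}|_\infty\le h/2}m_T(x)\,dx$, and $m^n\in\mathcal K_h$ for all $n$. (Under the stated assumptions this system has a unique solution.) Assumptions on $\Phi_h$ (maps $\mathcal K_h$ to grid functions). $(\Phi_{h1})$: $\Phi_h$ is continuous on $\mathcal K_h$. $(\Phi_{h2})$: $(\Phi_h[m]-\Phi_h[\tilde m],m-\tilde m)_2\le0$ implies $\Phi_h[m]=\Phi_h[\tilde m]$. $(\Phi_{h3})$: there is a constant $C$ independent of $h$ such that for all $m\in\mathcal K_h$, $\|\Phi_h[m]\|_\infty\le C$ and $|(\Phi_h[m])_{i,j}-(\Phi_h[m])_{k,\ell}|\le C\,d_{\mathbb T}(x_{i,j},x_{k,\ell})$, with $d_{\mathbb T}$ the distance on the torus. $(\Phi_{h4})$: there is a continuous bounded function $\omega:\mathbb R_+\to\mathbb R_+$ with $\omega(0)=0$ such that for all $m\in\mathcal K$ and all sequences $(m_h)_h$ with $m_h\in\mathcal K_h$, $\|\Phi[m]-\Phi_h[m_h]\|_{L^\infty(\mathbb T_h^2)}\le\omega(\|m-\tilde m_h\|_{L^1(\mathbb T^2)})$, where $\tilde m_h$ is the piecewise bilinear interpolation of $m_h$ at the grid nodes. *)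

(* Defs.v *)
From HB Require Import structures.
From mathcomp Require Import all_boot all_order all_algebra.
From mathcomp Require Import all_classical all_reals all_analysis.
From mathcomp Require Import measurable_realfun.

Set Implicit Arguments.
Unset Strict Implicit.
Unset Printing Implicit Defensive.
Import Order.TTheory GRing.Theory Num.Theory.
Import numFieldNormedType.Exports.
Local Open Scope classical_set_scope.
Local Open Scope ring_scope.

(* Points of the torus are represented by points of the plane, functions on the
   torus by functions on the plane that are 1-periodic in each variable, and
   Borel measures on the torus by measures on the plane that are carried by the
   fundamental cell [0, 1[ x [0, 1[. *)

Notation mplane R := (measurableTypeR R * measurableTypeR R)%type.

Section Torus.
Variable R : realType.
Implicit Types (f g : R * R -> R) (x y p : R * R).

Definition leb1 : {measure set (measurableTypeR R) -> \bar R} :=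
  @lebesgue_measure R.

Definition leb2 : {measure set (mplane R) -> \bar R} :=
  (@lebesgue_measure R \x @lebesgue_measure R)%E.

(* [\x^] is the library's product measure whose defining integral runs over the
   second factor; [\x] would require [leb2] to be declared sigma-finite. *)
Definition leb3 : {measure set (measurableTypeR R * mplane R) -> \bar R} :=
  (@lebesgue_measure R \x^ leb2)%E.

Definition cell : set (R * R) := [set x | 0 <= x.1 < 1 /\ 0 <= x.2 < 1].

Definition torus_fun f := forall x, f (x + (1, 0)) = f x /\ f (x + (0, 1)) = f x.

Definition enorm p : R := Num.sqrt (p.1 ^+ 2 + p.2 ^+ 2).

Definition torus_dist x y : R :=
  inf [set enorm (x - y + (k.1%:~R, k.2%:~R)) | k in [set: int * int]].

Definition evec (i : 'I_2) : R * R := ((i == 0)%:R, (i == 1)%:R).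

Definition pd (i : 'I_2) f : R * R -> R := fun x => 'D_(evec i) f x.

Definition grad f x : R * R := (pd 0 f x, pd 1 f x).

Definition laplacian f x : R := \sum_(i < 2) pd i (pd i f) x.

Fixpoint is_Ck (k : nat) f : Prop :=
  continuous f /\
  if k is k'.+1 then
    (forall x i, derivable f x (evec i)) /\ (forall i, is_Ck k' (pd i f))
  else True.

Definition smooth f := forall k, is_Ck k f.

Definition sup_norm f : \bar R := ereal_sup [set `|f x|%:E | x in [set: R * R]].

Definition hoelder_seminorm (alpha : R) f : \bar R :=
  ereal_sup [set s | exists x y, 0 < torus_dist x y /\
                       s = (`|f x - f y| / (torus_dist x y `^ alpha))%:E].

Definition lip_norm f : \bar R := (sup_norm f + hoelder_seminorm 1 f)%E.

Definition mpd (a b : nat) f : R * R -> R := iter a (pd 0) (iter b (pd 1) f).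

(* For [alpha = 0] the seminorm is at most twice the sup norm, so that the norm
   is then equivalent to the usual norm of C^k. *)
Definition Ckalpha_norm (k : nat) (alpha : R) f : \bar R :=
  (\sum_(a < k.+1) \sum_(b < k.+1 | (a + b <= k)%N) sup_norm (mpd a b f) +
   \sum_(a < k.+1) hoelder_seminorm alpha (mpd a (k - a) f))%E.

Definition Ckalpha (k : nat) (alpha : R) f :=
  [/\ torus_fun f, is_Ck k f & (Ckalpha_norm k alpha f < +oo)%E].

Definition is_density f :=
  [/\ torus_fun f, measurable_fun [set: mplane R] (f : mplane R -> measurableTypeR R),
      (forall x, 0 <= f x) & (\int[leb2]_(x in cell) (f x)%:E = 1)%E].

Record density : Type := Density { dens :> R * R -> R; densP : is_density dens }.

Definition density_measure (m : density) (A : set (mplane R)) : \bar R :=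
  (\int[leb2]_(x in A `&` cell) (m x)%:E)%E.

Lemma measurable_cell : measurable (cell : set (mplane R)).
Proof.
have -> : cell = `[0%R, 1%R[%classic `*` `[0%R, 1%R[%classic.
  by apply/seteqP; split => x /=; rewrite /cell /= !in_itv.
by apply: measurableX; exact: measurable_itv.
Qed.

Section density_measure_instance.
Variable m : density.

Let dm0 : density_measure m set0 = 0%E.
Proof. by rewrite /density_measure set0I integral_set0. Qed.

Let dm_ge0 A : (0 <= density_measure m A)%E.
Proof.
by apply: integral_ge0 => x _; rewrite lee_fin; case: (densP m) => _ _ + _.
Qed.

Let dm_sigma_additive : semi_sigma_additive (density_measure m).
Proof.
have [_ mm m0 _] := densP m.
have mE : measurable_fun [set: mplane R] ((fun x => (m x)%:E) : mplane R -> \bar R).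
  by apply/measurable_EFinP.
move=> F mF tF mUF; rewrite /density_measure; apply: cvg_toP.
  apply: ereal_nondecreasing_is_cvgn => k l kl.
  apply: lee_sum_nneg_natr => // i _ _; exact: dm_ge0.
rewrite setI_bigcupl ge0_integral_bigcup//=.
- by move=> k; apply: measurableI => //; exact: measurable_cell.
- exact: measurable_funTS mE.
- by move=> x _; rewrite lee_fin.
- move=> i j _ _ [x [[Fi _] [Fj _]]]; apply: tF => //; by exists x.
Qed.

HB.instance Definition _ :=
  isMeasure.Build _ _ _ (density_measure m) dm0 dm_ge0 dm_sigma_additive.

Let dm_setT : density_measure m setT = 1%E.
Proof. by rewrite /density_measure setTI; case: (densP m). Qed.

HB.instance Definition _ :=
  Measure_isProbability.Build _ _ _ (density_measure m) dm_setT.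
End density_measure_instance.

(* The probability measure f(x) dx; the value for a function that is not a
   density is irrelevant. *)
Definition law f : probability (mplane R) R :=
  if pselect (is_density f) is left Hf then density_measure (Density Hf)
  else \d_((0, 0) : mplane R).

Lemma lawE f (A : set (mplane R)) : is_density f ->
  law f A = (\int[leb2]_(x in A `&` cell) (f x)%:E)%E.
Proof. by move=> Hf; rewrite /law; case: pselect. Qed.

Definition on_torus (mu : probability (mplane R) R) : Prop := mu cell = 1%E.

Lemma law_on_torus f : is_density f -> on_torus (law f).
Proof. by move=> Hf; rewrite /on_torus lawE // setIid; case: Hf. Qed.

End Torus.

Section Coupling.
Variable R : realType.
Variable Phi : probability (mplane R) R -> R * R -> R.

Definition monotone_coupling : Prop :=
  forall mu mu' : probability (mplane R) R, on_torus mu -> on_torus mu' ->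
    \int[mu]_x (Phi mu x - Phi mu' x) - \int[mu']_x (Phi mu x - Phi mu' x) <= 0 ->
    forall A, measurable A -> mu A = mu' A.

(* Basic weak * neighbourhood of mu, given by finitely many test functions. *)
Definition weak_star_close (n : nat) (phi : 'I_n -> R * R -> R) (delta : R)
    (mu mu' : probability (mplane R) R) : Prop :=
  forall i, `| \int[mu']_x phi i x - \int[mu]_x phi i x | < delta.

Definition weak_star_to_lip_continuous : Prop :=
  forall mu, on_torus mu -> forall e : R, 0 < e ->
    exists (n : nat) (phi : 'I_n -> R * R -> R) (delta : R),
      [/\ forall i, torus_fun (phi i) /\ continuous (phi i), 0 < delta &
          forall mu', on_torus mu' -> weak_star_close phi delta mu mu' ->
            (lip_norm (fun x => (Phi mu' x - Phi mu x)%R) < e%:E)%E].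

Definition Ckalpha_continuous (k : nat) (alpha : R) : Prop :=
  (forall f, is_density f -> Ckalpha k alpha f ->
     Ckalpha k.+1 alpha (Phi (law f))) /\
  (forall f, is_density f -> Ckalpha k alpha f -> forall e : R, 0 < e ->
     exists2 delta : R, 0 < delta &
       forall f', is_density f' -> Ckalpha k alpha f' ->
         (Ckalpha_norm k alpha (fun x => (f' x - f x)%R) < delta%:E)%E ->
         (Ckalpha_norm k.+1 alpha
            (fun x => (Phi (law f') x - Phi (law f) x)%R) < e%:E)%E).

(* Phi acts on probability measures, hence on those functions of C^{k,alpha}
   that are probability densities. *)
Definition smoothing_coupling : Prop :=
  [/\ forall mu, on_torus mu -> torus_fun (Phi mu),
      exists C : R, forall mu, on_torus mu -> (lip_norm (Phi mu) <= C%:E)%E,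
      weak_star_to_lip_continuous &
      forall (k : nat) (alpha : R), 0 <= alpha < 1 -> Ckalpha_continuous k alpha].

End Coupling.

Section Continuous.
Variable R : realType.

Definition Ham (Hc : R * R -> R) (beta : R) (x p : R * R) : R :=
  Hc x + enorm p `^ beta.

Definition timeD (f : R -> R * R -> R) (t : R) (x : R * R) : R :=
  derive1 (f ^~ x) t.

(* Class C^1 in t and C^2 in x on the open set (0, T) x torus. *)
Definition is_C12 (T : R) (f : R -> R * R -> R) : Prop :=
  (forall t x, 0 < t < T ->
     [/\ derivable (f ^~ x) t 1,
         (forall i, derivable (f t) x (evec R i)) &
         (forall i j, derivable (pd i (f t)) x (evec R j))]) /\
  (forall z : R * (R * R), 0 < z.1 < T ->
     [/\ {for z, continuous (fun y : R * (R * R) => f y.1 y.2)},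
         {for z, continuous (fun y : R * (R * R) => timeD f y.1 y.2)},
         (forall i,
           {for z, continuous (fun y : R * (R * R) => pd i (f y.1) y.2)}) &
         (forall i j,
           {for z, continuous (fun y : R * (R * R) => pd j (pd i (f y.1)) y.2)})]).

Definition flux (Hc : R * R -> R) (beta : R) (v mu : R * R -> R) (i : 'I_2)
    (x : R * R) : R :=
  mu x * 'D_(evec R i) (Ham Hc beta x) (grad v x).

Record classical_solution (T nu beta : R) (Hc u0 mT : R * R -> R)
    (Phi : probability (mplane R) R -> R * R -> R) (u m : R -> R * R -> R) : Prop := {
  sol_periodic : forall t, 0 <= t <= T -> torus_fun (u t) /\ torus_fun (m t);
  sol_cont_u : {within [set z : R * (R * R) | 0 <= z.1 <= T],
                 continuous (fun z : R * (R * R) => u z.1 z.2)};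
  sol_cont_m : {within [set z : R * (R * R) | 0 <= z.1 <= T],
                 continuous (fun z : R * (R * R) => m z.1 z.2)};
  sol_C12_u : is_C12 T u;
  sol_C12_m : is_C12 T m;
  sol_density : forall t, 0 <= t <= T -> is_density (m t);
  sol_HJB : forall t x, 0 < t < T ->
    timeD u t x - nu * laplacian (u t) x + Ham Hc beta x (grad (u t) x)
    = Phi (law (m t)) x;
  sol_flux : forall t x i, 0 < t < T ->
    derivable (flux Hc beta (u t) (m t) i) x (evec R i);
  sol_FP : forall t x, 0 < t < T ->
    timeD m t x + nu * laplacian (m t) x
      + \sum_(i < 2) pd i (flux Hc beta (u t) (m t) i) x = 0;
  sol_initial : forall x, u 0 x = u0 x;
  sol_terminal : forall x, m T x = mT x }.

End Continuous.

Section Grid.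
Variable R : realType.

Definition step (N : nat) : R := N%:R^-1.

Definition node (N : nat) (i j : int) : R * R :=
  (i%:~R * step N, j%:~R * step N).

(* Extension of a grid function with indices modulo N: for N > 0 the double sum
   has exactly one term. *)
Definition gext (N : nat) (z : 'M[R]_N) (i j : int) : R :=
  \sum_(k < N | (k%:Z == i %[mod N%:Z])%Z)
    \sum_(l < N | (l%:Z == j %[mod N%:Z])%Z) z k l.

Definition gdot (N : nat) (y z : 'M[R]_N) : R :=
  \sum_(i < N) \sum_(j < N) y i j * z i j.

Definition Kh (N : nat) : set 'M[R]_N :=
  [set z | step N ^+ 2 * (\sum_(i < N) \sum_(j < N) z i j) = 1 /\
           forall i j, 0 <= z i j].

Section Schemes.
Variables (Hc : R * R -> R) (beta nu T : R) (N : nat).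
Local Notation h := (step N).
Implicit Types (z u m : 'M[R]_N) (i j : int).

Definition D1 z i j : R := (gext z (i + 1) j - gext z i j) / h.
Definition D2 z i j : R := (gext z i (j + 1) - gext z i j) / h.

Definition Dh z i j : 'rV[R]_4 :=
  \row_k [:: D1 z i j; D1 z (i - 1) j; D2 z i j; D2 z i (j - 1)]`_k.

Definition Lh z i j : R :=
  - (1 / h ^+ 2) * (4 * gext z i j - gext z (i + 1) j - gext z (i - 1) j
                    - gext z i (j + 1) - gext z i (j - 1)).

Definition pos_part (r : R) := Num.max r 0.
Definition neg_part (r : R) := Num.max (- r) 0.

Definition gnum (x : R * R) (q : 'rV[R]_4) : R :=
  Hc x + (neg_part (q 0 0) ^+ 2 + pos_part (q 0 1) ^+ 2
          + neg_part (q 0 2) ^+ 2 + pos_part (q 0 3) ^+ 2) `^ (beta / 2).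

(* The index k = 0, 1, 2, 3 corresponds to the variables q_1, q_2, q_3, q_4. *)
Definition gder (k : 'I_4) u i j : R :=
  'D_(delta_mx 0 k) (gnum (node N i j)) (Dh u i j).

Definition transport u m i j : R :=
  1 / h * (gext m i j * gder 0 u i j - gext m (i - 1) j * gder 0 u (i - 1) j
           + gext m (i + 1) j * gder 1 u (i + 1) j - gext m i j * gder 1 u i j
           + gext m i j * gder 2 u i j - gext m i (j - 1) * gder 2 u i (j - 1)
           + gext m i (j + 1) * gder 3 u i (j + 1) - gext m i j * gder 3 u i j).

Record discrete_solution (u0 mT : R * R -> R) (Phih : 'M[R]_N -> 'M[R]_N)
    (NT : nat) (u m : nat -> 'M[R]_N) : Prop := {
  dsol_HJB : forall (n : nat) (i j : 'I_N), (n < NT)%N ->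
    (u n.+1 i j - u n i j) / (T / NT%:R) - nu * Lh (u n.+1) i j
      + gnum (node N i j) (Dh (u n.+1) i j) = Phih (m n) i j;
  dsol_FP : forall (n : nat) (i j : 'I_N), (n < NT)%N ->
    (m n.+1 i j - m n i j) / (T / NT%:R) + nu * Lh (m n) i j
      + transport (u n.+1) (m n) i j = 0;
  dsol_initial : forall i j : 'I_N, u 0%N i j = u0 (node N i j);
  (* the norm of [R * R] is the max norm *)
  dsol_terminal : forall i j : 'I_N,
    m NT i j = 1 / h ^+ 2 *
      \int[leb2 R]_(x in [set x : R * R | `|x - node N i j| <= h / 2]) mT x;
  dsol_density : forall n, (n <= NT)%N -> Kh (m n) }.

Definition bilin z (x : R * R) : R :=
  let i := Num.floor (x.1 / h) in
  let j := Num.floor (x.2 / h) in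
  let a := x.1 / h - i%:~R in
  let b := x.2 / h - j%:~R in
  (1 - a) * (1 - b) * gext z i j + a * (1 - b) * gext z (i + 1) j
  + (1 - a) * b * gext z i (j + 1) + a * b * gext z (i + 1) (j + 1).

(* At t = T the weight of [v NT.+1] vanishes, so that only [v 0, ..., v NT]
   matter on [0, T]. *)
Definition trilin (NT : nat) (v : nat -> 'M[R]_N) (t : R) (x : R * R) : R :=
  let n := Num.truncn (t / (T / NT%:R)) in
  let c := t / (T / NT%:R) - n%:R in
  (1 - c) * bilin (v n) x + c * bilin (v n.+1) x.

End Schemes.

Section DiscreteCoupling.
Variable Phih : forall N : nat, 'M[R]_N -> 'M[R]_N.

Definition Phih1 : Prop :=
  forall N, (0 < N)%N -> {within @Kh N, continuous (@Phih N)}.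

Definition Phih2 : Prop :=
  forall N, (0 < N)%N -> forall m m', @Kh N m -> @Kh N m' ->
    gdot (Phih m - Phih m') (m - m') <= 0 -> Phih m = Phih m'.

Definition Phih3 : Prop :=
  exists C : R, forall N, (0 < N)%N -> forall m, @Kh N m ->
    (forall i j : 'I_N, `|Phih m i j| <= C) /\
    (forall i j k l : 'I_N,
       `|Phih m i j - Phih m k l| <= C * torus_dist (node N i j) (node N k l)).

Definition Phih4 (Phi : probability (mplane R) R -> R * R -> R) : Prop :=
  exists omega : R -> R,
    [/\ {within [set r : R | 0 <= r], continuous omega},
        (forall r, 0 <= r -> 0 <= omega r),
        (exists B : R, forall r, 0 <= r -> omega r <= B),
        omega 0 = 0 &
        forall m, is_density m ->
        forall mh : (forall N : nat, 'M[R]_N),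
          (forall N, (0 < N)%N -> Kh (mh N)) ->
        forall N, (0 < N)%N -> forall i j : 'I_N,
          `|Phi (law m) (node N i j) - Phih (mh N) i j|
          <= omega (\int[leb2 R]_(x in @cell R) `|m x - bilin (mh N) x|)].

End DiscreteCoupling.
End Grid.

Section Convergence.
Variable R : realType.

Definition sup_norm_TQ (T : R) (f : R -> R * R -> R) : \bar R :=
  ereal_sup [set s | exists t x, 0 <= t <= T /\ s = `|f t x|%:E].

Definition L2_norm_TQ (T : R) (f : R -> R * R -> R) : \bar R :=
  ('N[leb3 R]_2%:E [(fun z : R * (R * R) => (f z.1 z.2)%:E)
                    \_ [set z | (0 < z.1 < T)%R /\ cell z.2]])%E.

Definition L2_norm (f : R * R -> R) : \bar R :=
  ('N[leb2 R]_2%:E [(EFin \o f) \_ (@cell R)])%E.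

Definition weak_pd (i : 'I_2) (f g : R * R -> R) : Prop :=
  [/\ torus_fun g,
      (leb2 R).-integrable (@cell R) (EFin \o f),
      (leb2 R).-integrable (@cell R) (EFin \o g) &
      forall phi : R * R -> R, torus_fun phi -> smooth phi ->
        \int[leb2 R]_(x in @cell R) (f x * pd i phi x)
        = - \int[leb2 R]_(x in @cell R) (g x * phi x)].

(* The weak gradient is unique up to a null set, so that the infimum is taken
   over at most one value; it is +oo if there is no weak gradient. *)
Definition W12_norm (f : R * R -> R) : \bar R :=
  ereal_inf [set s | exists g1 g2 : R * R -> R,
    [/\ weak_pd 0 f g1, weak_pd 1 f g2 &
        s = ((L2_norm f ^+ 2 + L2_norm g1 ^+ 2 + L2_norm g2 ^+ 2) `^ 2^-1)%E]].

Definition L2W12_norm (T : R) (f : R -> R * R -> R) : \bar R :=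
  ('N[leb1 R]_2%:E [(fun t => W12_norm (f t)) \_ [set t | (0 < t < T)%R]])%E.

Definition vanishes_as_steps_to_0 (T : R) (E : nat -> nat -> \bar R) : Prop :=
  forall e : R, 0 < e -> exists2 delta : R, 0 < delta &
    forall NT N : nat, (0 < NT)%N -> (0 < N)%N ->
      T / NT%:R < delta -> step R N < delta -> (E NT N < e%:E)%E.

End Convergence.

(* Main.v *)
Require Import Defs.
From mathcomp Require Import all_boot all_order all_algebra.
From mathcomp Require Import all_classical all_reals all_analysis.
From mathcomp Require Import measurable_realfun.
From mathcomp Require Import zify ring lra.
Set Implicit Arguments.
Unset Strict Implicit.
Unset Printing Implicit Defensive.
Import Order.TTheory GRing.Theory Num.Theory.
Import numFieldNormedType.Exports.
Local Open Scope classical_set_scope.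
Local Open Scope ring_scope.

(** The grid solution [(U, Mu)] is compared with the nodal values [(V, M)] of the exact solution. The
numerical Hamiltonian is the function [|P| ^ beta] of the vector [P] of the four upwind
differences, and the transport operator is the adjoint of its linearization. Hence the
monotonicity argument of Lasry and Lions has an exact discrete form, [mfg_identity]: the increment
in time of the mean of [(U - V) (Mu - M)] is the sum of two nonnegative convexity gaps, of the
coupling term, which is nonnegative up to consistency errors by the monotonicity of the discrete
coupling ([coupling_inequality]), and of the consistency error of the Fokker-Planck equation
paired with [U - V]. Since [|P| ^ beta] is strongly convex on balls ([Gg_convex]) and [m] is
bounded below, the gaps control [|P(U) - P(V)| ^ 2] in mean, which gives the convergence of the
gradients in mean square on compact subintervals of [(0, T)] ([gradient_sum]).

Derivatives of the exact solution are controlled only on such subintervals [[a, b]], so the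
pairing must be small at both ends. Near [t = 0] the functions [U] and [V] are both close to [u0],
because the scheme is monotone and [u0] is smooth ([U_bounds], [initial_layer]), and [Mu - M] is
bounded in mean. Near [t = T] the densities are both close to [mT], by an energy estimate
([M_near_terminal]), and [U - V] is bounded.

The delicate point is the consistency of the Fokker-Planck equation. For [beta < 2] the flux [F =
m beta |grad u| ^ (beta - 2) grad u] is only known to be continuous with partial derivatives,
which may be unbounded near critical points of [u(t)], so that difference quotients of [F] need
not converge to [div F] uniformly. It suffices to write the residual as [Div r + s] with [r] and
[s] small in mean square ([fp_consistency]): [r] comes from replacing [F] by the regularized flux
[F_ep], in which [|grad u| ^ 2] becomes [|grad u| ^ 2 + ep], and [s] from [div F_ep - div F],
which tends to zero in mean square as [ep] tends to zero. The latter follows from the pointwise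
bound [static_pointwise]: [div F] determines, up to lower order terms, the trace of the Hessian of
[u] minus [2 - beta] times its entry along the gradient; as [2 - beta < 1], the square of this
entry is bounded by [div F] and minus the determinant of the Hessian. The determinant term carries
the weight [ep ^ beta / (|grad u| ^ 2 + ep) ^ 2], and its mean is zero, because [int det (D ^ 2 u)
psi(grad u) = 0] for a periodic function [u] ([int_weighted_det]). The other term is dominated and
vanishes in the limit outside the critical points; at almost every critical point [div F = 0]
([pd_ae_null]), so [defect_cvg] follows by dominated convergence.

Once the gradients converge in mean square, the energy estimate for [Mu - M] together with the
Hoelder continuity of the flux in the gradient gives the convergence of the densities in mean
square, uniformly in time away from [0] ([M_sup]). Then the couplings converge uniformly, and
comparison gives the uniform convergence of [U] ([U_sup]). It remains to pass from nodal values to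
the trilinear interpolations. Means over the grid bound the integrals of the squared errors; the
interpolations are Lipschitz, hence weakly derivable, with difference quotients of nodal values as
gradients; and near [t = 0] and [t = T] uniform bounds suffice because the time is short. *)

(** * Calculus of periodic grid functions *)

Definition ed (i : 'I_2) : int * int := ((i == 0)%:R, (i == 1)%:R).

Section GridFunctions.
Context {R : realType} (N : nat).
Implicit Types (z w : int * int -> R) (p : int * int) (i : 'I_2).
Local Notation h := (step R N).

Definition gper z := forall p i, z (p + ed i *+ N) = z p.

(** The mean over one period, the discrete counterpart of the integral over the torus. *)
Definition avg z : R :=
  h ^+ 2 * \sum_(k < N) \sum_(l < N) z (k%:Z, l%:Z).

Definition Dp i z p : R := (z (p + ed i) - z p) / h.
Definition Dm i z p : R := (z p - z (p - ed i)) / h.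
Definition Lapg z p : R :=
  \sum_i (z (p + ed i) - 2 * z p + z (p - ed i)) / h ^+ 2.

Lemma ord2P (P : 'I_2 -> Prop) : P 0 -> P 1 -> forall i, P i.
Proof.
move=> P0 P1 [[|[|//]] hi].
- by have <- : 0 = Ordinal hi by exact/val_inj.
- by have <- : 1 = Ordinal hi by exact/val_inj.
Qed.

Lemma sum2E (V : nmodType) (F : 'I_2 -> V) : \sum_i F i = F 0 + F 1.
Proof. by rewrite big_ord_recl big_ord1; congr (_ + F _); exact/val_inj. Qed.

Lemma ed0 : ed 0 = (1, 0). Proof. by []. Qed.
Lemma ed1 : ed 1 = (0, 1). Proof. by []. Qed.

Lemma gperM z p i (n : nat) : gper z -> z (p + ed i *+ (N * n)) = z p.
Proof.
move=> zp; elim: n p => [|n IH] p; first by rewrite muln0 mulr0n addr0.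
by rewrite mulnS addnC mulrnDr addrA zp IH.
Qed.

Lemma gperMz z p i (k : int) : gper z -> z (p + ed i *~ (N%:Z * k)) = z p.
Proof.
move=> zp; case: k => n; first by rewrite -PoszM -pmulrn gperM.
rewrite NegzE mulrN mulrNz -PoszM -pmulrn.
by rewrite -[in RHS](subrK (ed i *+ (N * n.+1)) p) gperM.
Qed.

Lemma pair_edE (a b : int) : (a, b) = ed 0 *~ a + ed 1 *~ b.
Proof.
have E : forall k : int, (ed 0 *~ k = (k, 0)) /\ (ed 1 *~ k = (0, k)).
  have En : forall n : nat, (ed 0 *+ n = (n%:Z, 0)) /\ (ed 1 *+ n = (0, n%:Z)).
    elim=> [|n [IH1 IH2]]; first by rewrite !mulr0n.
    by rewrite !mulrSr IH1 IH2 ed0 ed1; split; congr (_, _); rewrite /= ?addr0// -addn1 PoszD.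
  case=> n; first by rewrite -!pmulrn; exact: En.
  rewrite NegzE !mulrNz -!pmulrn; have [-> ->] := En n.+1.
  by split; congr (_, _); rewrite oppr0.
have [-> _] := E a; have [_ ->] := E b.
by congr (_, _); rewrite /= ?addr0 ?add0r.
Qed.

(** The representative does not depend on [z], so several periodic functions can be evaluated at
the same nodes of the fundamental cell. *)
Lemma grid_rep (N0 : (0 < N)%N) p :
  exists k l : 'I_N, [/\ (k%:Z = p.1 %[mod N%:Z])%Z, (l%:Z = p.2 %[mod N%:Z])%Z &
  forall z, gper z -> z p = z (k%:Z, l%:Z)].
Proof.
have Nz : (N%:Z != 0)%R by rewrite eqz_nat -lt0n.
have rep (a : int) : exists2 k : 'I_N, (k%:Z = a %[mod N%:Z])%Z & exists c, a = k%:Z + N%:Z * c.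
  have ge : (0 <= (a %% N%:Z)%Z)%R by exact: modz_ge0.
  have lt : (`|(a %% N%:Z)%Z|%N < N)%N.
    by rewrite -ltz_nat gez0_abs// ltz_pmod // ltz_nat.
  exists (Ordinal lt) => /=; first by rewrite gez0_abs// modz_mod.
  by exists (a %/ N%:Z)%Z; rewrite gez0_abs// addrC mulrC -divz_eq.
case: p => a b; have [k ka [c ac]] := rep a; have [l lb [d bd]] := rep b.
exists k, l; split=> // z zp.
have -> : (a, b) = (k%:Z, l%:Z) + ed 0 *~ (N%:Z * c) + ed 1 *~ (N%:Z * d).
  by rewrite ac bd !(pair_edE (_ + _)) !mulrzDr (pair_edE k%:Z) -!addrA; congr (_ + _); rewrite addrCA.
by rewrite !gperMz.
Qed.

Lemma eqmodz_ordP (k l : 'I_N) : (k%:Z = l%:Z %[mod N%:Z])%Z -> k = l.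
Proof. by rewrite !modz_small ?lez_nat ?ltz_nat ?ltn_ord//= => -[] /val_inj. Qed.

Lemma gper_shift z e : gper z -> gper (fun p => z (p + e)).
Proof. by move=> zp p i /=; rewrite addrAC zp. Qed.

Lemma gper_comp2 (F : R -> R -> R) z w : gper z -> gper w ->
  gper (fun p => F (z p) (w p)).
Proof. by move=> zp wp p i /=; rewrite zp wp. Qed.

Lemma gperB z w : gper z -> gper w -> gper (fun p => z p - w p).
Proof. by move=> zp wp p i /=; rewrite zp wp. Qed.

Lemma gperMul z w : gper z -> gper w -> gper (fun p => z p * w p).
Proof. by move=> zp wp p i /=; rewrite zp wp. Qed.

Lemma gper_Dp i z : gper z -> gper (Dp i z).
Proof. by move=> zp p j; rewrite /Dp (addrAC p) !zp. Qed.

Lemma gper_Dm i z : gper z -> gper (Dm i z).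
Proof. by move=> zp p j; rewrite /Dm (addrAC p) !zp. Qed.

Lemma gper_Lapg z : gper z -> gper (Lapg z).
Proof.
move=> zp p j; have A e : z (p + ed j *+ N + e) = z (p + e) by rewrite addrAC zp.
by apply: eq_bigr => i _; rewrite !A zp.
Qed.

Lemma sum_shift1 (y : int -> R) : y N%:Z = y 0 ->
  \sum_(k < N) y (k%:Z + 1) = \sum_(k < N) y k%:Z.
Proof.
case: N => [|n] yn; first by rewrite !big_ord0.
rewrite big_ord_recr big_ord_recl /= addrC; congr (_ + _).
  by rewrite -yn -addn1 PoszD.
by apply: eq_bigr => k _; congr y; rewrite /bump /= add1n -addn1 PoszD.
Qed.

Lemma avg_shift i z : gper z -> avg (fun p => z (p + ed i)) = avg z.
Proof.
move=> zp; rewrite /avg; congr (_ * _).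
have z2 p : z (p + (0, N%:Z)) = z p.
  by have := zp p 1; rewrite (pair_edE 0) mulr0z add0r -pmulrn.
have z1 p : z (p + (N%:Z, 0)) = z p.
  by have := zp p 0; rewrite (pair_edE N%:Z) mulr0z addr0 -pmulrn.
elim/ord2P: i.
- rewrite exchange_big [RHS]exchange_big /=; apply: eq_bigr => l _.
  rewrite -(@sum_shift1 (fun a => z (a, l%:Z))) //.
    by apply: eq_bigr => k _; congr z; congr (_, _); rewrite /= addr0.
  by have := z1 (0, l%:Z) => <-; congr z; congr (_, _); rewrite /= ?addr0 ?add0r.
- apply: eq_bigr => k _.
  rewrite -(@sum_shift1 (fun a => z (k%:Z, a))) //.
    by apply: eq_bigr => l _; congr z; congr (_, _); rewrite /= addr0.
  by have := z2 (k%:Z, 0) => <-; congr z; congr (_, _); rewrite /= ?addr0 ?add0r.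
Qed.

Lemma avg_shiftN i z : gper z -> avg (fun p => z (p - ed i)) = avg z.
Proof.
move=> zp; rewrite -(@avg_shift i (fun p => z (p - ed i))) //; last exact: gper_shift.
by congr avg; apply/funext => p; rewrite addrK.
Qed.

Lemma eq_avg z w : z =1 w -> avg z = avg w.
Proof. by move=> /funext ->. Qed.

Lemma avgD z w : avg (fun p => z p + w p) = avg z + avg w.
Proof.
by rewrite /avg -mulrDr -big_split; congr (_ * _); apply: eq_bigr => k _; rewrite big_split.
Qed.

Lemma avgZ c z : avg (fun p => c * z p) = c * avg z.
Proof.
rewrite /avg mulrCA; congr (_ * _); rewrite mulr_sumr; apply: eq_bigr => k _.
by rewrite mulr_sumr.
Qed.

Lemma avgN z : avg (fun p => - z p) = - avg z.
Proof. by rewrite -mulN1r -avgZ; apply: eq_avg => p; rewrite mulN1r. Qed.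

Lemma avgB z w : avg (fun p => z p - w p) = avg z - avg w.
Proof. by rewrite avgD avgN. Qed.

Lemma avg_sum (I : finType) (F : I -> int * int -> R) :
  avg (fun p => \sum_i F i p) = \sum_i avg (F i).
Proof.
rewrite /avg -mulr_sumr; congr (_ * _).
rewrite [RHS]exchange_big /=.
by apply: eq_bigr => k _; rewrite [RHS]exchange_big.
Qed.

Lemma avg_le z w : (forall p, z p <= w p) -> avg z <= avg w.
Proof.
move=> zw; rewrite /avg ler_wpM2l ?sqr_ge0//.
by do 2 apply: ler_sum => ? _.
Qed.

Lemma avg_ge0 z : (forall p, 0 <= z p) -> 0 <= avg z.
Proof.
move=> z0; rewrite /avg mulr_ge0 ?sqr_ge0//.
by do 2 apply: sumr_ge0 => ? _.
Qed.

Lemma step_gt0 : (0 < N)%N -> 0 < h.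
Proof. by move=> N0; rewrite invr_gt0 ltr0n. Qed.

Lemma avg_cst (N0 : (0 < N)%N) c : avg (fun=> c) = c.
Proof.
rewrite /avg !(sumr_const, card_ord) -(mulr_natr c) -(mulr_natr (c * _)) /step.
by field; rewrite pnatr_eq0 -lt0n.
Qed.

Lemma avg_norm z : `|avg z| <= avg (fun p => `|z p|).
Proof.
rewrite ler_norml lerNl -avgN; apply/andP; split; apply: avg_le => p.
  by rewrite lerNl; have := ler_norm (- z p); rewrite normrN lerNl.
exact: ler_norm.
Qed.

Lemma avg_parts i z w : gper z -> gper w ->
  avg (fun p => Dp i z p * w p) = - avg (fun p => z p * Dm i w p).
Proof.
move=> zp wp; rewrite -avgN.
have -> : (fun p => Dp i z p * w p) =
    (fun p => h^-1 * (z (p + ed i) * w p) - h^-1 * (z p * w p)).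
  by apply/funext => p; rewrite /Dp; ring.
have -> : (fun p => - (z p * Dm i w p)) =
    (fun p => h^-1 * (z p * w (p - ed i)) - h^-1 * (z p * w p)).
  by apply/funext => p; rewrite /Dm; ring.
rewrite !avgB !avgZ; congr (_ * _ - _).
rewrite -[RHS](avg_shift i); last first.
  by apply: gper_comp2 => //; exact: gper_shift.
by apply: eq_avg => p; rewrite addrK.
Qed.

Lemma avg_shiftD e z : gper z -> avg (fun p => z (p + e)) = avg z.
Proof.
move=> zp.
have S i (k : int) y : gper y -> avg (fun p => y (p + ed i *~ k)) = avg y.
  move=> yp; case: k => n.
    elim: n => [|n IH].
      by apply: eq_avg => p; rewrite mulr0z addr0.
    rewrite -{}IH -[LHS](avg_shiftN i); last exact: gper_shift.
    by apply: eq_avg => p; rewrite -!pmulrn mulrS addrA subrK.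
  rewrite NegzE; elim: n.+1 => [|m IH].
    by apply: eq_avg => p; rewrite mulr0z addr0.
  rewrite -{}IH -[LHS](avg_shift i); last exact: gper_shift.
  by apply: eq_avg => p; rewrite !mulrNz -!pmulrn mulrS opprD addrA addrK.
case: e => a b; rewrite pair_edE -(S 1 b z zp) -[RHS](S 0 a); last exact: gper_shift.
by apply: eq_avg => p; rewrite addrA.
Qed.

Lemma avg_partsN i z w : gper z -> gper w ->
  avg (fun p => Dm i z p * w p) = - avg (fun p => z p * Dp i w p).
Proof.
move=> zp wp; rewrite [in RHS](eq_avg (w := fun p => Dp i w p * z p)); last first.
  by move=> p; rewrite mulrC.
by rewrite avg_parts// opprK; apply: eq_avg => p; rewrite mulrC.
Qed.

Lemma LapgE z p : Lapg z p = \sum_i Dm i (Dp i z) p.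
Proof.
apply: eq_bigr => i _; rewrite /Dm /Dp subrK expr2 invfM; ring.
Qed.

Lemma avg_Lapg z w : gper z -> gper w ->
  avg (fun p => Lapg z p * w p) = - \sum_i avg (fun p => Dp i z p * Dp i w p).
Proof.
move=> zp wp.
rewrite (eq_avg (w := fun p => \sum_i Dm i (Dp i z) p * w p)); last first.
  by move=> p; rewrite LapgE mulr_suml.
rewrite avg_sum -sumrN; apply: eq_bigr => i _.
by rewrite avg_partsN //; exact: gper_Dp.
Qed.

Lemma avg_Lapg_sym z w : gper z -> gper w ->
  avg (fun p => Lapg z p * w p) = avg (fun p => z p * Lapg w p).
Proof.
move=> zp wp; rewrite avg_Lapg// [RHS](eq_avg (w := fun p => Lapg w p * z p)); last first.
  by move=> p; rewrite mulrC.
rewrite avg_Lapg//; congr (- _); apply: eq_bigr => i _; apply: eq_avg => p; exact: mulrC.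
Qed.

Lemma grid_argmax (N0 : (0 < N)%N) z : gper z -> exists p, forall q, z q <= z p.
Proof.
move=> zp; pose i0 := Ordinal N0.
pose k := [arg max_(k > (i0, i0)) z ((k.1)%:Z, (k.2)%:Z)]%O.
exists ((k.1)%:Z, (k.2)%:Z) => q; have [a [b [_ _ /(_ _ zp) ->]]] := grid_rep N0 q.
by rewrite /k; case: arg_maxP => // m _ /(_ (a, b) isT).
Qed.

(** The discrete form of [int d1 a d2 b = int d2 a d1 b]; central differences are antisymmetric,
hence summation by parts moves both of them without a shift. *)
Lemma avg_central_cross a b : gper a -> gper b ->
  avg (fun p => (a (p + ed 0) - a (p - ed 0)) * (b (p + ed 1) - b (p - ed 1))) =
  avg (fun p => (a (p + ed 1) - a (p - ed 1)) * (b (p + ed 0) - b (p - ed 0))).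
Proof.
move=> ap bp.
have E e f : avg (fun p => (a (p + e) - a (p - e)) * (b (p + f) - b (p - f))) =
  (avg (fun p => a (p + e) * b (p + f)) + avg (fun p => a (p - e) * b (p - f))) -
  (avg (fun p => a (p + e) * b (p - f)) + avg (fun p => a (p - e) * b (p + f))).
  by rewrite -!avgD -avgB; apply: eq_avg => p; ring.
rewrite !E; congr (_ - _).
- rewrite addrC; congr (_ + _).
  + rewrite -(avg_shiftD (ed 0 + ed 1)) ?[RHS]/=; last first.
      by apply: gper_comp2; exact: gper_shift.
    by apply: eq_avg => p; congr (a _ * b _); ring.
  + rewrite -(avg_shiftD (- (ed 0 + ed 1))) ?[RHS]/=; last first.
      by apply: gper_comp2; exact: gper_shift.
    by apply: eq_avg => p; congr (a _ * b _); ring.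
- congr (_ + _).
  + rewrite -(avg_shiftD (ed 1 - ed 0)) ?[RHS]/=; last first.
      by apply: gper_comp2; exact: gper_shift.
    by apply: eq_avg => p; congr (a _ * b _); ring.
  + rewrite -(avg_shiftD (ed 0 - ed 1)) ?[RHS]/=; last first.
      by apply: gper_comp2; exact: gper_shift.
    by apply: eq_avg => p; congr (a _ * b _); ring.
Qed.
End GridFunctions.

(** * Powers of the Euclidean norm *)

Section Powers.
Context {R : realType}.
Implicit Types (a b x y r L : R).

Lemma is_derive_powR r x : 0 < x ->
  is_derive x 1 (fun y : R => y `^ r) (r * x `^ (r - 1)).
Proof.
move=> x0; have xin : x \in `]0, +oo[%R by rewrite in_itv/= x0.
apply: DeriveDef; first exact: derivable_powR.
by rewrite -derive1E powR_derive1.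
Qed.

Lemma continuous_powR_pos r x : 0 < x -> {for x, continuous (fun y : R => y `^ r)}.
Proof.
move=> x0; apply: differentiable_continuous; apply/derivable1_diffP.
by have [] := is_derive_powR r x0.
Qed.

Lemma powR_MVT r a b : 0 < a -> a < b ->
  exists2 c, a < c < b & b `^ r - a `^ r = r * c `^ (r - 1) * (b - a).
Proof.
move=> a0 ab; have [||c] := @MVT R (fun y : R => y `^ r) (fun c => r * c `^ (r - 1)) a b ab.
- by move=> x; rewrite in_itv => /andP[ax _]; apply: is_derive_powR; exact: lt_trans ax.
- apply: continuous_in_subspaceT => x; rewrite inE/= in_itv => /andP[ax _].
  apply: continuous_powR_pos; exact: lt_le_trans ax.
by rewrite in_itv/= => cab E; exists c.
Qed.

Lemma le_powR_neg r a b : r <= 0 -> 0 < a -> a <= b -> b `^ r <= a `^ r.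
Proof.
move=> r0 a0 ab; have b0 : 0 < b by exact: lt_le_trans ab.
have E (z : R) : z `^ r = (z `^ (- r))^-1 by rewrite powRN invrK.
rewrite !E lef_pV2 ?posrE ?powR_gt0//.
by apply: ge0_ler_powR; rewrite ?nnegrE ?oppr_ge0// ltW.
Qed.

Lemma le_powR_pos r a b : 0 <= r -> 0 <= a -> a <= b -> a `^ r <= b `^ r.
Proof. by move=> r0 a0 ab; apply: ge0_ler_powR; rewrite ?nnegrE// (le_trans a0). Qed.

Lemma mulr_powR a r : 0 < r -> 0 <= a -> a `^ r = a `^ (r - 1) * a.
Proof. by move=> r0 a0; rewrite mulrC mulr_powRB1. Qed.

Lemma sqr_powR a r : 0 <= a -> (a ^+ 2) `^ r = (a `^ r) ^+ 2.
Proof.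
by move=> a0; rewrite -powR_mulrn// -powRrM mulrC powRrM powR_mulrn ?powR_ge0.
Qed.

Lemma sqr_powR2 a r : 0 <= a -> (a ^+ 2) `^ (r / 2) = a `^ r.
Proof.
by move=> a0; rewrite -powR_mulrn// -powRrM; congr (_ `^ _); field.
Qed.

(** The second derivative [beta (beta - 1) a ^ (beta - 2)] decreases in [a], because [beta < 2],
so on [[0, L]] it is smallest at [L]. *)
Lemma powR_strongly_convex beta L a b : 1 < beta < 2 -> 0 <= a <= L -> 0 <= b <= L ->
  beta * (beta - 1) / 2 * L `^ (beta - 2) * (b - a) ^+ 2 <=
  b `^ beta - a `^ beta - beta * a `^ (beta - 1) * (b - a).
Proof.
move=> /andP[b1 b2].
set k := L `^ (beta - 2).
have low x y : 0 < x -> x < y -> y <= L -> (beta - 1) * k * (y - x) <= y `^ (beta - 1) - x `^ (beta - 1).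
  move=> x0 xy yL; have [c /andP[xc cy] ->] := powR_MVT (beta - 1) x0 xy.
  rewrite ler_wpM2r ?subr_ge0 ?(ltW xy)// ler_wpM2l ?subr_ge0 ?(ltW b1)//.
  have -> : beta - 1 - 1 = beta - 2 by ring.
  apply: le_powR_neg; first by rewrite subr_le0 ltW.
    exact: lt_trans xc.
  exact: le_trans (ltW cy) yL.
have k0 : 0 <= k by exact: powR_ge0.
have sq (x : R) : 0 <= x -> x <= L -> k * x ^+ 2 <= x `^ beta.
  move=> x0 xL; have [->|xn0] := eqVneq x 0.
    by rewrite expr0n mulr0 powR_ge0.
  have xp : 0 < x by rewrite lt_neqAle eq_sym xn0.
  have -> : x `^ beta = x `^ (beta - 2) * x ^+ 2.
    by rewrite -powR_mulrn// -powRD ?subrK// xn0 implybT.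
  rewrite ler_wpM2r ?sqr_ge0//; apply: le_powR_neg => //.
  by rewrite subr_le0 ltW.
move=> /andP[a0 aL] /andP[bb0 bL].
have [a00|an0] := eqVneq a 0.
  rewrite a00 !powR0; last 2 first.
  - by rewrite gt_eqF// subr_gt0.
  - by rewrite gt_eqF// (lt_trans _ b1).
  rewrite !subr0 mulr0 mul0r subr0.
  apply: le_trans (sq b bb0 bL); rewrite -mulrA ler_piMl ?mulr_ge0 ?sqr_ge0//; nra.
have [b00|bn0] := eqVneq b 0.
  rewrite b00 powR0; last by rewrite gt_eqF// (lt_trans _ b1).
  have E : a `^ beta = a `^ (beta - 1) * a by apply: mulr_powR => //; lra.
  have := sq a a0 aL; rewrite !sub0r sqrrN => sqa.
  have -> : - a `^ beta - beta * a `^ (beta - 1) * - a = (beta - 1) * a `^ beta.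
    by rewrite E; ring.
  have ka0 : 0 <= k * a ^+ 2 by rewrite mulr_ge0 ?sqr_ge0.
  have -> : beta * (beta - 1) / 2 * k * a ^+ 2 = (beta - 1) * (beta / 2 * (k * a ^+ 2)) by ring.
  rewrite ler_wpM2l ?subr_ge0 ?(ltW b1)//; apply: le_trans sqa.
  by rewrite ler_piMl//; lra.
have ap : 0 < a by rewrite lt_neqAle eq_sym an0.
have bp : 0 < b by rewrite lt_neqAle eq_sym bn0.
pose psi y := y `^ beta - beta * a `^ (beta - 1) * y - beta * (beta - 1) / 2 * k * (y - a) ^+ 2.
pose dpsi y := beta * y `^ (beta - 1) - beta * a `^ (beta - 1) - beta * (beta - 1) * k * (y - a).
have dP y : 0 < y -> is_derive y 1 psi (dpsi y).
  move=> y0; have := is_derive_powR beta y0 => d1.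
  rewrite /psi /dpsi.
  apply: is_derive_eq.
  transitivity (beta * y `^ (beta - 1) - beta * a `^ (beta - 1) * 1 -
    beta * (beta - 1) / 2 * k * ((y - a) * (1 - 0) + (y - a) * (1 - 0))); first by [].
  by field.
have cP y : 0 < y -> {for y, continuous psi}.
  by move=> y0; apply: differentiable_continuous; apply/derivable1_diffP; have [] := dP _ y0.
suff : psi a <= psi b by rewrite /psi subrr expr0n /=; lra.
have mvt x y : 0 < x -> x < y -> exists2 c, x < c < y & psi y - psi x = dpsi c * (y - x).
  move=> x0 xy; have [||c] := @MVT R psi dpsi x y xy.
  - by move=> z; rewrite in_itv => /andP[xz _]; apply: dP; exact: lt_trans xz.
  - apply: continuous_in_subspaceT => z; rewrite inE/= in_itv => /andP[xz _].
    by apply: cP; exact: lt_le_trans xz.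
  by rewrite in_itv/= => cxy E; exists c.
have [ab|ba|->//] := ltgtP a b.
- have [c /andP[ac cb] E] := mvt _ _ ap ab.
  rewrite -subr_ge0 E mulr_ge0//; last by rewrite subr_ge0 ltW.
  have := low _ _ ap ac (ltW (lt_le_trans cb bL)); rewrite /dpsi; nra.
- have [c /andP[ac cb] E] := mvt _ _ bp ba.
  rewrite -subr_ge0 -opprB E oppr_ge0 mulr_le0_ge0 ?subr_ge0 ?(ltW ba)//.
  have := low _ _ (lt_trans bp ac) cb aL; rewrite /dpsi; nra.
Qed.

End Powers.

Section PowerVectors.
Context {R : realType} {I : finType}.
Implicit Types (x y : I -> R).

Definition nsq x : R := \sum_k x k ^+ 2.

Lemma nsq_ge0 x : 0 <= nsq x.
Proof. by apply: sumr_ge0 => k _; exact: sqr_ge0. Qed.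

Lemma nsq_ge1 x k : x k ^+ 2 <= nsq x.
Proof. by rewrite /nsq (bigD1 k)//= lerDl sumr_ge0// => ? _; exact: sqr_ge0. Qed.

Lemma nsqD x y : nsq (fun k => x k + y k) <= 2 * nsq x + 2 * nsq y.
Proof.
rewrite /nsq !mulr_sumr -big_split; apply: ler_sum => k _ /=.
have := sqr_ge0 (x k - y k); nra.
Qed.

Lemma nsqZ c x : nsq (fun k => c * x k) = c ^+ 2 * nsq x.
Proof. by rewrite /nsq mulr_sumr; apply: eq_bigr => k _; rewrite exprMn. Qed.

Lemma nsqBE x y : nsq (fun k => x k - y k) = nsq x + nsq y - 2 * \sum_k x k * y k.
Proof.
rewrite /nsq mulr_sumr -big_split -sumrB; apply: eq_bigr => k _ /=; ring.
Qed.

Lemma nsq_eq0 x : nsq x = 0 -> forall k, x k = 0.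
Proof.
move=> x0 k; apply/eqP; rewrite -sqrf_eq0; apply/eqP/le_anti.
by rewrite sqr_ge0 andbT -x0 nsq_ge1.
Qed.

Lemma cauchy_schwarz x y a b : 0 <= a -> 0 <= b -> nsq x = a ^+ 2 -> nsq y = b ^+ 2 ->
  \sum_k x k * y k <= a * b.
Proof.
move=> a0 b0 xa yb; have [az|an0] := eqVneq a 0.
  rewrite az mul0r big1// => k _; rewrite (nsq_eq0 (x := x)) ?mul0r//.
  by rewrite xa az expr0n.
have [bz|bn0] := eqVneq b 0.
  rewrite bz mulr0 big1// => k _; rewrite (nsq_eq0 (x := y)) ?mulr0//.
  by rewrite yb bz expr0n.
have ap : 0 < a by rewrite lt_neqAle eq_sym an0.
have bp : 0 < b by rewrite lt_neqAle eq_sym bn0.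
have := nsq_ge0 (fun k => b * x k - a * y k).
rewrite nsqBE !nsqZ xa yb.
have -> : \sum_k b * x k * (a * y k) = a * b * \sum_k x k * y k.
  by rewrite mulr_sumr; apply: eq_bigr => k _; ring.
have ab : 0 < a * b by exact: mulr_gt0.
set s := \sum_k _ => H.
rewrite -(ler_pM2l ab); nra.
Qed.

Variable beta : R.
Hypothesis hb : 1 < beta < 2.

(** The gradient of [|x| ^ beta] divided by [beta]; the exponent of [nsq] is [(beta - 2) / 2], and
the value at [x = 0] is [0]. *)
Definition powgrad x k : R := nsq x `^ (beta / 2 - 1) * x k.

Lemma norm_of x : exists2 a : R, 0 <= a & nsq x = a ^+ 2.
Proof.
exists (Num.sqrt (nsq x)); first exact: sqrtr_ge0.
by rewrite sqr_sqrtr// nsq_ge0.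
Qed.

Lemma powgradE x a : 0 <= a -> nsq x = a ^+ 2 ->
  forall k, powgrad x k = a `^ (beta - 2) * x k.
Proof.
move=> a0 xa k; rewrite /powgrad xa; congr (_ * _).
by rewrite -(sqr_powR2 _ a0); congr (_ `^ _); field.
Qed.

Lemma nsq_powgrad x : nsq (powgrad x) = nsq x `^ (beta - 1).
Proof.
have [a a0 xa] := norm_of x.
rewrite (_ : powgrad x = fun k => a `^ (beta - 2) * x k); last first.
  by apply/funext => k; rewrite (powgradE a0 xa).
have /andP[b1 _] := hb; rewrite nsqZ xa -exprMn sqr_powR// (@mulr_powR _ a (beta - 1)) ?subr_gt0//.
by congr ((_ `^ _ * _) ^+ 2); ring.
Qed.

(** Let [a >= b] be the two lengths and [d] that of [x - y]. The difference of the gradients is [a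
^ (beta - 2) (x - y)] plus a multiple of [y] that is at most as long, and [a ^ (beta - 2) d <= 2 d
^ (beta - 1)] because [d <= 2 a] and [beta < 2]. *)
Lemma powgrad_hoelder x y :
  nsq (fun k => powgrad x k - powgrad y k) <=
  16 * nsq (fun k => x k - y k) `^ (beta - 1).
Proof.
have /andP[b1 b2] := hb.
wlog : x y / nsq y <= nsq x.
  move=> W; case: (leP (nsq y) (nsq x)) => [/W//|/ltW/W].
  have S (f g : I -> R) : nsq (fun k => f k - g k) = nsq (fun k => g k - f k).
    by apply: eq_bigr => k _; rewrite -sqrrN opprB.
  by rewrite (S (powgrad y)) (S y).
have [a a0 xa] := norm_of x; have [b b0 yb] := norm_of y.
have [d d0 dd] := norm_of (fun k => x k - y k).
rewrite xa yb dd ler_sqr ?nnegrE// sqr_powR// => ba.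
have [az|an0] := eqVneq a 0.
  have bz : b = 0 by apply/le_anti; rewrite b0 -az ba.
  rewrite (_ : nsq _ = 0) ?mulr_ge0 ?sqr_ge0 ?powR_ge0//.
  rewrite /nsq big1// => k _; rewrite (powgradE a0 xa) (powgradE b0 yb).
  by rewrite (nsq_eq0 (x := x)) ?(nsq_eq0 (x := y)) ?xa ?yb ?az ?bz ?expr0n// !mulr0 subrr expr0n.
have ap : 0 < a by rewrite lt_neqAle eq_sym an0.
have xy := cauchy_schwarz a0 b0 xa yb.
move: (dd); rewrite nsqBE xa yb => dE.
have dge : a - b <= d.
  rewrite -ler_sqr ?nnegrE ?subr_ge0// -dE; nra.
have d2a : d <= 2 * a.
  have xny : - \sum_k x k * y k <= a * b.
    rewrite -sumrN.
    have -> : \sum_k - (x k * y k) = \sum_k x k * (- y k) by apply: eq_bigr => k _; rewrite mulrN.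
    apply: cauchy_schwarz => //; rewrite -yb /nsq; apply: eq_bigr => k _; exact: sqrrN.
  rewrite -ler_sqr ?nnegrE ?mulr_ge0// -dE; nra.
have [dz|dn0] := eqVneq d 0.
  rewrite (_ : nsq _ = 0) ?mulr_ge0 ?sqr_ge0 ?powR_ge0//.
  have xey : x = y.
    apply/funext => k; apply/eqP; rewrite -subr_eq0; apply/eqP.
    by apply: (nsq_eq0 (x := fun k => x k - y k)); rewrite dd dz expr0n.
  by rewrite /nsq big1// => k _; rewrite xey subrr expr0n.
have dp : 0 < d by rewrite lt_neqAle eq_sym dn0.
rewrite (_ : (fun k => _) = fun k => a `^ (beta - 2) * (x k - y k) +
    (a `^ (beta - 2) - b `^ (beta - 2)) * y k); last first.
  by apply/funext => k; rewrite (powgradE a0 xa) (powgradE b0 yb); ring.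
apply: le_trans (nsqD _ _) _; rewrite !nsqZ dd yb -!exprMn.
set A := a `^ (beta - 2) * d.
have A0 : 0 <= A by rewrite mulr_ge0 ?powR_ge0.
have second : ((a `^ (beta - 2) - b `^ (beta - 2)) * b) ^+ 2 <= A ^+ 2.
  have [bz|bn0] := eqVneq b 0; first by rewrite bz mulr0 expr0n sqr_ge0.
  have bp : 0 < b by rewrite lt_neqAle eq_sym bn0.
  have le1 : a `^ (beta - 2) <= b `^ (beta - 2).
    by apply: le_powR_neg => //; rewrite subr_le0 ltW.
  rewrite -sqrrN -mulNr opprB ler_sqr ?nnegrE ?mulr_ge0 ?subr_ge0 ?powR_ge0//.
  have q01 : 0 < b / a <= 1 by rewrite divr_gt0//= ler_pdivrMr// mul1r.
  have := ge1r_powR (a := b / a) (r := 2 - beta) q01.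
  have qE : (b / a) `^ (2 - beta) <= 1.
    have := le_powR_pos (r := 2 - beta) (a := b / a) (b := 1).
    by rewrite powR1; apply; first lra; case/andP: q01 => // /ltW.
  move=> _.
  have qlow : b / a <= (b / a) `^ (2 - beta) by apply: ger1_powR => //; lra.
  have aE : a `^ (beta - 2) = b `^ (beta - 2) * (b / a) `^ (2 - beta).
    rewrite powRM ?invr_ge0 ?ltW// mulrA -powRD; last by rewrite (gt_eqF bp) implybT.
    have -> : beta - 2 + (2 - beta) = 0 by ring.
    rewrite powRr0 mul1r -(powR_inv1 (ltW ap)) -powRrM; congr (_ `^ _); ring.
  have bb : b `^ (beta - 2) * b <= a `^ (beta - 2) * a.
    have E (z : R) : 0 < z -> z `^ (beta - 2) * z = z `^ (beta - 1).
      move=> z0; rewrite [RHS]mulr_powR ?ltW// ?subr_gt0//; congr (_ `^ _ * _); ring.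
    by rewrite !E//; apply: le_powR_pos => //; lra.
  have : (b `^ (beta - 2) - a `^ (beta - 2)) * b <= b `^ (beta - 2) * b * ((a - b) / a).
    rewrite {1}aE.
    have -> : (b `^ (beta - 2) - b `^ (beta - 2) * (b / a) `^ (2 - beta)) * b =
      b `^ (beta - 2) * b * (1 - (b / a) `^ (2 - beta)) by ring.
    rewrite ler_wpM2l ?mulr_ge0 ?powR_ge0//.
    have -> : (a - b) / a = 1 - b / a by field; rewrite gt_eqF.
    by rewrite lerD2l lerN2.
  move=> H; apply: le_trans H _.
  apply: (@le_trans _ _ (a `^ (beta - 2) * a * (d / a))).
      by apply: ler_pM => //; [rewrite mulr_ge0 ?powR_ge0|rewrite divr_ge0 ?subr_ge0|
      rewrite ler_wpM2r ?invr_ge0].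
  by rewrite /A le_eqVlt; apply/orP; left; apply/eqP; field; rewrite gt_eqF.
have Ale : A <= 2 * d `^ (beta - 1).
  rewrite /A; have : a `^ (beta - 2) <= (d / 2) `^ (beta - 2).
    apply: le_powR_neg; first by rewrite subr_le0 ltW.
      by rewrite divr_gt0.
    by rewrite ler_pdivrMr// mulrC.
  have -> : (d / 2) `^ (beta - 2) = d `^ (beta - 2) * 2 `^ (2 - beta).
    rewrite powRM ?invr_ge0 ?ltW//; congr (_ * _).
    rewrite -(powR_inv1 (a := 2))// -powRrM; congr (_ `^ _); ring.
  have e2 : 2 `^ (2 - beta) <= 2 :> R by apply: ler1_powR; [lra|lra].
  have -> : d `^ (beta - 1) = d `^ (beta - 2) * d.
    by rewrite mulr_powR// ?subr_gt0//; congr (_ `^ _ * _); ring.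
  move=> H; rewrite mulrA ler_wpM2r//; apply: le_trans H _.
  by rewrite mulrC ler_wpM2r ?powR_ge0.
have : A ^+ 2 <= (2 * d `^ (beta - 1)) ^+ 2 by rewrite ler_sqr ?nnegrE// mulr_ge0 ?powR_ge0.
rewrite !exprMn; move: second; rewrite !exprMn; lra.
Qed.

(** Convexity in the radial variable gives the gap for the lengths, and the Cauchy-Schwarz
inequality transfers it to the vectors. *)
Lemma powgrad_convex x y L : 0 <= L -> nsq x <= L ^+ 2 -> nsq y <= L ^+ 2 ->
  beta * (beta - 1) / 2 * L `^ (beta - 2) * nsq (fun k => y k - x k) <=
  nsq y `^ (beta / 2) - nsq x `^ (beta / 2) -
  \sum_k beta * powgrad x k * (y k - x k).
Proof.
have /andP[b1 b2] := hb.
move=> L0; have [a a0 xa] := norm_of x; have [b b0 yb] := norm_of y.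
rewrite xa yb !ler_sqr ?nnegrE// !sqr_powR2// => aL bL.
have := @powR_strongly_convex R beta L a b hb; rewrite a0 aL b0 bL => /(_ isT isT).
set K := beta * (beta - 1) / 2 * _ => H1.
have xy := cauchy_schwarz b0 a0 yb xa.
rewrite nsqBE xa yb.
have -> : \sum_k beta * powgrad x k * (y k - x k) =
    beta * a `^ (beta - 2) * (\sum_k y k * x k - a ^+ 2).
  rewrite -xa /nsq -sumrB mulr_sumr; apply: eq_bigr => k _.
  rewrite (powgradE a0 xa); ring.
move: xy; set s := \sum_k _ => xy.
have K0 : 0 <= K by rewrite !mulr_ge0 ?powR_ge0//; lra.
have [az|an0] := eqVneq a 0.
  have s0 : s = 0.
    by rewrite /s big1// => k _; rewrite (nsq_eq0 (x := x)) ?mulr0// xa az expr0n.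
  have n1 : beta != 0 by rewrite gt_eqF// (lt_trans _ b1).
  have n2 : beta - 1 != 0 by rewrite gt_eqF// subr_gt0.
  have n3 : beta - 2 != 0 by rewrite lt_eqF// subr_lt0.
  move: H1; rewrite s0 az !powR0//.
  by rewrite ?mulr0 ?mul0r ?expr0n /= !subr0 ?mulr0 ?addr0 ?mul0r ?subr0.
have ap : 0 < a by rewrite lt_neqAle eq_sym an0.
have aE : a `^ (beta - 1) = a `^ (beta - 2) * a.
  by rewrite mulr_powR ?subr_gt0//; congr (_ `^ _ * _); ring.
have Kle : 2 * K <= beta * a `^ (beta - 2).
  have : L `^ (beta - 2) <= a `^ (beta - 2) by apply: le_powR_neg => //; rewrite subr_le0 ltW.
  move=> la; have -> : 2 * K = beta * (beta - 1) * L `^ (beta - 2) by rewrite /K; field.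
  by apply: ler_pM => //; rewrite ?powR_ge0//; nra.
move: H1; rewrite aE; nra.
Qed.

End PowerVectors.

(** * Comparison, energy and duality for one time step *)

Section Scheme.
Context {R : realType} (N : nat) (N0 : (0 < N)%N) (beta nu : R).
Hypotheses (hb : 1 < beta < 2) (hnu : 0 < nu).
Implicit Types (u v w m z phi : int * int -> R) (p : int * int) (i : 'I_2).
Local Notation h := (step R N).
Local Notation gper := (@gper R N).
Local Notation avg := (@avg R N).
Local Notation Dp := (@Dp R N).
Local Notation Dm := (@Dm R N).
Local Notation Lapg := (@Lapg R N).

(** The index [(i, true)] stands for the positive part of the backward difference in the direction
[i] and [(i, false)] for the negative part of the forward difference, the only combinations that
enter the numerical Hamiltonian. *)
Definition Pv u p : 'I_2 * bool -> R := fun k =>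
  if k.2 then Num.max (Dm k.1 u p) 0 else Num.max (- Dp k.1 u p) 0.

(** The numerical Hamiltonian without its part that depends on the point only. *)
Definition Gg u p : R := nsq (Pv u p) `^ (beta / 2).

(** Up to sign, the derivatives of the numerical Hamiltonian with respect to its four arguments.
*)
Definition bb u p k : R := beta * powgrad beta (Pv u p) k.

(** The numerical flux through the edge from [p] to [p + ed i]. *)
Definition Rf u m i p : R :=
  m (p + ed i) * bb u (p + ed i) (i, true) - m p * bb u p (i, false).

Definition Tr u m p : R := \sum_i Dm i (Rf u m i) p.

(** The derivative of [Gg] at [u] in the direction [phi]. *)
Definition Lin u phi p : R :=
  \sum_i (bb u p (i, true) * Dm i phi p - bb u p (i, false) * Dp i phi p).

Lemma sum_pairE (F : 'I_2 * bool -> R) : \sum_k F k = \sum_i (F (i, true) + F (i, false)).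
Proof.
transitivity (\sum_i \sum_b F (i, b)).
  by rewrite pair_bigA; apply: eq_bigr => -[].
by apply: eq_bigr => i _; rewrite big_bool.
Qed.

Lemma Dm_shift i z p : Dm i z (p + ed i) = Dp i z p.
Proof. by rewrite /Dm addrK. Qed.

Lemma Dp_shift i z p : Dp i z (p - ed i) = Dm i z p.
Proof. by rewrite /Dp subrK. Qed.

Lemma Pv_per u : gper u -> forall p i, Pv u (p + ed i *+ N) = Pv u p.
Proof.
move=> up p i; apply/funext => -[j b]; rewrite /Pv /=.
by rewrite (gper_Dp j up) (gper_Dm j up).
Qed.

Lemma gper_Gg u : gper u -> gper (Gg u).
Proof. by move=> up p i; rewrite /Gg Pv_per. Qed.

Lemma gper_bb u k : gper u -> gper (fun p => bb u p k).
Proof. by move=> up p i; rewrite /bb Pv_per. Qed.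

Lemma gper_Rf u m i : gper u -> gper m -> gper (Rf u m i).
Proof.
move=> up mp; apply: gperB.
  by apply: gperMul; [exact: gper_shift|exact: (gper_shift _ (gper_bb (i, true) up))].
by apply: gperMul => //; exact: gper_bb.
Qed.

Lemma le_max0 (a b : R) : a <= b -> Num.max a 0 <= Num.max b 0.
Proof. by move=> ab; rewrite ge_max !le_max ab lexx orbT. Qed.

Lemma gper_sum (F : 'I_2 -> int * int -> R) : (forall i, gper (F i)) -> gper (fun p => \sum_i F i p).
Proof. by move=> Fp p j; apply: eq_bigr => i _; rewrite Fp. Qed.

Lemma gper_Tr u m : gper u -> gper m -> gper (Tr u m).
Proof. by move=> up mp; apply: gper_sum => i; exact/gper_Dm/gper_Rf. Qed.

(** The transport operator is minus the adjoint of the linearized Hamiltonian, by summation by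
parts. *)
Lemma avg_Tr u m phi : gper u -> gper m -> gper phi ->
  avg (fun p => Tr u m p * phi p) = - avg (fun p => m p * Lin u phi p).
Proof.
move=> up mp php.
rewrite (eq_avg N (w := fun p => \sum_i Dm i (Rf u m i) p * phi p)); last first.
  by move=> p; rewrite /Tr mulr_suml.
rewrite [in RHS](eq_avg N (w := fun p => \sum_i (m p * bb u p (i, true) * Dm i phi p
     - m p * bb u p (i, false) * Dp i phi p))); last first.
  by move=> p; rewrite /Lin mulr_sumr; apply: eq_bigr => i _; ring.
rewrite !avg_sum -sumrN; apply: eq_bigr => i _.
rewrite avg_partsN //; last exact: gper_Rf.
congr (- _).
rewrite (eq_avg N (w := fun p => m (p + ed i) * bb u (p + ed i) (i, true) * Dp i phi p -
   m p * bb u p (i, false) * Dp i phi p)); last by move=> p; rewrite /Rf; ring.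
rewrite !avgB; congr (_ - _).
rewrite -(@avg_shift _ N i (fun p => m p * bb u p (i, true) * Dm i phi p)).
  by apply: eq_avg => p; rewrite Dm_shift.
apply: gperMul; last exact: gper_Dm.
by apply: gperMul => //; exact: gper_bb.
Qed.

Lemma LinB u v w p : Lin u (fun p => w p - v p) p = Lin u w p - Lin u v p.
Proof.
rewrite /Lin -sumrB; apply: eq_bigr => i _; rewrite /Dm /Dp; ring.
Qed.

Lemma Pv_ge0 u p k : 0 <= Pv u p k.
Proof. by rewrite /Pv; case: k => i [] /=; rewrite le_max lexx orbT. Qed.

Lemma bb_ge0 u p k : 0 <= bb u p k.
Proof.
rewrite /bb /powgrad !mulr_ge0 ?powR_ge0 ?Pv_ge0//.
by case/andP: hb; lra.
Qed.

(** Both one-sided differences at the ends of an edge are the same number, so its two parts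
recover it. *)
Lemma Dp_Pv i u p : Dp i u p = Pv u (p + ed i) (i, true) - Pv u p (i, false).
Proof.
rewrite /Pv /= Dm_shift; set r := Dp i u p.
have [r0|r0] := leP r 0.
  by rewrite max_l ?oppr_ge0// sub0r opprK.
by rewrite max_r ?subr0// oppr_le0 ltW.
Qed.

Lemma Gg_mono u v p : (forall k, Pv v p k <= Pv u p k) -> Gg v p <= Gg u p.
Proof.
move=> vu; apply: le_powR_pos; [by case/andP: hb; lra|exact: nsq_ge0|].
apply: ler_sum => k _; have := Pv_ge0 v p k; have := vu k; nra.
Qed.

(** At a maximum point of [v - w] the discrete Laplacian of [v - w] is nonpositive and the upwind
differences of [v] dominate those of [w], hence so does [Gg]. *)
Lemma comparison v0 v w0 w (A B : int * int -> R) (dt K c : R) :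
  gper v -> gper w -> 0 < dt ->
  (forall p, (v p - v0 p) / dt - nu * Lapg v p + Gg v p = A p) ->
  (forall p, (w p - w0 p) / dt - nu * Lapg w p + Gg w p = B p) ->
  (forall p, A p - B p <= K) -> (forall p, v0 p - w0 p <= c) ->
  forall p, v p - w p <= c + dt * K.
Proof.
move=> vp wp dt0 Av Bw AB c0 q.
have [p pmax] := grid_argmax N0 (z := fun p => v p - w p) (gperB vp wp).
apply: le_trans (pmax q) _.
have h0 : 0 < h^-1 by rewrite !invr_gt0 ltr0n.
have D1 i : Dp i v p <= Dp i w p.
  by rewrite /Dp (ler_pM2r h0); have := pmax (p + ed i); lra.
have D2 i : Dm i w p <= Dm i v p.
  by rewrite /Dm (ler_pM2r h0); have := pmax (p - ed i); lra.
have G : Gg w p <= Gg v p.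
  apply: Gg_mono => -[i b]; rewrite /Pv /=; case: b.
    exact: le_max0 (D2 i).
  by apply: le_max0; rewrite lerN2.
have L : Lapg v p <= Lapg w p.
  apply: ler_sum => i _; rewrite -exprVn (ler_pM2r (exprn_gt0 2 h0)).
  by have := pmax (p + ed i); have := pmax (p - ed i); lra.
have E : (v p - w p) - (v0 p - w0 p) =
    dt * (A p - B p + nu * (Lapg v p - Lapg w p) - (Gg v p - Gg w p)).
  rewrite -(Av p) -(Bw p); field; rewrite gt_eqF//.
have : dt * (A p - B p + nu * (Lapg v p - Lapg w p) - (Gg v p - Gg w p)) <= dt * K.
  rewrite ler_pM2l//; have := AB p.
  have : nu * (Lapg v p - Lapg w p) <= 0 by rewrite mulr_ge0_le0 ?subr_le0// ltW.
  lra.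
by have := c0 p; lra.
Qed.

Lemma Pv_bound u p L : 0 <= L -> (forall i p, `|Dp i u p| <= L) -> forall k, Pv u p k <= L.
Proof.
move=> L0 uL [i b]; rewrite /Pv /=; case: b; rewrite ge_max L0 andbT.
  by have := uL i (p - ed i); rewrite Dp_shift ler_norml => /andP[].
by have := uL i p; rewrite ler_norml => /andP[]; rewrite lerNl.
Qed.

Lemma nsq_Pv_bound u p L : 0 <= L -> (forall i p, `|Dp i u p| <= L) -> nsq (Pv u p) <= (2 * L) ^+ 2.
Proof.
move=> L0 uL; rewrite /nsq.
apply: (@le_trans _ _ (\sum_(k : 'I_2 * bool) L ^+ 2)).
  by apply: ler_sum => k _; rewrite ler_sqr ?nnegrE ?Pv_ge0//; exact: Pv_bound.
by rewrite sumr_const card_prod card_ord card_bool -[in leLHS]mulr_natr; lra.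
Qed.

Lemma bb_bound u p L k : 0 <= L -> (forall i p, `|Dp i u p| <= L) ->
  bb u p k <= beta * (2 * L) `^ (beta - 1).
Proof.
have /andP[b1 b2] := hb.
move=> L0 uL; rewrite /bb ler_wpM2l//; first by lra.
have g0 : 0 <= powgrad beta (Pv u p) k by rewrite /powgrad mulr_ge0 ?powR_ge0 ?Pv_ge0.
rewrite -ler_sqr ?nnegrE ?powR_ge0//.
apply: le_trans (nsq_ge1 _ k) _; rewrite nsq_powgrad// -sqr_powR ?mulr_ge0//.
by apply: le_powR_pos; [lra|exact: nsq_ge0|exact: nsq_Pv_bound].
Qed.

(** The positive part is convex and [bb] is nonnegative, so replacing the upwind differences by
the signed ones in [powgrad_convex] only increases the gap. *)
Lemma Gg_convex v w p L : 0 <= L ->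
  (forall i p, `|Dp i v p| <= L) -> (forall i p, `|Dp i w p| <= L) ->
  beta * (beta - 1) / 2 * (2 * L) `^ (beta - 2) * nsq (fun k => Pv w p k - Pv v p k) <=
  Gg w p - Gg v p - Lin v (fun p => w p - v p) p.
Proof.
move=> L0 vL wL; have L20 : 0 <= 2 * L by rewrite mulr_ge0.
apply: le_trans (powgrad_convex hb L20 (nsq_Pv_bound p L0 vL) (nsq_Pv_bound p L0 wL)) _.
rewrite /Gg lerD2l lerN2 LinB /Lin -sumrB sum_pairE; apply: ler_sum => i _.
have key k (a b : R) : (Pv v p k = Num.max a 0) -> (Pv w p k = Num.max b 0) ->
   bb v p k * (b - a) <= beta * powgrad beta (Pv v p) k * (Pv w p k - Pv v p k).
  move=> va wb; have := bb_ge0 v p k; rewrite /bb => g0.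
  have [a0|a0] := leP a 0.
    have -> : powgrad beta (Pv v p) k = 0.
      by rewrite /powgrad va max_r// mulr0.
    by rewrite mulr0 !mul0r.
  rewrite ler_wpM2l// va wb (max_l (ltW a0)) lerB//.
  by rewrite le_max lexx.
have := key (i, true) (Dm i v p) (Dm i w p) erefl erefl.
have := key (i, false) (- Dp i v p) (- Dp i w p) erefl erefl.
lra.
Qed.

Lemma avg_young (a b : int * int -> R) (k : R) : 0 < k ->
  avg (fun p => a p * b p) <= k * avg (fun p => a p ^+ 2) + (4 * k)^-1 * avg (fun p => b p ^+ 2).
Proof.
move=> k0; rewrite -!avgZ -avgD; apply: avg_le => p.
have := sqr_ge0 (2 * k * a p - b p) => H.
rewrite -(ler_pM2l (_ : 0 < 4 * k)) ?mulr_gt0// mulrDr mulrA mulVKf ?gt_eqF ?mulr_gt0//.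
lra.
Qed.

(** Testing with [e]: the dissipation [nu |D e| ^ 2] absorbs the transport term, whose coefficient
is at most [B], and the fluxes [r], which are given in divergence form. *)
Lemma energy_step u e e1 s (r : 'I_2 -> int * int -> R) (dt B : R) :
  gper u -> gper e -> (forall i, gper (r i)) -> 0 < dt ->
  (forall p k, bb u p k <= B) ->
  (forall p, (e1 p - e p) / dt + nu * Lapg e p + Tr u e p = \sum_i Dm i (r i) p + s p) ->
  avg (fun p => e p ^+ 2) <= avg (fun p => e1 p ^+ 2) +
    dt * (16 * B ^+ 2 / nu + 1 + 2 / nu) * (avg (fun p => e p ^+ 2) +
       (\sum_i avg (fun p => r i p ^+ 2) + avg (fun p => s p ^+ 2))).
Proof.
move=> up ep rp dt0 uB eqn.
set E := avg (fun p => e p ^+ 2); set X := \sum_i avg (fun p => Dp i e p ^+ 2).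
set Rr := \sum_i _; set S := avg (fun p => s p ^+ 2).
have Dme i : avg (fun p => Dm i e p ^+ 2) = avg (fun p => Dp i e p ^+ 2).
  rewrite -(@avg_shift _ N i (fun p => Dm i e p ^+ 2)); last by move=> p j; rewrite (gper_Dm i ep).
  by apply: eq_avg => p; rewrite Dm_shift.
have Bge : 0 <= B by apply: le_trans (uB 0 (0, true)); exact: bb_ge0.
have tr : avg (fun p => Tr u e p * e p) <= nu / 4 * X + 8 * B ^+ 2 / nu * E.
  rewrite avg_Tr//.
  have -> : nu / 4 * X + 8 * B ^+ 2 / nu * E =
    avg (fun p => \sum_i (nu / 8 * (Dm i e p ^+ 2 + Dp i e p ^+ 2) + 4 * B ^+ 2 / nu * e p ^+ 2)).
    rewrite avg_sum /X mulr_sumr.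
    have -> : 8 * B ^+ 2 / nu * E = \sum_(i < 2) 4 * B ^+ 2 / nu * E by rewrite sum2E; ring.
    rewrite -big_split; apply: eq_bigr => i _ /=.
    rewrite avgD !avgZ avgD Dme; congr (_ + _); by field; rewrite ?gt_eqF.
  rewrite -avgN; apply: avg_le => p; rewrite /Lin mulr_sumr -sumrN; apply: ler_sum => i _.
  have y (a d : R) : `|a| <= B -> - (e p * (a * d)) <= nu / 8 * d ^+ 2 + 2 * B ^+ 2 / nu * e p ^+ 2.
    move=> aB.
    have a2 : a ^+ 2 <= B ^+ 2 by rewrite -(real_normK (num_real a)) ler_sqr ?nnegrE.
    have H : 0 <= (nu * d + 4 * (a * e p)) ^+ 2 by exact: sqr_ge0.
    have H2 : a ^+ 2 * e p ^+ 2 <= B ^+ 2 * e p ^+ 2 by rewrite ler_wpM2r ?sqr_ge0.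
    have -> : nu / 8 * d ^+ 2 + 2 * B ^+ 2 / nu * e p ^+ 2 =
       (nu ^+ 2 * d ^+ 2 + 16 * (B ^+ 2 * e p ^+ 2)) / (8 * nu) by field; rewrite gt_eqF.
    rewrite ler_pdivlMr ?mulr_gt0//; nra.
  have bB k : `|bb u p k| <= B by rewrite ger0_norm ?bb_ge0.
  have := y (bb u p (i, true)) (Dm i e p) (bB _).
  have := y (- bb u p (i, false)) (Dp i e p); rewrite normrN => /(_ (bB _)).
  lra.
have rr : - avg (fun p => (\sum_i Dm i (r i) p) * e p) <= nu / 4 * X + nu^-1 * Rr.
  rewrite (eq_avg N (w := fun p => \sum_i Dm i (r i) p * e p)); last by move=> p; rewrite mulr_suml.
  rewrite avg_sum -sumrN /X /Rr !mulr_sumr -big_split; apply: ler_sum => i _ /=.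
  rewrite avg_partsN// opprK.
  rewrite (eq_avg N (w := fun p => Dp i e p * r i p)); last by move=> p; rewrite mulrC.
  have n4 : 0 < nu / 4 by rewrite divr_gt0.
  apply: le_trans (avg_young _ _ n4) _.
  by rewrite [4 * _]mulrC divfK.
have ss : - avg (fun p => s p * e p) <= 2^-1 * S + 2^-1 * E.
  rewrite -avgN (eq_avg N (w := fun p => s p * - e p)); last by move=> p; rewrite mulrN.
  apply: le_trans (avg_young _ _ (_ : 0 < 2^-1)) _; first by rewrite invr_gt0.
  rewrite lerD2l (_ : (4 * 2^-1)^-1 = 2^-1 :> R); last by field.
  by rewrite ler_wpM2l// le_eqVlt; apply/orP; left; apply/eqP/eq_avg => p; rewrite sqrrN.
have tot : avg (fun p => e1 p * e p) - E + dt * (- nu * X + avg (fun p => Tr u e p * e p)) =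
    dt * (avg (fun p => (\sum_i Dm i (r i) p) * e p) + avg (fun p => s p * e p)).
  rewrite (_ : - nu * X = nu * avg (fun p => Lapg e p * e p)); last first.
    have -> : avg (fun p => Lapg e p * e p) = - X.
      by rewrite avg_Lapg// /X; congr (- _); apply: eq_bigr => i _.
    by rewrite mulNr mulrN.
  rewrite /E -avgB -!(avgD, avgZ); apply: eq_avg => p.
  have := eqn p => Ep.
  have -> : e1 p * e p - e p ^+ 2 + dt * (nu * (Lapg e p * e p) + Tr u e p * e p) =
    dt * e p * ((e1 p - e p) / dt + nu * Lapg e p + Tr u e p) by field; rewrite gt_eqF.
  rewrite Ep; ring.
have e1e : avg (fun p => e1 p * e p) <= 2^-1 * avg (fun p => e1 p ^+ 2) + 2^-1 * E.
  apply: le_trans (avg_young _ _ (_ : 0 < 2^-1)) _; first by rewrite invr_gt0.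
  by rewrite (_ : (4 * 2^-1)^-1 = 2^-1 :> R)//; field.
have X0 : 0 <= X by apply: sumr_ge0 => i _; apply: avg_ge0 => p; exact: sqr_ge0.
have R0 : 0 <= Rr by apply: sumr_ge0 => i _; apply: avg_ge0 => p; exact: sqr_ge0.
have S0 : 0 <= S by apply: avg_ge0 => p; exact: sqr_ge0.
have E0 : 0 <= E by apply: avg_ge0 => p; exact: sqr_ge0.
move: tot tr rr ss e1e.
set TT := avg (fun p => Tr u e p * e p); set RE := avg (fun p => (\sum_i Dm i (r i) p) * e p); set SE := avg (fun p => s p * e p).
set E11 := avg (fun p => e1 p * e p); set E1 := avg (fun p => e1 p ^+ 2).
move=> tot tr rr ss e1e.
have nn : 0 < nu^-1 by rewrite invr_gt0.
have q : dt * (- nu * X + TT) - dt * (RE + SE) <=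
   dt * (8 * B ^+ 2 / nu * E + nu^-1 * Rr + 2^-1 * S + 2^-1 * E).
  rewrite -mulrBr ler_pM2l//; have nX : 0 <= nu * X by rewrite mulr_ge0// ltW.
  lra.
have q2 : dt * (8 * B ^+ 2 / nu * E + nu^-1 * Rr + 2^-1 * S + 2^-1 * E) * 2 <=
   dt * (16 * B ^+ 2 / nu + 1 + 2 / nu) * (E + (Rr + S)).
  rewrite -!mulrA ler_pM2l//.
  have B2 : 0 <= B ^+ 2 / nu by rewrite mulr_ge0 ?sqr_ge0// ltW.
  have := mulr_ge0 B2 R0; have := mulr_ge0 B2 S0; have := mulr_ge0 B2 E0.
  have := mulr_ge0 (ltW nn) R0; have := mulr_ge0 (ltW nn) S0; have := mulr_ge0 (ltW nn) E0.
  lra.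
lra.
Qed.

(** Backward in time, as the Fokker-Planck equation is solved; the constant [2 a] comes from [(1 -
a) ^ -1 <= 1 + 2 a] for [a <= 1 / 2]. *)
Lemma gronwall (x y : nat -> R) (a : R) (n0 n1 : nat) : 0 <= a <= 2^-1 ->
  (forall n, 0 <= x n) -> (forall n, 0 <= y n) ->
  (forall n, (n0 <= n < n1)%N -> x n <= x n.+1 + a * (x n + y n)) ->
  forall n, (n0 <= n <= n1)%N ->
    x n <= expR (2 * a * (n1 - n)%:R) * (x n1 + a * \sum_(n <= j < n1) y j).
Proof.
move=> /andP[a0 a1] x0 y0 H n /andP[n0n nn1].
have [k kE] : exists k, k = (n1 - n)%N by exists (n1 - n)%N.
elim: k n n0n nn1 kE => [|k IH] n n0n nn1 kE.
  have -> : n = n1 by apply/eqP; rewrite eqn_leq nn1 -subn_eq0 -kE.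
  by rewrite subnn big_geq// !mulr0 expR0 mul1r addr0.
have nlt : (n < n1)%N by rewrite -subn_gt0 -kE.
have := IH n.+1 (leqW n0n) nlt; rewrite subnS -kE => /(_ erefl) IHn.
have := H n; rewrite n0n nlt => /(_ isT) Hn.
rewrite (big_ltn nlt) /=; set Y := \sum_(_ <= _ < _) _ in IHn *.
have Y0 : 0 <= Y by apply: sumr_ge0.
have step1 : x n <= (1 + 2 * a) * (x n.+1 + a * y n).
  have := x0 n; have := y0 n; have := x0 n.+1 => h1 h2 h3.
  have h4 : x n * (1 - a) <= x n.+1 + a * y n by lra.
  have h5 : 1 <= (1 + 2 * a) * (1 - a) by nra.
  have : x n <= x n * ((1 + 2 * a) * (1 - a)) by rewrite ler_peMr.
  move=> /le_trans; apply; rewrite mulrCA ler_wpM2l//; lra.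
have ek : 1 <= expR (2 * a * k%:R).
  by rewrite -expR0 ler_expR mulr_ge0// mulr_ge0.
have e2 : 1 + 2 * a <= expR (2 * a) by exact: expR_ge1Dx.
have -> : expR (2 * a * k.+1%:R) = expR (2 * a) * expR (2 * a * k%:R).
  by rewrite -expRD; congr expR; rewrite -(addn1 k) natrD; ring.
apply: le_trans step1 _.
rewrite -mulrA; apply: ler_pM => //.
- lra.
- by rewrite addr_ge0// mulr_ge0.
have ay : 0 <= a * y n by rewrite mulr_ge0.
have : a * y n <= expR (2 * a * k%:R) * (a * y n) by rewrite ler_peMl.
move: IHn; rewrite /= ; set X1 := expR _; nra.
Qed.

(** Multiply the difference of the Hamilton-Jacobi equations by [mu0 - M0] and that of the
Fokker-Planck equations by [v1 - w1]: the Laplacians cancel by symmetry, and [avg_Tr] turns the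
transport terms into the linear parts of the two convexity gaps. *)
Lemma mfg_identity v0 v1 w0 w1 mu0 mu1 M0 M1 (A B b : int * int -> R) (dt : R) :
  gper v1 -> gper w1 -> gper mu0 -> gper M0 -> 0 < dt ->
  (forall p, (v1 p - v0 p) / dt - nu * Lapg v1 p + Gg v1 p = A p) ->
  (forall p, (w1 p - w0 p) / dt - nu * Lapg w1 p + Gg w1 p = B p) ->
  (forall p, (mu1 p - mu0 p) / dt + nu * Lapg mu0 p + Tr v1 mu0 p = 0) ->
  (forall p, (M1 p - M0 p) / dt + nu * Lapg M0 p + Tr w1 M0 p = b p) ->
  avg (fun p => (v1 p - w1 p) * (mu1 p - M1 p)) - avg (fun p => (v0 p - w0 p) * (mu0 p - M0 p)) =
  dt * (avg (fun p => mu0 p * (Gg w1 p - Gg v1 p - Lin v1 (fun p => w1 p - v1 p) p)) +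
        avg (fun p => M0 p * (Gg v1 p - Gg w1 p - Lin w1 (fun p => v1 p - w1 p) p)) +
        avg (fun p => (A p - B p) * (mu0 p - M0 p)) - avg (fun p => b p * (v1 p - w1 p))).
Proof.
move=> vp wp mup Mp dt0 Hv Hw Hmu HM.
have fp : gper (fun p => v1 p - w1 p) by exact: gperB.
have ep : gper (fun p => mu0 p - M0 p) by exact: gperB.
have gp : gper (fun p => w1 p - v1 p) by exact: gperB.
have T1 := avg_Tr vp mup fp.
have T2 := avg_Tr wp Mp fp.
have L1 := avg_Lapg_sym fp ep.
have EQ p : (v1 p - w1 p) * (mu1 p - M1 p) - (v0 p - w0 p) * (mu0 p - M0 p) =
   dt * (mu0 p * (Gg w1 p - Gg v1 p) + M0 p * (Gg v1 p - Gg w1 p) + (A p - B p) * (mu0 p - M0 p)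
     - b p * (v1 p - w1 p)
     + nu * (Lapg (fun p => v1 p - w1 p) p * (mu0 p - M0 p) - (v1 p - w1 p) * Lapg (fun p => mu0 p - M0 p) p)
     - Tr v1 mu0 p * (v1 p - w1 p) + Tr w1 M0 p * (v1 p - w1 p)).
  have LB (f g : int * int -> R) : Lapg (fun p => f p - g p) p = Lapg f p - Lapg g p.
    by rewrite /Lapg -sumrB; apply: eq_bigr => i _; ring.
  rewrite -(Hv p) -(Hw p) -(HM p) !LB.
  have Z := Hmu p.
  have -> : mu1 p = mu0 p - dt * (nu * Lapg mu0 p + Tr v1 mu0 p).
    apply/eqP; rewrite -subr_eq0; apply/eqP.
    have -> : mu1 p - (mu0 p - dt * (nu * Lapg mu0 p + Tr v1 mu0 p)) =
      dt * ((mu1 p - mu0 p) / dt + nu * Lapg mu0 p + Tr v1 mu0 p) by field; rewrite gt_eqF.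
    by rewrite Z mulr0.
  by field; rewrite gt_eqF.
rewrite -avgB (eq_avg N EQ) avgZ; congr (_ * _).
rewrite !(avgD, avgN) avgZ avgB L1 subrr mulr0 addr0 T1 T2.
rewrite -!(avgD, avgN); apply: eq_avg => p.
rewrite !LinB; ring.
Qed.

Lemma Dp_diff_Pv v w : gper v -> gper w ->
  \sum_i avg (fun p => Dp i (fun p => v p - w p) p ^+ 2) <=
  2 * avg (fun p => nsq (fun k => Pv v p k - Pv w p k)).
Proof.
move=> vp wp.
pose d k p := Pv v p k - Pv w p k.
have dp k : gper (fun p => d k p ^+ 2) by move=> p i; rewrite /d !Pv_per.
have -> : 2 * avg (fun p => nsq (fun k => Pv v p k - Pv w p k)) =
    \sum_i (2 * avg (fun p => d (i, true) (p + ed i) ^+ 2) + 2 * avg (fun p => d (i, false) p ^+ 2)).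
  rewrite (eq_avg N (w := fun p => \sum_i (d (i, true) p ^+ 2 + d (i, false) p ^+ 2))); last first.
    by move=> p; rewrite /nsq sum_pairE.
  rewrite avg_sum mulr_sumr; apply: eq_bigr => i _.
  by rewrite avgD mulrDr -(avg_shift i (dp (i, true))).
apply: ler_sum => i _; rewrite -!avgZ -avgD; apply: avg_le => p.
have -> : Dp i (fun p => v p - w p) p = d (i, true) (p + ed i) - d (i, false) p.
  have -> : Dp i (fun p => v p - w p) p = Dp i v p - Dp i w p by rewrite /Dp; ring.
  rewrite !Dp_Pv /d; ring.
set x := d _ _; set y := d _ _; have := sqr_ge0 (x + y); nra.
Qed.

(** The first term suffices for [y <= eta] and the second one for [eta <= y], because [y ^ (beta -
2)] decreases in [y]. *)
Lemma powR_young (eta y : R) : 0 < eta -> 0 <= y -> y `^ (beta - 1) <= eta `^ (beta - 1) + eta `^ (beta - 2) * y.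
Proof.
have /andP[b1 b2] := hb.
move=> e0 y0; have [ye|ey] := leP y eta.
  apply: (@le_trans _ _ (eta `^ (beta - 1))); first by apply: le_powR_pos => //; lra.
  by rewrite lerDl mulr_ge0 ?powR_ge0.
apply: (@le_trans _ _ (eta `^ (beta - 2) * y)); last by rewrite lerDr powR_ge0.
have -> : y `^ (beta - 1) = y `^ (beta - 2) * y.
  by rewrite mulr_powR ?subr_gt0//; congr (_ `^ _ * _); ring.
by rewrite ler_wpM2r//; apply: le_powR_neg => //; [lra|exact: ltW].
Qed.

(** The fluxes are only Hoelder continuous in the differences, so the mean of a power appears;
[powR_young] trades it for the mean square at the price of a large constant. *)
Lemma Rf_diff v w M (Mx eta : R) : gper v -> gper w -> gper M -> 0 < eta ->
  (forall p, `|M p| <= Mx) ->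
  \sum_i avg (fun p => (Rf v M i p - Rf w M i p) ^+ 2) <=
  32 * beta ^+ 2 * Mx ^+ 2 * (eta `^ (beta - 1) +
    eta `^ (beta - 2) * avg (fun p => nsq (fun k => Pv v p k - Pv w p k))).
Proof.
move=> vp wp Mp e0 MM.
pose d k p := bb v p k - bb w p k.
have dp k : gper (fun p => d k p ^+ 2) by move=> p i; rewrite /d !gper_bb.
apply: (@le_trans _ _ (2 * Mx ^+ 2 * avg (fun p => nsq (fun k => d k p)))).
  have -> : 2 * Mx ^+ 2 * avg (fun p => nsq (fun k => d k p)) =
    \sum_i (2 * Mx ^+ 2 * avg (fun p => d (i, true) (p + ed i) ^+ 2) +
            2 * Mx ^+ 2 * avg (fun p => d (i, false) p ^+ 2)).
    rewrite (eq_avg N (w := fun p => \sum_i (d (i, true) p ^+ 2 + d (i, false) p ^+ 2))); last first.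
      by move=> p; rewrite /nsq sum_pairE.
    rewrite avg_sum mulr_sumr; apply: eq_bigr => i _.
    by rewrite avgD mulrDr -(avg_shift i (dp (i, true))).
  apply: ler_sum => i _; rewrite -!avgZ -avgD; apply: avg_le => p.
  have -> : Rf v M i p - Rf w M i p = M (p + ed i) * d (i, true) (p + ed i) - M p * d (i, false) p.
    by rewrite /Rf /d; ring.
  have Ms q (x : R) : (M q * x) ^+ 2 <= Mx ^+ 2 * x ^+ 2.
    rewrite exprMn ler_wpM2r ?sqr_ge0// -(real_normK (num_real (M q))) ler_sqr ?nnegrE//.
    by apply: le_trans (MM q); exact: normr_ge0.
  have := Ms (p + ed i) (d (i, true) (p + ed i)); have := Ms p (d (i, false) p).
  set x := M _ * _; set y := M _ * _; have := sqr_ge0 (x + y); nra.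
have -> : 32 * beta ^+ 2 * Mx ^+ 2 * (eta `^ (beta - 1) +
    eta `^ (beta - 2) * avg (fun p => nsq (fun k => Pv v p k - Pv w p k))) =
  2 * Mx ^+ 2 * avg (fun p => 16 * beta ^+ 2 * (eta `^ (beta - 1) +
    eta `^ (beta - 2) * nsq (fun k => Pv v p k - Pv w p k))).
  by rewrite avgZ avgD avg_cst// avgZ; ring.
apply: ler_wpM2l; first by rewrite mulr_ge0 ?sqr_ge0.
apply: avg_le => p.
rewrite (_ : (fun k => d k p) = fun k => beta * (powgrad beta (Pv v p) k - powgrad beta (Pv w p) k)); last first.
  by apply/funext => k; rewrite /d /bb; ring.
have -> : 16 * beta ^+ 2 = beta ^+ 2 * 16 by ring.
rewrite nsqZ -mulrA ler_wpM2l ?sqr_ge0//.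
apply: le_trans (powgrad_hoelder hb _ _) _.
by rewrite ler_wpM2l//; apply: powR_young => //; exact: nsq_ge0.
Qed.

End Scheme.

(** * Periodic functions of two variables *)

Section TorusFunctions.
Context {R : realType}.
Implicit Types (f : R * R -> R) (Q : R -> R * R -> R) (x y : R * R) (i j : 'I_2).

Lemma torus_shift f x (k l : int) : torus_fun f -> f (x + (k%:~R, l%:~R)) = f x.
Proof.
move=> tf.
have S1 (y : R * R) (n : nat) : f (y + (n%:R, 0)) = f y.
  elim: n y => [|n IH] y; first by rewrite (_ : (0%:R, 0) = 0) ?addr0.
  rewrite -(IH y) -[RHS](tf _).1 -addrA; congr (f (y + _)).
  by congr pair; rewrite /= ?addr0// -natr1.
have S2 (y : R * R) (n : nat) : f (y + (0, n%:R)) = f y.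
  elim: n y => [|n IH] y; first by rewrite (_ : (0, 0%:R) = 0) ?addr0.
  rewrite -(IH y) -[RHS](tf _).2 -addrA; congr (f (y + _)).
  by congr pair; rewrite /= ?addr0// -natr1.
have Z1 (y : R * R) (z : int) : f (y + (z%:~R, 0)) = f y.
  case: z => n; first exact: S1.
  rewrite -(S1 (y + _) n.+1) -addrA; congr f.
  by rewrite -[RHS]addr0; congr (y + _); congr pair; rewrite /= ?addr0// NegzE mulrNz addNr.
have Z2 (y : R * R) (z : int) : f (y + (0, z%:~R)) = f y.
  case: z => n; first exact: S2.
  rewrite -(S2 (y + _) n.+1) -addrA; congr f.
  by rewrite -[RHS]addr0; congr (y + _); congr pair; rewrite /= ?addr0// NegzE mulrNz addNr.
rewrite -[RHS](Z1 _ k) -[RHS](Z2 _ l) -addrA; congr (f (x + _)).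
by congr pair; rewrite /= ?addr0 ?add0r.
Qed.

Lemma torus_rep x : exists k l : int, exists2 y : R * R, x = y + (k%:~R, l%:~R) & cell y.
Proof.
exists (Num.floor x.1), (Num.floor x.2), (x.1 - (Num.floor x.1)%:~R, x.2 - (Num.floor x.2)%:~R).
  by case: x => a b; congr pair; rewrite /= subrK.
have F (a : R) : 0 <= a - (Num.floor a)%:~R < 1.
  have /andP[h1 h2] := floor_itv a.
  by rewrite intrD in h2; lra.
by split=> /=; exact: F.
Qed.

Lemma prod_norm_lt x (d : R) : (`|x| < d) = (`|x.1| < d) && (`|x.2| < d).
Proof. by rewrite prod_normE gt_max. Qed.

Lemma prod_norm_le x (d : R) : (`|x| <= d) = (`|x.1| <= d) && (`|x.2| <= d).
Proof. by rewrite prod_normE ge_max. Qed.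

(** Uniform continuity jointly in time and space, on a time interval and on the whole plane. *)
Definition ucp (a b : R) Q := forall e : R, 0 < e -> exists2 d : R, 0 < d &
  forall t t' x x', a <= t <= b -> a <= t' <= b -> `|t - t'| < d -> `|x - x'| < d ->
    `|Q t x - Q t' x'| < e.

Definition bdd (a b : R) Q := exists C : R, forall t x, a <= t <= b -> `|Q t x| <= C.

(** Compactness of [[a, b] * [0, 1] * [0, 1]] makes a property that holds near each point along a
filter hold for one index everywhere. *)
Lemma torus_compact_near (a b : R) (P : R -> R * (R * R) -> Prop) (F : set_system R) :
  ProperFilter F ->
  (forall z : R * (R * R), a <= z.1 <= b ->
     exists2 r : R, 0 < r & \forall d \near F, forall z', `|z - z'| < r -> P d z') ->
  exists d, (forall t x, a <= t <= b -> 0 <= x.1 <= 1 -> 0 <= x.2 <= 1 -> P d (t, x)).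
Proof.
move=> FF H.
pose K : set (R * (R * R)) := `[a, b]%classic `*` (`[0, 1]%classic `*` `[0, 1]%classic).
have cK : compact K by apply: compact_setX; [|apply: compact_setX]; exact: segment_compact.
have : \forall d \near F, K `<=` P d.
  apply: ((compact_near_coveringP K).1 cK R F P) => z [/= za _].
  have := H z; rewrite in_itv /= in za => /(_ za) [r r0 Hr].
  exists (ball z r, [set d | forall z', `|z - z'| < r -> P d z']) => /=.
    by split => //; exact: nbhsx_ballx.
  move=> [z' d] /= [bz Hd]; apply: Hd.
  by move: bz; rewrite -ball_normE.
move=> /filter_ex [d Hd]; exists d => t x tab x1 x2.
by apply: Hd; split; rewrite /= ?in_itv //; split; rewrite /= in_itv.
Qed.

(** Continuity relative to the time interval. *)
Definition ccont (a b : R) Q := forall t x, a <= t <= b -> forall e : R, 0 < e ->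
  exists2 r : R, 0 < r & forall t' x', a <= t' <= b -> `|t - t'| < r -> `|x - x'| < r ->
    `|Q t x - Q t' x'| < e.

Lemma within_ccont (a b : R) Q :
  {within [set z : R * (R * R) | a <= z.1 <= b], continuous (fun z : R * (R * R) => Q z.1 z.2)} ->
  ccont a b Q.
Proof.
move=> cQ t x tab e e0; have /subspace_continuousP := cQ.
move=> /(_ (t, x) tab) /cvgr_dist_lt /(_ e e0).
rewrite near_withinE => /nbhs_normP [r /= r0 Hr]; exists r => // t' x' t'ab tt xx.
by apply: (Hr (t', x')) => //=; rewrite /ball_ prod_normE /= gt_max tt xx.
Qed.

Lemma for_ccont (a b : R) Q :
  (forall z : R * (R * R), a <= z.1 <= b -> {for z, continuous (fun z : R * (R * R) => Q z.1 z.2)}) ->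
  ccont a b Q.
Proof.
move=> cQ; apply: within_ccont; apply: continuous_in_subspaceT => z.
by rewrite inE /= => zab; exact: cQ.
Qed.

(** Continuity near the unit square is uniform by compactness, and periodicity moves any point to
that square. *)
Lemma torus_uc (a b : R) Q : ccont a b Q -> (forall t, a <= t <= b -> torus_fun (Q t)) -> ucp a b Q.
Proof.
move=> cQ tQ e e0.
pose P (d : R) (z : R * (R * R)) := 0 < d /\ forall t' x', a <= z.1 <= b -> a <= t' <= b ->
  `|z.1 - t'| < d -> `|z.2 - x'| < d -> `|Q z.1 z.2 - Q t' x'| < e.
have [z zab|d Hd] := @torus_compact_near a b P (0:R)^'+.
- have [r r0 Hr] := cQ z.1 z.2 zab (e / 2) (divr_gt0 e0 (ltr0n _ 2)).
  exists (r / 2); first by rewrite divr_gt0.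
  near=> d => z'; rewrite prod_normE /= gt_max => /andP[zt zx]; split.
    by near: d; exact: nbhs_right_gt.
  move=> t' x' z'ab t'ab tt xx.
  have dr : d < r / 2 by near: d; apply: nbhs_right_lt; rewrite divr_gt0.
  have h1 := Hr _ z'.2 z'ab; have h2 := Hr _ x' t'ab.
  have -> : Q z'.1 z'.2 - Q t' x' = (Q z.1 z.2 - Q t' x') - (Q z.1 z.2 - Q z'.1 z'.2) by ring.
  rewrite (le_lt_trans (ler_normB _ _))// [e]splitr ltrD//.
    apply: h2.
      have -> : z.1 - t' = (z.1 - z'.1) + (z'.1 - t') by ring.
      by rewrite (le_lt_trans (ler_normD _ _))//; lra.
    have -> : z.2 - x' = (z.2 - z'.2) + (z'.2 - x') by rewrite addrA subrK.
    by rewrite (le_lt_trans (ler_normD _ _))//; lra.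
  by apply: h1; lra.
have [tb|tb] := pselect (exists t, a <= t <= b); last first.
  by exists 1 => // t t' x x' tab; case: tb; exists t.
have d0 : 0 < d by case: tb => t tab; case: (Hd t (0, 0)) => //=; rewrite ?lexx ?ler01.
exists d => // t t' x x' tab t'ab tt xx.
have [k [l [y xE cy]]] := torus_rep x; rewrite {}xE in xx *.
have -> : x' = (x' - (k%:~R, l%:~R)) + (k%:~R, l%:~R) by rewrite subrK.
rewrite !torus_shift; [|exact: tQ|exact: tQ].
case: cy => /andP[y10 y11] /andP[y20 y21].
have [_] : P d (t, y) by apply: Hd => //; rewrite ?y10 ?y20 /= ltW.
move=> /(_ t' (x' - (k%:~R, l%:~R)) tab t'ab tt); apply => /=.
by rewrite opprB addrA.
Unshelve. all: by end_near. Qed.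

Lemma torus_bdd (a b : R) Q : ccont a b Q -> (forall t, a <= t <= b -> torus_fun (Q t)) -> bdd a b Q.
Proof.
move=> cQ tQ.
pose P (M : R) (z : R * (R * R)) := a <= z.1 <= b -> `|Q z.1 z.2| <= M.
have [z zab|M HM] := @torus_compact_near a b P (+oo : set_system R).
- have [r r0 Hr] := cQ z.1 z.2 zab 1 ltr01.
  exists r => //; near=> M => z'; rewrite prod_normE /= gt_max => /andP[zt zx] z'ab.
  have := Hr _ _ z'ab zt zx => H.
  have : `|Q z'.1 z'.2| <= `|Q z.1 z.2| + 1.
    have -> : Q z'.1 z'.2 = Q z.1 z.2 - (Q z.1 z.2 - Q z'.1 z'.2) by ring.
    by rewrite (le_trans (ler_normB _ _))// lerD2l ltW.
  move=> /le_trans; apply; near: M; apply: nbhs_pinfty_ge; exact: num_real.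
exists M => t x tab; have [k [l [y -> [/andP[y0 y1] /andP[z0 z1]]]]] := torus_rep x.
rewrite torus_shift; last exact: tQ.
by apply: (HM t y) => //=; rewrite ?y0 ?z0 /= ltW.
Unshelve. all: by end_near. Qed.

Lemma torus_uc1 f : continuous f -> torus_fun f -> forall e : R, 0 < e -> exists2 d : R, 0 < d &
  forall x x', `|x - x'| < d -> `|f x - f x'| < e.
Proof.
move=> cf tf e e0; have [|//|d d0 H] := @torus_uc 0 0 (fun=> f) _ _ e e0.
  move=> t x _ e1 e10; have /cvgr_dist_lt /(_ e1 e10) := cf x.
  move=> /nbhs_normP [r /= r0 Hr]; exists r => // t' x' _ _ xx; exact: Hr.
by exists d => // x x' xx; apply: (H 0 0) => //; rewrite ?lexx// subrr normr0.
Qed.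

Lemma torus_bdd1 f : continuous f -> torus_fun f -> exists2 C : R, 0 <= C & forall x, `|f x| <= C.
Proof.
move=> cf tf; have [|//|C H] := @torus_bdd 0 0 (fun=> f).
  move=> t x _ e1 e10; have /cvgr_dist_lt /(_ e1 e10) := cf x.
  move=> /nbhs_normP [r /= r0 Hr]; exists r => // t' x' _ _ xx; exact: Hr.
exists C => [|x]; last by apply: (H 0); rewrite lexx.
by apply: le_trans (H 0 0 _); rewrite ?normr_ge0 ?lexx.
Qed.

Lemma derive_shift f v a x :
  (derivable f (x + a) v -> derivable (fun y => f (y + a)) x v) /\
  'D_v (fun y => f (y + a)) x = 'D_v f (x + a).
Proof.
have E : (fun h : R => h^-1 *: (((fun y => f (y + a)) \o shift x) (h *: v) - f (x + a))) =
  (fun h : R => h^-1 *: ((f \o shift (x + a)) (h *: v) - f (x + a))).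
  by apply/funext => h /=; congr (_ *: (f _ - _)); rewrite addrA.
by split; rewrite /derivable /derive E.
Qed.

Lemma derive_diff f v a x : (forall y, derivable f y v) ->
  is_derive x v (fun y => f (y + a) - f y) ('D_v f (x + a) - 'D_v f x).
Proof.
move=> df; have [d1 d2] := derive_shift f v a x.
rewrite -d2; apply: (@is_deriveB _ _ _ (fun y => f (y + a)) f); apply: DeriveDef => //; exact: d1.
Qed.

Lemma torus_pd i f : torus_fun f -> torus_fun (pd i f).
Proof.
move=> tf x.
have E e : (forall y, f (y + e) = f y) -> pd i f (x + e) = pd i f x.
  move=> fe; rewrite /pd -(derive_shift f (evec R i) e x).2.
  by have -> : (fun y => f (y + e)) = f by apply/funext.
by split; apply: E => y; case: (tf y).
Qed.

Lemma line_is_derive f v x (r : R) : derivable f (x + r *: v) v ->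
  is_derive r (1:R) (fun r : R => f (x + r *: v)) ('D_v f (x + r *: v)).
Proof.
move=> df.
have E : (fun h : R => h^-1 *: (((fun r : R => f (x + r *: v)) \o shift r) (h *: (1:R)) - f (x + r *: v))) =
  (fun h : R => h^-1 *: ((f \o shift (x + r *: v)) (h *: v) - f (x + r *: v))).
  apply/funext => h /=; congr (_ *: (f _ - _)).
  by rewrite scalerDl /= [h *: 1]mulr1 addrCA.
apply: DeriveDef; first by rewrite /derivable E.
by rewrite /derive E.
Qed.

Lemma line_MVT f v x (s : R) : 0 < s -> (forall c, 0 <= c <= s -> derivable f (x + c *: v) v) ->
  exists2 c, 0 < c < s & f (x + s *: v) - f x = 'D_v f (x + c *: v) * s.
Proof.
move=> s0 df.
have D c : 0 <= c <= s -> is_derive c (1:R) (fun r : R => f (x + r *: v)) ('D_v f (x + c *: v)).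
  by move=> /df; exact: line_is_derive.
have [||c] := @MVT R (fun r => f (x + r *: v)) (fun r => 'D_v f (x + r *: v)) 0 s s0.
- by move=> c; rewrite in_itv /= => /andP[c0 cs]; apply: D; rewrite !ltW.
- apply: continuous_in_subspaceT => c; rewrite inE /= in_itv /= => cs.
  by apply: differentiable_continuous; apply/derivable1_diffP; have [] := D c cs.
rewrite in_itv /= scale0r addr0 subr0 => cs E; exists c => //.
Qed.

Lemma normZ_evec (c : R) i : `|c *: evec R i| = `|c|.
Proof.
rewrite normrZ prod_normE /evec /=.
by elim/ord2P: i => /=; rewrite normr0 normr1 ?(max_l ler01) ?(max_r ler01) mulr1.
Qed.

Lemma second_diff f i x (s : R) : 0 < s -> (forall y, derivable f y (evec R i)) ->
  (forall y, derivable (pd i f) y (evec R i)) ->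
  exists2 y, `|y - x| <= s &
    f (x + s *: evec R i) - 2 * f x + f (x - s *: evec R i) = pd i (pd i f) y * s ^+ 2.
Proof.
move=> s0 df ddf; set v := evec R i.
pose g y := f (y + s *: v) - f y.
have D y := derive_diff (s *: v) y df.
have dg y : derivable g y v by have [] := D y.
have gE y : 'D_v g y = pd i f (y + s *: v) - pd i f y by have [] := D y.
have [c /andP[c0 cs] Ec] := @line_MVT g v (x - s *: v) s s0 (fun c _ => dg _).
have [c' /andP[c'0 c's] Ec'] := @line_MVT (pd i f) v (x - s *: v + c *: v) s s0 (fun c _ => ddf _).
exists (x - s *: v + c *: v + c' *: v).
  have -> : x - s *: v + c *: v + c' *: v - x = (c + c' - s) *: v.
    by apply: (addIr x); rewrite subrK scalerBl scalerDl [RHS]addrC !addrA (addrAC x) (addrAC (x + _)).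
  by rewrite normZ_evec ler_norml; lra.
rewrite expr2 mulrA -Ec' -gE -Ec /g subrK; ring.
Qed.

Lemma cross_diff f i j x (s : R) : 0 < s -> (forall y, derivable f y (evec R j)) ->
  (forall y, derivable (pd j f) y (evec R i)) ->
  exists2 y, `|y - x| <= 2 * s &
    f (x + s *: evec R i + s *: evec R j) - f (x + s *: evec R i) - f (x + s *: evec R j) + f x
      = pd i (pd j f) y * s ^+ 2.
Proof.
move=> s0 df ddf; set v := evec R j; set w := evec R i.
pose g y := f (y + s *: w) - f y.
have D y := derive_diff (s *: w) y df.
have dg y : derivable g y v by have [] := D y.
have gE y : 'D_v g y = pd j f (y + s *: w) - pd j f y by have [] := D y.
have [c /andP[c0 cs] Ec] := @line_MVT g v x s s0 (fun c _ => dg _).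
have [c' /andP[c'0 c's] Ec'] := @line_MVT (pd j f) w (x + c *: v) s s0 (fun c _ => ddf _).
exists (x + c *: v + c' *: w).
  rewrite addrAC (addrAC x) subrr add0r (le_trans (ler_normD _ _))// !normZ_evec !ger0_norm ?ltW//; lra.
rewrite expr2 mulrA -Ec' -gE -Ec /g (addrAC x); ring.
Qed.

Let close2 (a b c d e : R) : `|a - c| < e / 2 -> `|b - d| < e / 2 -> c = d -> `|a - b| <= e.
Proof. by move=> + + cd; rewrite cd !ltr_norml ler_norml; lra. Qed.

Let cancel_sq (a b c d p q s : R) : a - b - c + d = p * s -> a - c - b + d = q * s -> s != 0 -> p = q.
Proof. by move=> E1 E s0; apply: (mulIf s0); rewrite -E -E1; ring. Qed.

(** Both mixed derivatives are values, at nearby points, of the same second order difference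
quotient. *)
Lemma clairaut f x : (forall y i, derivable f y (evec R i)) ->
  (forall y i j, derivable (pd i f) y (evec R j)) ->
  {for x, continuous (pd 0 (pd 1 f))} -> {for x, continuous (pd 1 (pd 0 f))} ->
  pd 0 (pd 1 f) x = pd 1 (pd 0 f) x.
Proof.
move=> df ddf c1 c2; apply/eqP; rewrite -subr_eq0 -normr_le0; apply/ler_addgt0Pl => e e0.
rewrite addr0; have e2 : 0 < e / 2 by rewrite divr_gt0.
have /cvgr_dist_lt /(_ _ e2) /nbhs_normP [r1 /= r10 H1] := c1.
have /cvgr_dist_lt /(_ _ e2) /nbhs_normP [r2 /= r20 H2] := c2.
pose s := Num.min r1 r2 / 4.
have s0 : 0 < s by rewrite divr_gt0// lt_min r10 r20.
have s1 : 2 * s < r1.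
  have : Num.min r1 r2 <= r1 by rewrite ge_min lexx.
  rewrite /s; lra.
have s2 : 2 * s < r2.
  have : Num.min r1 r2 <= r2 by rewrite ge_min lexx orbT.
  rewrite /s; lra.
have [y1 Y1 E1] := @cross_diff f 0 1 x s s0 (fun y => df y 1) (fun y => ddf y 1 0).
have [y2 Y2 E2] := @cross_diff f 1 0 x s s0 (fun y => df y 0) (fun y => ddf y 0 1).
have E : pd 0 (pd 1 f) y1 = pd 1 (pd 0 f) y2.
  apply: (cancel_sq E1 _ (_ : s ^+ 2 != 0)); last by rewrite expf_neq0// gt_eqF.
  by rewrite -E2 (addrAC x (s *: evec R 1)).
apply: (close2 _ _ E); [apply: H1|apply: H2]; rewrite /= distrC.
  exact: le_lt_trans s1.
exact: le_lt_trans s2.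
Qed.

Lemma C1_lipschitz f : torus_fun f -> is_Ck 1 f -> exists2 L : R, 0 <= L &
  forall x i (s : R), 0 <= s -> `|f (x + s *: evec R i) - f x| <= L * s.
Proof.
move=> tf [cf [df cdf]].
have [C0 C00 B0] := torus_bdd1 (cdf 0).1 (torus_pd 0 tf).
have [C1 C10 B1] := torus_bdd1 (cdf 1).1 (torus_pd 1 tf).
exists (C0 + C1); first exact: addr_ge0.
move=> x i s; rewrite le_eqVlt => /predU1P[<-|s0].
  by rewrite scale0r addr0 subrr normr0 mulr0.
have [c _ ->] := @line_MVT f (evec R i) x s s0 (fun c _ => df _ _).
rewrite normrM (gtr0_norm s0) ler_wpM2r ?(ltW s0)//.
elim/ord2P: i.
  by apply: le_trans (B0 _) _; rewrite lerDl.
by apply: le_trans (B1 _) _; rewrite lerDr.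
Qed.

End TorusFunctions.

(** * Integration over the fundamental cell *)

(** No measurability is needed: the integral of a nonnegative function is a supremum over the
simple functions below it. *)
Lemma ge0_le_integral_any d (T : measurableType d) (R : realType)
    (mu : {measure set T -> \bar R}) (D : set T) (f g : T -> \bar R) :
  (forall x, D x -> (0 <= f x)%E) -> (forall x, D x -> (f x <= g x)%E) ->
  (\int[mu]_(x in D) f x <= \int[mu]_(x in D) g x)%E.
Proof.
move=> f0 fg; rewrite (integral_mkcond D f) (integral_mkcond D g).
have F0 x : (0 <= (f \_ D) x)%E by apply: erestrict_ge0.
have G0 x : (0 <= (g \_ D) x)%E.
  by apply: erestrict_ge0 => y Dy; exact: le_trans (f0 _ Dy) (fg _ Dy).
rewrite !ge0_integralTE//; apply: ereal_sup_le => _ [h hf <-].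
exists h => // x; apply: le_trans (hf x) _.
by rewrite /patch; case: ifPn => // /set_mem; exact: fg.
Qed.

Section Covering.
Context d (X : measurableType d) (R : realType) (mu : {measure set X -> \bar R}).
Variables (I : finType) (A : I -> set X) (D : set X).
Hypotheses (mD : measurable D) (mA : forall i, measurable (A i)).

(** The step function with values [c i] dominates [f]; it is measurable although [f] need not be.
*)
Lemma int_cover_le (f : X -> \bar R) (c : I -> R) : (forall i, 0 <= c i) ->
  (forall x, D x -> (0 <= f x)%E) -> (forall x, D x -> exists2 i, A i x & (f x <= (c i)%:E)%E) ->
  (\int[mu]_(x in D) f x <= \sum_i (c i)%:E * mu (A i))%E.
Proof.
move=> c0 f0 fc.
have mi i : measurable_fun D (fun x => ((c i)%:E * (\1_(A i) x)%:E)%E).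
  apply: emeasurable_funM; first exact: measurable_cst.
  by apply/measurable_EFinP; apply: measurable_indic.
have gi i x : (0 <= (c i)%:E * (\1_(A i) x)%:E)%E by apply: mule_ge0; rewrite lee_fin.
apply: (@le_trans _ _ (\int[mu]_(x in D) (\sum_i (c i)%:E * (\1_(A i) x)%:E))%E).
  apply: ge0_le_integral_any => x Dx; first exact: f0.
  have [i Aix fi] := fc x Dx; apply: le_trans fi _.
  rewrite (bigD1 i)//= {1}/indic mem_set// mule1.
  by apply: leeDl; apply: sume_ge0 => j _; exact: gi.
rewrite ge0_integral_sum//; apply: lee_sum => i _.
rewrite ge0_integralZl_EFin//; last by apply/measurable_EFinP; apply: measurable_indic.
apply: lee_wpmul2l; first by rewrite lee_fin.
rewrite integral_indic//; apply: le_measure; last exact: subIsetl.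
  by rewrite inE; exact: measurableI.
by rewrite inE.
Qed.

End Covering.

Section Torus2.
Context {R : realType}.
Local Notation mplane := (mplane R).
Implicit Types (f g F : R * R -> R) (x : R * R).

Lemma continuous_measurable2 f : continuous f ->
  measurable_fun [set: mplane] (f : mplane -> measurableTypeR R).
Proof.
move=> cf; apply: (measurability (@RGenOpens.G R)).
  exact: RGenOpens.measurableE.
move=> _ [_ [a [b ->] <-]]; rewrite setTI.
set U := f @^-1` _.
have oU : open U by apply: open_comp; [move=> x _; exact: cf|exact: interval_open].
pose B (q : rat * rat * rat * rat) : set mplane :=
  `]ratr q.1.1.1, ratr q.1.1.2[%classic `*` `]ratr q.1.2, ratr q.2[%classic.
have -> : U = \bigcup_(q : rat * rat * rat * rat) (if asbool (B q `<=` U) then B q else set0).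
  apply/seteqP; split => [x Ux|x [q _]]; last by case: asboolP => // qU qx; exact: qU.
  have /nbhs_ballP [r /= r0 Hr] := oU x Ux.
  have rq (c : R) : exists q1 q2 : rat, [/\ c - r < ratr q1, ratr q1 < c, c < ratr q2 & ratr q2 < c + r].
    have /rat_in_itvoo [q1] : c - r < c by lra.
    have /rat_in_itvoo [q2] : c < c + r by lra.
    by rewrite !in_itv /= => /andP[h1 h2] /andP[h3 h4]; exists q1, q2.
  have [q1 [q2 [h1 h2 h3 h4]]] := rq x.1; have [q3 [q4 [h5 h6 h7 h8]]] := rq x.2.
  exists (q1, q2, q3, q4) => //; rewrite asboolT.
    by split; rewrite /= in_itv /= ?h2 ?h3 ?h6 ?h7.
  move=> y [/= ]; rewrite !in_itv /= => /andP[a1 a2] /andP[a3 a4].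
  by apply: Hr; rewrite -ball_normE /= prod_norm_lt /= !ltr_norml; apply/andP; split; lra.
apply: countable_bigcupT_measurable => [|q].
  exact: countableP.
by case: asboolP => _ //; apply: measurableX; exact: measurable_itv.
Qed.

Lemma EFin_continuous_measurable2 f : continuous f ->
  measurable_fun [set: mplane] (fun x : mplane => (f x)%:E).
Proof. by move=> cf; apply/measurable_EFinP; exact: continuous_measurable2. Qed.

Lemma leb2X (A B : set R) : measurable A -> measurable B ->
  leb2 R (A `*` B) = (lebesgue_measure A * lebesgue_measure B)%E.
Proof. by move=> mA mB; exact: (product_measure1E lebesgue_measure lebesgue_measure mA mB). Qed.

Lemma cellE : @cell R = `[0, 1[%classic `*` `[0, 1[%classic.
Proof. by apply/seteqP; split => x /=; rewrite /cell /= !in_itv. Qed.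

Lemma leb2_cell : leb2 R (@cell R) = 1%E.
Proof.
rewrite cellE leb2X// !lebesgue_measure_itv /= !lte_fin ltr01.
by rewrite sube0 mule1.
Qed.

(** Half-open, so that the squares partition the fundamental cell. *)
Definition sq (N k l : nat) : set (R * R) :=
  `[k%:R * step R N, k.+1%:R * step R N[%classic `*` `[l%:R * step R N, l.+1%:R * step R N[%classic.

Lemma measurable_sq N k l : measurable (sq N k l : set mplane).
Proof. by apply: measurableX; exact: measurable_itv. Qed.

Lemma leb1_step N (k : nat) : (0 < N)%N ->
  lebesgue_measure (`[k%:R * step R N, k.+1%:R * step R N[%classic : set R) = (step R N)%:E.
Proof.
move=> N0; have h0 : 0 < step R N by exact: step_gt0.
rewrite lebesgue_measure_itv /= lte_fin ltr_pM2r// ltr_nat ltnSn -EFinD.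
by congr (_%:E); rewrite -natr1; ring.
Qed.

Lemma leb2_sq N k l : (0 < N)%N -> leb2 R (sq N k l) = (step R N ^+ 2)%:E.
Proof. by move=> N0; rewrite leb2X// !leb1_step// -EFinM expr2. Qed.

Lemma cell_sq N x : (0 < N)%N -> cell x -> exists k l : 'I_N, sq N k l x.
Proof.
move=> N0; have h0 : 0 < step R N by exact: step_gt0.
have H (a : R) : 0 <= a < 1 -> exists k : 'I_N, k%:R * step R N <= a < k.+1%:R * step R N.
  move=> /andP[a0 a1].
  have aN : 0 <= a * N%:R by rewrite mulr_ge0.
  have /andP[h1 h2] := truncn_itv aN.
  have kN : (Num.truncn (a * N%:R) < N)%N.
    rewrite -(ltr_nat R); apply: le_lt_trans h1 _.
    by rewrite -[ltRHS]mul1r ltr_pM2r// ltr0n.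
  exists (Ordinal kN); rewrite /step ler_pdivrMr ?ltr0n// ltr_pdivlMr ?ltr0n//.
  by rewrite h1 h2.
case: x => a b [/= /H[k hk] /H[l hl]]; exists k, l.
by split; rewrite /= in_itv.
Qed.

Lemma sq_cell N (k l : 'I_N) x : sq N k l x -> cell x.
Proof.
have N0 : (0 < N)%N by case: k => k; exact: leq_trans.
have H (i : 'I_N) (a : R) : i%:R * step R N <= a < i.+1%:R * step R N -> 0 <= a < 1.
  move=> /andP[h1 h2]; rewrite (le_trans _ h1) ?mulr_ge0 ?invr_ge0//=.
  apply: lt_le_trans h2 _; rewrite /step ler_pdivrMr ?ltr0n// mul1r ler_nat.
  exact: ltn_ord.
by case: x => a b [/=]; rewrite !in_itv /= => /H h1 /H h2.
Qed.

Lemma int_cell_le N F (c : int * int -> R) : (0 < N)%N ->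
  (forall x, cell x -> 0 <= F x) ->
  (forall (k l : 'I_N) x, sq N k l x -> F x <= c (k%:Z, l%:Z)) ->
  (\int[leb2 R]_(x in @cell R) (F x)%:E <= (avg N c)%:E)%E.
Proof.
move=> N0 F0 Fc; have h0 : 0 < step R N by exact: step_gt0.
have c0 (k l : 'I_N) : 0 <= c (k%:Z, l%:Z).
  have sx : sq N k l (k%:R * step R N, l%:R * step R N).
    by split; rewrite /= in_itv /= lexx ltr_pM2r// ltr_nat ltnSn.
  by apply: le_trans (Fc k l _ sx); apply: F0; exact: sq_cell sx.
apply: le_trans (@int_cover_le _ _ _ (leb2 R) _ (fun kl : 'I_N * 'I_N => sq N kl.1 kl.2) _ _ _ _
   (fun kl => c (kl.1%:Z, kl.2%:Z)) _ _ _) _.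
- exact: measurable_cell.
- by move=> kl; exact: measurable_sq.
- by move=> kl; exact: c0.
- by move=> x cx; rewrite lee_fin; exact: F0.
- by move=> x cx; have [k [l skl]] := cell_sq N0 cx; exists (k, l) => //=; rewrite lee_fin; exact: Fc.
rewrite /avg mulr_sumr le_eqVlt; apply/orP; left; apply/eqP.
under [X in _ = X%:E]eq_bigr do rewrite mulr_sumr.
rewrite pair_big /= -sumEFin; apply: eq_bigr => -[k l] _ /=.
by rewrite leb2_sq// -EFinM mulrC.
Qed.

Lemma bounded_integrable_cell f : measurable_fun [set: mplane] (f : mplane -> measurableTypeR R) ->
  (exists C : R, forall x, `|f x| <= C) ->
  (leb2 R).-integrable (@cell R) (EFin \o f).
Proof.
move=> mf [C fC]; apply: measurable_bounded_integrable.
- exact: measurable_cell.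
- by rewrite leb2_cell ltry.
- exact: measurable_funTS.
- exists C; split => [|x Cx y _]; first exact: num_real.
  by apply: le_trans (fC y) _; exact: ltW.
Qed.

Lemma cont_integrable f : continuous f -> torus_fun f -> (leb2 R).-integrable (@cell R) (EFin \o f).
Proof.
move=> cf tf; apply: bounded_integrable_cell; first exact: continuous_measurable2.
by have [C _ HC] := torus_bdd1 cf tf; exists C.
Qed.

Definition nd N (p : int * int) : R * R := node R N p.1 p.2.

Lemma int_cell_cst (c : R) : \int[leb2 R]_(x in @cell R) c = c.
Proof.
rewrite Rintegral_cst; last exact: measurable_cell.
by rewrite leb2_cell mulr1.
Qed.

(** On each square the function differs from its value at the corner by at most [e]. *)
Lemma riemann N f (e : R) : (0 < N)%N -> measurable_fun [set: mplane] (f : mplane -> measurableTypeR R) ->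
  (exists C : R, forall x, `|f x| <= C) ->
  (forall (k l : 'I_N) x, sq N k l x -> `|f x - f (nd N (k%:Z, l%:Z))| <= e) ->
  `|avg N (fun p => f (nd N p)) - \int[leb2 R]_(x in @cell R) f x| <= e.
Proof.
move=> N0.
have H g : measurable_fun [set: mplane] (g : mplane -> measurableTypeR R) ->
   (exists C : R, forall x, `|g x| <= C) ->
   (forall (k l : 'I_N) x, sq N k l x -> `|g x - g (nd N (k%:Z, l%:Z))| <= e) ->
   \int[leb2 R]_(x in @cell R) g x <= avg N (fun p => g (nd N p)) + e.
  move=> mg [C gC] osc.
  have ig : (leb2 R).-integrable (@cell R) (EFin \o g) by apply: bounded_integrable_cell => //; exists C.
  have iC : (leb2 R).-integrable (@cell R) (EFin \o (fun=> C)).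
    by apply: bounded_integrable_cell; [exact: measurable_cst|exists `|C| => _].
  rewrite -(lerD2r C) -[X in _ + X <= _](int_cell_cst C) -RintegralD//; last exact: measurable_cell.
  have E : avg N (fun p => g (nd N p)) + e + C = avg N (fun p => g (nd N p) + (e + C)).
    by rewrite avgD avg_cst// addrA.
  rewrite E /Rintegral -lee_fin.
  have L := @int_cell_le N (fun x => g x + C) (fun p => g (nd N p) + (e + C)) N0.
  have {}L : (\int[leb2 R]_(x in @cell R) (g x + C)%:E <= (avg N (fun p => (g (nd N p) + (e + C))%R))%:E)%E.
    apply: L => [x _|k l x skl].
      by have := gC x; rewrite ler_norml => /andP[]; lra.
    by have := osc k l x skl; rewrite ler_norml => /andP[_]; lra.
  rewrite fineK//; rewrite ge0_fin_numE; first exact: le_lt_trans L (ltry _).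
  apply: integral_ge0 => x _; rewrite lee_fin.
  by have := gC x; rewrite ler_norml => /andP[]; lra.
move=> mf [C fC] osc; rewrite ler_norml.
have h1 := H f mf (ex_intro _ C fC) osc.
have h2 : \int[leb2 R]_(x in @cell R) (- f x) <= avg N (fun p => - f (nd N p)) + e.
  apply: H.
  - exact: measurable_funN.
  - by exists C => x; rewrite normrN.
  - by move=> k l x skl; rewrite -opprD normrN; exact: osc skl.
have h3 : \int[leb2 R]_(x in @cell R) (- f x) = - \int[leb2 R]_(x in @cell R) f x.
  transitivity (\int[leb2 R]_(x in @cell R) (-1 * f x)).
    by apply: eq_Rintegral => x _; rewrite mulN1r.
  rewrite RintegralZl ?mulN1r//; first exact: measurable_cell.
  by apply: bounded_integrable_cell => //; exists C.
rewrite h3 avgN in h2; lra.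
Qed.

End Torus2.

(** * Critical points, cross derivatives and regularized fluxes *)

Lemma step_small0 (R : realType) (d : R) : 0 < d -> exists2 N, (0 < N)%N & N%:R^-1 < d.
Proof.
move=> d0; exists (Num.truncn d^-1).+1 => //.
rewrite invf_plt ?posrE//.
have di : 0 <= d^-1 by rewrite invr_ge0 ltW.
by have /andP[] := truncn_itv di.
Qed.

Section DifferenceQuotients.
Context {R : realType} {V : normedModType R}.
Implicit Types (f : V -> R) (x v : V).

Lemma derive_eps f x v (e : R) : derivable f x v -> 0 < e ->
  exists2 d : R, 0 < d & forall s, s != 0 -> `|s| < d ->
    `|s^-1 * (f (x + s *: v) - f x) - 'D_v f x| < e.
Proof.
move=> /cvg_ex [l Hl] e0.
have -> : 'D_v f x = l by rewrite /derive; exact: cvg_lim Hl.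
move: Hl => /cvgr_dist_lt /(_ _ e0) /nbhs_normP [d /= d0 Hd].
exists d => // s s0 sd; have := Hd s; rewrite /= sub0r normrN => /(_ sd s0).
by rewrite distrC [x + _]addrC.
Qed.

Lemma derive_seq f x v : derivable f x v ->
  (fun k : nat => k.+1%:R * (f (x + k.+1%:R^-1 *: v) - f x)) @ \oo --> 'D_v f x.
Proof.
move=> df; apply/cvgrPdist_lt => e e0; have [d d0 Hd] := derive_eps df e0.
near=> k.
have k0 : k.+1%:R^-1 != 0 :> R by rewrite invr_neq0// pnatr_eq0.
have := Hd k.+1%:R^-1 k0; rewrite invrK distrC; apply.
rewrite gtr0_norm ?invr_gt0//; near: k.
have [N N0 hN] := step_small0 d0.
exists N => // k /= Nk; apply: le_lt_trans hN.
by rewrite lef_pV2 ?posrE ?ltr0n// ler_nat ltnW.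
Unshelve. all: by end_near. Qed.

End DifferenceQuotients.

Section Nodes.
Context {R : realType}.
Implicit Types (f : R * R -> R) (x : R * R) (i : 'I_2).

Lemma nd_ed N p i : nd N (p + ed i) = nd N p + step R N *: evec R i :> R * R.
Proof.
rewrite /nd /node /evec /=; elim/ord2P: i => /=.
  by congr pair; rewrite /= ?addr0 ?scaler0 ?addr0// intrD mulrDl mul1r [_ *: 1]mulr1.
by congr pair; rewrite /= ?addr0 ?scaler0 ?addr0// intrD mulrDl mul1r [_ *: 1]mulr1.
Qed.

Lemma nd_edN N p i : nd N (p - ed i) = nd N p - step R N *: evec R i :> R * R.
Proof. by rewrite -[in RHS](subrK (ed i) p) nd_ed addrK. Qed.

Lemma gper_nd N f : (0 < N)%N -> torus_fun f -> gper N (fun p => f (nd N p)).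
Proof.
move=> N0 tf p i.
have -> : nd N (p + ed i *+ N) = nd N p + evec R i.
  have E (n : nat) : nd N (p + ed i *+ n) = nd N p + (n%:R * step R N) *: evec R i :> R * R.
    elim: n => [|n IH]; first by rewrite mulr0n addr0 mul0r scale0r addr0.
    by rewrite mulrSr addrA nd_ed IH -addrA -scalerDl -natr1 mulrDl mul1r.
  by rewrite E /step mulfV ?scale1r// pnatr_eq0 -lt0n.
rewrite /evec; elim/ord2P: i => /=; [exact: (tf _).1|exact: (tf _).2].
Qed.

Lemma sq_nd N (k l : nat) x : (0 < N)%N -> sq N k l x -> `|x - nd N (k%:Z, l%:Z)| < step R N.
Proof.
move=> N0 [/=]; rewrite !in_itv /= => /andP[h1 h2] /andP[h3 h4].
have E (n : nat) : n.+1%:R * step R N = n%:R * step R N + step R N by rewrite -natr1 mulrDl mul1r.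
rewrite E in h2; rewrite E in h4.
by rewrite prod_norm_lt /nd /node /= !ger0_norm ?subr_ge0//; apply/andP; split; lra.
Qed.

Lemma step_small (d : R) : 0 < d -> exists2 N, (0 < N)%N & step R N < d.
Proof. exact: step_small0. Qed.

Lemma riemann_uc f (e : R) : continuous f -> torus_fun f -> 0 < e ->
  exists2 d : R, 0 < d & forall N, (0 < N)%N -> step R N < d ->
    `|avg N (fun p => f (nd N p)) - \int[leb2 R]_(x in @cell R) f x| <= e.
Proof.
move=> cf tf e0; have [d d0 H] := torus_uc1 cf tf e0.
exists d => // N N0 hd; apply: riemann => //; first exact: continuous_measurable2.
  by have [C _ HC] := torus_bdd1 cf tf; exists C.
by move=> k l x /(sq_nd N0) skl; apply/ltW/H; exact: lt_trans hd.
Qed.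

Lemma avg_close N (f g : int * int -> R) e : (0 < N)%N -> (forall p, `|f p - g p| <= e) ->
  `|avg N f - avg N g| <= e.
Proof.
move=> N0 fg; rewrite -avgB (le_trans (avg_norm _ _))//.
by rewrite -[leRHS](avg_cst N0); exact: avg_le.
Qed.

Lemma central_diff f i x (s : R) : 0 < s -> (forall y, derivable f y (evec R i)) ->
  exists2 y, `|y - x| <= s & f (x + s *: evec R i) - f (x - s *: evec R i) = pd i f y * (2 * s).
Proof.
move=> s0 df; have s20 : 0 < 2 * s by rewrite mulr_gt0.
have [c /andP[c0 c2]] := line_MVT (x := x - s *: evec R i) s20 (fun c _ => df _).
have -> : x - s *: evec R i + (2 * s) *: evec R i = x + s *: evec R i.
  by rewrite mulr2n mulrDl !mul1r scalerDl addrA subrK.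
move=> E; exists (x - s *: evec R i + c *: evec R i) => //.
rewrite addrAC (addrAC x) subrr add0r -scaleNr -scalerDl normZ_evec ler_norml; lra.
Qed.

(** The limit of [avg_central_cross] along refined grids, which avoids second derivatives of [a]
and [b]. *)
Lemma int_cross a b : torus_fun a -> torus_fun b -> is_Ck 1 a -> is_Ck 1 b ->
  \int[leb2 R]_(x in @cell R) (pd 0 a x * pd 1 b x - pd 1 a x * pd 0 b x) = 0.
Proof.
move=> ta tb [ca [da cda]] [cb [db cdb]].
have cpa i : continuous (pd i a) := (cda i).1.
have cpb i : continuous (pd i b) := (cdb i).1.
have tpa i : torus_fun (pd i a) by exact: torus_pd.
have tpb i : torus_fun (pd i b) by exact: torus_pd.
pose F x := pd 0 a x * pd 1 b x - pd 1 a x * pd 0 b x.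
have cF : continuous F.
  by move=> x; apply: cvgB; apply: cvgM; [exact: cpa|exact: cpb|exact: cpa|exact: cpb].
have tF : torus_fun F.
  by move=> x; split; rewrite /F ?(tpa _ _).1 ?(tpb _ _).1 ?(tpa _ _).2 ?(tpb _ _).2.
have [C C0 BC] : exists2 C : R, 0 < C & forall i x, `|pd i a x| <= C /\ `|pd i b x| <= C.
  have [C1 h1 H1] := torus_bdd1 (cpa 0) (tpa 0); have [C2 h2 H2] := torus_bdd1 (cpa 1) (tpa 1).
  have [C3 h3 H3] := torus_bdd1 (cpb 0) (tpb 0); have [C4 h4 H4] := torus_bdd1 (cpb 1) (tpb 1).
  exists (C1 + C2 + C3 + C4 + 1); first lra.
  elim/ord2P => x; split.
  - by apply: le_trans (H1 x) _; lra.
  - by apply: le_trans (H3 x) _; lra.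
  - by apply: le_trans (H2 x) _; lra.
  - by apply: le_trans (H4 x) _; lra.
apply/eqP; rewrite -normr_le0; apply/ler_addgt0Pl => e e0; rewrite addr0.
have e2 : 0 < e / 2 by rewrite divr_gt0.
have [d d0 Hd] := riemann_uc cF tF e2.
pose eta := e / 2 / (4 * C).
have eta0 : 0 < eta by rewrite !divr_gt0// mulr_gt0.
have [r r0 Hr] : exists2 r : R, 0 < r & forall i x y, `|x - y| < r ->
   `|pd i a x - pd i a y| <= eta /\ `|pd i b x - pd i b y| <= eta.
  have [r1 h1 H1] := torus_uc1 (cpa 0) (tpa 0) eta0; have [r2 h2 H2] := torus_uc1 (cpa 1) (tpa 1) eta0.
  have [r3 h3 H3] := torus_uc1 (cpb 0) (tpb 0) eta0; have [r4 h4 H4] := torus_uc1 (cpb 1) (tpb 1) eta0.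
  exists (Num.min (Num.min r1 r2) (Num.min r3 r4)); first by rewrite !lt_min h1 h2 h3 h4.
  move=> i x y; rewrite !lt_min => /andP[/andP[k1 k2] /andP[k3 k4]].
  by elim/ord2P: i; split; apply: ltW; [exact: H1|exact: H3|exact: H2|exact: H4].
have dr : 0 < Num.min d r by rewrite lt_min d0 r0.
have [N N0] := step_small dr; rewrite lt_min => /andP[hd hr].
have h0 : 0 < step R N by exact: step_gt0.
have close f i p : (forall y, derivable f y (evec R i)) -> (forall x y, `|x - y| < r -> `|pd i f x - pd i f y| <= eta) ->
   (forall x, `|pd i f x| <= C) ->
   exists al, [/\ f (nd N (p + ed i)) - f (nd N (p - ed i)) = al * (2 * step R N),
     `|al - pd i f (nd N p)| <= eta & `|al| <= C].
  move=> df Hf fC; have [y yx E] := central_diff (nd N p) h0 df.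
  exists (pd i f y); rewrite nd_ed nd_edN E; split=> //.
  by apply: Hf; exact: le_lt_trans yx hr.
have alg (al0 al1 be0 be1 a0 a1 b0 b1 : R) :
   `|al0 - a0| <= eta -> `|al1 - a1| <= eta -> `|be0 - b0| <= eta -> `|be1 - b1| <= eta ->
   `|al0| <= C -> `|al1| <= C -> `|b0| <= C -> `|b1| <= C ->
   `|(a0 * b1 - a1 * b0) - (al0 * be1 - al1 * be0)| <= e / 2.
  move=> h1 h2 h3 h4 h5 h6 h7 h8.
  have -> : e / 2 = 4 * C * eta by rewrite /eta; field; rewrite gt_eqF.
  have -> : (a0 * b1 - a1 * b0) - (al0 * be1 - al1 * be0) =
    (- ((al0 - a0) * b1)) - (al0 * (be1 - b1)) + ((al1 - a1) * b0) + (al1 * (be0 - b0)) by ring.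
  have M (x y X Y : R) : `|x| <= X -> `|y| <= Y -> `|x * y| <= X * Y by move=> *; rewrite normrM ler_pM.
  have := M _ _ _ _ h1 h8; have := M _ _ _ _ h5 h4; have := M _ _ _ _ h2 h7; have := M _ _ _ _ h6 h3.
  rewrite !ler_norml => /andP[? ?] /andP[? ?] /andP[? ?] /andP[? ?]; apply/andP; split; lra.
pose cd f i p := (f (nd N (p + ed i)) - f (nd N (p - ed i))) / (2 * step R N).
have Z : avg N (fun p => cd a 0 p * cd b 1 p - cd a 1 p * cd b 0 p) = 0.
  have := avg_central_cross (gper_nd N0 ta) (gper_nd N0 tb).
  move=> E; rewrite avgB.
  have S i j : avg N (fun p => cd a i p * cd b j p) = (2 * step R N) ^- 2 *
     avg N (fun p => (a (nd N (p + ed i)) - a (nd N (p - ed i))) * (b (nd N (p + ed j)) - b (nd N (p - ed j)))).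
    rewrite -avgZ; apply: eq_avg => p; rewrite /cd.
    set A := _ - _; set B := _ - _; set t := 2 * _.
    by rewrite -exprVn expr2 mulrACA mulrC.
  by rewrite !S E subrr.
have := avg_close (f := fun p => F (nd N p)) (g := fun p => cd a 0 p * cd b 1 p - cd a 1 p * cd b 0 p) (e := e / 2) N0.
rewrite Z subr0 => H1.
have {}H1 : `|avg N (fun p => F (nd N p))| <= e / 2.
  apply: H1 => p.
  have [al0 [A0 A0' A0'']] := close a 0 p (fun y => da y 0) (fun x y xy => (Hr 0 x y xy).1) (fun x => (BC 0 x).1).
  have [al1 [A1 A1' A1'']] := close a 1 p (fun y => da y 1) (fun x y xy => (Hr 1 x y xy).1) (fun x => (BC 1 x).1).
  have [be0 [B0 B0' B0'']] := close b 0 p (fun y => db y 0) (fun x y xy => (Hr 0 x y xy).2) (fun x => (BC 0 x).2).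
  have [be1 [B1 B1' B1'']] := close b 1 p (fun y => db y 1) (fun x y xy => (Hr 1 x y xy).2) (fun x => (BC 1 x).2).
  rewrite /cd A0 A1 B0 B1 !mulfK ?mulf_neq0 ?gt_eqF//.
  exact: (alg _ _ _ _ _ _ _ _ A0' A1' B0' B1' A0'' A1'' (BC 0 _).2 (BC 1 _).2).
have H2 := Hd N N0 hd.
move: H1 H2; rewrite /F; set I := Rintegral _ _ _; set J := avg _ _.
by move=> H1 H2; rewrite -[I](subKr J) (le_trans (ler_normB _ _))// [e]splitr lerD.
Qed.

End Nodes.

Section Isolated.
Context {R : realType}.
Implicit Types (x : R * R) (i : 'I_2).

(** A zero of [g] with nonzero derivative is isolated from the other zeros of [g]; rational
intervals count such points. *)
Lemma isolated_countable (A : set R) (g dg : R -> R) :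
  (forall r, A r -> g r = 0) -> (forall r, A r -> is_derive r (1:R) g (dg r)) ->
  countable [set r | A r /\ dg r != 0].
Proof.
move=> g0 dgP.
pose B (q : rat * rat) := [set r | [/\ A r, ratr q.1 < r < ratr q.2 &
   forall r', A r' -> ratr q.1 < r' < ratr q.2 -> r' = r]].
apply: (@sub_countable _ _ _ (\bigcup_q B q)); last first.
  apply: bigcup_countable => [|q _]; first exact: countableP.
  have [[r Br]|nB] := pselect (exists r, B q r).
    apply: (@sub_countable _ _ _ [set r]); last exact: countable1.
    apply: subset_card_le => s [As qs Hs].
    by case: Br => Ar qr Hr; exact: Hr.
  rewrite (_ : B q = set0); first exact: countable0.
  by apply/seteqP; split => // r Br; apply: nB; exists r.
apply: subset_card_le => r [Ar dr].
have [d1 d2] := dgP r Ar.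
have dn : 0 < `|dg r| by rewrite normr_gt0.
have [e e0 He] := derive_eps d1 dn.
have iso r' : A r' -> `|r' - r| < e -> r' = r.
  move=> Ar' re; apply/eqP/negPn/negP => ne.
  have := He (r' - r); rewrite subr_eq0 => /(_ ne re).
  by rewrite [_ *: 1]mulr1 [r + _]addrC subrK !g0// subrr mulr0 sub0r d2 normrN ltxx.
have /rat_in_itvoo [q1] : r - e < r by lra.
have /rat_in_itvoo [q2] : r < r + e by lra.
rewrite !in_itv /= => /andP[h1 h2] /andP[h3 h4].
exists (q1, q2) => //; split => //=; first by rewrite h4 h1.
move=> r' Ar' /andP[k1 k2]; apply: iso => //.
by rewrite ltr_norml; apply/andP; split; lra.
Qed.

Lemma measurable_pd i (g : R * R -> R) : continuous g -> (forall x, derivable g x (evec R i)) ->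
  measurable_fun [set: mplane R] (pd i g : mplane R -> measurableTypeR R).
Proof.
move=> cg dg.
pose h (k : nat) x := k.+1%:R * (g (x + k.+1%:R^-1 *: evec R i) - g x).
apply: (@measurable_fun_cvg _ _ _ _ h).
  move=> k; apply: (continuous_measurable2 (f := h k)) => x.
  apply: cvgM; first exact: cvg_cst.
  apply: cvgB; last exact: cg.
  apply: (@cvg_comp _ _ _ (fun y : R * R => y + k.+1%:R^-1 *: evec R i) g).
    by apply: cvgD; [exact: cvg_id|exact: cvg_cst].
  exact: cg.
move=> x _.
exact: derive_seq.
Qed.

Lemma leb2_null_xsection (B : set (R * R)) : measurable (B : set (mplane R)) ->
  (forall a, countable (xsection B a)) -> leb2 R B = 0%E.
Proof.
move=> mB cB.
have -> : leb2 R B = (\int[lebesgue_measure]_a (lebesgue_measure (xsection B a)))%E by [].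
by apply: integral0_eq => a _; exact: countable_lebesgue_measure0.
Qed.

Lemma leb2_null_ysection (B : set (R * R)) : measurable (B : set (mplane R)) ->
  (forall a, countable (ysection B a)) -> leb2 R B = 0%E.
Proof.
move=> mB cB.
have -> : leb2 R B = (lebesgue_measure \x^ lebesgue_measure)%E B.
  by apply: product_measure_unique => // A A' mA mA'; rewrite /= product_measure2E.
have -> : (lebesgue_measure \x^ lebesgue_measure)%E B =
  (\int[lebesgue_measure]_a (lebesgue_measure (ysection B a)))%E by [].
by apply: integral0_eq => a _; exact: countable_lebesgue_measure0.
Qed.

(** On every line parallel to the axis [i] the exceptional points are countable by
[isolated_countable], so the set is null by Fubini's theorem. *)
Lemma pd_ae_null i (Z : set (R * R)) g : continuous g -> (forall x, derivable g x (evec R i)) ->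
  measurable (Z : set (mplane R)) -> (forall x, Z x -> g x = 0) ->
  measurable ([set x | Z x /\ pd i g x != 0] : set (mplane R)) /\
  leb2 R [set x | Z x /\ pd i g x != 0] = 0%E.
Proof.
move=> cg dg mZ gZ.
set B := [set x | _].
have mB : measurable (B : set (mplane R)).
  have -> : B = Z `&` ((pd i g) @^-1` (~` [set 0])).
    by apply/seteqP; split => x [Zx dx]; split => //; [move=> /eqP; apply/negP|apply/eqP].
  apply: measurableI => //; rewrite -[X in measurable X]setTI.
  by apply: measurable_pd => //; exact: measurableC.
split=> //.
have D (x : R * R) (r : R) : is_derive r (1:R) (fun r => g (x + r *: evec R i)) (pd i g (x + r *: evec R i)).
  exact: line_is_derive.
move: dg D @B mB; elim/ord2P: i => dg D B mB.
- apply: leb2_null_ysection => // a.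
  apply: (@sub_countable _ _ _ [set r | [set r | Z ((0, a) + r *: evec R 0)] r /\ pd 0 g ((0, a) + r *: evec R 0) != 0]); last first.
    exact: (isolated_countable (g := fun r => g ((0, a) + r *: evec R 0)) (fun r h => gZ _ h) (fun r _ => D _ r)).
  apply: subset_card_le => r; rewrite /ysection /= inE /B /=.
  by have -> : (r, a) = (0, a) + r *: evec R 0
    by congr pair; rewrite /= ?scaler0 ?addr0 ?add0r// [_ *: 1]mulr1.
- apply: leb2_null_xsection => // a.
  apply: (@sub_countable _ _ _ [set r | [set r | Z ((a, 0) + r *: evec R 1)] r /\ pd 1 g ((a, 0) + r *: evec R 1) != 0]); last first.
    exact: (isolated_countable (g := fun r => g ((a, 0) + r *: evec R 1)) (fun r h => gZ _ h) (fun r _ => D _ r)).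
  apply: subset_card_le => r; rewrite /xsection /= inE /B /=.
  by have -> : (a, r) = (a, 0) + r *: evec R 1
    by congr pair; rewrite /= ?scaler0 ?addr0 ?add0r// [_ *: 1]mulr1.
Qed.

End Isolated.

Section FluxAlgebra.
Context {R : realType}.

(** In an orthonormal frame whose first vector is along [p], [- det A] is the square of the mixed
entry minus the product of the pure ones; the quadratic form along [p] is the first pure entry,
and the trace determines the second one. *)
Lemma hessian_along (p0 p1 a00 a01 a11 : R) :
  (p0 ^+ 2 + p1 ^+ 2) ^+ 2 * (a01 ^+ 2 - a00 * a11) =
  (p0 * p1 * (a11 - a00) + (p0 ^+ 2 - p1 ^+ 2) * a01) ^+ 2 -
  (p0 ^+ 2 * a00 + 2 * p0 * p1 * a01 + p1 ^+ 2 * a11) *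
  ((p0 ^+ 2 + p1 ^+ 2) * (a00 + a11) - (p0 ^+ 2 * a00 + 2 * p0 * p1 * a01 + p1 ^+ 2 * a11)).
Proof. ring. Qed.

Lemma sqr3 (x y z : R) : (x + y + z) ^+ 2 <= 3 * (x ^+ 2 + y ^+ 2 + z ^+ 2).
Proof. have := sqr_ge0 (x - y); have := sqr_ge0 (y - z); have := sqr_ge0 (x - z); lra. Qed.

(** The numbers [a], [b], [e] stand for the powers of exponent [k = 1 - beta / 2] of [s0 = |p| ^
2], of [s = s0 + ep] and of [ep]; [dv] and [f] are the divergences of the regularized flux and of
the flux. Up to lower order terms, [f] determines the trace of the Hessian minus [2 k] times its
entry [lam] along [p], and [dv - f] is a combination of [f] and [lam] with factors that decrease
in [s0 / ep]. As [2 k < 1], [- det] exceeds a positive multiple of [lam ^ 2] up to a multiple of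
[f ^ 2] and lower order terms. *)
Lemma flux_algebra (k mu Mu cu D p0 p1 d0 d1 a00 a01 a11 ep a b e f : R) :
  0 < k < 2^-1 -> 0 < cu -> cu <= mu <= Mu -> d0 ^+ 2 + d1 ^+ 2 <= D ->
  0 < ep ->
  let s0 := p0 ^+ 2 + p1 ^+ 2 in let s := s0 + ep in
  let Q := p0 ^+ 2 * a00 + 2 * p0 * p1 * a01 + p1 ^+ 2 * a11 in
  let beta := 2 - 2 * k in
  let dv := beta * ((d0 * p0 + d1 * p1) / b + mu * (a00 + a11) / b - 2 * k * mu * Q / (b * s)) in
  let cc := 12 * k ^+ 2 * beta ^+ 2 * Mu ^+ 2 in
  0 < s0 -> 0 < a -> a <= b -> 0 < e -> e <= b -> b <= a + e -> ep * b ^+ 2 <= e ^+ 2 * s ->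
  f = beta * ((d0 * p0 + d1 * p1) / a + mu * (a00 + a11) / a - 2 * k * mu * Q / (a * s0)) ->
  (dv - f) ^+ 2 <=
    (3 * beta ^+ 2 * D + (3 * beta ^+ 2 * Mu ^+ 2 + cc / (1 - 2 * k) ^+ 2) *
       (2 + 2 * beta ^+ 2 * D) / (beta ^+ 2 * cu ^+ 2)) * (f ^+ 2 + s0 / a ^+ 2) * (e / b) ^+ 2 +
    cc * (2 / (1 - 2 * k)) * (ep ^+ 2 / e ^+ 2) * ((a01 ^+ 2 - a00 * a11) / s ^+ 2).
Proof.
move=> /andP[k0 k1] cu0 /andP[cmu muM] dD ep0 s0 s Q beta dv cc s00 a0 ab e0 eb bae epb fE.
have s0' : 0 < s by rewrite addr_gt0.
have b0 : 0 < b by exact: lt_le_trans ab.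
have mu0 : 0 < mu by exact: lt_le_trans cmu.
have beta0 : 0 < beta by rewrite /beta; lra.
have k2 : 0 < 1 - 2 * k by lra.
have bge := ltW beta0; have kge := ltW k0; have muge := ltW mu0.
have sq2 (x y : R) : 0 <= x ^+ 2 * y ^+ 2 by apply: mulr_ge0; exact: sqr_ge0.
pose lam := Q / s0.
pose dp := d0 * p0 + d1 * p1.
pose rho := (f - beta * dp / a) / (beta * mu).
have QE : Q = lam * s0 by rewrite /lam divfK// gt_eqF.
have trE : a00 + a11 = rho * a + 2 * k * lam.
  rewrite /rho fE QE /dp; field; rewrite !gt_eqF//.
have dvE : dv - f = beta * dp * (a^-1 - b^-1) * (-1) + beta * mu * rho * (a / b - 1) +
    2 * k * beta * mu * ((ep / s) / b) * lam.
  have -> : f = beta * mu * rho + beta * dp / a by rewrite /rho; field; rewrite !gt_eqF.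
  rewrite /dv trE QE -/dp /s; field; rewrite !gt_eqF//.
have zb : 0 <= 1 - a / b <= e / b.
  rewrite subr_ge0 ler_pdivrMr// mul1r ab /= lerBlDr -mulrDl ler_pdivlMr// mul1r addrC.
  by [].
set z := e / b in zb *.
have z01 : 0 <= z <= 1 by rewrite /z divr_ge0 ?(ltW e0) ?(ltW b0)//= ler_pdivrMr// mul1r.
set X := f ^+ 2 + s0 / a ^+ 2.
have sa0 : 0 <= s0 / a ^+ 2 by rewrite divr_ge0 ?sqr_ge0// ltW.
have dp2 : (dp / a) ^+ 2 <= D * (s0 / a ^+ 2).
  rewrite exprMn exprVn mulrA ler_wpM2r ?invr_ge0 ?sqr_ge0//.
  apply: (@le_trans _ _ ((d0 ^+ 2 + d1 ^+ 2) * s0)); last by rewrite ler_wpM2r// ltW.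
  rewrite /dp /s0; have := sqr_ge0 (d0 * p1 - d1 * p0); lra.
have D0 : 0 <= D by apply: le_trans dD; rewrite addr_ge0 ?sqr_ge0.
have X0 : 0 <= X by rewrite addr_ge0 ?sqr_ge0.
have sX : s0 / a ^+ 2 <= X by rewrite lerDr sqr_ge0.
have fX : f ^+ 2 <= X by rewrite lerDl.
have t1 : (beta * dp * (a^-1 - b^-1) * (-1)) ^+ 2 <= beta ^+ 2 * D * X * z ^+ 2.
  have -> : (beta * dp * (a^-1 - b^-1) * (-1)) ^+ 2 = beta ^+ 2 * ((dp / a) ^+ 2 * (1 - a / b) ^+ 2).
    by field; rewrite !gt_eqF.
  have -> : beta ^+ 2 * D * X * z ^+ 2 = beta ^+ 2 * (D * X * z ^+ 2) by ring.
  rewrite ler_wpM2l ?sqr_ge0//; apply: ler_pM; rewrite ?sqr_ge0//.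
    by apply: le_trans dp2 _; rewrite ler_wpM2l.
  by case/andP: zb => zb1 zb2; rewrite ler_sqr// nnegrE (le_trans zb1).
have rho2 : rho ^+ 2 <= (2 + 2 * beta ^+ 2 * D) / (beta ^+ 2 * cu ^+ 2) * X.
  rewrite /rho exprMn.
  have h1 : (f - beta * dp / a) ^+ 2 <= (2 + 2 * beta ^+ 2 * D) * X.
    have h : (f - beta * dp / a) ^+ 2 <= 2 * f ^+ 2 + 2 * beta ^+ 2 * (dp / a) ^+ 2.
      have := sqr_ge0 (f + beta * (dp / a)); lra.
    apply: le_trans h _; rewrite [leRHS]mulrDl lerD//; first by rewrite ler_wpM2l.
    rewrite -[leRHS]mulrA ler_wpM2l ?mulr_ge0 ?sqr_ge0//.
    by apply: le_trans dp2 _; rewrite ler_wpM2l.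
  rewrite [leRHS]mulrAC; apply: ler_pM => //; rewrite ?sqr_ge0//.
  rewrite exprVn lef_pV2 ?posrE ?exprn_gt0 ?mulr_gt0 ?exprn_gt0//.
  have h2 : 0 <= beta * cu by rewrite mulr_ge0 ?(ltW beta0) ?(ltW cu0).
  have h3 : 0 <= beta * mu by rewrite mulr_ge0 ?(ltW beta0) ?(ltW mu0).
  by rewrite -exprMn ler_sqr ?nnegrE// ler_pM2l.
set cr := (2 + _) / _ in rho2 *.
have mu2 : mu ^+ 2 <= Mu ^+ 2 by rewrite ler_sqr ?nnegrE ?(ltW mu0)// (le_trans (ltW mu0)).
have t2 : (beta * mu * rho * (a / b - 1)) ^+ 2 <= beta ^+ 2 * Mu ^+ 2 * (cr * X) * z ^+ 2.
  have -> : (beta * mu * rho * (a / b - 1)) ^+ 2 = beta ^+ 2 * (mu ^+ 2 * (rho ^+ 2 * (1 - a / b) ^+ 2)).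
    by ring.
  have -> : beta ^+ 2 * Mu ^+ 2 * (cr * X) * z ^+ 2 = beta ^+ 2 * (Mu ^+ 2 * (cr * X * z ^+ 2)) by ring.
  rewrite ler_wpM2l ?sqr_ge0//.
  apply: ler_pM; [exact: sqr_ge0|exact: sq2|exact: mu2|].
  apply: ler_pM; [exact: sqr_ge0|exact: sqr_ge0|exact: rho2|].
  by case/andP: zb => zb1 zb2; rewrite ler_sqr// nnegrE (le_trans zb1).
set nd := a01 ^+ 2 - a00 * a11.
have lam2 : lam ^+ 2 <= 2 / (1 - 2 * k) * nd + (rho * a) ^+ 2 / (1 - 2 * k) ^+ 2.
  have : - (lam * (a00 + a11 - lam)) <= nd.
    have H := hessian_along p0 p1 a00 a01 a11.
    have s02 : 0 < s0 ^+ 2 by rewrite exprn_gt0.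
    rewrite -/s0 -/Q -/nd QE in H; rewrite -(ler_pM2l s02) H.
    set W := (_ + _) ^+ 2; have W0 : 0 <= W by exact: sqr_ge0.
    lra.
  rewrite trE => h.
  have : lam ^+ 2 * (1 - 2 * k) ^+ 2 <= 2 * (1 - 2 * k) * nd + (rho * a) ^+ 2.
    have := sqr_ge0 (lam * (1 - 2 * k) - rho * a).
    have := ler_wpM2l (ltW k2) h; lra.
  move=> h2; rewrite -(ler_pM2r (_ : 0 < (1 - 2 * k) ^+ 2)) ?exprn_gt0//.
  apply: le_trans h2 _; rewrite le_eqVlt; apply/orP; left; apply/eqP; field; rewrite gt_eqF//.
set rl := 2 / (1 - 2 * k) * nd + _ in lam2.
have rl0 : 0 <= rl by apply: le_trans lam2; exact: sqr_ge0.
pose co := ep ^+ 2 / e ^+ 2 / s ^+ 2.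
have co0 : 0 <= co by rewrite !divr_ge0 ?sqr_ge0.
have coE : ((ep / s) / b) ^+ 2 <= co.
  have -> : co = ((ep / s) / e) ^+ 2 by rewrite /co; field; rewrite !gt_eqF.
  have h1 : 0 <= ep / s / b by rewrite !divr_ge0 ?(ltW ep0) ?(ltW s0') ?(ltW b0).
  have h2 : 0 <= ep / s / e by rewrite !divr_ge0 ?(ltW ep0) ?(ltW s0') ?(ltW e0).
  by rewrite ler_sqr ?nnegrE// ler_pM2l ?divr_gt0// lef_pV2 ?posrE.
have coR : co * (rho * a) ^+ 2 <= cr * X * z ^+ 2.
  have h : co * a ^+ 2 <= z ^+ 2.
    have -> : co * a ^+ 2 = (ep * a / (e * s)) ^+ 2 by rewrite /co; field; rewrite !gt_eqF.
    have h1 : 0 <= ep * a / (e * s).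
      by rewrite divr_ge0 ?mulr_ge0 ?(ltW ep0) ?(ltW s0') ?(ltW e0) ?(ltW a0).
    have h2 : 0 <= z by case/andP: z01.
    rewrite ler_sqr ?nnegrE// /z ler_pdivrMr ?mulr_gt0// mulrAC ler_pdivlMr//.
    have : ep * a * b <= ep * b ^+ 2 by rewrite expr2 -mulrA ler_pM2l// ler_pM2r.
    move=> /le_trans; apply; apply: le_trans epb _; lra.
  have -> : co * (rho * a) ^+ 2 = (co * a ^+ 2) * rho ^+ 2 by ring.
  rewrite [leRHS]mulrC; apply: ler_pM; [|exact: sqr_ge0|exact: h|exact: rho2].
  by apply: mulr_ge0 => //; exact: sqr_ge0.
have t3 : (2 * k * beta * mu * ((ep / s) / b) * lam) ^+ 2 <=
    4 * k ^+ 2 * beta ^+ 2 * Mu ^+ 2 * (2 / (1 - 2 * k) * (co * nd) + cr * X * z ^+ 2 / (1 - 2 * k) ^+ 2).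
  have -> : (2 * k * beta * mu * ((ep / s) / b) * lam) ^+ 2 =
    4 * k ^+ 2 * beta ^+ 2 * (mu ^+ 2 * (((ep / s) / b) ^+ 2 * lam ^+ 2)) by ring.
  rewrite -[leRHS]mulrA ler_wpM2l ?mulr_ge0 ?sqr_ge0//.
  apply: ler_pM; [exact: sqr_ge0|exact: sq2|exact: mu2|].
  apply: (@le_trans _ _ (co * rl)); first by apply: ler_pM; rewrite ?sqr_ge0.
  have -> : co * rl = 2 / (1 - 2 * k) * (co * nd) + (co * (rho * a) ^+ 2) / (1 - 2 * k) ^+ 2.
    by rewrite /rl; ring.
  by rewrite lerD2l ler_wpM2r ?invr_ge0 ?sqr_ge0.
rewrite dvE; apply: le_trans (sqr3 _ _ _) _.
have -> : cc * (2 / (1 - 2 * k)) * (ep ^+ 2 / e ^+ 2) * (nd / s ^+ 2) =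
  cc * (2 / (1 - 2 * k)) * (co * nd) by rewrite /co; ring.
have -> : (3 * beta ^+ 2 * D + (3 * beta ^+ 2 * Mu ^+ 2 + cc / (1 - 2 * k) ^+ 2) *
       (2 + 2 * beta ^+ 2 * D) / (beta ^+ 2 * cu ^+ 2)) =
    3 * beta ^+ 2 * D + (3 * beta ^+ 2 * Mu ^+ 2 + cc / (1 - 2 * k) ^+ 2) * cr by rewrite /cr; ring.
move: t1 t2 t3; rewrite /cc.
set A1 := (_) ^+ 2; set A2 := (_) ^+ 2; set A3 := (_) ^+ 2.
lra.
Qed.

End FluxAlgebra.

(** * Derivatives of the regularized flux *)

Section Derivatives.
Context {R : realType}.

Lemma powR_harmonic (k : R) : 0 < k -> (fun n : nat => (n.+1%:R^-1 ^+ 2) `^ k) @ \oo --> (0:R).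
Proof.
move=> k0; apply/cvgrPdist_lt => e e0; pose d := e `^ (2 * k)^-1.
have d0 : 0 < d by exact: powR_gt0.
have [N N0 hN] := step_small0 d0.
exists N => // n /= Nn; rewrite sub0r normrN ger0_norm ?powR_ge0//.
have r0 : 0 < n.+1%:R^-1 :> R by rewrite invr_gt0.
have rd : n.+1%:R^-1 < d.
  by apply: le_lt_trans hN; rewrite lef_pV2 ?posrE ?ltr0n// ler_nat ltnW.
have -> : e = (d ^+ 2) `^ k.
  rewrite -powR_mulrn ?(ltW d0)// -powRrM /d -powRrM mulVf ?powRr1 ?(ltW e0)//.
  by rewrite mulf_neq0// gt_eqF.
apply: gt0_ltr_powR => //; rewrite ?nnegrE ?sqr_ge0//.
by rewrite ltr_sqr ?nnegrE ?(ltW r0) ?(ltW d0).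
Qed.

Lemma derive_line (V : normedModType R) (f : V -> R) x v (d : R) :
  is_derive (0:R) (1:R) (fun r : R => f (x + r *: v)) d -> is_derive x v f d.
Proof.
move=> [d1 d2].
have E : (fun h : R => h^-1 *: (((fun r : R => f (x + r *: v)) \o shift (0:R)) (h *: (1:R)) - f (x + 0 *: v))) =
  (fun h : R => h^-1 *: ((f \o shift x) (h *: v) - f x)).
  apply/funext => h /=.
  by rewrite scale0r [x + 0]addr0 [h *: 1 + 0]addr0 [h *: 1]mulr1 (addrC x).
by apply: DeriveDef; [move: d1; rewrite /derivable E|rewrite -d2 /derive E].
Qed.

Variable beta : R.
Hypothesis hb : 1 < beta < 2.

(** At a zero of [q] the power has derivative zero, because [q] is at most quadratic there and
[beta > 1]. *)
Lemma pow_deriv (q : R -> R) (q' : R) : is_derive (0:R) (1:R) q q' -> (forall r, 0 <= q r) ->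
  (q 0 = 0 -> forall r, q r <= r ^+ 2) ->
  is_derive (0:R) (1:R) (fun r => q r `^ (beta / 2)) (beta / 2 * q 0 `^ (beta / 2 - 1) * q').
Proof.
have /andP[b1 b2] := hb.
move=> dq q0 qr; have [qz|qn] := eqVneq (q 0) 0; last first.
  have qp : 0 < q 0 by rewrite lt_neqAle eq_sym qn q0.
  apply: (@is_derive1_comp _ (fun y : R => y `^ (beta / 2)) q 0 _ _ (is_derive_powR _ qp) dq).
rewrite qz powR0; last by rewrite lt_eqF//; lra.
rewrite mulr0 mul0r.
have L : (fun h : R => h^-1 *: (((fun r => q r `^ (beta / 2)) \o shift (0:R)) (h *: (1:R)) - q 0 `^ (beta / 2))) @ 0^' --> (0:R).
  apply/cvgrPdist_lt => e e0.
  pose d := e `^ (beta - 1)^-1.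
  have d0 : 0 < d by exact: powR_gt0.
  near=> h.
  have h0 : h != 0 by near: h; exact: nbhs_dnbhs_neq.
  have hd : `|h| < d.
    near: h; apply: dnbhs0_lt => //.
  rewrite /= sub0r normrN addr0 [h *: 1]mulr1 qz powR0 ?subr0; last by rewrite gt_eqF//; lra.
  rewrite normrM (ger0_norm (powR_ge0 _ _)) normfV.
  have nh : 0 < `|h| by rewrite normr_gt0.
  have le1 : q h `^ (beta / 2) <= `|h| `^ beta.
    rewrite -(sqr_powR2 beta (normr_ge0 h)); apply: le_powR_pos => //; [lra|].
    by rewrite real_normK ?num_real//; exact: qr.
  rewrite mulrC ltr_pdivrMr//; apply: le_lt_trans le1 _.
  rewrite (mulr_powR (a := `|h|)) ?normr_ge0//; last lra.
  rewrite ltr_pM2r//.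
  have -> : e = d `^ (beta - 1) by rewrite /d -powRrM mulVf ?powRr1 ?ltW// gt_eqF//; lra.
  by apply: gt0_ltr_powR; rewrite ?nnegrE ?(ltW d0)//; lra.
apply: DeriveDef; first by apply/cvg_ex; exists 0; exact: L.
by rewrite /derive; exact: cvg_lim L.
Unshelve. all: by end_near. Qed.

Lemma enorm_pow (p : R * R) : enorm p `^ beta = (p.1 ^+ 2 + p.2 ^+ 2) `^ (beta / 2).
Proof.
rewrite /enorm -powR12_sqrt ?addr_ge0 ?sqr_ge0// -powRrM; congr (_ `^ _); ring.
Qed.

Lemma powgrad2E (g : 'I_2 -> R) i : powgrad beta g i = (g 0 ^+ 2 + g 1 ^+ 2) `^ (beta / 2 - 1) * g i.
Proof. by rewrite /powgrad /nsq sum2E. Qed.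

Lemma flux_powgrad Hc (v mu : R * R -> R) i x :
  flux Hc beta v mu i x = mu x * (beta * powgrad beta (fun j => pd j v x) i).
Proof.
rewrite /flux; congr (_ * _).
suff : is_derive (grad v x) (evec R i) (Ham Hc beta x) (beta * powgrad beta (fun j => pd j v x) i).
  by case.
apply: derive_line.
have [ev evp] : (evec R i).1 ^+ 2 + (evec R i).2 ^+ 2 = 1 /\
    pd i v x = pd 0 v x * (evec R i).1 + pd 1 v x * (evec R i).2.
  by elim/ord2P: i; rewrite /evec /= ?expr0n ?expr1n /= ?mulr1 ?mulr0 ?addr0 ?add0r.
move: ev evp; set e := evec R i => ev evp.
pose q (r : R) := (pd 0 v x + r * e.1) ^+ 2 + (pd 1 v x + r * e.2) ^+ 2.
have -> : (fun r : R => Ham Hc beta x (grad v x + r *: e)) = (fun r => Hc x + q r `^ (beta / 2)).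
  by apply/funext => r; rewrite /Ham enorm_pow.
have dq : is_derive (0:R) (1:R) q (2 * pd i v x).
  rewrite /q; apply: is_derive_eq.
  rewrite !mul0r !addr0 evp.
  set A := pd 0 v x; set B := pd 1 v x; set a := e.1; set b := e.2.
  transitivity ((A * a + A * a) + (B * b + B * b) : R); last by ring.
  by rewrite !scale0r /GRing.scale /=; ring.
have dp := pow_deriv dq.
have q0 r : 0 <= q r by rewrite addr_ge0 ?sqr_ge0.
have {dp} H := dp q0.
have E : beta * powgrad beta (fun j => pd j v x) i = 0 + beta / 2 * q 0 `^ (beta / 2 - 1) * (2 * pd i v x).
  by rewrite powgrad2E /q !mul0r !addr0 add0r; field.
rewrite E; apply: is_deriveD; apply: H.
rewrite /q !mul0r !addr0 => /eqP; rewrite paddr_eq0 ?sqr_ge0// !sqrf_eq0 => /andP[/eqP A0 /eqP B0] r.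
rewrite A0 B0 !add0r !exprMn -mulrDr ev mulr1.
by [].
Qed.

End Derivatives.

Section RegularizedFlux.
Context {R : realType} (beta : R) (hb : 1 < beta < 2) (v mu : R * R -> R).
Local Notation k := (1 - beta / 2).
Local Notation p i x := (pd i v x).
Local Notation A i j x := (pd j (pd i v) x).

Definition gsq x : R := pd 0 v x ^+ 2 + pd 1 v x ^+ 2.

(** The component [i] of the regularized flux; [ep = 0] gives the flux of the Fokker-Planck
equation. *)
Definition Fe (ep : R) (i : 'I_2) x : R := mu x * (beta * ((gsq x + ep) `^ (- k) * p i x)).

(** The derivative of [Fe ep i] in the direction [i], by the product rule. *)
Definition DFi (ep : R) (i : 'I_2) x : R :=
  pd i mu x * (beta * ((gsq x + ep) `^ (- k) * p i x)) +
  mu x * (beta * ((gsq x + ep) `^ (- k) * A i i x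
    - k * (gsq x + ep) `^ (- k - 1) * (2 * (p 0 x * A 0 i x + p 1 x * A 1 i x)) * p i x)).

Hypothesis dv : forall x i, derivable v x (evec R i).
Hypothesis ddv : forall x i j, derivable (pd i v) x (evec R j).
Hypothesis dmu : forall x i, derivable mu x (evec R i).

Lemma gsq_ge0 x : 0 <= gsq x.
Proof. by rewrite addr_ge0 ?sqr_ge0. Qed.

Lemma Fe_is_derive ep i x : 0 < gsq x + ep -> is_derive x (evec R i) (Fe ep i) (DFi ep i x).
Proof.
move=> s0; apply: derive_line.
have L (f : R * R -> R) j : derivable f x (evec R j) -> is_derive (0:R) (1:R) (fun r : R => f (x + r *: evec R j)) (pd j f x).
  move=> df; have := @line_is_derive _ f (evec R j) x 0; rewrite scale0r addr0; exact.
have L0 := L _ _ (@ddv x 0 i); have L1 := L _ _ (@ddv x 1 i); have Li := L _ _ (@ddv x i i).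
have Lm := L _ _ (@dmu x i).
pose s (r : R) := gsq (x + r *: evec R i) + ep.
have sE : s 0 = gsq x + ep by rewrite /s scale0r addr0.
have Ls : is_derive (0:R) (1:R) s (2 * (p 0 x * A 0 i x + p 1 x * A 1 i x)).
  rewrite /s /gsq; apply: is_derive_eq.
  rewrite !scale0r !addr0.
  set a := pd 0 v x; set b := pd 1 v x; set a' := pd i _ x; set b' := pd i _ x.
  transitivity ((a * a' + a * a') + (b * b' + b * b') : R); last by ring.
  by rewrite /GRing.scale /=; ring.
have sp : 0 < s 0 by rewrite sE.
have Lw := is_derive1_comp (is_derive_powR (- k) sp) Ls.
rewrite /Fe; apply: is_derive_eq.
rewrite !scale0r !addr0 sE /DFi /=.
move: ((gsq x + ep) `^ (- k)) ((gsq x + ep) `^ (- k - 1)) (A i i x) (A 0 i x) (A 1 i x).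
move: (p 0 x) (p 1 x) (p i x) (pd i mu x) (mu x) (1 - beta / 2) => c1 c2 c3 c4 c5 c6 w w' c7 c8 c9.
by rewrite /GRing.scale /=; ring.
Qed.

Lemma Fe_pd ep i x : 0 < gsq x + ep -> pd i (Fe ep i) x = DFi ep i x.
Proof. by move=> s0; have [] := Fe_is_derive i s0. Qed.

(** Along the axis [i] the component [i] of [|p| ^ (beta - 2) p] would grow like the power [beta -
1 < 1] of the distance if the pure second derivative did not vanish, and then the flux would not
be derivable. *)
Lemma crit_pure_zero i x : 0 < mu x -> {for x, continuous mu} -> gsq x = 0 ->
  derivable (Fe 0 i) x (evec R i) -> A i i x = 0.
Proof.
have /andP[b1 b2] := hb.
have beta0 : 0 < beta by lra.
have k0 : 0 < k by lra.
move=> mu0 cmu gx dF; apply/eqP/negPn/negP => a0.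
have p0 j : p j x = 0.
  move: gx => /eqP; rewrite paddr_eq0 ?sqr_ge0// !sqrf_eq0 => /andP[/eqP h0 /eqP h1].
  by elim/ord2P: j.
pose r (n : nat) : R := n.+1%:R^-1.
have r0 n : 0 < r n by rewrite invr_gt0 ltr0n.
pose y (n : nat) := x + r n *: evec R i.
pose a (j : 'I_2) (n : nat) := n.+1%:R * p j (y n).
have ca j : a j @ \oo --> A j i x.
  have := derive_seq (@ddv x j i); apply: cvg_trans; apply: near_eq_cvg.
  by near=> n; rewrite /a /y /r p0 subr0.
have cS : (fun n => a 0 n ^+ 2 + a 1 n ^+ 2) @ \oo --> A 0 i x ^+ 2 + A 1 i x ^+ 2.
  by apply: cvgD; rewrite expr2; under eq_fun do rewrite expr2; apply: cvgM; exact: ca.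
have S0 : 0 < A 0 i x ^+ 2 + A 1 i x ^+ 2.
  have : 0 < A i i x ^+ 2 by rewrite exprn_even_gt0.
  by elim/ord2P: i {dF y a ca cS} a0 => a0 h; [apply: ltr_wpDr|apply: ltr_wpDl]; rewrite ?sqr_ge0.
have cw : (fun n => (a 0 n ^+ 2 + a 1 n ^+ 2) `^ (- k)) @ \oo --> (A 0 i x ^+ 2 + A 1 i x ^+ 2) `^ (- k).
  apply: (cvg_comp (G := nbhs (A 0 i x ^+ 2 + A 1 i x ^+ 2)) _ (fun z : R => z `^ (- k)) cS).
  exact: continuous_powR_pos.
have cmuy : (fun n => mu (y n)) @ \oo --> mu x.
  apply: (cvg_comp (G := nbhs x) y mu) => //.
  apply/cvgrPdist_lt => e e0; have [N N0 hN] := step_small0 e0.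
  exists N => // n /= Nn.
  rewrite /y opprD addrA subrr sub0r normrN normZ_evec gtr0_norm//.
  by apply: le_lt_trans hN; rewrite lef_pV2 ?posrE ?ltr0n// ler_nat ltnW.
have cR : (fun n => mu (y n) * (beta * ((a 0 n ^+ 2 + a 1 n ^+ 2) `^ (- k) * a i n))) @ \oo -->
   mu x * (beta * ((A 0 i x ^+ 2 + A 1 i x ^+ 2) `^ (- k) * A i i x)).
  exact: (cvgM cmuy (cvgM (cvg_cst beta) (cvgM cw (ca i)))).
have cF := derive_seq dF.
have cr : (fun n => (r n ^+ 2) `^ k) @ \oo --> (0:R) by exact: powR_harmonic.
have := cvgM cr cF; rewrite mul0r.
have -> : (fun n => (r n ^+ 2) `^ k) \* (fun n => n.+1%:R * (Fe 0 i (x + n.+1%:R^-1 *: evec R i) - Fe 0 i x)) =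
   (fun n => mu (y n) * (beta * ((a 0 n ^+ 2 + a 1 n ^+ 2) `^ (- k) * a i n))).
  apply/funext => n /=; rewrite {2}/Fe p0 !mulr0 subr0 /Fe -/(y n) addr0.
  have nr : n.+1%:R = (r n)^-1 by rewrite /r invrK.
  have -> : a 0 n ^+ 2 + a 1 n ^+ 2 = gsq (y n) / r n ^+ 2.
    by rewrite /a /gsq nr; field; rewrite gt_eqF.
  rewrite powRM ?gsq_ge0 ?invr_ge0 ?sqr_ge0//.
  have -> : (r n ^+ 2)^-1 `^ (- k) = (r n ^+ 2) `^ k.
    by rewrite -powR_inv1 ?sqr_ge0// -powRrM mulN1r opprK.
  rewrite /a; ring.
move=> /(_ _) c0.
have /eqP : mu x * (beta * ((A 0 i x ^+ 2 + A 1 i x ^+ 2) `^ (- k) * A i i x)) = 0.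
  transitivity (lim ((fun n => mu (y n) * (beta * ((a 0 n ^+ 2 + a 1 n ^+ 2) `^ (- k) * a i n))) @ \oo)).
    by symmetry; exact: cvg_lim cR.
  exact: cvg_lim c0.
rewrite !mulf_eq0.
rewrite (gt_eqF mu0) (negbTE a0) (gt_eqF (powR_gt0 _ S0)) orbF orbF.
by rewrite gt_eqF.
Unshelve. all: by end_near. Qed.

End RegularizedFlux.

(** * Pointwise control of the divergence of the regularized flux *)

Section TorusAlgebra.
Context {R : realType}.
Implicit Types f g : R * R -> R.

Lemma torusC (c : R) : torus_fun (fun _ : R * R => c). Proof. by []. Qed.

Lemma torusM f g : torus_fun f -> torus_fun g -> torus_fun (fun x => f x * g x).
Proof. by move=> tf tg x; have [f1 f2] := tf x; have [g1 g2] := tg x; rewrite f1 f2 g1 g2. Qed.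

Lemma torusD f g : torus_fun f -> torus_fun g -> torus_fun (fun x => f x + g x).
Proof. by move=> tf tg x; have [f1 f2] := tf x; have [g1 g2] := tg x; rewrite f1 f2 g1 g2. Qed.

Lemma torusB f g : torus_fun f -> torus_fun g -> torus_fun (fun x => f x - g x).
Proof. by move=> tf tg x; have [f1 f2] := tf x; have [g1 g2] := tg x; rewrite f1 f2 g1 g2. Qed.

Lemma torus_comp (F : R -> R) f : torus_fun f -> torus_fun (fun x => F (f x)).
Proof. by move=> tf x; have [f1 f2] := tf x; rewrite f1 f2. Qed.

End TorusAlgebra.

Lemma weighted_det_algebra (R : realType) (p0 p1 a00 a01 a10 a11 ep : R) : let s := p0 ^+ 2 + p1 ^+ 2 + ep in
  ep != 0 -> 0 < s ->
  (a01 * a10 - a00 * a11) / s ^+ 2 = - (2 * ep)^-1 *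
    (((a00 * s^-1 - p0 * (s ^- 2 * (2 * (p0 * a00 + p1 * a10)))) * a11 -
      (a01 * s^-1 - p0 * (s ^- 2 * (2 * (p0 * a01 + p1 * a11)))) * a10) -
     ((a10 * s^-1 - p1 * (s ^- 2 * (2 * (p0 * a00 + p1 * a10)))) * a01 -
      (a11 * s^-1 - p1 * (s ^- 2 * (2 * (p0 * a01 + p1 * a11)))) * a00)).
Proof. by move=> s ep0 ss; rewrite /s in ss *; field; rewrite ep0 gt_eqF. Qed.

Section StaticFlux.
Context {R : realType} (beta : R) (hb : 1 < beta < 2) (v mu f : R * R -> R).
Local Notation k := (1 - beta / 2).
Local Notation A i j x := (pd j (pd i v) x).
Hypotheses (tv : torus_fun v) (tmu : torus_fun mu) (tf : torus_fun f).
Hypotheses (dv : forall x i, derivable v x (evec R i))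
  (ddv : forall x i j, derivable (pd i v) x (evec R j))
  (dmu : forall x i, derivable mu x (evec R i)).
Hypotheses (cp : forall i, continuous (pd i v)) (cA : forall i j, continuous (pd j (pd i v)))
  (cmu : continuous mu) (cdmu : forall i, continuous (pd i mu)) (cf : continuous f).
Variables (Mu cu D : R).
Hypotheses (cu0 : 0 < cu) (muP : forall x, cu <= mu x <= Mu)
  (dmuP : forall x, pd 0 mu x ^+ 2 + pd 1 mu x ^+ 2 <= D).
Hypotheses (dF : forall x i, derivable (Fe beta v mu 0 i) x (evec R i))
  (fE : forall x, f x = pd 0 (Fe beta v mu 0 0) x + pd 1 (Fe beta v mu 0 1) x).

(** The divergence of the regularized flux. *)
Definition dvF (ep : R) x : R := DFi beta v mu ep 0 x + DFi beta v mu ep 1 x.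

Definition cst2 : R := 12 * k ^+ 2 * beta ^+ 2 * Mu ^+ 2.
(** The constants are those of [flux_algebra]. *)
Definition cst1 : R := 1 + 3 * beta ^+ 2 * D + (3 * beta ^+ 2 * Mu ^+ 2 + cst2 / (1 - 2 * k) ^+ 2) *
       (2 + 2 * beta ^+ 2 * D) / (beta ^+ 2 * cu ^+ 2).

(** The second summand is the square of the flux divided by [(beta mu) ^ 2]. *)
Definition Wf x : R := f x ^+ 2 + gsq v x `^ (beta - 1).
(** The factor that tends to zero with [ep] outside the critical points of [v]. *)
Definition theta (ep : R) x : R := (ep / (gsq v x + ep)) `^ (2 * k).

Lemma beta_facts : [/\ 0 < beta, 0 < k, k < 2^-1, 0 < 1 - 2 * k & beta = 2 - 2 * k].
Proof. by have /andP[b1 b2] := hb; split; [lra|lra|lra|lra|field]. Qed.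

Lemma Hess_sym x : A 0 1 x = A 1 0 x.
Proof.
symmetry; apply: clairaut.
- by move=> y i; exact: (@dv y i).
- by move=> y i j; exact: (@ddv y i j).
- exact: cA.
- exact: cA.
Qed.

(** The form in which [flux_algebra] applies. *)
Lemma dvFE ep x : 0 < gsq v x + ep ->
  dvF ep x = (2 - 2 * k) * ((pd 0 mu x * pd 0 v x + pd 1 mu x * pd 1 v x) / (gsq v x + ep) `^ k
    + mu x * (A 0 0 x + A 1 1 x) / (gsq v x + ep) `^ k
    - 2 * k * mu x * (pd 0 v x ^+ 2 * A 0 0 x + 2 * pd 0 v x * pd 1 v x * A 0 1 x + pd 1 v x ^+ 2 * A 1 1 x)
       / ((gsq v x + ep) `^ k * (gsq v x + ep))).
Proof.
move=> s0; rewrite /dvF /DFi -(Hess_sym x).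
have -> : (gsq v x + ep) `^ (- k - 1) = ((gsq v x + ep) `^ k * (gsq v x + ep))^-1.
  rewrite powRB; last by rewrite (gt_eqF s0) implybT.
  by rewrite powRr1 ?(ltW s0)// powRN -invfM.
rewrite powRN (_ : 2 - 2 * k = beta); last by field.
have w0 := powR_gt0 k s0; move: w0.
move: (_ `^ k) => w w0; move: (gsq v x + ep) s0 => s s0.
move: (A 0 0 x) (A 0 1 x) (A 1 1 x) (pd 0 v x) (pd 1 v x) (mu x) (pd 0 mu x) (pd 1 mu x) => *.
by field; rewrite !gt_eqF.
Qed.

(** Outside the critical points this is [flux_algebra]. At a critical point the regularized
divergence is zero, since the pure second derivatives vanish by [crit_pure_zero], and the
determinant term is nonnegative for the same reason. *)
Lemma static_pointwise ep x : 0 < ep ->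
  (dvF ep x - f x) ^+ 2 <= cst1 * (Wf x * theta ep x) +
    cst2 * (2 / (1 - 2 * k)) * (ep `^ beta / (gsq v x + ep) ^+ 2 * (A 0 1 x * A 1 0 x - A 0 0 x * A 1 1 x)).
Proof.
move=> ep0; have [beta0 k0 k1 k2 bE] := beta_facts.
have g0 := gsq_ge0 v x.
have Mu0 : 0 < Mu by have /andP[h1 h2] := muP x; apply: lt_le_trans h2; exact: lt_le_trans h1.
have D0 : 0 <= D by apply: le_trans (dmuP x); rewrite addr_ge0 ?sqr_ge0.
have bge := ltW beta0; have kge := ltW k0; have Muge := ltW Mu0; have cuge := ltW cu0.
have c20 : 0 <= cst2 by rewrite /cst2 !mulr_ge0.
have c1a : 0 <= (3 * beta ^+ 2 * Mu ^+ 2 + cst2 / (1 - 2 * k) ^+ 2) *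
       (2 + 2 * beta ^+ 2 * D) / (beta ^+ 2 * cu ^+ 2).
  have h1 : 0 <= 3 * beta ^+ 2 * Mu ^+ 2 by rewrite !mulr_ge0 ?(ltW beta0) ?(ltW Mu0).
  have h2 : 0 <= cst2 / (1 - 2 * k) ^+ 2 by rewrite divr_ge0 ?sqr_ge0.
  have h3 : 0 <= 2 * beta ^+ 2 * D by rewrite !mulr_ge0 ?(ltW beta0).
  have h4 : 0 <= beta ^+ 2 * cu ^+ 2 by rewrite !mulr_ge0 ?(ltW beta0) ?(ltW cu0).
  by rewrite divr_ge0// mulr_ge0// addr_ge0.
have c1b : 0 <= 3 * beta ^+ 2 * D by rewrite !mulr_ge0 ?(ltW beta0).
have W0 : 0 <= Wf x by rewrite addr_ge0 ?sqr_ge0 ?powR_ge0.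
have [gz|gn] := eqVneq (gsq v x) 0.
  have p0 i : pd i v x = 0.
    move: gz => /eqP; rewrite paddr_eq0 ?sqr_ge0// !sqrf_eq0 => /andP[/eqP z0 /eqP z1].
    by elim/ord2P: i.
  have a0 i : A i i x = 0.
    have mx0 : 0 < mu x by have /andP[h1 _] := muP x; exact: lt_le_trans h1.
    by apply: (@crit_pure_zero _ beta hb v mu) => //; exact: cmu.
  have -> : dvF ep x = 0.
    by rewrite dvFE ?gz ?add0r// !p0 !a0 !(mulr0, mul0r, addr0, expr0n, subr0) /= ?(mulr0, mul0r, addr0, subr0).
  rewrite sub0r sqrrN a0 mul0r subr0 -Hess_sym -expr2.
  have -> : theta ep x = 1 by rewrite /theta gz add0r divff ?gt_eqF// powR1.
  rewrite mulr1.
  have h5 : 0 <= cst2 * (2 / (1 - 2 * k)) * (ep `^ beta / (gsq v x + ep) ^+ 2 * (A 0 1 x) ^+ 2).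
    have h51 : 0 <= 2 / (1 - 2 * k) by rewrite divr_ge0 ?(ltW k2).
    have h52 : 0 <= ep `^ beta / (gsq v x + ep) ^+ 2 by rewrite divr_ge0 ?powR_ge0 ?sqr_ge0.
    by apply: mulr_ge0; [exact: mulr_ge0|apply: mulr_ge0 => //; exact: sqr_ge0].
  have h6 : f x ^+ 2 <= Wf x by rewrite /Wf lerDl powR_ge0.
  have h7 : Wf x <= cst1 * Wf x.
    by rewrite ler_peMl// /cst1; lra.
  by apply: le_trans h6 _; apply: le_trans h7 _; rewrite lerDl.
have gp : 0 < gsq v x by rewrite lt_neqAle eq_sym gn.
have s0 : 0 < gsq v x + ep by rewrite addr_gt0.
set a := gsq v x `^ k; set b := (gsq v x + ep) `^ k; set e := ep `^ k.
have a0 : 0 < a by exact: powR_gt0.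
have e0 : 0 < e by exact: powR_gt0.
have b0 : 0 < b by exact: powR_gt0.
have ab : a <= b by apply: le_powR_pos; [exact: ltW|exact: ltW|rewrite lerDl ltW].
have eb : e <= b by apply: le_powR_pos; [exact: ltW|exact: ltW|rewrite lerDr ltW].
have div_pow (y : R) : 0 <= y -> (y / (gsq v x + ep)) `^ k = y `^ k / b.
  by move=> y0; rewrite powRM ?invr_ge0 ?(ltW s0)// -(powR_inv1 (ltW s0)) -powRrM mulN1r powRN.
have bae : b <= a + e.
  have h (y : R) : 0 < y -> y <= gsq v x + ep -> y / (gsq v x + ep) <= y `^ k / b.
    move=> y0 ys; rewrite -div_pow ?(ltW y0)//; apply: ger1_powR; last by lra.
    by rewrite divr_gt0// ler_pdivrMr// mul1r.
  have h1 := h _ gp; have h2 := h _ ep0.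
  have bi : 0 < b^-1 by rewrite invr_gt0.
  rewrite -(ler_pM2r bi) mulfV ?gt_eqF//.
  have -> : 1 = gsq v x / (gsq v x + ep) + ep / (gsq v x + ep) by rewrite -mulrDl mulfV// gt_eqF.
  rewrite [leRHS]mulrDl; apply: lerD; [apply: h1; rewrite lerDl; exact: ltW|apply: h2; rewrite lerDr; exact: ltW].
have sqp (y : R) : 0 < y -> (y `^ k) ^+ 2 * y `^ (1 - 2 * k) = y.
  move=> y0; rewrite -powR_mulrn ?powR_ge0// -powRrM -powRD; last by rewrite (gt_eqF y0) implybT.
  have -> : k * 2%:R + (1 - 2 * k) = 1 by ring.
  by rewrite powRr1 ?(ltW y0).
have epb : ep * b ^+ 2 <= e ^+ 2 * (gsq v x + ep).
  have E1 := sqp _ ep0; have E2 := sqp _ s0; rewrite -/e in E1; rewrite -/b in E2.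
  rewrite -[X in X * b ^+ 2 <= _]E1 -[X in _ <= _ * X]E2.
  have -> : e ^+ 2 * (b ^+ 2 * (gsq v x + ep) `^ (1 - 2 * k)) = e ^+ 2 * (gsq v x + ep) `^ (1 - 2 * k) * b ^+ 2 by ring.
  rewrite ler_wpM2r ?sqr_ge0// ler_wpM2l ?sqr_ge0//.
  by apply: le_powR_pos; [exact: ltW|exact: ltW|rewrite lerDr ltW].
have fE' : f x = (2 - 2 * k) * ((pd 0 mu x * pd 0 v x + pd 1 mu x * pd 1 v x) / a
    + mu x * (A 0 0 x + A 1 1 x) / a
    - 2 * k * mu x * (pd 0 v x ^+ 2 * A 0 0 x + 2 * pd 0 v x * pd 1 v x * A 0 1 x + pd 1 v x ^+ 2 * A 1 1 x)
       / (a * gsq v x)).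
  have g00 : 0 < gsq v x + 0 by rewrite addr0.
  rewrite fE !Fe_pd//.
  have := dvFE (ep := 0) g00; rewrite /dvF => ->.
  by rewrite addr0.
have k01 : 0 < k < 2^-1 by rewrite k0 k1.
have H := flux_algebra k01 cu0 (muP x) (dmuP x) ep0 gp a0 ab e0 eb bae epb fE'.
cbv zeta in H; rewrite -/(gsq v x) in H.
have dE := dvFE s0; rewrite -/b in dE; rewrite -dE -bE -/cst2 in H.
apply: le_trans H _.
have -> : gsq v x / a ^+ 2 = gsq v x `^ (beta - 1).
  have E := sqp _ gp; rewrite -/a (_ : 1 - 2 * k = beta - 1) in E; last by field.
  by rewrite -[X in X / _ = _]E mulrAC mulfV ?mul1r// gt_eqF// exprn_gt0.
rewrite -/(Wf x).
have -> : (e / b) ^+ 2 = theta ep x.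
  have -> : theta ep x = ((ep / (gsq v x + ep)) `^ k) ^+ 2.
    by rewrite /theta -powR_mulrn ?powR_ge0// -powRrM (mulrC k).
  by rewrite div_pow ?(ltW ep0).
have -> : ep ^+ 2 / e ^+ 2 = ep `^ beta.
  have e2 : e ^+ 2 = ep `^ (k * 2%:R) by rewrite -powR_mulrn ?powR_ge0// -powRrM.
  have -> : ep ^+ 2 = ep `^ beta * e ^+ 2.
    rewrite e2 -powRD; last by rewrite (gt_eqF ep0) implybT.
    by rewrite -powR_mulrn ?(ltW ep0)//; congr (_ `^ _); field.
  by rewrite mulfK// gt_eqF// exprn_gt0.
have t0 : 0 <= theta ep x by exact: powR_ge0.
have Wt : 0 <= Wf x * theta ep x by rewrite mulr_ge0.
have sqE : A 0 1 x * A 1 0 x = A 0 1 x ^+ 2 by rewrite -(Hess_sym x) expr2.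
move: sqE; clear -Wt; move: (A 0 1 x) (A 1 0 x) (A 0 0 x) (A 1 1 x) => a01 a10 a00 a11 sqE.
rewrite sqE.
have assoc (a' b' c' d' : R) : a' * b' * (c' / d') = a' * (b' / d' * c') by ring.
rewrite assoc lerD2r.
rewrite -[leLHS]mulrA; apply: ler_wpM2r => //.
by rewrite /cst1 -[leRHS]addrA lerDr ler01.
Qed.

Lemma cst1_ge0 : 0 <= cst1.
Proof.
have [beta0 k0 k1 k2 bE] := beta_facts.
have D0 : 0 <= D by apply: le_trans (dmuP 0); rewrite addr_ge0 ?sqr_ge0.
have Mu0 : 0 <= Mu by have /andP[h1 h2] := muP 0; apply: le_trans h2; apply: le_trans h1; exact: ltW.
have bge := ltW beta0; have kge := ltW k0; have cuge := ltW cu0; have k2ge := ltW k2.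
rewrite /cst1 /cst2 !addr_ge0// ?mulr_ge0 ?divr_ge0 ?addr_ge0 ?mulr_ge0 ?invr_ge0 ?mulr_ge0//.
Qed.

Lemma contM (g1 g2 : R * R -> R) : continuous g1 -> continuous g2 -> continuous (fun x => g1 x * g2 x).
Proof. by move=> c1 c2 x; apply: cvgM; [exact: c1|exact: c2]. Qed.

Lemma contD (g1 g2 : R * R -> R) : continuous g1 -> continuous g2 -> continuous (fun x => g1 x + g2 x).
Proof. by move=> c1 c2 x; apply: cvgD; [exact: c1|exact: c2]. Qed.

Lemma contB (g1 g2 : R * R -> R) : continuous g1 -> continuous g2 -> continuous (fun x => g1 x - g2 x).
Proof. by move=> c1 c2 x; apply: cvgB; [exact: c1|exact: c2]. Qed.

Lemma contC (c : R) : continuous (fun _ : R * R => c).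
Proof. by move=> x; exact: cvg_cst. Qed.

Lemma cont_gsq : continuous (gsq v).
Proof. by apply: contD; apply: contM; exact: cp. Qed.

Lemma cont_pow (ep r : R) : 0 < ep -> continuous (fun x => (gsq v x + ep) `^ r).
Proof.
move=> ep0 x; have s0 : 0 < gsq v x + ep by rewrite ltr_wpDl ?gsq_ge0.
apply: (cvg_comp (G := nbhs (gsq v x + ep)) (fun x => gsq v x + ep) (fun y : R => y `^ r)).
  by apply: cvgD; [exact: cont_gsq|exact: cvg_cst].
exact: continuous_powR_pos.
Qed.

Lemma cont_DFi ep i : 0 < ep -> continuous (DFi beta v mu ep i).
Proof.
move=> ep0; apply: contD.
  apply: contM; first exact: cdmu.
  by apply: contM; [exact: contC|apply: contM; [exact: cont_pow|exact: cp]].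
apply: contM; first exact: cmu.
apply: contM; first exact: contC.
apply: contB; first by apply: contM; [exact: cont_pow|exact: cA].
apply: contM; last exact: cp.
apply: contM; first by apply: contM; [exact: contC|exact: cont_pow].
apply: contM; first exact: contC.
by apply: contD; apply: contM; [exact: cp|exact: cA|exact: cp|exact: cA].
Qed.

Lemma cont_dvF ep : 0 < ep -> continuous (dvF ep).
Proof. by move=> ep0; apply: contD; exact: cont_DFi. Qed.

Let tp i : torus_fun (pd i v) := torus_pd i tv.
Let tA i j : torus_fun (pd j (pd i v)) := torus_pd j (tp i).
Let tdmu i : torus_fun (pd i mu) := torus_pd i tmu.

Lemma torus_gsq : torus_fun (gsq v).
Proof. by apply: torusD; apply: (@torus_comp _ (fun y => y ^+ 2)); exact: tp. Qed.

Lemma torus_DFi ep i : torus_fun (DFi beta v mu ep i).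
Proof.
have tw r : torus_fun (fun x => (gsq v x + ep) `^ r).
  by apply: (@torus_comp _ (fun y => (y + ep) `^ r)); exact: torus_gsq.
apply: torusD.
  apply: torusM; first exact: tdmu.
  by apply: torusM; [exact: torusC|apply: torusM; [exact: tw|exact: tp]].
apply: torusM; first exact: tmu.
apply: torusM; first exact: torusC.
apply: torusB; first by apply: torusM; [exact: tw|exact: tA].
apply: torusM; last exact: tp.
apply: torusM; first by apply: torusM; [exact: torusC|exact: tw].
apply: torusM; first exact: torusC.
apply: torusD; apply: torusM; [exact: tp|exact: tA|exact: tp|exact: tA].
Qed.

Lemma torus_dvF ep : torus_fun (dvF ep).
Proof. by move=> x; split; rewrite /dvF ?(torus_DFi _ _ _).1 ?(torus_DFi _ _ _).2. Qed.

(** The weight is [(2 ep) ^ -1] times the divergence of [B(p) = p / (|p| ^ 2 + ep)] as a function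
of [p] in the plane, so the integrand is, up to that factor, a sum of cross terms of [B(grad v)]
and [grad v], to which [int_cross] applies. *)
Lemma int_weighted_det ep : 0 < ep ->
  \int[leb2 R]_(x in @cell R) ((A 0 1 x * A 1 0 x - A 0 0 x * A 1 1 x) / (gsq v x + ep) ^+ 2) = 0.
Proof.
move=> ep0.
have s0 x : 0 < gsq v x + ep by rewrite ltr_wpDl ?gsq_ge0.
pose a i x := pd i v x * (gsq v x + ep) `^ (-1).
pose da i j x := A i j x * (gsq v x + ep) `^ (-1) -
  pd i v x * ((gsq v x + ep) `^ (-2) * (2 * (pd 0 v x * A 0 j x + pd 1 v x * A 1 j x))).
have Da i j x : is_derive x (evec R j) (a i) (da i j x).
  apply: derive_line.
  have L l : is_derive (0:R) (1:R) (fun r : R => pd l v (x + r *: evec R j)) (A l j x).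
    have := @line_is_derive _ (pd l v) (evec R j) x 0; rewrite scale0r addr0; apply; exact: (@ddv x l j).
  have L0 := L 0; have L1 := L 1; have Li := L i.
  pose s (r : R) := gsq v (x + r *: evec R j) + ep.
  have sE : s 0 = gsq v x + ep by rewrite /s scale0r addr0.
  have Ls : is_derive (0:R) (1:R) s (2 * (pd 0 v x * A 0 j x + pd 1 v x * A 1 j x)).
    rewrite /s /gsq; apply: is_derive_eq.
    rewrite !scale0r !addr0.
    move: (pd 0 v x) (pd 1 v x) (A 0 j x) (A 1 j x) => b1 b2 b3 b4.
    transitivity ((b1 * b3 + b1 * b3) + (b2 * b4 + b2 * b4) : R); last by ring.
    by rewrite /GRing.scale /=; ring.
  have sp : 0 < s 0 by rewrite sE.
  have Lw := is_derive1_comp (is_derive_powR (-1) sp) Ls.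
  rewrite /a; apply: is_derive_eq.
  rewrite !scale0r !addr0 sE /da /=.
  have -> : -1 - 1 = - 2 :> R by ring.
  move: ((gsq v x + ep) `^ (-1)) ((gsq v x + ep) `^ (-2)) (A i j x) (A 0 j x) (A 1 j x).
  move: (pd 0 v x) (pd 1 v x) (pd i v x) => c1 c2 c3 c4 c5 c6 c7 c8.
  by rewrite /GRing.scale /=; ring.
have pda i j : pd j (a i) = da i j by apply/funext => x; have [] := Da i j x.
have cda i j : continuous (da i j).
  apply: contB; first by apply: contM; [exact: cA|exact: cont_pow].
  apply: contM; first exact: cp.
  apply: contM; first exact: cont_pow.
  apply: contM; first exact: contC.
  by apply: contD; apply: contM; [exact: cp|exact: cA|exact: cp|exact: cA].
have ta i : torus_fun (a i).
  by move=> x; split; rewrite /a ?(tp _ _).1 ?(torus_gsq _).1 ?(tp _ _).2 ?(torus_gsq _).2.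
have Ca i : is_Ck 1 (a i).
  split; first by apply: contM; [exact: cp|exact: cont_pow].
  split; first by move=> x j; have [] := Da i j x.
  by move=> j; split=> //; rewrite pda.
have Cp i : is_Ck 1 (pd i v).
  by split; [exact: cp|split; [move=> x j; exact: (@ddv x i j)|move=> j; split=> //; exact: cA]].
have I1 := int_cross (ta 0) (tp 1) (Ca 0) (Cp 1).
have I2 := int_cross (ta 1) (tp 0) (Ca 1) (Cp 0).
have cint (a1 b1 a2 b2 : R * R -> R) : continuous a1 -> continuous b1 -> continuous a2 -> continuous b2 ->
   torus_fun a1 -> torus_fun b1 -> torus_fun a2 -> torus_fun b2 ->
  (leb2 R).-integrable (@cell R) (EFin \o (fun x => a1 x * b1 x - a2 x * b2 x)).
  move=> ? ? ? ? t1 t2 t3 t4; apply: cont_integrable; first by apply: contB; apply: contM.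
  by apply: torusB; apply: torusM.
have tda i j : torus_fun (pd j (a i)) by exact: torus_pd.
have cpda i j : continuous (pd j (a i)) by rewrite pda.
have E : (fun x => (A 0 1 x * A 1 0 x - A 0 0 x * A 1 1 x) / (gsq v x + ep) ^+ 2) =
  (fun x => - (2 * ep)^-1 * ((pd 0 (a 0) x * pd 1 (pd 1 v) x - pd 1 (a 0) x * pd 0 (pd 1 v) x) -
     (pd 0 (a 1) x * pd 1 (pd 0 v) x - pd 1 (a 1) x * pd 0 (pd 0 v) x))).
  apply/funext => x; rewrite !pda /da.
  rewrite (powR_inv1 (ltW (s0 x))) (_ : (gsq v x + ep) `^ (-2) = (gsq v x + ep) ^- 2); last first.
    by rewrite powR_invn ?(ltW (s0 x)).
  exact: (@weighted_det_algebra R (pd 0 v x) (pd 1 v x) (A 0 0 x) (A 0 1 x) (A 1 0 x) (A 1 1 x) ep (lt0r_neq0 ep0) (s0 x)).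
rewrite E RintegralZl.
- rewrite RintegralB.
  + by transitivity (- (2 * ep)^-1 * (0 - 0)); [congr (_ * (_ - _)); [exact: I1|exact: I2]|rewrite subrr mulr0].
  + exact: measurable_cell.
  + exact: cint.
  + exact: cint.
- exact: measurable_cell.
- apply: cont_integrable; first by apply: contB; apply: contB; apply: contM => //; exact: cA.
  by apply: torusB; apply: torusB; apply: torusM; [exact: tda|exact: tA|exact: tda|exact: tA|exact: tda|exact: tA|exact: tda|exact: tA].
Qed.

End StaticFlux.

(** * Mean-square convergence of the divergence of the regularized flux *)

Lemma cvg_sumsq (R : realType) (T : Type) (F : set_system T) (FF : Filter F) (I : finType) (f : I -> T -> R) (l : I -> R) :
  (forall i, f i @ F --> l i) -> (fun x => nsq (f ^~ x)) @ F --> nsq l.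
Proof.
move=> fl; rewrite /nsq; elim: (index_enum I) => [|i r IH].
  by under eq_fun do rewrite big_nil; rewrite big_nil; exact: cvg_cst.
under eq_fun do rewrite big_cons; rewrite big_cons.
by apply: cvgD => //; under eq_fun do rewrite expr2; rewrite expr2; apply: cvgM.
Qed.

Section PowgradContinuity.
Context {R : realType} (beta : R) (hb : 1 < beta < 2).

(** A consequence of [powgrad_hoelder], uniform over the index types. *)
Lemma powgrad_uc (e : R) : 0 < e -> exists2 d : R, 0 < d &
  forall (I : finType) (x y : I -> R), nsq (fun k => x k - y k) <= d ->
  forall k, `|powgrad beta x k - powgrad beta y k| <= e.
Proof.
have /andP[b1 b2] := hb.
move=> e0; exists ((e ^+ 2 / 16) `^ (beta - 1)^-1); first by rewrite powR_gt0// divr_gt0// exprn_gt0.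
move=> I x y xy k.
have e2 : 0 <= e ^+ 2 / 16 by rewrite divr_ge0 ?sqr_ge0.
have b10 : 0 < beta - 1 by rewrite subr_gt0.
have H := powgrad_hoelder hb x y.
have h1 : nsq (fun k => x k - y k) `^ (beta - 1) <= e ^+ 2 / 16.
  apply: le_trans (le_powR_pos (ltW b10) (nsq_ge0 _) xy) _.
  by rewrite -powRrM mulVf ?gt_eqF// powRr1.
rewrite -ler_sqr ?nnegrE ?(ltW e0)// real_normK ?num_real//.
apply: le_trans (nsq_ge1 (fun k => powgrad beta x k - powgrad beta y k) k) _.
apply: le_trans H _; move: h1; move: (_ `^ _) => z; lra.
Qed.

Lemma powgrad_cont (T : topologicalType) (I : finType) (g : I -> T -> R) (x : T) :
  (forall k, {for x, continuous (g k)}) -> forall i, {for x, continuous (fun y => powgrad beta (g ^~ y) i)}.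
Proof.
move=> cg i; apply/cvgrPdist_le => e e0; have [d d0 Hd] := powgrad_uc e0.
have H : (fun y => nsq (fun k => g k x - g k y)) @ x --> (0 : R).
  have -> : 0 = nsq (fun k => g k x - g k x) by rewrite /nsq big1// => k _; rewrite subrr expr0n.
  by apply: cvg_sumsq => k; apply: cvgB; [exact: cvg_cst|exact: cg].
near=> y; apply: Hd.
have : `|nsq (fun k => g k x - g k y)| <= d by near: y; exact: (cvgr0_norm_le _ H).
by rewrite ger0_norm ?nsq_ge0.
Unshelve. all: by end_near. Qed.

Variables v mu : R * R -> R.

(** The gradient with [sqrt ep] as an additional component: the regularized flux is the exact one
of this longer vector, so that [powgrad_uc] compares fluxes for different [ep]. *)
Definition gvec (ep : R) (x : R * R) (o : option 'I_2) : R :=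
  if o is Some j then pd j v x else Num.sqrt ep.

Lemma nsq_gvec ep x : 0 <= ep -> nsq (gvec ep x) = gsq v x + ep.
Proof.
move=> ep0; rewrite /nsq (bigD1 None)//= sqr_sqrtr// addrC; congr (_ + _).
rewrite (reindex_onto Some (fun o => if o is Some j then j else 0)) /=; last by case.
rewrite /gsq -(sum2E (fun j => pd j v x ^+ 2)); apply: eq_bigl => j; exact: eqxx.
Qed.

Lemma Fe_powgrad ep i x : 0 <= ep -> Fe beta v mu ep i x = mu x * (beta * powgrad beta (gvec ep x) (Some i)).
Proof.
by move=> ep0; rewrite /Fe /powgrad nsq_gvec// opprB.
Qed.

Lemma cont_Fe ep i : 0 <= ep -> (forall i, continuous (pd i v)) -> continuous mu -> continuous (Fe beta v mu ep i).
Proof.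
move=> ep0 cp cmu; have -> : Fe beta v mu ep i = fun x => mu x * (beta * powgrad beta (gvec ep x) (Some i)).
  by apply/funext => x; rewrite Fe_powgrad.
apply: contM => //; apply: contM; first exact: contC.
move=> x; apply: (@powgrad_cont _ _ (fun o y => gvec ep y o)) => -[j|] /=; first exact: cp.
exact: cvg_cst.
Qed.

Lemma cont_gsq_pow : (forall i, continuous (pd i v)) -> continuous (fun x => gsq v x `^ (beta - 1)).
Proof.
move=> cp; have -> : (fun x => gsq v x `^ (beta - 1)) =
    (fun x => nsq (powgrad beta (fun j => pd j v x))).
  by apply/funext => x; rewrite (nsq_powgrad hb) /gsq -(sum2E (fun j => pd j v x ^+ 2)).
move=> x; apply: cvg_sumsq => j.
by apply: (@powgrad_cont _ _ (fun j y => pd j v y)) => k; exact: cp.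
Qed.

End PowgradContinuity.

Section StaticFluxConvergence.
Context {R : realType} (beta : R) (hb : 1 < beta < 2) (v mu f : R * R -> R).
Local Notation k := (1 - beta / 2).
Local Notation A i j x := (pd j (pd i v) x).
Hypotheses (tv : torus_fun v) (tmu : torus_fun mu) (tf : torus_fun f).
Hypotheses (dv : forall x i, derivable v x (evec R i))
  (ddv : forall x i j, derivable (pd i v) x (evec R j))
  (dmu : forall x i, derivable mu x (evec R i)).
Hypotheses (cp : forall i, continuous (pd i v)) (cA : forall i j, continuous (pd j (pd i v)))
  (cmu : continuous mu) (cdmu : forall i, continuous (pd i mu)) (cf : continuous f).
Variables (Mu cu D : R).
Hypotheses (cu0 : 0 < cu) (muP : forall x, cu <= mu x <= Mu)
  (dmuP : forall x, pd 0 mu x ^+ 2 + pd 1 mu x ^+ 2 <= D).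
Hypotheses (dF : forall x i, derivable (Fe beta v mu 0 i) x (evec R i))
  (fE : forall x, f x = pd 0 (Fe beta v mu 0 0) x + pd 1 (Fe beta v mu 0 1) x).

Local Notation dvF := (dvF beta v mu).
Local Notation Wf := (Wf beta v f).
Local Notation theta := (theta beta v).
Local Notation cst1 := (cst1 beta Mu cu D).
Local Notation cst2 := (cst2 beta Mu).

Lemma cont_theta ep : 0 < ep -> continuous (theta ep).
Proof.
move=> ep0 x; have s0 : 0 < gsq v x + ep by rewrite ltr_wpDl ?gsq_ge0.
apply: (cvg_comp (G := nbhs (ep / (gsq v x + ep))) (fun x => ep / (gsq v x + ep)) (fun y : R => y `^ (2 * k))).
  apply: cvgM; first exact: cvg_cst.
  apply: cvgV; first by rewrite gt_eqF.
  by apply: cvgD; [exact: (cont_gsq cp)|exact: cvg_cst].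
by apply: continuous_powR_pos; rewrite divr_gt0.
Qed.

Lemma torus_theta ep : torus_fun (theta ep).
Proof. by apply: (torus_comp (fun y => (ep / (y + ep)) `^ (2 * k))); exact: torus_gsq. Qed.

Lemma cont_Wf : continuous Wf.
Proof. by apply: contD; [apply: contM|exact: (cont_gsq_pow hb cp)]. Qed.

Lemma torus_Wf : torus_fun Wf.
Proof.
apply: torusD; first exact: (torus_comp (fun y => y ^+ 2) tf).
apply: (torus_comp (fun y => y `^ (beta - 1))); exact: torus_gsq.
Qed.

Lemma theta_le1 ep x : 0 < ep -> 0 <= theta ep x <= 1.
Proof.
have [beta0 k0 k1 k2 bE] := beta_facts hb.
move=> ep0; rewrite powR_ge0 /=.
have s0 : 0 < gsq v x + ep by rewrite ltr_wpDl ?gsq_ge0.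
have E1 : 1 = 1 `^ (2 * k) :> R by rewrite powR1.
rewrite [leRHS]E1; apply: le_powR_pos; [lra|by rewrite divr_ge0 ?(ltW ep0) ?(ltW s0)|].
by rewrite ler_pdivrMr// mul1r lerDr gsq_ge0.
Qed.

Definition defect ep : R := \int[leb2 R]_(x in @cell R) ((dvF ep x - f x) ^+ 2).

Let cWt ep : 0 < ep -> continuous (fun x => Wf x * theta ep x).
Proof. by move=> ep0; apply: contM; [exact: cont_Wf|exact: cont_theta]. Qed.
Let tWt ep : torus_fun (fun x => Wf x * theta ep x).
Proof. by apply: torusM; [exact: torus_Wf|exact: torus_theta]. Qed.

(** The determinant term of [static_pointwise] integrates to zero by [int_weighted_det]. *)
Lemma defect_le ep : 0 < ep ->
  defect ep <= cst1 * \int[leb2 R]_(x in @cell R) (Wf x * theta ep x).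
Proof.
move=> ep0.
pose det x := (A 0 1 x * A 1 0 x - A 0 0 x * A 1 1 x) / (gsq v x + ep) ^+ 2.
have s0 x : 0 < gsq v x + ep by rewrite ltr_wpDl ?gsq_ge0.
have mcell := @measurable_cell R.
have tA i j : torus_fun (pd j (pd i v)) by apply: torus_pd; exact: torus_pd.
have cdet : continuous det.
  apply: contM; first by apply: contB; apply: contM; exact: cA.
  move=> x; apply: cvgV; first by rewrite gt_eqF// exprn_gt0.
  by apply: contM; apply: contD; [exact: (cont_gsq cp)|exact: contC|exact: (cont_gsq cp)|exact: contC].
have tdet : torus_fun det.
  apply: torusM; first by apply: torusB; apply: torusM; exact: tA.
  by apply: (torus_comp (fun y => ((y + ep) ^+ 2)^-1)); exact: torus_gsq.
have I0 : \int[leb2 R]_(x in @cell R) det x = 0 := int_weighted_det tv ddv cp cA ep0.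
have cd : continuous (fun x => (dvF ep x - f x) ^+ 2).
  have c0 : continuous (fun x => dvF ep x - f x) by apply: contB; [eapply cont_dvF; eassumption|].
  by apply: contM.
have td : torus_fun (fun x => (dvF ep x - f x) ^+ 2).
  by apply: (@torus_comp _ (fun y => y ^+ 2)); apply: torusB => //; eapply torus_dvF; eassumption.
pose c2 := cst2 * (2 / (1 - 2 * k)) * ep `^ beta.
have H : defect ep <= \int[leb2 R]_(x in @cell R) (cst1 * (Wf x * theta ep x) + c2 * det x).
  apply: le_Rintegral => //.
  - exact: cont_integrable.
  - apply: cont_integrable.
      by apply: contD; apply: contM; [exact: contC|exact: cWt|exact: contC|].
    by apply: torusD; apply: torusM; [exact: torusC|exact: tWt|exact: torusC|].
  - move=> x _.
    have P : (dvF ep x - f x) ^+ 2 <= cst1 * (Wf x * theta ep x) +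
      cst2 * (2 / (1 - 2 * k)) * (ep `^ beta / (gsq v x + ep) ^+ 2 * (A 0 1 x * A 1 0 x - A 0 0 x * A 1 1 x)).
      exact: (static_pointwise hb dv ddv dmu cA cmu cu0 muP dmuP dF fE x ep0).
    apply: le_trans P _; rewrite lerD2l /c2 /det.
    move: (A 0 1 x * A 1 0 x - A 0 0 x * A 1 1 x) (cst2 * (2 / (1 - 2 * k))) (ep `^ beta) ((gsq v x + ep) ^+ 2) => d1 d2 d3 d4.
    by rewrite le_eqVlt; apply/orP; left; apply/eqP; rewrite -[RHS]mulrA; congr (_ * _); rewrite -mulrA; congr (_ * _); exact: mulrC.
apply: le_trans H _.
have i1 : (leb2 R).-integrable (@cell R) (EFin \o (fun x => cst1 * (Wf x * theta ep x))).
  by apply: cont_integrable; [apply: contM; [exact: contC|exact: cWt]|apply: torusM; [exact: torusC|exact: tWt]].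
have i2 : (leb2 R).-integrable (@cell R) (EFin \o (fun x => c2 * det x)).
  by apply: cont_integrable; [apply: contM; [exact: contC|]|apply: torusM; [exact: torusC|]].
rewrite (RintegralD mcell i1 i2).
have Z2 : \int[leb2 R]_(x in @cell R) (c2 * det x) = c2 * \int[leb2 R]_(x in @cell R) det x.
  by apply: RintegralZl => //; exact: cont_integrable.
have Z1 : \int[leb2 R]_(x in @cell R) (cst1 * (Wf x * theta ep x)) =
    cst1 * \int[leb2 R]_(x in @cell R) (Wf x * theta ep x).
  by apply: RintegralZl => //; apply: cont_integrable; [exact: cWt|exact: tWt].
by rewrite Z2 I0 mulr0 addr0 Z1.
Qed.

Lemma defect_bound ep W : 0 < ep -> (forall x, Wf x <= W) -> 0 <= defect ep <= cst1 * W.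
Proof.
move=> ep0 hW; apply/andP; split; first by apply: Rintegral_ge0 => x _; exact: sqr_ge0.
apply: le_trans (defect_le ep0) _; apply: ler_wpM2l.
  by eapply cst1_ge0; eassumption.
rewrite -[leRHS]int_cell_cst; apply: le_Rintegral.
- exact: measurable_cell.
- by apply: cont_integrable; [exact: cWt|exact: tWt].
- by apply: cont_integrable; [exact: contC|exact: torusC].
move=> x _; have W0 : 0 <= Wf x by rewrite addr_ge0 ?sqr_ge0 ?powR_ge0.
have /andP[t0 t1] := theta_le1 x ep0.
by apply: le_trans (hW x); rewrite ler_piMr.
Qed.

Lemma theta_cvg x : 0 < gsq v x -> (fun n => theta (n.+1%:R^-1 ^+ 2) x) @ \oo --> (0 : R).
Proof.
have [beta0 k0 k1 k2 bE] := beta_facts hb.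
have k20 : 0 < 2 * k by lra.
move=> gx.
have H : (fun n : nat => (n.+1%:R^-1 ^+ 2) `^ (2 * k) * (gsq v x)^-1 `^ (2 * k)) @ \oo --> (0:R).
  rewrite -[X in _ --> X](mul0r ((gsq v x)^-1 `^ (2 * k))); apply: cvgM; last exact: cvg_cst.
  exact: powR_harmonic.
apply: (squeeze_cvgr _ (cvg_cst 0) H); near=> n.
have e0 : 0 < n.+1%:R^-1 ^+ 2 :> R by rewrite exprn_gt0// invr_gt0.
rewrite powR_ge0 /= /theta -powRM ?invr_ge0 ?(ltW e0) ?(ltW gx)//.
apply: le_powR_pos; first exact: ltW.
  by apply: divr_ge0; [exact: ltW|apply: addr_ge0; exact: ltW].
have g1 : 0 < gsq v x + n.+1%:R^-1 ^+ 2 by exact: addr_gt0.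
apply: ler_wpM2l; first exact: ltW.
by rewrite lef_pV2// lerDl ltW.
Unshelve. all: by end_near. Qed.

(** [theta] tends to zero outside the critical points, where dominated convergence applies. At
almost every critical point each summand [pd i F_i] of [f] vanishes, since [F_i] vanishes on the
whole critical set; there [Wf] is zero. *)
Lemma defect_cvg : (fun n => defect (n.+1%:R^-1 ^+ 2)) @ \oo --> (0 : R).
Proof.
have [beta0 k0 k1 k2 bE] := beta_facts hb.
pose ep (n : nat) : R := n.+1%:R^-1 ^+ 2.
have ep0 n : 0 < ep n by rewrite exprn_gt0// invr_gt0.
have mcell := @measurable_cell R.
pose Z : set (R * R) := [set x | gsq v x = 0].
have mZ : measurable (Z : set (mplane R)).
  have -> : Z = setT `&` (gsq v @^-1` [set 0]) by rewrite setTI.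
  exact: (continuous_measurable2 (cont_gsq cp)).
have p0 x j : Z x -> pd j v x = 0.
  move=> /eqP; rewrite paddr_eq0 ?sqr_ge0// !sqrf_eq0 => /andP[/eqP h0 /eqP h1].
  by elim/ord2P: j.
have N i : measurable ([set x | Z x /\ pd i (Fe beta v mu 0 i) x != 0] : set (mplane R)) /\
    leb2 R [set x | Z x /\ pd i (Fe beta v mu 0 i) x != 0] = 0%E.
  apply: (@pd_ae_null R i Z (Fe beta v mu 0 i)).
  - by apply: cont_Fe.
  - by move=> x; exact: (@dF x i).
  - exact: mZ.
  move=> x Zx; by rewrite /Fe p0// !mulr0.
pose B i : set (R * R) := [set x | Z x /\ pd i (Fe beta v mu 0 i) x != 0].
have mB i : measurable (B i : set (mplane R)) := (N i).1.
have B0 i : leb2 R (B i) = 0%E := (N i).2.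
clear N.
have [C C0 HC] := torus_bdd1 cont_Wf torus_Wf.
have W0 x : 0 <= Wf x by rewrite addr_ge0 ?sqr_ge0 ?powR_ge0.
have [] // := @dominated_convergence _ _ _ (leb2 R) (@cell R) mcell
    (fun n x => (Wf x * theta (ep n) x)%:E) (fun=> 0%E) (fun=> C%:E).
- move=> n; apply: measurable_funTS.
  exact: (EFin_continuous_measurable2 (cWt (ep0 n))).
- exists (B 0 `|` B 1); split.
  + exact: (measurableU _ _ (mB 0) (mB 1)).
  + exact: (null_set_setU (mB 0) (mB 1) (B0 0) (B0 1)).
  move=> x; apply: contra_notP => nB _.
  apply: cvg_EFin; first by near=> n.
  have [gz|gn] := eqVneq (gsq v x) 0.
    have f0 : f x = 0.
      have q0 : pd 0 (Fe beta v mu 0 0) x = 0 by apply/eqP/negPn/negP => q; apply: nB; left.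
      have q1 : pd 1 (Fe beta v mu 0 1) x = 0 by apply/eqP/negPn/negP => q; apply: nB; right.
      by rewrite fE q0 q1 addr0.
    have -> : fine \o (fun n => (Wf x * theta (ep n) x)%:E) = fun=> 0.
      apply/funext => n /=; rewrite /Wf f0 gz expr0n add0r powR0 ?mul0r//.
      by case/andP: hb => b1 _; rewrite gt_eqF// subr_gt0.
    exact: cvg_cst.
  rewrite -[X in _ --> X](mulr0 (Wf x)); apply: cvgM; first exact: cvg_cst.
  by apply: theta_cvg; rewrite lt_neqAle eq_sym gn gsq_ge0.
- apply/integrableP; split; first exact: measurable_cst.
  by rewrite integral_cst//= leb2_cell mule1 ltry.
- apply: aeW => x n _ /=; rewrite lee_fin.
  have /andP[t0 t1] := theta_le1 x (ep0 n).
  rewrite ger0_norm ?mulr_ge0//; apply: le_trans (_ : Wf x <= _); first by rewrite ler_piMr.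
  by have := HC x; rewrite ger0_norm.
move=> _ _; rewrite integral0 => H.
have H2 : (fun n => cst1 * \int[leb2 R]_(x in @cell R) (Wf x * theta (ep n) x)) @ \oo --> (0 : R).
  rewrite -[X in _ --> X](mulr0 cst1); apply: cvgM; first exact: cvg_cst.
  exact: (@fine_cvg _ _ _ _ _ (0:R) H).
apply: (squeeze_cvgr _ (cvg_cst 0) H2); near=> n.
have /andP[-> _] := defect_bound (ep0 n) (fun x => le_trans (ler_norm _) (HC x)).
by rewrite /=; exact: defect_le.
Unshelve. all: by end_near. Qed.

End StaticFluxConvergence.

(** * Difference operators on compact time intervals *)

Section PointwiseContinuity.
Context {R : realType} {V : topologicalType}.
Implicit Types (f g : V -> R) (z : V).

Lemma cfM f g z : {for z, continuous f} -> {for z, continuous g} -> {for z, continuous (fun y => f y * g y)}.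
Proof. exact: cvgM. Qed.
Lemma cfD f g z : {for z, continuous f} -> {for z, continuous g} -> {for z, continuous (fun y => f y + g y)}.
Proof. exact: cvgD. Qed.
Lemma cfB f g z : {for z, continuous f} -> {for z, continuous g} -> {for z, continuous (fun y => f y - g y)}.
Proof. exact: cvgB. Qed.
Lemma cfC (c : R) z : {for z, continuous (fun _ : V => c)}.
Proof. exact: cvg_cst. Qed.
Lemma cfX f z : {for z, continuous f} -> {for z, continuous (fun y => f y ^+ 2)}.
Proof. by move=> cf; exact: (cfM cf cf). Qed.
Lemma cf_pow f z r : 0 < f z -> {for z, continuous f} -> {for z, continuous (fun y => f y `^ r)}.
Proof.
by move=> f0 cf; apply: (cvg_comp (G := nbhs (f z)) f (fun y : R => y `^ r)) => //; exact: continuous_powR_pos.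
Qed.
End PointwiseContinuity.

Lemma closed_MVT (R : realType) (g dg : R -> R) (a b : R) : a < b ->
  (forall c, c \in `[a, b] -> is_derive c (1:R) g (dg c)) ->
  exists2 c, a <= c <= b & g b - g a = dg c * (b - a).
Proof.
move=> ab D.
have D' c : c \in `]a, b[ -> is_derive c (1:R) g (dg c) := fun ci => D c (subset_itv_oo_cc ci).
have C : {within `[a, b], continuous g}.
  by apply: derivable_within_continuous => c ct; have [D1 _] := D c ct.
have [c] := MVT ab D' C.
by rewrite in_itv /= => /andP[ac cb] E; exists c => //; rewrite !ltW.
Qed.

Section InteriorRegularity.
Context {R : realType} (T : R) (f : R -> R * R -> R).
Hypotheses (hf : is_C12 T f) (tf : forall t, 0 <= t <= T -> torus_fun (f t)).

Lemma torus_timeD t : 0 < t < T -> torus_fun (timeD f t).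
Proof.
move=> /andP[t0 tT] x.
have H y : (forall s, 0 <= s <= T -> f s y = f s x) -> timeD f t y = timeD f t x.
  move=> E; rewrite /timeD !derive1E; apply: near_eq_derive.
  have N0 : \forall s \near t, 0 < s by exact: lt_nbhsr.
  have NT : \forall s \near t, s < T by exact: lt_nbhsl.
  by near=> s; apply: E; apply/andP; split; apply: ltW; near: s.
by split; apply: H => s /tf /(_ x) [].
Unshelve. all: by end_near. Qed.

Lemma time_MVT t (s : R) x : 0 < s -> 0 < t -> t + s < T ->
  exists2 c, t <= c <= t + s & f (t + s) x - f t x = timeD f c x * s.
Proof.
move=> s0 t0 tsT.
have D c : c \in `[t, t + s] -> is_derive c (1:R) (fun r => f r x) (timeD f c x).
  rewrite in_itv /= => /andP[tc ct]; have cT : 0 < c < T by rewrite (lt_le_trans t0 tc) (le_lt_trans ct tsT).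
  by have [d _ _] := hf.1 c x cT; rewrite /timeD derive1E; apply: DeriveDef.
have ts : t < t + s by rewrite ltrDl.
by have [c tc E] := closed_MVT ts D; exists c => //; rewrite E addrAC subrr add0r.
Qed.

Variables (a b : R).
Hypotheses (ha : 0 < a) (hbT : b < T).

Let ab t : a <= t <= b -> 0 < t < T.
Proof. by case/andP => at_ tb; rewrite (lt_le_trans ha at_) (le_lt_trans tb hbT). Qed.
Let ab' t : a <= t <= b -> 0 <= t <= T.
Proof. by move=> /ab /andP[/ltW -> /ltW ->]. Qed.

Lemma uc_sol : ucp a b f.
Proof.
apply: torus_uc => [|t /ab' /tf//]; apply: for_ccont => z /ab hz.
by have [] := hf.2 z hz.
Qed.

Lemma uc_timeD : ucp a b (timeD f).
Proof.
apply: torus_uc => [|t /ab]; last exact: torus_timeD.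
by apply: for_ccont => z /ab hz; have [] := hf.2 z hz.
Qed.

Lemma uc_pd i : ucp a b (fun t => pd i (f t)).
Proof.
apply: torus_uc => [|t /ab' /tf]; last exact: torus_pd.
by apply: for_ccont => z /ab hz; have [_ _ + _] := hf.2 z hz; apply.
Qed.

Lemma uc_pdd i j : ucp a b (fun t => pd j (pd i (f t))).
Proof.
apply: torus_uc => [|t /ab' /tf tft]; last by do 2 apply: torus_pd.
by apply: for_ccont => z /ab hz; have [_ _ _] := hf.2 z hz; apply.
Qed.

Lemma bdd_pd i : bdd a b (fun t => pd i (f t)).
Proof.
apply: torus_bdd => [|t /ab' /tf]; last exact: torus_pd.
by apply: for_ccont => z /ab hz; have [_ _ + _] := hf.2 z hz; apply.
Qed.

Lemma bdd_pdd i j : bdd a b (fun t => pd j (pd i (f t))).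
Proof.
apply: torus_bdd => [|t /ab' /tf tft]; last by do 2 apply: torus_pd.
by apply: for_ccont => z /ab hz; have [_ _ _] := hf.2 z hz; apply.
Qed.

(** By the mean value theorem a difference is a derivative at a point at distance at most one
step, and the derivatives are uniformly continuous on the compact time interval. *)
Lemma Dp_consistent (e : R) : 0 < e -> exists2 r : R, 0 < r & forall N t i p, (0 < N)%N -> step R N < r ->
  a <= t <= b -> `|Dp N i (fun q => f t (nd N q)) p - pd i (f t) (nd N p)| <= e /\
     `|Dm N i (fun q => f t (nd N q)) p - pd i (f t) (nd N p)| <= e.
Proof.
move=> e0.
pose Q i := uc_pd i e0.
have [d0 d00 H0] := Q 0; have [d1 d10 H1] := Q 1.
exists (Num.min d0 d1); first by rewrite lt_min d00.
move=> N t i p N0; rewrite lt_min => /andP[s0 s1] tab.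
have h0 : 0 < step R N by exact: step_gt0.
have H y : `|y - nd N p| <= step R N -> `|pd i (f t) y - pd i (f t) (nd N p)| <= e.
  move=> yp; apply: ltW.
  by elim/ord2P: i; [apply: H0|apply: H1] => //; rewrite ?subrr ?normr0//; exact: le_lt_trans yp _.
have D y : derivable (f t) y (evec R i) by have [_ + _] := hf.1 t y (ab tab); apply.
split.
  have [c c0s E] := line_MVT h0 (fun c _ => D (nd N p + c *: evec R i)).
  rewrite /Dp nd_ed E mulfK ?gt_eqF//; apply: H.
  case/andP: c0s => c0 cs.
  by rewrite addrAC subrr add0r normZ_evec gtr0_norm// ltW.
have [c c0s E] := line_MVT h0 (fun c _ => D (nd N p - step R N *: evec R i + c *: evec R i)).
rewrite subrK in E; rewrite /Dm nd_edN E mulfK ?gt_eqF//; apply: H.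
case/andP: c0s => c0 cs.
have -> : nd N p - step R N *: evec R i + c *: evec R i - nd N p = (c - step R N) *: evec R i.
  by rewrite scalerBl addrAC [_ - nd N p]addrAC subrr add0r addrC.
rewrite normZ_evec ler_norml; apply/andP; split; lra.
Qed.

Lemma Lapg_consistent (e : R) : 0 < e -> exists2 r : R, 0 < r & forall N t p, (0 < N)%N -> step R N < r ->
  a <= t <= b -> `|Lapg N (fun q => f t (nd N q)) p - laplacian (f t) (nd N p)| <= e.
Proof.
move=> e0; have e2 : 0 < e / 2 by rewrite divr_gt0.
have [d0 d00 H0] := uc_pdd 0 0 e2; have [d1 d10 H1] := uc_pdd 1 1 e2.
exists (Num.min d0 d1); first by rewrite lt_min d00.
move=> N t p N0; rewrite lt_min => /andP[s0 s1] tab.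
have h0 : 0 < step R N by exact: step_gt0.
have D y i : derivable (f t) y (evec R i) by have [_ + _] := hf.1 t y (ab tab); apply.
have DD y i j : derivable (pd i (f t)) y (evec R j) by have [_ _] := hf.1 t y (ab tab); apply.
have H i y : `|y - nd N p| <= step R N -> `|pd i (pd i (f t)) y - pd i (pd i (f t)) (nd N p)| <= e / 2.
  move=> yp; apply: ltW.
  by elim/ord2P: i; [apply: H0|apply: H1] => //; rewrite ?subrr ?normr0//; exact: le_lt_trans yp _.
have [y0 y00 E0] := second_diff (i := 0) (nd N p) h0 (fun y => D y 0) (fun y => DD y 0 0).
have [y1 y10 E1] := second_diff (i := 1) (nd N p) h0 (fun y => D y 1) (fun y => DD y 1 1).
have -> : Lapg N (fun q => f t (nd N q)) p = pd 0 (pd 0 (f t)) y0 + pd 1 (pd 1 (f t)) y1.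
  rewrite LapgE sum2E /Dm /Dp !subrK !nd_ed !nd_edN.
  move: E0 E1; rewrite -!nd_ed -!nd_edN.
  move: (f t (nd N p)) (f t (nd N (p + ed 0))) (f t (nd N (p - ed 0))) (f t (nd N (p + ed 1))) (f t (nd N (p - ed 1))).
  move: (pd 0 (pd 0 (f t)) y0) (pd 1 (pd 1 (f t)) y1) => q0 q1 z zp0 zm0 zp1 zm1 E0 E1.
  have -> : q0 = (zp0 - 2 * z + zm0) / step R N ^+ 2 by rewrite E0 mulfK// gt_eqF// exprn_gt0.
  have -> : q1 = (zp1 - 2 * z + zm1) / step R N ^+ 2 by rewrite E1 mulfK// gt_eqF// exprn_gt0.
  by field; rewrite gt_eqF.
rewrite /laplacian sum2E opprD addrACA; apply: le_trans (ler_normD _ _) _.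
by rewrite [leRHS](splitr e); apply: lerD; apply: H.
Qed.

Lemma time_consistent (e : R) : 0 < e -> exists2 r : R, 0 < r & forall t t' dt x, 0 < dt < r ->
  a <= t -> t + dt <= b -> t <= t' <= t + dt -> `|(f (t + dt) x - f t x) / dt - timeD f t' x| <= e.
Proof.
move=> e0; have [d d0 H] := uc_timeD e0; exists d => // t t' dt x /andP[dt0 dtd] at_ tb /andP[tt' t't].
have [c /andP[tc ct] ->] := time_MVT x dt0 (lt_le_trans ha at_) (le_lt_trans tb hbT).
rewrite mulfK ?gt_eqF//; apply: ltW; apply: H; rewrite ?subrr ?normr0//.
- by rewrite (le_trans at_ tc) (le_trans ct tb).
- by rewrite (le_trans at_ tt') (le_trans t't tb).
apply: le_lt_trans dtd; rewrite ler_norml; apply/andP; split; lra.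
Qed.

End InteriorRegularity.

(** * The exact solution on compact time intervals *)

Section SplitGradient.
Context {R : realType} (beta : R) (hb : 1 < beta < 2).

(** The limit of the upwind differences [Pv] of smooth functions. *)
Definition spv (v : R * R -> R) (x : R * R) : 'I_2 * bool -> R := fun k =>
  if k.2 then Num.max (pd k.1 v x) 0 else Num.max (- pd k.1 v x) 0.

Lemma nsq_spv v x : nsq (spv v x) = gsq v x.
Proof.
have H (y : R) : Num.max y 0 ^+ 2 + Num.max (- y) 0 ^+ 2 = y ^+ 2.
  have [y0|y0] := leP y 0.
    by rewrite max_l ?oppr_ge0// expr0n add0r sqrrN.
  by rewrite max_r ?oppr_le0 ?(ltW y0)// expr0n addr0.
by rewrite /nsq sum_pairE sum2E /spv /= !H.
Qed.

(** Splitting the partial derivatives into positive and negative parts does not change the length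
of the vector. *)
Lemma powgrad_spv v x i :
  powgrad beta (spv v x) (i, true) - powgrad beta (spv v x) (i, false) = powgrad beta (fun j => pd j v x) i.
Proof.
rewrite powgrad2E /powgrad nsq_spv -mulrBr /gsq; congr (_ * _); rewrite /spv /=.
move: (pd i v x) => y; have [y0|y0] := leP y 0.
  by rewrite max_l ?oppr_ge0// sub0r opprK.
by rewrite max_r ?oppr_le0 ?(ltW y0)// subr0.
Qed.

Lemma max0_lip (a b : R) : `|Num.max a 0 - Num.max b 0| <= `|a - b|.
Proof. by rewrite !maxEle; case: (leP a 0) => ?; case: (leP b 0) => ?; rewrite ler_norml; apply/andP; split; have [] := ler_normlP _ _ (lexx `|a - b|); lra. Qed.

Lemma Pv_spv N (u : int * int -> R) p v x d : 0 <= d ->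
  (forall i, `|Dp N i u p - pd i v x| <= d /\ `|Dm N i u p - pd i v x| <= d) ->
  nsq (fun k => Pv N u p k - spv v x k) <= 4 * d ^+ 2.
Proof.
move=> d0 H.
have S k : (Pv N u p k - spv v x k) ^+ 2 <= d ^+ 2.
  rewrite -real_normK ?num_real// ler_sqr ?nnegrE//.
  case: k => i [] /=; apply: le_trans (max0_lip _ _) _; have [h1 h2] := H i => //.
  by rewrite -opprD normrN.
rewrite /nsq sum_pairE sum2E.
rewrite (_ : 4 * d ^+ 2 = d ^+ 2 + d ^+ 2 + (d ^+ 2 + d ^+ 2)); last by ring.
by apply: lerD; apply: lerD; exact: S.
Qed.

Lemma nsq_pow_uc (L e : R) : 0 < L -> 0 < e -> exists2 d : R, 0 < d &
  forall (I : finType) (x y : I -> R), nsq x <= L ^+ 2 -> nsq y <= L ^+ 2 -> nsq (fun k => x k - y k) <= d ->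
  `|nsq x `^ (beta / 2) - nsq y `^ (beta / 2)| <= e.
Proof.
have /andP[b1 b2] := hb; have b0 : 0 < beta by lra.
move=> L0 e0; pose B := (L ^+ 2) `^ (beta - 1).
have B0 : 0 <= B by exact: powR_ge0.
pose c := e / (beta * (B + 1)).
have c0 : 0 < c by rewrite divr_gt0// mulr_gt0//; lra.
have d0 : 0 < e * c / beta by rewrite divr_gt0// mulr_gt0.
exists (e * c / beta) => // I.
suff H (x y : I -> R) : nsq x <= L ^+ 2 -> nsq y <= L ^+ 2 -> nsq (fun k => x k - y k) <= e * c / beta ->
    nsq x `^ (beta / 2) - nsq y `^ (beta / 2) <= e.
  move=> x y xL yL xy; rewrite ler_norml lerNl opprB; apply/andP; split; last exact: H.
  apply: H => //; apply: le_trans xy; rewrite le_eqVlt; apply/orP; left; apply/eqP.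
  by apply: eq_bigr => k _; rewrite -sqrrN opprB.
move=> xL yL xy.
have C := powgrad_convex hb (ltW L0) xL yL.
have C0 : 0 <= beta * (beta - 1) / 2 * L `^ (beta - 2) * nsq (fun k => y k - x k).
  by rewrite !mulr_ge0 ?nsq_ge0 ?powR_ge0//; lra.
have S : - (\sum_k beta * powgrad beta x k * (y k - x k)) <=
    beta * (c / 2 * nsq (powgrad beta x) + (2 * c)^-1 * nsq (fun k => x k - y k)).
  rewrite -sumrN /nsq !mulr_sumr -big_split mulr_sumr /=; apply: ler_sum => k _.
  move: (powgrad beta x k) (x k) (y k) => g a b'.
  have -> : - (beta * g * (b' - a)) = beta * (g * (a - b')) by ring.
  rewrite ler_pM2l//.
  have := sqr_ge0 (c * g - (a - b')); move: (a - b') => z h.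
  rewrite -(ler_pM2l c0).
  have -> : c * (c / 2 * g ^+ 2 + (2 * c)^-1 * z ^+ 2) = c ^+ 2 / 2 * g ^+ 2 + z ^+ 2 / 2.
    by field; rewrite gt_eqF.
  by move: h; rewrite sqrrB exprMn; lra.
have N1 : nsq (powgrad beta x) <= B.
  by rewrite (nsq_powgrad hb); apply: le_powR_pos; rewrite ?nsq_ge0//; lra.
have h1 : beta * (c / 2 * nsq (powgrad beta x)) <= e / 2.
  apply: (@le_trans _ _ (beta * (c / 2 * (B + 1)))).
    apply: ler_wpM2l; first exact: ltW.
    apply: ler_wpM2l; first by rewrite divr_ge0 ?(ltW c0).
    by apply: le_trans N1 _; rewrite lerDl.
  by rewrite /c le_eqVlt; apply/orP; left; apply/eqP; field; rewrite !gt_eqF//; lra.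
have h2 : beta * ((2 * c)^-1 * nsq (fun k => x k - y k)) <= e / 2.
  apply: (@le_trans _ _ (beta * ((2 * c)^-1 * (e * c / beta)))).
    by rewrite ler_pM2l// ler_pM2l// invr_gt0 mulr_gt0.
  by rewrite le_eqVlt; apply/orP; left; apply/eqP; field; rewrite !gt_eqF.
rewrite mulrDr in S.
suff gen (X Y A S1 H1 H2 : R) : A <= Y - X - S1 -> 0 <= A -> - S1 <= H1 + H2 ->
    H1 <= e / 2 -> H2 <= e / 2 -> X - Y <= e by exact: (gen _ _ _ _ _ _ C C0 S h1 h2).
by move=> *; lra.
Qed.

End SplitGradient.

Section InteriorSolution.
Context {R : realType} (T nu beta : R) (hb : 1 < beta < 2) (Hc u0 mT : R * R -> R)
  (Phi : probability (mplane R) R -> R * R -> R) (u m : R -> R * R -> R).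
Hypotheses (hsol : classical_solution T nu beta Hc u0 mT Phi u m)
  (hm_pos : forall t x, 0 <= t <= T -> 0 < m t x).
Variables (a b : R).
Hypotheses (ha : 0 < a) (hbT : b < T).
Local Notation k := (1 - beta / 2).

Let Cu := sol_C12_u hsol.
Let Cm := sol_C12_m hsol.
Let tu t (ht : 0 <= t <= T) := (sol_periodic hsol ht).1.
Let tm t (ht : 0 <= t <= T) := (sol_periodic hsol ht).2.

Lemma inside t : a <= t <= b -> 0 < t < T.
Proof. by case/andP => at_ tb; rewrite (lt_le_trans ha at_) (le_lt_trans tb hbT). Qed.
Lemma inside_le t : a <= t <= b -> 0 <= t <= T.
Proof. by move=> /inside /andP[/ltW -> /ltW ->]. Qed.

Lemma slice (Q : R -> R * R -> R) t x :
  {for (t, x), continuous (fun z : R * (R * R) => Q z.1 z.2)} -> {for x, continuous (Q t)}.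
Proof.
move=> cQ; apply/cvgrPdist_lt => e e0.
have /cvgrPdist_lt /(_ e e0) /nbhs_normP [r /= r0 H] := cQ.
have B : nbhs x (ball x r) by exact: nbhsx_ballx.
apply: filterS B => y; rewrite -ball_normE /= => xy; apply: (H (t, y)).
by rewrite /ball_ /= prod_normE /= subrr normr0 gt_max r0.
Qed.

(** The divergence of the flux, as given by the Fokker-Planck equation. In this form it is
continuous in time and space, unlike the partial derivatives of the flux. *)
Definition divF t x : R := - (timeD m t x + nu * laplacian (m t) x).

Lemma flux_Fe t i : flux Hc beta (u t) (m t) i = Fe beta (u t) (m t) 0 i.
Proof.
apply/funext => x; rewrite (flux_powgrad hb) /Fe powgrad2E /gsq addr0.
by rewrite opprB.
Qed.

Lemma divFE t x : a <= t <= b ->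
  divF t x = pd 0 (Fe beta (u t) (m t) 0 0) x + pd 1 (Fe beta (u t) (m t) 0 1) x.
Proof.
move=> /inside tT; have := sol_FP hsol x tT; rewrite sum2E !flux_Fe /divF.
move: (pd 0 _ x) (pd 1 _ x) (timeD m t x) (nu * _) => *; lra.
Qed.

Lemma Fe_derivable t x i : a <= t <= b -> derivable (Fe beta (u t) (m t) 0 i) x (evec R i).
Proof. by move=> /inside tT; rewrite -flux_Fe; exact: (@sol_flux _ _ _ _ _ _ _ _ _ _ hsol t x i tT). Qed.

Let cfu (z : R * (R * R)) : 0 < z.1 < T -> {for z, continuous (fun y : R * (R * R) => m y.1 y.2)}.
Proof. by move=> hz; have [] := Cm.2 z hz. Qed.
Let cfdm i (z : R * (R * R)) : 0 < z.1 < T -> {for z, continuous (fun y : R * (R * R) => pd i (m y.1) y.2)}.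
Proof. by move=> hz; have [_ _ + _] := Cm.2 z hz; apply. Qed.
Let cfddm i j (z : R * (R * R)) : 0 < z.1 < T -> {for z, continuous (fun y : R * (R * R) => pd j (pd i (m y.1)) y.2)}.
Proof. by move=> hz; have [_ _ _ +] := Cm.2 z hz; apply. Qed.
Let cftm (z : R * (R * R)) : 0 < z.1 < T -> {for z, continuous (fun y : R * (R * R) => timeD m y.1 y.2)}.
Proof. by move=> hz; have [] := Cm.2 z hz. Qed.
Let cfp i (z : R * (R * R)) : 0 < z.1 < T -> {for z, continuous (fun y : R * (R * R) => pd i (u y.1) y.2)}.
Proof. by move=> hz; have [_ _ + _] := Cu.2 z hz; apply. Qed.
Let cfA i j (z : R * (R * R)) : 0 < z.1 < T -> {for z, continuous (fun y : R * (R * R) => pd j (pd i (u y.1)) y.2)}.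
Proof. by move=> hz; have [_ _ _ +] := Cu.2 z hz; apply. Qed.

Lemma cf_gsq (z : R * (R * R)) : 0 < z.1 < T -> {for z, continuous (fun y : R * (R * R) => gsq (u y.1) y.2)}.
Proof. by move=> hz; apply: cfD; apply: cfX; exact: cfp. Qed.

Lemma cf_DFi ep i (z : R * (R * R)) : 0 < ep -> 0 < z.1 < T ->
  {for z, continuous (fun y : R * (R * R) => DFi beta (u y.1) (m y.1) ep i y.2)}.
Proof.
move=> ep0 hz.
have cw r : {for z, continuous (fun y : R * (R * R) => (gsq (u y.1) y.2 + ep) `^ r)}.
  apply: cf_pow; first by rewrite ltr_wpDl ?gsq_ge0.
  by apply: cfD; [exact: cf_gsq|exact: cfC].
apply: cfD.
  apply: cfM; first exact: cfdm.
  by apply: cfM; [exact: cfC|apply: cfM; [exact: cw|exact: cfp]].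
apply: cfM; first exact: cfu.
apply: cfM; first exact: cfC.
apply: cfB; first by apply: cfM; [exact: cw|exact: cfA].
apply: cfM; last exact: cfp.
apply: cfM; first by apply: cfM; [exact: cfC|exact: cw].
apply: cfM; first exact: cfC.
by apply: cfD; apply: cfM; [exact: cfp|exact: cfA|exact: cfp|exact: cfA].
Qed.

Lemma cf_divF (z : R * (R * R)) : 0 < z.1 < T -> {for z, continuous (fun y : R * (R * R) => divF y.1 y.2)}.
Proof.
move=> hz; have -> : (fun y : R * (R * R) => divF y.1 y.2) =
    (fun y : R * (R * R) => 0 - (timeD m y.1 y.2 + nu * laplacian (m y.1) y.2)).
  by apply/funext => y; rewrite sub0r.
apply: cfB; first exact: cfC.
apply: cfD; first exact: cftm.
have -> : (fun y : R * (R * R) => nu * laplacian (m y.1) y.2) =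
   (fun y : R * (R * R) => nu * (pd 0 (pd 0 (m y.1)) y.2 + pd 1 (pd 1 (m y.1)) y.2)).
  by apply/funext => y; rewrite /laplacian sum2E.
by apply: cfM; [exact: cfC|apply: cfD; exact: cfddm].
Qed.

Lemma torus_divF t : a <= t <= b -> torus_fun (divF t).
Proof.
move=> /[dup] /inside_le tT /inside tT'.
have t1 : torus_fun (timeD m t) by exact: (torus_timeD tm tT').
have t2 i : torus_fun (pd i (pd i (m t))) by do 2 apply: torus_pd; exact: tm.
have -> : divF t = fun x => 0 - (timeD m t x + nu * (pd 0 (pd 0 (m t)) x + pd 1 (pd 1 (m t)) x)).
  by apply/funext => x; rewrite sub0r /divF /laplacian sum2E.
apply: torusB; first exact: torusC.
apply: torusD; first exact: t1.
by apply: torusM; [exact: torusC|apply: torusD; exact: t2].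
Qed.

Let Wt ep t x : R := (dvF beta (u t) (m t) ep x - divF t x) ^+ 2.

Lemma uc_resid ep : 0 < ep -> ucp a b (Wt ep).
Proof.
move=> ep0; apply: torus_uc => [|t tab].
  apply: for_ccont => z /inside hz; apply: cfX; apply: cfB; last exact: cf_divF.
  by apply: cfD; exact: cf_DFi.
apply: (@torus_comp _ (fun y => y ^+ 2)); apply: torusB; last exact: torus_divF.
by apply: torus_dvF; [apply: tu|apply: tm]; exact: inside_le.
Qed.

Lemma uc_DFi ep i : 0 < ep -> ucp a b (fun t => DFi beta (u t) (m t) ep i).
Proof.
move=> ep0; apply: torus_uc => [|t tab].
  by apply: for_ccont => z /inside hz; exact: cf_DFi.
by apply: torus_DFi; [apply: tu|apply: tm]; exact: inside_le.
Qed.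

Lemma bdd_m : exists2 Mu : R, 0 < Mu & forall t x, a <= t <= b -> m t x <= Mu.
Proof.
have [C HC] : bdd a b m.
  apply: torus_bdd => [|t tab]; last by apply: tm; exact: inside_le.
  by apply: for_ccont => z /inside hz; exact: cfu.
exists (`|C| + 1) => [|t x tab]; first by rewrite ltr_wpDl.
apply: le_trans (ler_norm _) _; apply: le_trans (HC t x tab) _.
by apply: le_trans (ler_norm _) _; rewrite lerDl.
Qed.

Lemma m_lower : exists2 cu : R, 0 < cu & forall t x, a <= t <= b -> cu <= m t x.
Proof.
have [C HC] : bdd a b (fun t x => (m t x)^-1).
  apply: torus_bdd => [|t tab].
    apply: for_ccont => z /inside hz; apply: cvgV; last exact: cfu.
    by case/andP: hz => z0 z1; rewrite gt_eqF// hm_pos// !ltW.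
  by apply: (@torus_comp _ (fun y => y^-1)); apply: tm; exact: inside_le.
exists (`|C| + 1)^-1 => [|t x tab]; first by rewrite invr_gt0 ltr_wpDl.
have m0 : 0 < m t x by apply: hm_pos; exact: inside_le.
rewrite -[leRHS]invrK lef_pV2 ?posrE ?invr_gt0 ?ltr_wpDl//.
apply: le_trans (ler_norm _) _; apply: le_trans (HC t x tab) _.
by apply: le_trans (ler_norm _) _; rewrite lerDl.
Qed.

(** The constants of the static estimates can be chosen for all times of [[a, b]]. *)
Lemma static_hyps : exists Mu cu D : R, [/\ 0 < cu,
  forall t x, a <= t <= b -> cu <= m t x <= Mu,
  forall t x, a <= t <= b -> pd 0 (m t) x ^+ 2 + pd 1 (m t) x ^+ 2 <= D &
  exists W : R, forall t x, a <= t <= b -> Wf beta (u t) (divF t) x <= W].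
Proof.
have [Mu Mu0 HM] := bdd_m; have [cu cu0 Hc'] := m_lower.
have [D0 HD0] := bdd_pd Cm tm ha hbT 0; have [D1 HD1] := bdd_pd Cm tm ha hbT 1.
have [P0 HP0] := bdd_pd Cu tu ha hbT 0; have [P1 HP1] := bdd_pd Cu tu ha hbT 1.
have [F HF] : bdd a b divF.
  apply: torus_bdd => [|t]; last exact: torus_divF.
  by apply: for_ccont => z /inside; exact: cf_divF.
have sq (y C : R) : `|y| <= C -> y ^+ 2 <= C ^+ 2.
  move=> yC; have C0 := le_trans (normr_ge0 _) yC.
  by rewrite -real_normK ?num_real// ler_sqr ?nnegrE.
exists Mu, cu, (D0 ^+ 2 + D1 ^+ 2); split => //.
- by move=> t x tab; rewrite HM// Hc'.
- by move=> t x tab; apply: lerD; apply: sq; [exact: HD0|exact: HD1].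
exists (F ^+ 2 + (P0 ^+ 2 + P1 ^+ 2) `^ (beta - 1)) => t x tab.
apply: lerD; first by apply: sq; exact: HF.
apply: le_powR_pos; first by case/andP: hb => h1 _; rewrite subr_ge0 ltW.
  exact: gsq_ge0.
by apply: lerD; apply: sq; [exact: HP0|exact: HP1].
Qed.

Let dfct ep t : R := defect beta (u t) (m t) (divF t) ep.

(** The bound that does not depend on [ep] allows dominated convergence in time. *)
Lemma dfct_facts : (exists C : R, forall t ep, a <= t <= b -> 0 < ep -> 0 <= dfct ep t <= C) /\
  (forall t, a <= t <= b -> (fun n => dfct (n.+1%:R^-1 ^+ 2) t) @ \oo --> (0 : R)).
Proof.
have [Mu [cu [D [cu0 muP dmuP [W WP]]]]] := static_hyps.
have H t (tab : a <= t <= b) : [/\ torus_fun (u t), torus_fun (m t) & torus_fun (divF t)].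
  by split; [apply: tu; exact: inside_le|apply: tm; exact: inside_le|exact: torus_divF].
have dd t (tab : a <= t <= b) : [/\ forall x i, derivable (u t) x (evec R i),
   forall x i j, derivable (pd i (u t)) x (evec R j) & forall x i, derivable (m t) x (evec R i)].
  split=> [x i|x i j|x i].
  - by have [_ + _] := Cu.1 t x (inside tab); apply.
  - by have [_ _] := Cu.1 t x (inside tab); apply.
  - by have [_ + _] := Cm.1 t x (inside tab); apply.
have cc t (tab : a <= t <= b) : [/\ forall i, continuous (pd i (u t)),
   forall i j, continuous (pd j (pd i (u t))), continuous (m t), forall i, continuous (pd i (m t)) & continuous (divF t)].
  have hz x : 0 < ((t, x) : R * (R * R)).1 < T by exact: inside.
  split=> [i|i j||i|] x.
  - exact: (@slice (fun t => pd i (u t)) t x (@cfp i _ (hz x))).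
  - exact: (@slice (fun t => pd j (pd i (u t))) t x (@cfA i j _ (hz x))).
  - exact: (@slice (m) t x (@cfu _ (hz x))).
  - exact: (@slice (fun t => pd i (m t)) t x (@cfdm i _ (hz x))).
  - exact: (@slice (divF) t x (@cf_divF _ (hz x))).
split.
  exists (cst1 beta Mu cu D * W) => t ep tab ep0.
  have [t1 t2 t3] := H t tab; have [d1 d2 d3] := dd t tab; have [c1 c2 c3 c4 c5] := cc t tab.
  exact: (defect_bound hb t1 t2 t3 d1 d2 d3 c1 c2 c3 c4 c5 cu0 (fun x => muP t x tab)
    (fun x => dmuP t x tab) (fun x i => @Fe_derivable t x i tab) (fun x => divFE x tab) ep0 (fun x => WP t x tab)).
move=> t tab.
have [t1 t2 t3] := H t tab; have [d1 d2 d3] := dd t tab; have [c1 c2 c3 c4 c5] := cc t tab.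
exact: (defect_cvg hb t1 t2 t3 d1 d2 d3 c1 c2 c3 c4 c5 cu0 (fun x => muP t x tab)
    (fun x => dmuP t x tab) (fun x i => @Fe_derivable t x i tab) (fun x => divFE x tab)).
Qed.

End InteriorSolution.

(** * Consistency of the numerical flux *)

Section TimeSums.
Context {R : realType}.
Implicit Types (Q : R -> R * R -> R) (a b : R).

Lemma ucp_continuous a b Q t : ucp a b Q -> a <= t <= b -> continuous (Q t).
Proof.
move=> H tab x; apply/cvgrPdist_lt => e e0; have [d d0 Hd] := H e e0.
have B : nbhs x (ball x d) by exact: nbhsx_ballx.
by apply: filterS B => y; rewrite -ball_normE /= => xy; apply: Hd; rewrite // subrr normr0.
Qed.

Lemma int_uc a b Q : ucp a b Q -> (forall t, a <= t <= b -> torus_fun (Q t)) -> ucp a b (fun t _ =>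
  \int[leb2 R]_(x in @cell R) Q t x).
Proof.
move=> H tQ e e0; have e2 : 0 < e / 2 by rewrite divr_gt0.
have [d d0 Hd] := H _ e2; exists d => // t t' _ _ tab tab' tt _.
have iQ s : a <= s <= b -> (leb2 R).-integrable (@cell R) (EFin \o Q s).
  by move=> sab; apply: cont_integrable; [exact: (ucp_continuous H)|exact: tQ].
have iC (c : R) : (leb2 R).-integrable (@cell R) (EFin \o (fun=> c)).
  by apply: cont_integrable => // x; exact: cvg_cst.
have mc := @measurable_cell R.
have K s s' : a <= s <= b -> a <= s' <= b -> `|s - s'| < d ->
    \int[leb2 R]_(x in @cell R) Q s x <= \int[leb2 R]_(x in @cell R) Q s' x + e / 2.
  move=> sab s'ab ss; rewrite -[X in _ + X](int_cell_cst (e / 2)) -(RintegralD mc (iQ _ s'ab) (iC _)).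
  apply: le_Rintegral => //; first exact: iQ.
    by apply: cont_integrable; [apply: contD; [exact: (ucp_continuous H)|exact: contC]|apply: torusD; [exact: tQ|exact: torusC]].
  move=> x _; have := Hd s s' x x sab s'ab ss; rewrite subrr normr0 => /(_ d0).
  by rewrite ltr_norml => /andP[_]; lra.
have h1 := K _ _ tab tab' tt; have h2 := K t' t tab' tab; rewrite distrC in h2; have {}h2 := h2 tt.
by rewrite ltr_norml; apply/andP; split; lra.
Qed.

Lemma riemann_ucp a b Q (e : R) : ucp a b Q -> (forall t, a <= t <= b -> torus_fun (Q t)) -> 0 < e ->
  exists2 d : R, 0 < d & forall N t, (0 < N)%N -> step R N < d -> a <= t <= b ->
    `|avg N (fun p => Q t (nd N p)) - \int[leb2 R]_(x in @cell R) Q t x| <= e.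
Proof.
move=> H tQ e0; have [d d0 Hd] := H _ e0; exists d => // N t N0 sd tab.
have cQ := ucp_continuous H tab.
apply: riemann => //; first exact: continuous_measurable2.
  by have [C _ HC] := torus_bdd1 cQ (tQ t tab); exists C.
move=> k l x skl; apply: ltW; apply: Hd; rewrite // ?subrr ?normr0//.
by apply: lt_trans sd; exact: sq_nd.
Qed.

(** The factors [c] bound [G] from below on each time step, so the sum is an integral of a step
function below [G]. *)
Lemma time_sum_le_int a b (G c : R -> R) (dt : R) (n0 n1 : nat) : 0 < dt -> (n0 <= n1)%N ->
  a <= n0%:R * dt -> n1%:R * dt <= b ->
  measurable_fun (`[a, b]%classic : set (measurableTypeR R)) (G : measurableTypeR R -> measurableTypeR R) ->
  (forall t, a <= t <= b -> 0 <= G t) ->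
  (forall n : nat, (n0 <= n < n1)%N -> 0 <= c (n%:R * dt) /\
     forall s, n%:R * dt <= s <= n.+1%:R * dt -> c (n%:R * dt) <= G s) ->
  ((dt * \sum_(n0 <= n < n1) c (n%:R * dt))%:E <=
    \int[@lebesgue_measure R]_(s in `[a, b]) (G s)%:E)%E.
Proof.
move=> dt0 n01 an0 n1b mG G0 Hc.
pose I (n : nat) : set (measurableTypeR R) := `[n0%:R * dt, n%:R * dt[%classic.
have mI n : measurable (I n) by exact: measurable_itv.
have Iab n : (n <= n1)%N -> I n `<=` `[a, b]%classic.
  move=> nn1 s; rewrite /I /= !in_itv /= => /andP[h1 h2]; rewrite (le_trans an0 h1) /=.
  by apply: le_trans (ltW h2) _; apply: le_trans n1b; rewrite ler_pM2r// ler_nat.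
have mGE D : measurable D -> D `<=` `[a, b]%classic ->
    measurable_fun (D : set (measurableTypeR R)) (fun s => (G s)%:E).
  by move=> mD Dab; apply/measurable_EFinP; apply: measurable_funS mG => //; exact: measurable_itv.
have G0E n s : (n <= n1)%N -> I n s -> (0 <= (G s)%:E)%E.
  by move=> nn Is; rewrite lee_fin; apply: G0; have := Iab n nn s Is; rewrite /= in_itv.
suff H n : (n0 <= n <= n1)%N -> ((dt * \sum_(n0 <= j < n) c (j%:R * dt))%:E <=
    \int[@lebesgue_measure R]_(s in I n) (G s)%:E)%E.
  apply: le_trans (H n1 _) _; first by rewrite n01 leqnn.
  apply: ge0_subset_integral => //.
  - exact: mGE.
  - exact: Iab.
elim: n => [|n IH] /andP[h1 h2].
  move: h1; rewrite leqn0 => /eqP n00; rewrite big_geq ?n00// mulr0.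
  by apply: integral_ge0 => s; apply: G0E.
move: h1; rewrite leq_eqVlt => /orP[/eqP n0n|]; last rewrite ltnS => h1.
  rewrite big_geq ?n0n// mulr0.
  by apply: integral_ge0 => s; apply: G0E.
rewrite big_nat_recr//= mulrDr EFinD.
pose J : set (measurableTypeR R) := `[n%:R * dt, n.+1%:R * dt[%classic.
have mJ : measurable J by exact: measurable_itv.
have nd0 : n%:R * dt <= n.+1%:R * dt by rewrite ler_pM2r// ler_nat.
have E : I n.+1 = I n `|` J.
  apply/seteqP; split => s; rewrite /I /J /= !in_itv /=.
    by move=> /andP[s1 s2]; have [s3|s3] := ltP s (n%:R * dt); [left; rewrite s1|right].
  case=> /andP[s1 s2]; first by rewrite s1 (lt_le_trans s2).
  by rewrite s2 andbT; apply: le_trans s1; rewrite ler_pM2r// ler_nat.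
have JI : J `<=` I n.+1 by rewrite E; exact: subsetUr.
rewrite E ge0_integral_setU//.
- apply: leeD; first by apply: IH; rewrite h1 ltnW.
  have [c0 cG] := Hc n (introT andP (conj h1 h2)).
  apply: (@le_trans _ _ (\int[@lebesgue_measure R]_(s in J) (c (n%:R * dt))%:E)%E).
    rewrite integral_cst//= lebesgue_measure_itv /= lte_fin ltr_pM2r// ltr_nat ltnSn.
    rewrite -EFinB -EFinM lee_fin -mulrBl -natrB// subSnn mul1r mulrC//.
  apply: ge0_le_integral_any => s Js; rewrite lee_fin//.
  by apply: cG; move: Js; rewrite /J /= in_itv /= => /andP[-> /ltW ->].
- by rewrite -E; apply: mGE; [exact: mI|exact: Iab].
- by move=> s; rewrite -E; exact: G0E.
apply/disj_setPS => s [] /=; rewrite /I /J /= !in_itv /= => /andP[_ s1] /andP[s2 _].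
by move: (lt_le_trans s1 s2); rewrite ltxx.
Qed.

End TimeSums.

Lemma cf_max0 (R : realType) (V : topologicalType) (f : V -> R) (z : V) :
  {for z, continuous f} -> {for z, continuous (fun y => Num.max (f y) 0)}.
Proof.
move=> cf; apply/cvgrPdist_le => e e0; have /cvgrPdist_le /(_ e e0) := cf.
by apply: filterS => y; exact: le_trans (max0_lip _ _).
Qed.

Section FPConsistency.
Context {R : realType} (T nu beta : R) (hb : 1 < beta < 2) (Hc u0 mT : R * R -> R)
  (Phi : probability (mplane R) R -> R * R -> R) (u m : R -> R * R -> R).
Hypotheses (hsol : classical_solution T nu beta Hc u0 mT Phi u m)
  (hm_pos : forall t x, 0 <= t <= T -> 0 < m t x).
Variables (a b : R).
Hypotheses (ha : 0 < a) (hbT : b < T) (hab : a <= b).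

Let Cu := sol_C12_u hsol.
Let Cm := sol_C12_m hsol.
Let tu t (ht : 0 <= t <= T) := (sol_periodic hsol ht).1.
Let tm t (ht : 0 <= t <= T) := (sol_periodic hsol ht).2.
Let beta0 : 0 < beta. Proof. by case/andP: hb => h _; apply: lt_trans h. Qed.

(** The limits of the upwind derivatives [bb] of the numerical Hamiltonian. *)
Definition slopes t x : 'I_2 * bool -> R := fun k => beta * powgrad beta (spv (u t) x) k.

Lemma Pv_consistent (d : R) : 0 < d -> exists2 r : R, 0 < r & forall N t t' p, (0 < N)%N -> step R N < r ->
  a <= t <= b -> a <= t' <= b -> `|t - t'| < r ->
  nsq (fun k => Pv N (fun q => u t' (nd N q)) p k - spv (u t) (nd N p) k) <= d.
Proof.
move=> d0; pose e := Num.min 1 (d / 4).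
have e0 : 0 < e by rewrite lt_min ltr01 divr_gt0.
have e20 : 0 < e / 2 by rewrite divr_gt0.
have e1 : e <= 1 by rewrite ge_min lexx.
have ed : e <= d / 4 by rewrite ge_min lexx orbT.
have [r1 r10 H1] := Dp_consistent Cu tu ha hbT e20.
have [r2 r20 H2] := uc_pd Cu tu ha hbT 0 e20.
have [r3 r30 H3] := uc_pd Cu tu ha hbT 1 e20.
exists (Num.min r1 (Num.min r2 r3)); first by rewrite !lt_min r10 r20.
move=> N t t' p N0; rewrite !lt_min => /and3P[s1 s2 s3] tab tab' /and3P[t1 t2 t3].
have P i : `|pd i (u t') (nd N p) - pd i (u t) (nd N p)| <= e / 2.
  by rewrite distrC; apply: ltW; elim/ord2P: i; [apply: H2|apply: H3]; rewrite // subrr normr0.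
have tri (x y z : R) : `|x - y| <= e / 2 -> `|y - z| <= e / 2 -> `|x - z| <= e.
  move=> xy yz; rewrite [leRHS](splitr e); apply: le_trans (lerD xy yz).
  by rewrite -[x - z](subrKA y) ler_normD.
have S : nsq (fun k => Pv N (fun q => u t' (nd N q)) p k - spv (u t) (nd N p) k) <= 4 * e ^+ 2.
  apply: Pv_spv; first exact: ltW.
  by move=> i; have [h1 h2] := H1 N t' i p N0 s1 tab'; split; apply: tri (P i).
apply: le_trans S _; have : e ^+ 2 <= e by rewrite expr2 ler_piMl ?(ltW e0).
lra.
Qed.

Lemma bb_consistent (e : R) : 0 < e -> exists2 r : R, 0 < r & forall N t t' p k, (0 < N)%N -> step R N < r ->
  a <= t <= b -> a <= t' <= b -> `|t - t'| < r ->
  `|bb N beta (fun q => u t' (nd N q)) p k - slopes t (nd N p) k| <= e.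
Proof.
move=> e0; have eb : 0 < e / beta by rewrite divr_gt0.
have [d d0 Hd] := powgrad_uc hb eb; have [r r0 Hr] := Pv_consistent d0.
exists r => // N t t' p k N0 sr tab tab' tt.
have K (y z : R) : `|y - z| <= e / beta -> `|beta * y - beta * z| <= e.
  by rewrite -mulrBr normrM (gtr0_norm beta0) ler_pdivlMr// mulrC.
exact: K (Hd _ _ _ (Hr N t t' p N0 sr tab tab' tt) k).
Qed.

Lemma cf_slopes k (z : R * (R * R)) : 0 < z.1 < T -> {for z, continuous (fun y : R * (R * R) => slopes y.1 y.2 k)}.
Proof.
move=> hz; apply: cfM; first exact: cfC.
have cs l : {for z, continuous (fun y : R * (R * R) => spv (u y.1) y.2 l)}.
  have c1 : {for z, continuous (fun y : R * (R * R) => pd l.1 (u y.1) y.2)}.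
    by have [_ _ + _] := Cu.2 z hz; apply.
  case: l c1 => l [] /= c1; apply: cf_max0 => //.
  have -> : (fun y : R * (R * R) => - pd l (u y.1) y.2) = (fun y : R * (R * R) => 0 - pd l (u y.1) y.2).
    by apply/funext => y; rewrite sub0r.
  by apply: cfB => //; exact: cfC.
exact: (powgrad_cont hb (g := fun l (y : R * (R * R)) => spv (u y.1) y.2 l) cs).
Qed.

Lemma torus_slopes t k : a <= t <= b -> torus_fun (fun x => slopes t x k).
Proof.
move=> tab.
have tp i : torus_fun (pd i (u t)) by apply: torus_pd; apply: tu; exact: inside_le tab.
have E x y : (forall i, pd i (u t) x = pd i (u t) y) -> slopes t x k = slopes t y k.
  by move=> H; rewrite /slopes (_ : spv (u t) x = spv (u t) y)//; apply/funext => l; rewrite /spv !H.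
by move=> x; split; apply: E => i; [exact: (tp i x).1|exact: (tp i x).2].
Qed.

Lemma uc_mslopes k : ucp a b (fun t x => m t x * slopes t x k).
Proof.
apply: torus_uc => [|t tab].
  apply: for_ccont => z zab; have hz := inside ha hbT zab.
  by apply: cfM; [have [] := Cm.2 z hz|exact: cf_slopes].
by apply: torusM; [apply: tm; exact: inside_le tab|exact: torus_slopes].
Qed.

Lemma Fe0_slopes t x i : Fe beta (u t) (m t) 0 i x = m t x * slopes t x (i, true) - m t x * slopes t x (i, false).
Proof.
rewrite -mulrBr /slopes -mulrBr powgrad_spv /Fe powgrad2E /gsq addr0; congr (_ * (_ * (_ `^ _ * _))).
by rewrite opprB.
Qed.

(** The flux through an edge uses [m] and the slopes at both ends; by uniform continuity they may
be taken at one end, where positive and negative parts recombine into the flux. *)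
Lemma Rf_consistent (e : R) : 0 < e -> exists2 r : R, 0 < r & forall N t t' p i, (0 < N)%N -> step R N < r ->
  a <= t <= b -> a <= t' <= b -> `|t - t'| < r ->
  `|Rf N beta (fun q => u t' (nd N q)) (fun q => m t (nd N q)) i p - Fe beta (u t) (m t) 0 i (nd N p)| <= e.
Proof.
move=> e0; have [Mu Mu0 HM] := bdd_m hsol ha hbT.
have e3 : 0 < e / 3 by rewrite divr_gt0.
have eM : 0 < e / 3 / Mu by rewrite !divr_gt0.
have [r1 r10 H1] := bb_consistent eM.
have [r2 r20 H2] := uc_mslopes (0, true) e3.
have [r3 r30 H3] := uc_mslopes (1, true) e3.
exists (Num.min r1 (Num.min r2 r3)); first by rewrite !lt_min r10 r20.
move=> N t t' p i N0; rewrite !lt_min => /and3P[s1 s2 s3] tab tab' /and3P[t1 t2 t3].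
have m0 q : 0 < m t (nd N q) by apply: hm_pos; exact: inside_le tab.
have B q k : `|m t (nd N q) * (bb N beta (fun q => u t' (nd N q)) q k - slopes t (nd N q) k)| <= e / 3.
  rewrite normrM gtr0_norm//.
  apply: (@le_trans _ _ (Mu * (e / 3 / Mu))); last by rewrite mulrC divfK// gt_eqF.
  by apply: ler_pM; [exact: ltW|exact: normr_ge0|exact: HM|exact: H1].
have S : `|m t (nd N (p + ed i)) * slopes t (nd N (p + ed i)) (i, true) - m t (nd N p) * slopes t (nd N p) (i, true)| <= e / 3.
  have h0 := @step_gt0 R N N0.
  have dist : `|nd N (p + ed i) - nd N p| <= step R N.
    by rewrite nd_ed addrAC subrr add0r normZ_evec gtr0_norm.
  apply: ltW; move: dist; elim/ord2P: i => dist; [apply: H2|apply: H3] => //; rewrite ?subrr ?normr0//; exact: le_lt_trans dist _.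
rewrite Fe0_slopes /Rf.
move: (B (p + ed i) (i, true)) (B p (i, false)) S.
move: (m t (nd N (p + ed i))) (m t (nd N p)) (slopes t (nd N (p + ed i)) (i, true)) (slopes t (nd N p) (i, true))
  (slopes t (nd N p) (i, false)) (bb N beta _ (p + ed i) (i, true)) (bb N beta _ p (i, false)).
move=> A1 A3 A6 A7 A8 A2 A4 B1 B2 S.
have -> : A1 * A2 - A3 * A4 - (A3 * A7 - A3 * A8) =
   A1 * (A2 - A6) + (A1 * A6 - A3 * A7) - A3 * (A4 - A8) by ring.
apply: le_trans (ler_normB _ _) _; apply: le_trans (lerD (ler_normD _ _) (lexx _)) _.
have -> : e = e / 3 + e / 3 + e / 3 by field.
by apply: lerD => //; apply: lerD.
Qed.

Lemma Fe_regularized (e : R) : 0 < e -> exists2 d : R, 0 < d & forall ep t x i, a <= t <= b -> 0 <= ep <= d ->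
  `|Fe beta (u t) (m t) 0 i x - Fe beta (u t) (m t) ep i x| <= e.
Proof.
move=> e0; have [Mu Mu0 HM] := bdd_m hsol ha hbT.
have eM : 0 < e / (Mu * beta) by rewrite divr_gt0// mulr_gt0.
have [d d0 Hd] := powgrad_uc hb eM; exists d => // ep t x i tab /andP[ep0 epd].
rewrite !Fe_powgrad// -mulrBr -mulrBr normrM normrM (gtr0_norm beta0).
have m0 : 0 < m t x by apply: hm_pos; exact: inside_le tab.
rewrite gtr0_norm//.
have G : nsq (fun k => gvec (u t) 0 x k - gvec (u t) ep x k) <= d.
  rewrite /nsq (bigD1 None)//= sqrtr0 sub0r sqrrN sqr_sqrtr// big1 ?addr0//.
  by case=> // j _ /=; rewrite subrr expr0n.
have {}Hd := Hd _ _ _ G (Some i).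
apply: (@le_trans _ _ (Mu * (beta * (e / (Mu * beta))))); last first.
  by rewrite le_eqVlt; apply/orP; left; apply/eqP; field; rewrite !gt_eqF.
apply: ler_pM; [exact: ltW|by rewrite mulr_ge0 ?normr_ge0 ?ltW|exact: HM|by rewrite ler_pM2l].
Qed.

Let dfct ep t : R := defect beta (u t) (m t) (divF nu m t) ep.

Lemma uc_dfct ep : 0 < ep -> ucp a b (fun t _ => dfct ep t).
Proof.
move=> ep0; apply: (int_uc (Q := fun t x => (dvF beta (u t) (m t) ep x - divF nu m t x) ^+ 2)).
  exact: (uc_resid hsol ha hbT ep0).
move=> t tab; apply: (@torus_comp _ (fun y => y ^+ 2)); apply: torusB; last exact: (torus_divF hsol ha hbT tab).
by apply: torus_dvF; [apply: tu|apply: tm]; exact: inside_le tab.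
Qed.

Lemma measurable_dfct ep : 0 < ep ->
  measurable_fun (`[a, b]%classic : set (measurableTypeR R)) (dfct ep : measurableTypeR R -> measurableTypeR R).
Proof.
move=> ep0; apply: subspace_continuous_measurable_fun; first exact: measurable_itv.
apply/subspace_continuousP => t; rewrite /= in_itv /= => tab.
apply/cvgrPdist_lt => e e0; have [d d0 H] := uc_dfct ep0 e0.
rewrite near_withinE.
have B : nbhs t (ball t d) by exact: nbhsx_ballx.
apply: filterS B => s; rewrite -ball_normE /= in_itv /= => ts sab.
by apply: (H t s 0 0) => //; rewrite subrr normr0.
Qed.

(** Dominated convergence in time along [ep = (n + 1) ^ -2]. *)
Lemma dfct_int_small (eta d : R) : 0 < eta -> 0 < d -> exists2 ep : R, 0 < ep <= d &
  (\int[@lebesgue_measure R]_(t in `[a, b]) (dfct ep t)%:E <= eta%:E)%E.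
Proof.
move=> eta0 d0; have [[C HC] Hcv] := dfct_facts hb hsol hm_pos ha hbT.
pose ep (n : nat) : R := n.+1%:R^-1 ^+ 2.
have ep0 n : 0 < ep n by rewrite exprn_gt0// invr_gt0.
have mab : measurable (`[a, b]%classic : set (measurableTypeR R)) by exact: measurable_itv.
have [] // := @dominated_convergence _ _ _ (@lebesgue_measure R) (`[a, b]%classic : set (measurableTypeR R)) mab
    (fun n t => (dfct (ep n) t)%:E) (fun=> 0%E) (fun=> C%:E).
- by move=> n; apply/measurable_EFinP; exact: measurable_dfct.
- apply: aeW => t /=; rewrite in_itv /= => tab; apply: cvg_EFin; first by near=> n.
  exact: (Hcv t tab).
- apply/integrableP; split; first exact: measurable_cst.
  by rewrite integral_cst//= lebesgue_measure_itv /=; case: ifP; rewrite ?mule0 ?ltry// -EFinB -EFinM ltry.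
- apply: aeW => t n /=; rewrite in_itv /= => tab; have /andP[h0 h1] := HC t (ep n) tab (ep0 n).
  by rewrite lee_fin ger0_norm.
move=> _ _; rewrite integral0 => H.
have ne : \forall n \near \oo, ep n <= d.
  have := @powR_harmonic R 1 ltr01 => /cvgrPdist_le /(_ d d0); apply: filterS => n.
  by rewrite powRr1 ?sqr_ge0// sub0r normrN ger0_norm ?sqr_ge0.
have nI : \forall n \near \oo, (\int[@lebesgue_measure R]_(t in `[a, b]) (dfct (ep n) t)%:E <= eta%:E)%E.
  have := H => /fine_cvgP [F /cvgrPdist_le /(_ eta eta0) G].
  apply: filterS2 F G => n /= Fn Gn; rewrite -(fineK Fn) lee_fin; move: Gn; rewrite sub0r normrN.
  by apply: le_trans; exact: ler_norm.
have [n []] := filter_ex (filterI ne nI).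
by exists (ep n); rewrite ?ep0.
Unshelve. all: by end_near. Qed.

End FPConsistency.

(** * Consistency of the Fokker-Planck equation *)

Lemma residual_split (R : realType) (z1 z2 z3 z4 z5 z6 z7 z8 d : R) : `|z7 - z8| <= d / 4 -> `|z5 - z6| <= d / 4 ->
  `|z1 - z3| <= d / 4 -> `|z2 - z4| <= d / 4 -> `|z7 + z5 + (z1 + z2) - (z3 + z4 - - (z8 + z6))| <= d.
Proof.
rewrite !ler_norml => /andP[? ?] /andP[? ?] /andP[? ?] /andP[? ?].
by apply/andP; split; lra.
Qed.

Section FPResidual.
Context {R : realType} (T nu beta : R) (hb : 1 < beta < 2) (Hc u0 mT : R * R -> R)
  (Phi : probability (mplane R) R -> R * R -> R) (u m : R -> R * R -> R).
Hypotheses (hsol : classical_solution T nu beta Hc u0 mT Phi u m)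
  (hm_pos : forall t x, 0 <= t <= T -> 0 < m t x) (hnu : 0 < nu).
Variables (a b : R).
Hypotheses (ha : 0 < a) (hbT : b < T) (hab : a <= b).

Let Cu := sol_C12_u hsol.
Let Cm := sol_C12_m hsol.
Let tu t (ht : 0 <= t <= T) := (sol_periodic hsol ht).1.
Let tm t (ht : 0 <= t <= T) := (sol_periodic hsol ht).2.
Let beta0 : 0 < beta. Proof. by case/andP: hb => h _; apply: lt_trans h. Qed.
Let dfct ep t : R := defect beta (u t) (m t) (divF nu m t) ep.
Local Notation gr N f t := (fun q : int * int => f t (nd N q)).

Lemma Fe_ep_Dm ep (e : R) : 0 < ep -> 0 < e -> exists2 r : R, 0 < r & forall N t p i, (0 < N)%N -> step R N < r ->
  a <= t <= b -> `|Dm N i (fun q => Fe beta (u t) (m t) ep i (nd N q)) p - DFi beta (u t) (m t) ep i (nd N p)| <= e.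
Proof.
move=> ep0 e0.
have [d0 d00 H0] := uc_DFi hsol ha hbT 0 ep0 e0.
have [d1 d10 H1] := uc_DFi hsol ha hbT 1 ep0 e0.
exists (Num.min d0 d1); first by rewrite lt_min d00.
move=> N t p i N0; rewrite lt_min => /andP[s0 s1] tab.
have h0 : 0 < step R N by exact: step_gt0.
have H y : `|y - nd N p| <= step R N -> `|DFi beta (u t) (m t) ep i y - DFi beta (u t) (m t) ep i (nd N p)| <= e.
  move=> yp; apply: ltW.
  by elim/ord2P: i; [apply: H0|apply: H1] => //; rewrite ?subrr ?normr0//; exact: le_lt_trans yp _.
have ddv x j l : derivable (pd j (u t)) x (evec R l) by have [_ _] := Cu.1 t x (inside ha hbT tab); apply.
have dmu x j : derivable (m t) x (evec R j) by have [_ + _] := Cm.1 t x (inside ha hbT tab); apply.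
have D y : is_derive y (evec R i) (Fe beta (u t) (m t) ep i) (DFi beta (u t) (m t) ep i y).
  by apply: Fe_is_derive => //; rewrite ltr_wpDl ?gsq_ge0.
have D1 y : derivable (Fe beta (u t) (m t) ep i) y (evec R i) by have [] := D y.
have [c c0s E] := line_MVT h0 (fun c _ => D1 (nd N p - step R N *: evec R i + c *: evec R i)).
rewrite subrK in E; rewrite /Dm nd_edN E mulfK ?gt_eqF//.
have [_ ->] := D (nd N p - step R N *: evec R i + c *: evec R i).
apply: H; case/andP: c0s => c0 cs.
have -> : nd N p - step R N *: evec R i + c *: evec R i - nd N p = (c - step R N) *: evec R i.
  by rewrite scalerBl addrAC [_ - nd N p]addrAC subrr add0r addrC.
rewrite normZ_evec ler_norml; apply/andP; split; lra.
Qed.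

Lemma steps_in_interval (dt : R) (n0 n1 n : nat) : 0 < dt -> a <= n0%:R * dt -> n1%:R * dt <= b -> (n0 <= n < n1)%N ->
  [/\ a <= n%:R * dt <= b, a <= n.+1%:R * dt <= b & n.+1%:R * dt = n%:R * dt + dt].
Proof.
move=> dt0 an nb /andP[h1 h2].
have e1 : n0%:R * dt <= n%:R * dt by rewrite ler_pM2r// ler_nat.
have e2 : n.+1%:R * dt <= n1%:R * dt by rewrite ler_pM2r// ler_nat.
have e3 : n.+1%:R * dt = n%:R * dt + dt by rewrite -natr1 mulrDl mul1r.
split=> //; apply/andP; split; lra.
Qed.

(** At fixed [ep] the integrand is uniformly continuous, so its space-time Riemann sums converge
as the steps tend to zero. *)
Lemma dfct_sum_small (eta : R) ep (I : \bar R) : 0 < ep -> 0 < eta ->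
  (\int[@lebesgue_measure R]_(t in `[a, b]) (dfct ep t)%:E <= eta%:E)%E ->
  exists2 r : R, 0 < r & forall N (dt : R) (n0 n1 : nat), (0 < N)%N -> step R N < r -> 0 < dt < r ->
    (n0 <= n1)%N -> a <= n0%:R * dt -> n1%:R * dt <= b ->
    dt * \sum_(n0 <= n < n1) avg N (fun p => (dvF beta (u (n%:R * dt)) (m (n%:R * dt)) ep (nd N p)
        - divF nu m (n%:R * dt) (nd N p)) ^+ 2) <= 2 * eta.
Proof.
move=> ep0 eta0 HI.
pose K := 2 * (b - a + 1); have K0 : 0 < K by rewrite mulr_gt0// ltr_wpDl ?subr_ge0.
pose kk := eta / K; have kk0 : 0 < kk by rewrite divr_gt0.
have tQ t : a <= t <= b -> torus_fun (fun x => (dvF beta (u t) (m t) ep x - divF nu m t x) ^+ 2).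
  move=> tab; apply: (@torus_comp _ (fun y => y ^+ 2)); apply: torusB; last exact: (torus_divF hsol ha hbT tab).
  by apply: torus_dvF; [apply: tu|apply: tm]; exact: (inside_le ha hbT tab).
have [r1 r10 H1] := riemann_ucp (uc_resid hsol ha hbT ep0) tQ kk0.
have [r2 r20 H2] := uc_dfct hsol ha hbT ep0 kk0.
exists (Num.min r1 r2); first by rewrite lt_min r10.
move=> N dt n0 n1 N0; rewrite !lt_min => /andP[s1 s2] /and3P[dt0 d1 d2] n01 an nb.
have dfct0 t : 0 <= dfct ep t by apply: Rintegral_ge0 => x _; exact: sqr_ge0.
have ab_le : (n1 - n0)%:R * dt <= b - a by rewrite natrB// mulrBl; lra.
have S1 : dt * \sum_(n0 <= n < n1) avg N (fun p => (dvF beta (u (n%:R * dt)) (m (n%:R * dt)) ep (nd N p)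
        - divF nu m (n%:R * dt) (nd N p)) ^+ 2) <= dt * \sum_(n0 <= n < n1) dfct ep (n%:R * dt) + kk * (b - a).
  apply: (@le_trans _ _ (dt * \sum_(n0 <= n < n1) (dfct ep (n%:R * dt) + kk))).
    rewrite ler_pM2l// !big_seq; apply: ler_sum => n; rewrite mem_index_iota => hn.
    have [tab _ _] := steps_in_interval dt0 an nb hn.
    by have := H1 N _ N0 s1 tab; rewrite ler_norml => /andP[_]; rewrite lerBlDl addrC.
  rewrite big_split /= mulrDr lerD2l sumr_const_nat -[kk *+ _]mulr_natl mulrA [leRHS]mulrC ler_pM2r//.
  by rewrite mulrC.
have mdf := measurable_dfct hsol ha hbT ep0.
have S2 : ((dt * \sum_(n0 <= n < n1) dfct ep (n%:R * dt))%:E <=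
    \int[@lebesgue_measure R]_(s in `[a, b]) (dfct ep s + kk)%:E)%E.
  apply: (time_sum_le_int (c := dfct ep)) => //.
  - by apply: measurable_funD => //; exact: measurable_cst.
  - by move=> t _; rewrite addr_ge0// ltW.
  move=> n hn; split=> // s /andP[s3 s4].
  have [tab tab' E] := steps_in_interval dt0 an nb hn.
  have sab : a <= s <= b.
    by case/andP: tab => q1 q2; case/andP: tab' => q3 q4; rewrite (le_trans q1 s3) (le_trans s4 q4).
  have ts : `|n%:R * dt - s| < r2.
    by apply: le_lt_trans d2; rewrite ler_norml; apply/andP; split; lra.
  have := H2 (n%:R * dt) s 0 0 tab sab ts; rewrite subrr normr0 => /(_ r20).
  by rewrite ltr_norml => /andP[_ /ltW]; rewrite lerBlDl addrC.
have S3 : (\int[@lebesgue_measure R]_(s in `[a, b]) (dfct ep s + kk)%:E <= (eta + kk * (b - a))%:E)%E.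
  under eq_integral do rewrite EFinD.
  rewrite ge0_integralD//=.
  - rewrite EFinD; apply: leeD => //; rewrite integral_cst//= lebesgue_measure_itv /=.
    case: ifP => _; first by rewrite -EFinB -EFinM.
    by rewrite mule0 lee_fin mulr_ge0 ?subr_ge0// ltW.
  - by move=> t _; rewrite lee_fin.
  - by apply/measurable_EFinP.
  - by move=> t _; rewrite lee_fin ltW.
have S4 : dt * \sum_(n0 <= n < n1) dfct ep (n%:R * dt) <= eta + kk * (b - a).
  by rewrite -lee_fin; exact: le_trans S2 S3.
have S5 : 2 * (kk * (b - a)) <= eta.
  apply: (@le_trans _ _ (kk * K)); last by rewrite /kk divfK// gt_eqF.
  by rewrite /K mulrCA ler_pM2l// ler_pM2l// lerDl.
lra.
Qed.

(** First [ep] is chosen so small that the regularized flux is uniformly close to the flux and the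
defect is small; for that [ep] all functions have uniformly continuous derivatives, so the
difference quotients converge as the steps tend to zero. The part of the error without a small
derivative stays in divergence form. *)
Lemma fp_consistency (eta : R) : 0 < eta -> exists2 r0 : R, 0 < r0 &
  forall N (dt : R) (n0 n1 : nat), (0 < N)%N -> step R N < r0 -> 0 < dt < r0 ->
    (n0 <= n1)%N -> a <= n0%:R * dt -> n1%:R * dt <= b ->
  exists (r : nat -> 'I_2 -> int * int -> R) (s : nat -> int * int -> R),
    [/\ forall n i, (n0 <= n < n1)%N -> gper N (r n i),
      forall n p, (n0 <= n < n1)%N ->
        (m (n.+1%:R * dt) (nd N p) - m (n%:R * dt) (nd N p)) / dt + nu * Lapg N (gr N m (n%:R * dt)) p
          + Tr N beta (gr N u (n.+1%:R * dt)) (gr N m (n%:R * dt)) p = \sum_i Dm N i (r n i) p + s n p &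
      dt * \sum_(n0 <= n < n1) (\sum_i avg N (fun p => r n i p ^+ 2) + avg N (fun p => s n p ^+ 2)) <= eta].
Proof.
move=> eta0.
pose K := b - a + 1; have K0 : 0 < K by rewrite ltr_wpDl ?subr_ge0.
pose d1 := Num.min 1 (eta / (8 * K)).
have d10 : 0 < d1 by rewrite lt_min ltr01 divr_gt0// mulr_gt0.
have d1K : d1 * (8 * K) <= eta by rewrite -ler_pdivlMr ?mulr_gt0// ge_min lexx orbT.
have d1s : d1 ^+ 2 <= d1 by rewrite expr2 ler_piMl ?(ltW d10)// ge_min lexx.
have dd0 : 0 < d1 / 2 by rewrite divr_gt0.
have [q q0 HF] := Fe_regularized hb hsol hm_pos ha hbT dd0.
have e8 : 0 < eta / 8 by rewrite divr_gt0.
have [ep /andP[ep0 epq] HI] := dfct_int_small hb hsol hm_pos ha hbT e8 q0.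
have [r1 r10 H1] := dfct_sum_small 0%E ep0 e8 HI.
have [r2 r20 H2] := Rf_consistent hb hsol hm_pos ha hbT dd0.
have dn0 : 0 < d1 / (4 * nu) by rewrite divr_gt0// mulr_gt0.
have d40 : 0 < d1 / 4 by rewrite divr_gt0.
have [r3 r30 H3] := time_consistent Cm tm ha hbT d40.
have [r4 r40 H4] := Lapg_consistent Cm tm ha hbT dn0.
have [r5 r50 H5] := Fe_ep_Dm ep0 d40.
exists (Num.min r1 (Num.min r2 (Num.min r3 (Num.min r4 r5)))); first by rewrite !lt_min r10 r20 r30 r40.
move=> N dt n0 n1 N0; rewrite !lt_min => /and5P[s1 s2 s3 s4 s5] /andP[dt0 /and5P[t1 t2 t3 t4 t5]] n01 an nb.
pose F n i : int * int -> R := fun p => Fe beta (u (n%:R * dt)) (m (n%:R * dt)) ep i (nd N p).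
pose r n i : int * int -> R := fun p =>
  Rf N beta (gr N u (n.+1%:R * dt)) (gr N m (n%:R * dt)) i p - F n i p.
pose s n : int * int -> R := fun p =>
  (m (n.+1%:R * dt) (nd N p) - m (n%:R * dt) (nd N p)) / dt + nu * Lapg N (gr N m (n%:R * dt)) p
  + \sum_i Dm N i (F n i) p.
(* the divergence of the regularized flux is added to [s] and subtracted in [Div r] *)
exists r, s; split.
- move=> n i hn; have [tab tab' E] := steps_in_interval dt0 an nb hn.
  have TT := inside_le ha hbT tab; have TT' := inside_le ha hbT tab'.
  apply: gperB.
    by apply: gper_Rf; apply: gper_nd => //; [exact: tu|exact: tm].
  apply: gper_nd => //.
  have tp j : torus_fun (pd j (u (n%:R * dt))) by apply: torus_pd; exact: tu.
  apply: torusM; first exact: tm.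
  apply: torusM; first exact: torusC.
  apply: torusM; last exact: tp.
  apply: (@torus_comp _ (fun y => (y + ep) `^ (- (1 - beta / 2)))).
  by apply: torus_gsq; exact: tu.
- move=> n p hn.
  have E : Tr N beta (gr N u (n.+1%:R * dt)) (gr N m (n%:R * dt)) p =
      \sum_i Dm N i (r n i) p + \sum_i Dm N i (F n i) p.
    rewrite -big_split /=; apply: eq_bigr => i _.
    by rewrite /r /Dm; move: (F n i p) (F n i (p - ed i)) (Rf _ _ _ _ i p) (Rf _ _ _ _ i (p - ed i)) => *; ring.
  by rewrite E addrCA.
have R1 n i p : (n0 <= n < n1)%N -> `|r n i p| <= d1.
  move=> hn; have [tab tab' E] := steps_in_interval dt0 an nb hn.
  have tt : `|n%:R * dt - n.+1%:R * dt| < r2 by rewrite E opprD addrA subrr sub0r normrN gtr0_norm.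
  have h1 := H2 N _ _ p i N0 s2 tab tab' tt.
  have ep_q : 0 <= ep <= q by rewrite (ltW ep0).
  have h2 := HF _ _ (nd N p) i tab ep_q.
  rewrite /r /F -[_ - _](subrKA (Fe beta (u (n%:R * dt)) (m (n%:R * dt)) 0 i (nd N p))) [leRHS](splitr d1).
  by apply: le_trans (ler_normD _ _) _; exact: lerD.
pose w n p := dvF beta (u (n%:R * dt)) (m (n%:R * dt)) ep (nd N p) - divF nu m (n%:R * dt) (nd N p).
have S1 n p : (n0 <= n < n1)%N -> `|s n p - w n p| <= d1.
  move=> hn; have [tab tab' E] := steps_in_interval dt0 an nb hn.
  have /andP[tab1 tab2] := tab; have /andP[tab3 tab4] := tab'.
  have A1 : `|(m (n.+1%:R * dt) (nd N p) - m (n%:R * dt) (nd N p)) / dt - timeD m (n%:R * dt) (nd N p)| <= d1 / 4.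
    rewrite E; apply: H3; [by rewrite dt0|exact: tab1|by rewrite -E|by rewrite lexx lerDl ltW].
  have A2 : `|nu * Lapg N (gr N m (n%:R * dt)) p - nu * laplacian (m (n%:R * dt)) (nd N p)| <= d1 / 4.
    rewrite -mulrBr normrM (gtr0_norm hnu); have := H4 N _ p N0 s4 tab.
    by rewrite ler_pdivlMr ?mulr_gt0// ler_pdivlMr// => h; apply: le_trans h; rewrite le_eqVlt; apply/orP; left; apply/eqP; ring.
  have A3 i : `|Dm N i (F n i) p - DFi beta (u (n%:R * dt)) (m (n%:R * dt)) ep i (nd N p)| <= d1 / 4.
    exact: H5.
  have A30 := A3 0; have A31 := A3 1.
  move: A1 A2 A30 A31; rewrite /s /w /dvF /divF sum2E.
  move: (Dm N 0 _ p) (Dm N 1 _ p) (DFi _ _ _ _ 0 _) (DFi _ _ _ _ 1 _) (nu * Lapg N _ p) (nu * laplacian _ _) (_ / dt) (timeD _ _ _).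
  by move=> *; exact: residual_split.
have sq2 (x y e : R) : `|x - y| <= e -> x ^+ 2 <= 2 * e ^+ 2 + 2 * y ^+ 2.
  move=> xy; have e0 := le_trans (normr_ge0 _) xy.
  have h : (x - y) ^+ 2 <= e ^+ 2 by rewrite -real_normK ?num_real// ler_sqr ?nnegrE.
  have -> : 2 * e ^+ 2 + 2 * y ^+ 2 = x ^+ 2 + (x - 2 * y) ^+ 2 + 2 * (e ^+ 2 - (x - y) ^+ 2) by ring.
  by rewrite -[X in X <= _]addr0 -[X in _ <= X]addrA lerD2l addr_ge0 ?sqr_ge0// mulr_ge0// subr_ge0.
have B1 : dt * \sum_(n0 <= n < n1) avg N (fun p => w n p ^+ 2) <= 2 * (eta / 8).
  by apply: H1 => //; rewrite dt0.
have B2 : dt * \sum_(n0 <= n < n1) (\sum_i avg N (fun p => r n i p ^+ 2) + avg N (fun p => s n p ^+ 2)) <=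
  dt * \sum_(n0 <= n < n1) (4 * d1 ^+ 2 + 2 * avg N (fun p => w n p ^+ 2)).
  rewrite ler_pM2l// !big_seq; apply: ler_sum => n; rewrite mem_index_iota => hn.
  have C1 i : avg N (fun p => r n i p ^+ 2) <= d1 ^+ 2.
    rewrite -[leRHS](avg_cst N0); apply: avg_le => p.
    by rewrite -real_normK ?num_real// ler_sqr ?nnegrE ?(ltW d10)//; exact: R1.
  have C2 : avg N (fun p => s n p ^+ 2) <= 2 * d1 ^+ 2 + 2 * avg N (fun p => w n p ^+ 2).
    rewrite -[X in X + _](avg_cst N0) -avgZ -avgD; apply: avg_le => p.
    by apply: sq2; exact: S1.
  rewrite sum2E; apply: le_trans (lerD (lerD (C1 0) (C1 1)) C2) _.
  by rewrite le_eqVlt; apply/orP; left; apply/eqP; ring.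
apply: le_trans B2 _; rewrite big_split /= sumr_const_nat -mulr_sumr mulrDr [dt * (2 * _)]mulrCA.
have B3 : dt * ((4 * d1 ^+ 2) *+ (n1 - n0)) <= eta / 2.
  rewrite -[_ *+ (n1 - n0)]mulr_natl mulrA [dt * _]mulrC.
  have h1 : (n1 - n0)%:R * dt <= K by rewrite natrB// mulrBl /K; lra.
  apply: (@le_trans _ _ (K * (4 * d1))); last by lra.
  have -> : (n1 - n0)%:R * 4 * d1 ^+ 2 * dt = ((n1 - n0)%:R * dt) * (4 * d1 ^+ 2) by ring.
  apply: ler_pM => //; last by rewrite ler_pM2l.
    by rewrite mulr_ge0 ?(ltW dt0).
  by rewrite mulr_ge0 ?sqr_ge0.
by apply: le_trans (lerD B3 (_ : _ <= 2 * (2 * (eta / 8)))) _; [rewrite ler_pM2l|lra].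
Qed.

End FPResidual.

(** * Matrices as periodic grid functions *)

Lemma sqr_max0_is_derive (R : realType) (x : R) :
  is_derive x (1:R) (fun y => Num.max y 0 ^+ 2) (2 * Num.max x 0).
Proof.
have B (h : R) : `|Num.max (x + h) 0 ^+ 2 - Num.max x 0 ^+ 2 - h * (2 * Num.max x 0)| <= h ^+ 2.
  rewrite ler_norml !maxEle; case: (leP x 0) => x0; case: (leP (x + h) 0) => xh.
  - by rewrite expr0n /= !mulr0 !subr0 sqr_ge0 andbT oppr_le0 sqr_ge0.
  - rewrite expr0n /= !mulr0 !subr0; have := sqr_ge0 (x + h); have := sqr_ge0 h => h1 h2.
    apply/andP; split; first by lra.
    by rewrite ler_sqr ?nnegrE; lra.
  - have := sqr_ge0 h; have := sqr_ge0 (x + h) => h1 h2; apply/andP; split; nra.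
  - have := sqr_ge0 h => h1; apply/andP; split; nra.
have L : (fun h : R => h^-1 *: (((fun y => Num.max y 0 ^+ 2) \o shift x) (h *: (1 : R)) - Num.max x 0 ^+ 2)) @ 0^' --> 2 * Num.max x 0.
  apply/cvgrPdist_le => e e0; near=> h.
  have h0 : h != 0 by near: h; exact: nbhs_dnbhs_neq.
  have he : `|h| <= e by near: h; apply: dnbhs0_le.
  rewrite /= [h *: 1]mulr1 [h + x]addrC [_ *: _]mulrC distrC.
  have E : (Num.max (x + h) 0 ^+ 2 - Num.max x 0 ^+ 2) / h - 2 * Num.max x 0 =
    (Num.max (x + h) 0 ^+ 2 - Num.max x 0 ^+ 2 - h * (2 * Num.max x 0)) / h by field.
  rewrite E normrM normfV ler_pdivrMr ?normr_gt0//; apply: le_trans (B h) _.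
  by rewrite -real_normK ?num_real// expr2 ler_wpM2r.
by apply: DeriveDef; [apply/cvg_ex; eexists; exact: L|exact: cvg_lim L].
Unshelve. all: by end_near. Qed.

Section MatrixGrids.
Context {R : realType} (N : nat) (N0 : (0 < N)%N).
Local Notation h := (step R N).
Implicit Types (z : 'M[R]_N) (p q : int * int).

(** Indices in the integer lattice, so that shifts need no modular arithmetic. *)
Definition mxg z p : R := gext z p.1 p.2.

Lemma gextE z (k l : 'I_N) (i j : int) : (k%:Z = i %[mod N%:Z])%Z -> (l%:Z = j %[mod N%:Z])%Z ->
  gext z i j = z k l.
Proof.
move=> ki lj; rewrite /gext (big_pred1 k) => [|k'].
  rewrite (big_pred1 l) // => l' /=; rewrite -lj; apply/eqP/eqP => [|->//].
  exact: eqmodz_ordP.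
rewrite /= -ki; apply/eqP/eqP => [|->//]; exact: eqmodz_ordP.
Qed.

Lemma gper_mxg z : gper N (mxg z).
Proof.
move=> p i; rewrite /mxg.
have E (a c : int) : (a = c %[mod N%:Z])%Z -> forall b, gext z a b = gext z c b.
  by move=> ac b; apply: eq_bigl => k; rewrite ac.
have E' (a c : int) : (a = c %[mod N%:Z])%Z -> forall b, gext z b a = gext z b c.
  by move=> ac b; apply: eq_bigr => k _; apply: eq_bigl => l; rewrite ac.
have F (c : int) (k : nat) : (p + ed i *+ k).1 = p.1 + (ed i).1 *+ k /\ (p + ed i *+ k).2 = p.2 + (ed i).2 *+ k.
  by split; rewrite /=; [congr (_ + _)|congr (_ + _)]; elim: k => // k IH; rewrite !mulrS /= IH.
have [-> ->] := F 0 N.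
clear F; elim/ord2P: i => /=; rewrite ?mul0rn ?addr0.
  by apply: E; rewrite -[(1 *+ N)%R]/(1%:R *+ N) -mulr_natr mul1r natz modzDr.
by apply: E'; rewrite -[(1 *+ N)%R]/(1%:R *+ N) -mulr_natr mul1r natz modzDr.
Qed.

Lemma mxg_ord z (k l : 'I_N) : mxg z (k%:Z, l%:Z) = z k l.
Proof. exact: gextE. Qed.

Lemma gper_ext (F G : int * int -> R) : gper N F -> gper N G ->
  (forall k l : 'I_N, F (k%:Z, l%:Z) = G (k%:Z, l%:Z)) -> F =1 G.
Proof. by move=> pF pG FG p; have [k [l [_ _ E]]] := grid_rep (R := R) N0 p; rewrite (E F pF) (E G pG). Qed.

Definition gmx (F : int * int -> R) : 'M[R]_N := \matrix_(k, l) F (k%:Z, l%:Z).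

Lemma mxg_gmx F : gper N F -> mxg (gmx F) =1 F.
Proof. by move=> pF; apply: gper_ext => // [|k l]; [exact: gper_mxg|rewrite mxg_ord mxE]. Qed.

Lemma avg_mxg z : avg N (mxg z) = h ^+ 2 * \sum_(k < N) \sum_(l < N) z k l.
Proof. by congr (_ * _); apply: eq_bigr => k _; apply: eq_bigr => l _; rewrite mxg_ord. Qed.

Lemma Kh_avg z : Kh z <-> avg N (mxg z) = 1 /\ forall p, 0 <= mxg z p.
Proof.
rewrite avg_mxg; split=> [[z1 z0]|[z1 z0]]; split=> //.
  by move=> p; have [k [l [h1 h2 _]]] := grid_rep (R := R) N0 p; rewrite /mxg (gextE _ h1 h2).
by move=> k l; have := z0 (k%:Z, l%:Z); rewrite mxg_ord.
Qed.

Lemma gdot_avg y z : h ^+ 2 * gdot y z = avg N (fun p => mxg y p * mxg z p).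
Proof. by congr (_ * _); apply: eq_bigr => k _; apply: eq_bigr => l _; rewrite !mxg_ord. Qed.

Lemma mxgB y z p : mxg (y - z) p = mxg y p - mxg z p.
Proof.
have [k [l [h1 h2 _]]] := grid_rep (R := R) N0 p.
by rewrite /mxg !(gextE _ h1 h2) !mxE.
Qed.

Lemma D1E z i j : D1 z i j = Dp N 0 (mxg z) (i, j).
Proof. by rewrite /D1 /Dp /mxg /= addr0. Qed.
Lemma D1E' z i j : D1 z (i - 1) j = Dm N 0 (mxg z) (i, j).
Proof. by rewrite /D1 /Dm /mxg /= subr0 subrK. Qed.
Lemma D2E z i j : D2 z i j = Dp N 1 (mxg z) (i, j).
Proof. by rewrite /D2 /Dp /mxg /= addr0. Qed.
Lemma D2E' z i j : D2 z i (j - 1) = Dm N 1 (mxg z) (i, j).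
Proof. by rewrite /D2 /Dm /mxg /= subr0 subrK. Qed.

Lemma LhE z i j : Lh z i j = Lapg N (mxg z) (i, j).
Proof.
rewrite /Lapg sum2E /Lh /mxg /= !addr0 ?subr0.
have h0 := @step_gt0 R N N0; field; rewrite gt_eqF//.
Qed.

Variables (beta : R) (Hc : R * R -> R).
Hypothesis hb : 1 < beta < 2.

Let qsum (q : 'rV[R]_4) := neg_part (q 0 0) ^+ 2 + pos_part (q 0 1) ^+ 2
          + neg_part (q 0 2) ^+ 2 + pos_part (q 0 3) ^+ 2.

Lemma DhE z i j : [/\ Dh z i j 0 0 = Dp N 0 (mxg z) (i, j), Dh z i j 0 1 = Dm N 0 (mxg z) (i, j),
  Dh z i j 0 2 = Dp N 1 (mxg z) (i, j) & Dh z i j 0 3 = Dm N 1 (mxg z) (i, j)].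
Proof. by split; rewrite mxE /=; [exact: D1E|exact: D1E'|exact: D2E|exact: D2E']. Qed.

Lemma qsum_Pv z i j : qsum (Dh z i j) = nsq (Pv N (mxg z) (i, j)).
Proof.
have [e0 e1 e2 e3] := DhE z i j.
rewrite /qsum e0 e1 e2 e3 /nsq sum_pairE sum2E /Pv /= /neg_part /pos_part.
by move: (Num.max _ _) (Num.max _ _) (Num.max _ _) (Num.max _ _) => *; ring.
Qed.

Lemma gnum_Gg z i j : gnum Hc beta (node R N i j) (Dh z i j) = Hc (nd N (i, j)) + Gg N beta (mxg z) (i, j).
Proof. by rewrite /gnum /Gg -qsum_Pv. Qed.

Lemma gnum_derive (x : R * R) (q : 'rV[R]_4) (k : 'I_4) (d : R) :
  is_derive (0:R) (1:R) (fun r : R => qsum (q + r *: delta_mx 0 k)) d ->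
  (qsum q = 0 -> forall r, qsum (q + r *: delta_mx 0 k) <= r ^+ 2) ->
  'D_(delta_mx 0 k) (gnum Hc beta x) q = beta / 2 * qsum q `^ (beta / 2 - 1) * d.
Proof.
move=> dq hq; suff [] : is_derive q (delta_mx 0 k : 'rV[R]_4) (gnum Hc beta x) (beta / 2 * qsum q `^ (beta / 2 - 1) * d) by [].
apply: derive_line.
have E : qsum (q + 0 *: delta_mx 0 k) = qsum q by rewrite scale0r addr0.
have := pow_deriv hb dq _ _; rewrite E => /(_ _ _)/wrap[].
- by move=> r; rewrite /qsum !addr_ge0 ?sqr_ge0.
- by [].
move=> D; rewrite -[X in is_derive _ _ _ X]add0r.
exact: is_deriveD.
Qed.

Let sg (k : 'I_4) : R := if odd k then 1 else -1.

Let qsumE (q : 'rV[R]_4) : qsum q = \sum_(k < 4) Num.max (sg k * q 0 k) 0 ^+ 2.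
Proof.
have sum4 (F : 'I_4 -> R) : \sum_k F k = F 0 + F 1 + F 2 + F 3.
  rewrite !big_ord_recr big_ord0 /= add0r.
  by congr (F _ + F _ + F _ + F _); exact/val_inj.
by rewrite sum4 /qsum /sg /= !mulN1r !mul1r.
Qed.

Let qsum_line (q : 'rV[R]_4) (k : 'I_4) (r : R) : qsum (q + r *: delta_mx 0 k) =
  Num.max (sg k * q 0 k + sg k * r) 0 ^+ 2 + \sum_(l < 4 | l != k) Num.max (sg l * q 0 l) 0 ^+ 2.
Proof.
rewrite qsumE (bigD1 k)//= !mxE !eqxx mulr1 mulrDr; congr (_ + _).
by apply: eq_bigr => l lk; rewrite !mxE (negbTE lk) andbF mulr0 addr0.
Qed.

Let sg2 k : sg k ^+ 2 = 1.
Proof. by rewrite /sg; case: ifP; rewrite ?sqrrN expr1n. Qed.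

(** [sg] encodes which of the four arguments enter through their negative part. *)
Lemma gnum_derivative (x : R * R) (q : 'rV[R]_4) (k : 'I_4) :
  'D_(delta_mx 0 k) (gnum Hc beta x) q = sg k * (beta * (qsum q `^ (beta / 2 - 1) * Num.max (sg k * q 0 k) 0)).
Proof.
have L : is_derive (0:R) (1:R) (fun r => sg k * q 0 k + sg k * r) (sg k).
  apply: is_derive_eq; rewrite /GRing.scale /=; move: (sg k) => c; ring.
have D := @sqr_max0_is_derive R (sg k * q 0 k + sg k * 0).
have dq : is_derive (0:R) (1:R) (fun r : R => qsum (q + r *: delta_mx 0 k)) (sg k * (2 * Num.max (sg k * q 0 k) 0)).
  under eq_fun do rewrite qsum_line.
  have C : is_derive (0:R) (1:R) ((fun y => Num.max y 0 ^+ 2) \o (fun r => sg k * q 0 k + sg k * r))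
      (2 * Num.max (sg k * q 0 k + sg k * 0) 0 * sg k).
    exact: (@is_derive1_comp R (fun y => Num.max y 0 ^+ 2) (fun r => sg k * q 0 k + sg k * r) 0 _ _ D L).
  set S := \sum_(l < 4 | l != k) _.
  have C2 := @is_deriveD _ _ _ _ _ _ _ _ _ C (is_derive_cst S (0:R) (1:R)).
  have E : sg k * (2 * Num.max (sg k * q 0 k) 0) = 2 * Num.max (sg k * q 0 k + sg k * 0) 0 * sg k + 0.
    by rewrite mulr0 !addr0 mulrC.
  by rewrite E; exact: C2.
rewrite (gnum_derive x dq); first by field.
move=> q0 r; rewrite qsum_line; move: q0; rewrite qsumE (bigD1 k)//= => /eqP.
have S0 : 0 <= \sum_(l < 4 | l != k) Num.max (sg l * q 0 l) 0 ^+ 2 by apply: sumr_ge0 => l _; exact: sqr_ge0.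
rewrite paddr_eq0 ?sqr_ge0// => /andP[]; rewrite sqrf_eq0 => /eqP m0 /eqP ->.
have s0 : sg k * q 0 k <= 0 by rewrite -m0 le_max lexx.
rewrite addr0 -[leRHS]mul1r -(sg2 k) -exprMn.
have [_|p0] := leP (sg k * q 0 k + sg k * r) 0; first by rewrite expr0n sqr_ge0.
by rewrite ler_sqr ?nnegrE ?(ltW p0)//; lra.
Qed.

(** The four derivatives of the numerical Hamiltonian are, up to sign, the components of [bb]. *)
Lemma gderE z i j :
  [/\ gder Hc beta 0 z i j = - bb N beta (mxg z) (i, j) (0, false),
      gder Hc beta 1 z i j = bb N beta (mxg z) (i, j) (0, true),
      gder Hc beta 2 z i j = - bb N beta (mxg z) (i, j) (1, false) &
      gder Hc beta 3 z i j = bb N beta (mxg z) (i, j) (1, true)].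
Proof.
have [e0 e1 e2 e3] := DhE z i j.
by split; rewrite /gder gnum_derivative qsum_Pv ?e0 ?e1 ?e2 ?e3 /sg /= ?mulN1r ?mul1r.
Qed.

Lemma transportE z w i j : transport Hc beta z w i j = Tr N beta (mxg z) (mxg w) (i, j).
Proof.
rewrite /transport.
have [a0 a1 a2 a3] := gderE z i j.
have [b0 _ _ _] := gderE z (i - 1) j; have [_ b1 _ _] := gderE z (i + 1) j.
have [_ _ c2 _] := gderE z i (j - 1); have [_ _ _ c3] := gderE z i (j + 1).
rewrite a0 a1 a2 a3 b0 b1 c2 c3 /Tr sum2E /Dm /Rf !subrK.
have E0 : (i, j) + ed 0 = (i + 1, j) by congr pair; rewrite /= ?addr0.
have E0' : (i, j) - ed 0 = (i - 1, j) by congr pair; rewrite /= ?subr0.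
have E1 : (i, j) + ed 1 = (i, j + 1) by congr pair; rewrite /= ?addr0.
have E1' : (i, j) - ed 1 = (i, j - 1) by congr pair; rewrite /= ?subr0.
rewrite E0 E0' E1 E1' /mxg /=.
move: (bb _ _ _ (i, j) (0, false)) (bb _ _ _ (i, j) (0, true)) (bb _ _ _ (i, j) (1, false)) (bb _ _ _ (i, j) (1, true)).
move: (bb _ _ _ (i - 1, j) (0, false)) (bb _ _ _ (i + 1, j) (0, true)) (bb _ _ _ (i, j - 1) (1, false)) (bb _ _ _ (i, j + 1) (1, true)).
move: (gext w i j) (gext w (i - 1) j) (gext w (i + 1) j) (gext w i (j - 1)) (gext w i (j + 1)) h => *.
ring.
Qed.

End MatrixGrids.

(** * A priori estimates for the Hamilton-Jacobi scheme *)

Section SchemeEstimates.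
Context {R : realType} (N : nat) (N0 : (0 < N)%N) (beta nu : R) (hb : 1 < beta < 2) (hnu : 0 < nu).
Implicit Types (U W A B : nat -> int * int -> R) (w : int * int -> R).
Local Notation avg := (avg N).

Lemma scheme_compare U W A B (dt K c : R) (n0 n1 : nat) : 0 < dt ->
  (forall n, (n0 < n <= n1)%N -> gper N (U n) /\ gper N (W n)) ->
  (forall n p, (n0 <= n < n1)%N -> (U n.+1 p - U n p) / dt - nu * Lapg N (U n.+1) p + Gg N beta (U n.+1) p = A n p) ->
  (forall n p, (n0 <= n < n1)%N -> (W n.+1 p - W n p) / dt - nu * Lapg N (W n.+1) p + Gg N beta (W n.+1) p = B n p) ->
  (forall n p, (n0 <= n < n1)%N -> A n p - B n p <= K) ->
  (forall p, U n0 p - W n0 p <= c) ->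
  forall n p, (n0 <= n <= n1)%N -> U n p - W n p <= c + (n - n0)%:R * dt * K.
Proof.
move=> dt0 per HU HW AB H0 n; elim: n => [|n IH] p /andP[h1 h2].
  by move: h1; rewrite leqn0 => /eqP n00; rewrite n00 subnn !mul0r addr0 -n00.
move: h1; rewrite leq_eqVlt => /orP[/eqP <-|]; first by rewrite subnn !mul0r addr0.
rewrite ltnS => h1; have hn : (n0 <= n < n1)%N by rewrite h1.
have [pU pW] := per n.+1 (introT andP (conj h1 h2)).
have IH' q : U n q - W n q <= c + (n - n0)%:R * dt * K by apply: IH; rewrite h1 ltnW.
have := comparison N0 hb hnu pU pW dt0 (fun p => HU n p hn) (fun p => HW n p hn) (fun p => AB n p hn) IH' p.
move=> h; apply: le_trans h _; rewrite subSn// -natr1; lra.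
Qed.

Lemma Lapg_shift w e p : Lapg N (fun q => w (q + e)) p = Lapg N w (p + e).
Proof. by apply: eq_bigr => i _; rewrite (addrAC p (ed i) e) (addrAC p (- ed i) e). Qed.

Lemma Gg_shift w e p : Gg N beta (fun q => w (q + e)) p = Gg N beta w (p + e).
Proof.
rewrite /Gg (_ : Pv N (fun q => w (q + e)) p = Pv N w (p + e))//.
apply/funext => k; rewrite /Pv /Dm /Dp.
by rewrite (addrAC p (ed k.1) e) (addrAC p (- ed k.1) e).
Qed.

Lemma Gg0 p : Gg N beta (fun=> 0) p = 0.
Proof.
rewrite /Gg (_ : nsq _ = 0).
  by rewrite powR0//; case/andP: hb => b1 _; rewrite gt_eqF// divr_gt0//; exact: lt_trans b1.
rewrite /nsq big1// => k _; rewrite /Pv /Dm /Dp subrr mul0r oppr0 maxxx.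
by case: ifP; rewrite expr0n.
Qed.

Lemma Lapg0 p : Lapg N (fun=> 0 : R) p = 0.
Proof. by rewrite /Lapg big1// => i _; rewrite mulr0 subr0 addr0 mul0r. Qed.

Lemma Gg_ge0 w p : 0 <= Gg N beta w p. Proof. exact: powR_ge0. Qed.

Lemma Gg_bound w p L : 0 <= L -> (forall i p, `|Dp N i w p| <= L) -> Gg N beta w p <= ((2 * L) ^+ 2) `^ (beta / 2).
Proof.
move=> L0 HL; apply: le_powR_pos; [by case/andP: hb => b1 _; rewrite divr_ge0//; lra|exact: nsq_ge0|].
exact: nsq_Pv_bound.
Qed.

Section Solution.
Variables (U F : nat -> int * int -> R) (Hg u0g : int * int -> R) (dt C CH C0 : R) (NT : nat).
Hypotheses (dt0 : 0 < dt) (pU : forall n, gper N (U n))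
  (HU : forall n p, (n < NT)%N ->
     (U n.+1 p - U n p) / dt - nu * Lapg N (U n.+1) p + Gg N beta (U n.+1) p = F n p - Hg p)
  (U0 : forall p, U 0%N p = u0g p)
  (FC : forall n p, (n < NT)%N -> `|F n p| <= C)
  (HC : forall p, `|Hg p| <= CH) (uC : forall p, `|u0g p| <= C0).

Lemma solution_bound n p : (n <= NT)%N -> `|U n p| <= C0 + n%:R * dt * (C + CH).
Proof.
move=> nNT; have hn : (0 <= n <= NT)%N by [].
have Z (j : nat) q : (0 <= j < NT)%N -> ((fun=> 0) q - (fun=> 0) q : R) / dt - nu * Lapg N (fun=> 0) q + Gg N beta (fun=> 0) q = 0.
  by move=> _; rewrite subrr mul0r Lapg0 Gg0 mulr0 subrr addr0.
have pz j : (0 < j <= NT)%N -> gper N (U j) /\ gper N (fun=> 0 : R) by split.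
have pz' j : (0 < j <= NT)%N -> gper N (fun=> 0 : R) /\ gper N (U j) by split.
have FH j q : (j < NT)%N -> `|F j q - Hg q| <= C + CH.
  by move=> jN; apply: le_trans (ler_normB _ _) _; apply: lerD; [exact: FC|exact: HC].
have h1 := @scheme_compare U (fun _ _ => 0) _ (fun _ _ => 0) dt (C + CH) C0 0 NT dt0 pz (fun j q => @HU j q) Z _ _ n p hn.
have h2 := @scheme_compare (fun _ _ => 0) U (fun _ _ => 0) _ dt (C + CH) C0 0 NT dt0 pz' Z (fun j q => @HU j q) _ _ n p hn.
rewrite subn0 in h1 h2; rewrite ler_norml; apply/andP; split.
  rewrite lerNl -sub0r; apply: h2 => [j q jN|q].
    by rewrite sub0r; apply: le_trans (FH j q jN); rewrite -normrN ler_norm.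
  by rewrite sub0r U0; apply: le_trans (uC q); rewrite -normrN ler_norm.
rewrite -[U n p]subr0; apply: h1 => [j q jN|q].
  by rewrite subr0; apply: le_trans (FH j q jN); rewrite ler_norm.
by rewrite subr0 U0; apply: le_trans (uC q); rewrite ler_norm.
Qed.

(** A grid function with bounded differences, constant in time, solves the scheme up to a bounded
right-hand side, so the solution leaves it at most linearly in time. *)
Lemma solution_barrier w (K1 K2 c : R) n0 : gper N w -> 0 <= K2 -> (forall p, `|Lapg N w p| <= K1) ->
  (forall i p, `|Dp N i w p| <= K2) -> (forall p, `|U n0 p - w p| <= c) ->
  forall n p, (n0 <= n <= NT)%N ->
  `|U n p - w p| <= c + (n - n0)%:R * dt * (C + CH + nu * K1 + ((2 * K2) ^+ 2) `^ (beta / 2)).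
Proof.
move=> pw K20 HK1 HK2 Hc n p hn.
set K := C + CH + _ + _.
have FH j q : (j < NT)%N -> `|F j q - Hg q| <= C + CH.
  by move=> jN; apply: le_trans (ler_normB _ _) _; apply: lerD; [exact: FC|exact: HC].
have B q : `|- nu * Lapg N w q + Gg N beta w q| <= nu * K1 + ((2 * K2) ^+ 2) `^ (beta / 2).
  apply: le_trans (ler_normD _ _) _; apply: lerD.
    by rewrite normrM normrN (gtr0_norm hnu) ler_pM2l.
  by rewrite ger0_norm ?Gg_ge0//; exact: Gg_bound.
have Z (j : nat) q : (n0 <= j < NT)%N -> (w q - w q) / dt - nu * Lapg N w q + Gg N beta w q = - nu * Lapg N w q + Gg N beta w q.
  by move=> _; rewrite subrr mul0r sub0r mulNr.
have pz j : (n0 < j <= NT)%N -> gper N (U j) /\ gper N w by split.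
have pz' j : (n0 < j <= NT)%N -> gper N w /\ gper N (U j) by split.
have HU' j q : (n0 <= j < NT)%N -> (U j.+1 q - U j q) / dt - nu * Lapg N (U j.+1) q + Gg N beta (U j.+1) q = F j q - Hg q.
  by case/andP => _; exact: HU.
have AB j q : (n0 <= j < NT)%N -> `|F j q - Hg q - (- nu * Lapg N w q + Gg N beta w q)| <= K.
  case/andP => _ jN; apply: le_trans (ler_normB _ _) _; rewrite /K -addrA; apply: lerD; [exact: FH|exact: B].
have h1 := @scheme_compare U (fun _ => w) _ (fun _ q => - nu * Lapg N w q + Gg N beta w q) dt K c n0 NT dt0 pz HU' Z.
have h2 := @scheme_compare (fun _ => w) U (fun _ q => - nu * Lapg N w q + Gg N beta w q) _ dt K c n0 NT dt0 pz' Z HU'.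
rewrite ler_norml; apply/andP; split.
  rewrite lerNl opprB; apply: h2 => // [j q jN|q].
    by apply: le_trans (AB j q jN); rewrite distrC ler_norm.
  by apply: le_trans (Hc q); rewrite distrC ler_norm.
apply: h1 => // [j q jN|q].
  by apply: le_trans (AB j q jN); rewrite ler_norm.
by apply: le_trans (Hc q); rewrite ler_norm.
Qed.

Variables (LF LH L0 : R).
Hypotheses (FL : forall n i p, (n < NT)%N -> `|F n (p + ed i) - F n p| <= LF * step R N)
  (HL : forall i p, `|Hg (p + ed i) - Hg p| <= LH * step R N)
  (uL : forall i p, `|u0g (p + ed i) - u0g p| <= L0 * step R N).

(** The scheme is invariant under translations of the grid, so the solution can be compared with
its own shift. *)
Lemma solution_lipschitz n i p : (n <= NT)%N -> `|Dp N i (U n) p| <= L0 + n%:R * dt * (LF + LH).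
Proof.
move=> nNT; have hn : (0 <= n <= NT)%N by [].
have h0 := @step_gt0 R N N0.
pose S j q := U j (q + ed i).
have pS j : (0 < j <= NT)%N -> gper N (S j) /\ gper N (U j) by split => //; exact: gper_shift.
have pS' j : (0 < j <= NT)%N -> gper N (U j) /\ gper N (S j) by move=> /pS [].
have HS j q : (0 <= j < NT)%N -> (S j.+1 q - S j q) / dt - nu * Lapg N (S j.+1) q + Gg N beta (S j.+1) q = F j (q + ed i) - Hg (q + ed i).
  by move=> jN; rewrite Lapg_shift Gg_shift; exact: HU.
have AB j q : (0 <= j < NT)%N -> `|F j (q + ed i) - Hg (q + ed i) - (F j q - Hg q)| <= (LF + LH) * step R N.
  move=> jN; have -> : F j (q + ed i) - Hg (q + ed i) - (F j q - Hg q) = (F j (q + ed i) - F j q) - (Hg (q + ed i) - Hg q) by ring.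
  apply: le_trans (ler_normB _ _) _; rewrite mulrDl; apply: lerD; [exact: FL|exact: HL].
have h1 := @scheme_compare S U _ _ dt ((LF + LH) * step R N) (L0 * step R N) 0 NT dt0 pS HS (fun j q => @HU j q).
have h2 := @scheme_compare U S _ _ dt ((LF + LH) * step R N) (L0 * step R N) 0 NT dt0 pS' (fun j q => @HU j q) HS.
rewrite /Dp normrM normfV (gtr0_norm h0) ler_pdivrMr// mulrDl -mulrA.
have {}h1 : S n p - U n p <= L0 * step R N + (n - 0)%:R * dt * ((LF + LH) * step R N).
  apply: h1 => // [j q jN|q]; first by apply: le_trans (AB j q jN); rewrite ler_norm.
  by rewrite /S !U0; apply: le_trans (uL i q); rewrite ler_norm.
have {}h2 : U n p - S n p <= L0 * step R N + (n - 0)%:R * dt * ((LF + LH) * step R N).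
  apply: h2 => // [j q jN|q]; first by apply: le_trans (AB j q jN); rewrite distrC ler_norm.
  by rewrite /S !U0; apply: le_trans (uL i q); rewrite distrC ler_norm.
rewrite subn0 in h1 h2; rewrite -!mulrA; rewrite -!mulrA in h1 h2.
by rewrite ler_norml lerNl opprB; apply/andP; split.
Qed.

End Solution.
End SchemeEstimates.

(** * The discrete solution *)

(** The data bundled with their hypotheses, so that each estimate can be stated for one variable.
*)
Record mfg_data (R : realType) : Type := MfgData {
  beta_ : R; nu_ : R; T_ : R; Hc_ : R * R -> R; u0_ : R * R -> R; mT_ : R * R -> R;
  Phi_ : probability (mplane R) R -> R * R -> R;
  u_ : R -> R * R -> R; m_ : R -> R * R -> R;
  Phih_ : forall N : nat, 'M[R]_N -> 'M[R]_N;
  ud_ : forall NT N : nat, nat -> 'M[R]_N; md_ : forall NT N : nat, nat -> 'M[R]_N;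
  hbeta_ : 1 < beta_ < 2; hnu_ : 0 < nu_; hT_ : 0 < T_;
  hHc_ : torus_fun Hc_ /\ is_Ck 1 Hc_;
  hu0_ : torus_fun u0_ /\ smooth u0_; hmT_ : torus_fun mT_ /\ smooth mT_;
  hsol_ : classical_solution T_ nu_ beta_ Hc_ u0_ mT_ Phi_ u_ m_;
  hm_pos_ : forall t x, 0 <= t <= T_ -> 0 < m_ t x;
  htPhi_ : forall mu, on_torus mu -> torus_fun (Phi_ mu);
  hPhih2_ : Phih2 Phih_; hPhih3_ : Phih3 Phih_; hPhih4_ : Phih4 Phih_ Phi_;
  hdsol_ : forall NT N : nat, (0 < NT)%N -> (0 < N)%N ->
    discrete_solution Hc_ beta_ nu_ T_ u0_ mT_ (@Phih_ N) NT (ud_ NT N) (md_ NT N) }.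

Section NodeFunctions.
Context {R : realType}.
Implicit Types f : R * R -> R.

Lemma Lapg_bound f (K : R) N p : (0 < N)%N -> (forall x i, derivable f x (evec R i)) ->
  (forall x i j, derivable (pd i f) x (evec R j)) -> (forall x i, `|pd i (pd i f) x| <= K) ->
  `|Lapg N (fun q => f (nd N q)) p| <= K + K.
Proof.
move=> N0 df ddf HK; have h0 := @step_gt0 R N N0.
have S i : `|(f (nd N (p + ed i)) - 2 * f (nd N p) + f (nd N (p - ed i))) / step R N ^+ 2| <= K.
  have [y _ E] := second_diff (i := i) (nd N p) h0 (fun y => df y i) (fun y => ddf y i i).
  by rewrite nd_ed nd_edN E mulfK ?HK// gt_eqF// exprn_gt0.
rewrite /Lapg sum2E; apply: le_trans (ler_normD _ _) _; apply: lerD; exact: S.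
Qed.

Lemma Dp_bound f (K : R) N i p : (0 < N)%N -> (forall x i, derivable f x (evec R i)) ->
  (forall x i, `|pd i f x| <= K) -> `|Dp N i (fun q => f (nd N q)) p| <= K.
Proof.
move=> N0 df HK; have h0 := @step_gt0 R N N0.
have [c _ E] := line_MVT (f := f) (v := evec R i) (x := nd N p) h0 (fun c _ => df _ i).
by rewrite /Dp nd_ed E mulfK ?HK// gt_eqF.
Qed.

(** The averaging squares are centred at the nodes, so those of the nodes on the axes are not
contained in the fundamental cell; uniform continuity on the plane treats all of them alike. *)
Lemma cell_average f (e : R) : continuous f -> torus_fun f -> 0 < e -> exists2 d : R, 0 < d &
  forall N i j, (0 < N)%N -> step R N < d ->
  `|1 / step R N ^+ 2 * \int[leb2 R]_(x in [set x : R * R | `|x - node R N i j| <= step R N / 2]) f x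
     - f (node R N i j)| <= e.
Proof.
move=> cf tf e0; have [d d0 H] := torus_uc1 cf tf e0; exists d => // N i j N0 sd.
have h0 := @step_gt0 R N N0; set h := step R N in h0 sd *.
set c := node R N i j.
set B : set (R * R) := [set x | _].
have BE : B = (`[c.1 - h / 2, c.1 + h / 2]%classic `*` `[c.2 - h / 2, c.2 + h / 2]%classic).
  by apply/seteqP; split => x; rewrite /B /= prod_norm_le /= !ler_distl !in_itv /= => /andP.
have mB : measurable (B : set (mplane R)) by rewrite BE; apply: measurableX; exact: measurable_itv.
have I1 (y : R) : lebesgue_measure (`[y - h / 2, y + h / 2]%classic : set R) = h%:E.
  rewrite lebesgue_measure_itv /= lte_fin ifT; last by rewrite ltrD2l; lra.
  by rewrite -EFinB; congr EFin; lra.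
have LB : leb2 R B = (h ^+ 2)%:E.
  by rewrite BE leb2X ?I1 -?EFinM ?expr2//; exact: measurable_itv.
have [C _ HC] := torus_bdd1 cf tf.
have fin : (leb2 R B < +oo)%E by rewrite LB ltry.
have ic (a : R) : (leb2 R).-integrable B (EFin \o (fun=> a)).
  apply: measurable_bounded_integrable => //.
  by exists `|a|; split => [|M hM x _]; [exact: num_real|exact: ltW].
have iF : (leb2 R).-integrable B (EFin \o f).
  apply: measurable_bounded_integrable => //.
    by apply: measurable_funTS; exact: (continuous_measurable2 cf).
  exists C; split => [|M CM x _]; first exact: num_real.
  by apply: le_trans (HC x) _; exact: ltW.
have V (a : R) : \int[leb2 R]_(x in B) a = a * h ^+ 2.
  by rewrite Rintegral_cst// LB.
have near x : B x -> `|f x - f c| <= e.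
  rewrite /B /= => xc; apply: ltW; apply: H; apply: le_lt_trans xc _; lra.
have U : \int[leb2 R]_(x in B) f x <= (f c + e) * h ^+ 2.
  rewrite -V; apply: le_Rintegral => // x Bx.
  by have := near x Bx; rewrite ler_norml => /andP[_]; lra.
have L : (f c - e) * h ^+ 2 <= \int[leb2 R]_(x in B) f x.
  rewrite -V; apply: le_Rintegral => // x Bx.
  by have := near x Bx; rewrite ler_norml => /andP[+ _]; lra.
have h20 : 0 < h ^+ 2 by exact: exprn_gt0.
have {}U : \int[leb2 R]_(x in B) f x / h ^+ 2 <= f c + e by rewrite ler_pdivrMr.
have {}L : f c - e <= \int[leb2 R]_(x in B) f x / h ^+ 2 by rewrite ler_pdivlMr.
rewrite mul1r mulrC.
by rewrite ler_norml; apply/andP; split; lra.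
Qed.

Lemma torus_dist_le (x y : R * R) (k : int * int) : torus_dist x y <= enorm (x - y + (k.1%:~R, k.2%:~R)).
Proof.
apply: ge_inf; last by exists k.
by exists 0 => _ [l _ <-]; exact: sqrtr_ge0.
Qed.

End NodeFunctions.

Section DiscreteSolution.
Context {R : realType} (D : mfg_data R).
Local Notation beta := (beta_ D). Local Notation nu := (nu_ D). Local Notation T := (T_ D).
Local Notation Hc := (Hc_ D). Local Notation u0 := (u0_ D). Local Notation mT := (mT_ D).
Local Notation Phi := (@Phi_ _ D). Local Notation u := (u_ D). Local Notation m := (m_ D).
Local Notation Phih := (@Phih_ _ D).
Let hb := hbeta_ D. Let hnu := hnu_ D. Let hT := hT_ D.

Definition dt (NT : nat) : R := T / NT%:R.
Definition Ud NT N n := mxg (ud_ D NT N n).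
Definition Md NT N n := mxg (md_ D NT N n).
Definition Fd NT N n := mxg (Phih (md_ D NT N n)).

Lemma dt_gt0 NT : (0 < NT)%N -> 0 < dt NT.
Proof. by move=> NT0; rewrite divr_gt0// ltr0n. Qed.

Lemma dt_le NT n : (0 < NT)%N -> (n <= NT)%N -> n%:R * dt NT <= T.
Proof.
move=> NT0 nN; rewrite /dt mulrCA -[leRHS]mulr1 ler_pM2l// ler_pdivrMr ?ltr0n// mul1r ler_nat//.
Qed.

Lemma dt_NT NT : (0 < NT)%N -> NT%:R * dt NT = T.
Proof. by move=> NT0; rewrite /dt mulrC divfK// pnatr_eq0 -lt0n. Qed.

Section Fixed.
Variables (NT N : nat) (NT0 : (0 < NT)%N) (N0 : (0 < N)%N).
Let S := hdsol_ D NT0 N0.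
Local Notation U := (Ud NT N). Local Notation Mu := (Md NT N). Local Notation Fh := (Fd NT N).
Local Notation dt := (dt NT).

Lemma gper_U n : gper N (U n). Proof. exact: gper_mxg. Qed.
Lemma gper_Mu n : gper N (Mu n). Proof. exact: gper_mxg. Qed.
Lemma gper_Hc : gper N (fun p => Hc (nd N p)).
Proof. by apply: gper_nd => //; case: (hHc_ D). Qed.

Lemma gperD (F G : int * int -> R) : gper N F -> gper N G -> gper N (fun p => F p + G p).
Proof. by move=> pF pG p i; rewrite pF pG. Qed.

Lemma HJB_scheme n p : (n < NT)%N ->
  (U n.+1 p - U n p) / dt - nu * Lapg N (U n.+1) p + Gg N beta (U n.+1) p = Fh n p - Hc (nd N p).
Proof.
move=> nN; move: p; apply: (gper_ext N0).
- apply: gperD; last exact: gper_Gg (gper_U _).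
  by move=> p i; rewrite !gper_U (gper_Lapg (gper_U _)).
- by apply: gperB; [exact: gper_mxg|exact: gper_Hc].
move=> k l; have := dsol_HJB S k l nN.
rewrite (LhE N0) (gnum_Gg _ _ _ _) -!mxg_ord => E; rewrite /Fd /Ud.
by rewrite -E; ring.
Qed.

Lemma FP_scheme n p : (n < NT)%N ->
  (Mu n.+1 p - Mu n p) / dt + nu * Lapg N (Mu n) p + Tr N beta (U n.+1) (Mu n) p = 0.
Proof.
move=> nN; have := @gper_ext R N N0 (fun p => (Mu n.+1 p - Mu n p) / dt + nu * Lapg N (Mu n) p + Tr N beta (U n.+1) (Mu n) p) (fun=> 0).
apply=> [||k l].
- apply: gperD; last by apply: gper_Tr; exact: gper_mxg.
  by move=> q i; rewrite !gper_Mu (gper_Lapg (gper_Mu _)).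
- by [].
have := dsol_FP S k l nN.
by rewrite (LhE N0) (transportE Hc hb) -!mxg_ord.
Qed.

Lemma U_initial p : U 0%N p = u0 (nd N p).
Proof.
move: p; apply: (gper_ext N0) => [||k l]; first exact: gper_mxg.
  by apply: gper_nd => //; case: (hu0_ D).
by rewrite /Ud mxg_ord (dsol_initial S).
Qed.

Lemma Mu_density n : (n <= NT)%N -> avg N (Mu n) = 1 /\ forall p, 0 <= Mu n p.
Proof. by move=> nN; apply/(Kh_avg N0); exact: (dsol_density S nN). Qed.

End Fixed.

Lemma Phih3_grid : exists2 C : R, 0 <= C & forall N z, (0 < N)%N -> @Kh R N z ->
  (forall p, `|mxg (Phih z) p| <= C) /\ (forall p i, `|mxg (Phih z) (p + ed i) - mxg (Phih z) p| <= C * step R N).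
Proof.
have [C HC] := hPhih3_ D; exists `|C| => [//|N z N0 Kz]; have [H1 H2] := HC N N0 z Kz.
have h0 := @step_gt0 R N N0.
split=> [p|p i].
  have [k [l [h1 h2 _]]] := grid_rep (R := R) N0 p.
  by rewrite /mxg (gextE _ h1 h2); apply: le_trans (H1 k l) _; exact: ler_norm.
have [k [l [h1 h2 _]]] := grid_rep (R := R) N0 p.
have [k' [l' [h1' h2' _]]] := grid_rep (R := R) N0 (p + ed i).
rewrite /mxg (gextE _ h1 h2) (gextE _ h1' h2').
apply: le_trans (H2 k' l' k l) _.
have dv (a b : int) : (a = b %[mod N%:Z])%Z -> exists c : int, a = b + N%:Z * c.
  move=> ab; exists ((a %/ N%:Z)%Z - (b %/ N%:Z)%Z).
  by rewrite {1}(divz_eq a N%:Z) {1}(divz_eq b N%:Z) ab; ring.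
have [a Ea] := dv _ _ h1; have [b Eb] := dv _ _ h2; have [a' Ea'] := dv _ _ h1'; have [b' Eb'] := dv _ _ h2'.
have NR : N%:R != 0 :> R by rewrite pnatr_eq0 -lt0n.
have E : node R N k'%:Z l'%:Z - node R N k%:Z l%:Z + ((a - a')%:~R, (b - b')%:~R) = step R N *: evec R i.
  rewrite Ea Eb Ea' Eb' /node /evec /step; clear -N0 NR.
  elim/ord2P: i; congr pair; rewrite /= ?rmorphB ?rmorphD ?rmorphM /= ?addr0; rewrite ?[_ *: 1]mulr1 ?[_ *: 0]mulr0; field; rewrite ?NR//.
have := torus_dist_le (node R N k'%:Z l'%:Z) (node R N k%:Z l%:Z) (a - a', b - b'); rewrite /= E.
have -> : enorm (step R N *: evec R i) = step R N.
  by rewrite /enorm /evec; elim/ord2P: i {E h1' h2' Ea' Eb'} => /=; rewrite ?[_ *: 1]mulr1 ?[_ *: 0]mulr0 ?expr0n ?addr0 ?add0r sqrtr_sqr gtr0_norm.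
move=> dd; have d0 : 0 <= torus_dist (node R N k'%:Z l'%:Z) (node R N k%:Z l%:Z).
  apply: lb_le_inf; first by exists (enorm (node R N k'%:Z l'%:Z - node R N k%:Z l%:Z + (0%:~R, 0%:~R))), (0, 0).
  by move=> _ [c _ <-]; exact: sqrtr_ge0.
apply: (@le_trans _ _ (`|C| * torus_dist (node R N k'%:Z l'%:Z) (node R N k%:Z l%:Z))).
  by apply: ler_wpM2r => //; exact: ler_norm.
exact: ler_wpM2l.
Qed.

(** Strict monotonicity of the discrete coupling implies monotonicity: a negative pairing would
force equal couplings and hence a zero pairing. *)
Lemma Phih2_grid N (z z' : 'M[R]_N) : (0 < N)%N -> Kh z -> Kh z' ->
  0 <= avg N (fun p => (mxg (Phih z) p - mxg (Phih z') p) * (mxg z p - mxg z' p)).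
Proof.
move=> N0 Kz Kz'.
have -> : avg N (fun p => (mxg (Phih z) p - mxg (Phih z') p) * (mxg z p - mxg z' p)) =
    step R N ^+ 2 * gdot (Phih z - Phih z') (z - z').
  by rewrite gdot_avg; apply: eq_avg => p; rewrite !mxgB.
have [h|h] := leP (gdot (Phih z - Phih z') (z - z')) 0; last by rewrite mulr_ge0 ?sqr_ge0 ?ltW.
have -> := @hPhih2_ _ D N N0 _ _ Kz Kz' h.
by rewrite /gdot big1 ?mulr0// => i _; rewrite big1// => j _; rewrite subrr mxE mul0r.
Qed.

End DiscreteSolution.

(** * Bounds for the discrete solution *)

Section TransportLinearity.
Context {R : realType} (N : nat) (beta : R).
Implicit Types (u m w : int * int -> R).

Lemma Rf_B u m w i p : Rf N beta u (fun q => m q - w q) i p = Rf N beta u m i p - Rf N beta u w i p.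
Proof. by rewrite /Rf; ring. Qed.

Lemma Tr_B u m w p : Tr N beta u (fun q => m q - w q) p = Tr N beta u m p - Tr N beta u w p.
Proof.
rewrite /Tr -sumrB; apply: eq_bigr => i _; rewrite /Dm !Rf_B.
by move: (Rf _ _ _ _ _ p) (Rf _ _ _ _ _ p) (Rf _ _ _ _ _ (p - ed i)) (Rf _ _ _ _ _ (p - ed i)) => *; ring.
Qed.

Lemma Lapg_B u w p : Lapg N (fun q => u q - w q) p = Lapg N u p - Lapg N w p.
Proof. by rewrite /Lapg -sumrB; apply: eq_bigr => i _; ring. Qed.

End TransportLinearity.

Section DiscreteBounds.
Context {R : realType} (D : mfg_data R).
Local Notation beta := (beta_ D). Local Notation nu := (nu_ D). Local Notation T := (T_ D).
Local Notation Hc := (Hc_ D). Local Notation u0 := (u0_ D). Local Notation mT := (mT_ D).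
Local Notation Phi := (@Phi_ _ D). Local Notation u := (u_ D). Local Notation m := (m_ D).
Local Notation Phih := (@Phih_ _ D).
Local Notation dt := (dt D).
Local Notation U := (Ud D). Local Notation Mu := (Md D). Local Notation Fh := (Fd D).
Let hb := hbeta_ D. Let hnu := hnu_ D. Let hT := hT_ D.

Lemma Hc_bounds : exists2 C : R, 0 <= C & forall N, (0 < N)%N ->
  (forall p, `|Hc (nd N p)| <= C) /\ (forall i p, `|Hc (nd N (p + ed i)) - Hc (nd N p)| <= C * step R N).
Proof.
have [tH CH] := hHc_ D.
have [C1 C10 H1] := torus_bdd1 CH.1 tH; have [L L0 H2] := C1_lipschitz tH CH.
exists (C1 + L) => [|N N0]; first exact: addr_ge0.
have h0 := @step_gt0 R N N0.
split=> [p|i p]; first by apply: le_trans (H1 _) _; rewrite lerDl.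
rewrite nd_ed; apply: le_trans (H2 _ i _ (ltW h0)) _.
by rewrite ler_wpM2r ?(ltW h0)// lerDr.
Qed.

Lemma u0_bounds : exists2 C : R, 0 <= C & forall N, (0 < N)%N ->
  [/\ forall p, `|u0 (nd N p)| <= C, forall i p, `|u0 (nd N (p + ed i)) - u0 (nd N p)| <= C * step R N,
    forall p, `|Lapg N (fun q => u0 (nd N q)) p| <= C &
    forall i p, `|Dp N i (fun q => u0 (nd N q)) p| <= C].
Proof.
have [tu su] := hu0_ D.
have [C1 C10 H1] := torus_bdd1 (su 0%N).1 tu; have [L L0 H2] := C1_lipschitz tu (su 1%N).
have [_ [d1 d2]] := su 2%N.
have dd x i j : derivable (pd i u0) x (evec R j) by have [_ [+ _]] := d2 i; apply.
have cdd i : continuous (pd i (pd i u0)) by have [_ [_ /(_ i)]] := d2 i; case.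
have [K0 K00 B0] := torus_bdd1 (cdd 0) (torus_pd 0 (torus_pd 0 tu)).
have [K1 K10 B1] := torus_bdd1 (cdd 1) (torus_pd 1 (torus_pd 1 tu)).
pose C := C1 + L + (K0 + K1) + (K0 + K1).
have C0 : 0 <= C by rewrite !addr_ge0.
exists C => // N N0; have h0 := @step_gt0 R N N0.
have D1 i p : `|u0 (nd N (p + ed i)) - u0 (nd N p)| <= L * step R N.
  by rewrite nd_ed; exact: H2 _ i _ (ltW h0).
have LC : L <= C by rewrite /C; lra.
split=> [p|i p|p|i p].
- by apply: le_trans (H1 _) _; rewrite /C; lra.
- by apply: le_trans (D1 i p) _; rewrite ler_wpM2r ?(ltW h0).
- have HK x i : `|pd i (pd i u0) x| <= K0 + K1.
    by elim/ord2P: i; [apply: le_trans (B0 x) _|apply: le_trans (B1 x) _]; lra.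
  by apply: le_trans (Lapg_bound p N0 d1 dd HK) _; rewrite /C; lra.
- rewrite /Dp normrM normfV (gtr0_norm h0) ler_pdivrMr//.
  by apply: le_trans (D1 i p) _; rewrite ler_wpM2r ?(ltW h0).
Qed.

(** The right-hand sides are bounded and Lipschitz uniformly in the density, so comparison with
constants, with shifts and with [u0] applies. *)
Lemma U_bounds : exists2 C : R, 0 <= C & forall NT N n, (0 < NT)%N -> (0 < N)%N -> (n <= NT)%N ->
  [/\ forall p, `|U NT N n p| <= C, forall i p, `|Dp N i (U NT N n) p| <= C &
      forall p, `|U NT N n p - u0 (nd N p)| <= C * (n%:R * dt NT)].
Proof.
have [C1 C10 H1] := Phih3_grid D; have [C2 C20 H2] := Hc_bounds; have [C3 C30 H3] := u0_bounds.
pose B := ((2 * C3) ^+ 2) `^ (beta / 2).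
have B0 : 0 <= B by exact: powR_ge0.
have nuC : 0 <= nu * C3 by rewrite mulr_ge0 ?(ltW hnu).
have TC : 0 <= T * (C1 + C2) by rewrite mulr_ge0 ?(ltW hT) ?addr_ge0.
exists (C3 + T * (C1 + C2) + (C1 + C2 + nu * C3 + B)); first by rewrite !addr_ge0.
move=> NT N n NT0 N0 nN; have dt0 := dt_gt0 D NT0.
have [HF1 HF2] : (forall n p, (n < NT)%N -> `|Fh NT N n p| <= C1) /\
    (forall n i p, (n < NT)%N -> `|Fh NT N n (p + ed i) - Fh NT N n p| <= C1 * step R N).
  by split=> [k p kN|k i p kN]; have [h1 h2] := H1 N _ N0 (dsol_density (hdsol_ D NT0 N0) (ltnW kN)); [exact: h1|exact: h2].
have [Hc1 Hc2] := H2 N N0; have [u1 u2 u3 u4] := H3 N N0.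
have tn : n%:R * dt NT * (C1 + C2) <= T * (C1 + C2).
  by apply: ler_wpM2r; [exact: addr_ge0|exact: dt_le].
split=> [p|i p|p].
- apply: le_trans (@solution_bound _ _ N0 _ _ hb hnu (U NT N) (Fh NT N) (fun p => Hc (nd N p)) (fun p => u0 (nd N p)) (dt NT) C1 C2 C3 NT
    dt0 (@gper_U _ D NT N) (fun k q => @HJB_scheme _ D NT N NT0 N0 k q) (U_initial D NT0 N0) HF1 Hc1 u1 n p nN) _.
  by rewrite -[leRHS]addrA lerD2l; apply: le_trans tn _; rewrite lerDl !addr_ge0.
- apply: le_trans (@solution_lipschitz _ _ N0 _ _ hb hnu (U NT N) (Fh NT N) (fun p => Hc (nd N p)) (fun p => u0 (nd N p)) (dt NT) NT
    dt0 (@gper_U _ D NT N) (fun k q => @HJB_scheme _ D NT N NT0 N0 k q) (U_initial D NT0 N0) C1 C2 C3 HF2 Hc2 u2 n i p nN) _.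
  by rewrite -[leRHS]addrA lerD2l; apply: le_trans tn _; rewrite lerDl !addr_ge0.
have pu0 : gper N (fun p => u0 (nd N p)) by apply: gper_nd => //; case: (hu0_ D).
have n0N : (0 <= n <= NT)%N by [].
have c0 q : `|U NT N 0 q - u0 (nd N q)| <= 0 by rewrite (U_initial D NT0 N0) subrr normr0.
apply: le_trans (@solution_barrier _ _ N0 _ _ hb hnu (U NT N) (Fh NT N) (fun p => Hc (nd N p)) (dt NT) C1 C2 NT
    dt0 (@gper_U _ D NT N) (fun k q => @HJB_scheme _ D NT N NT0 N0 k q) HF1 Hc1 _ C3 C3 0 0 pu0 C30 u3 u4 c0 n p n0N) _.
rewrite add0r subn0 [leRHS]mulrC; apply: ler_wpM2l; first by rewrite mulr_ge0 ?(ltW dt0).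
by rewrite lerDr addr_ge0.
Qed.

(** The slice [u t0] is smooth for [0 < t0], so it is a barrier like the initial datum. *)
Lemma U_barrier t0 : 0 < t0 < T -> exists2 C : R, 0 <= C & forall NT N n n0 c p, (0 < NT)%N -> (0 < N)%N -> (n0 <= n <= NT)%N ->
  (forall p, `|U NT N n0 p - u t0 (nd N p)| <= c) -> `|U NT N n p - u t0 (nd N p)| <= c + C * ((n - n0)%:R * dt NT).
Proof.
move=> /[dup] ht0 /andP[t00 t0T].
have [C1 C10 H1] := Phih3_grid D; have [C2 C20 H2] := Hc_bounds.
have Cu := sol_C12_u (hsol_ D).
have tu t (ht : 0 <= t <= T) := (sol_periodic (hsol_ D) ht).1.
have tt : t0 <= t0 <= t0 by rewrite lexx.
have bd (i : 'I_2) := bdd_pd Cu tu t00 t0T i; have bdd (i : 'I_2) := bdd_pdd Cu tu t00 t0T i i.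
have [[K0 HK0] [K1 HK1] [L0 HL0] [L1 HL1]] := And4 (bd 0) (bd 1) (bdd 0) (bdd 1).
pose K := `|K0| + `|K1|; pose L := `|L0| + `|L1|.
have K_0 : 0 <= K by rewrite addr_ge0. have L_0 : 0 <= L by rewrite addr_ge0.
have HK x i : `|pd i (u t0) x| <= K.
  by rewrite /K; elim/ord2P: i; [apply: le_trans (HK0 t0 x tt) _|apply: le_trans (HK1 t0 x tt) _]; apply: le_trans (ler_norm _) _; rewrite ?lerDl ?lerDr.
have HL x i : `|pd i (pd i (u t0)) x| <= L.
  by rewrite /L; elim/ord2P: i; [apply: le_trans (HL0 t0 x tt) _|apply: le_trans (HL1 t0 x tt) _]; apply: le_trans (ler_norm _) _; rewrite ?lerDl ?lerDr.
have du x i : derivable (u t0) x (evec R i) by have [_ + _] := Cu.1 t0 x ht0; apply.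
have ddu x i j : derivable (pd i (u t0)) x (evec R j) by have [_ _] := Cu.1 t0 x ht0; apply.
pose B := ((2 * K) ^+ 2) `^ (beta / 2).
have B0 : 0 <= B by exact: powR_ge0.
exists (C1 + C2 + nu * (L + L) + B); first by rewrite !addr_ge0// mulr_ge0 ?(ltW hnu)// addr_ge0.
move=> NT N n n0 c p NT0 N0 hn Hc0; have dt0 := dt_gt0 D NT0.
have HF1 k q : (k < NT)%N -> `|Fh NT N k q| <= C1.
  by move=> kN; have [h1 h2] := H1 N _ N0 (dsol_density (hdsol_ D NT0 N0) (ltnW kN)); exact: h1.
have [Hc1 _] := H2 N N0.
have pw : gper N (fun p => u t0 (nd N p)) by apply: gper_nd => //; apply: tu; rewrite !ltW.
rewrite [C in c + C]mulrC.
exact: (@solution_barrier _ _ N0 _ _ hb hnu (U NT N) (Fh NT N) (fun p => Hc (nd N p)) (dt NT) C1 C2 NT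
    dt0 (@gper_U _ D NT N) (fun k q => @HJB_scheme _ D NT N NT0 N0 k q) HF1 Hc1 _ (L + L) K c n0 pw K_0
    (fun q => Lapg_bound q N0 du ddu HL) (fun i q => Dp_bound i q N0 du HK) Hc0 n p hn).
Qed.

Lemma M_terminal (e : R) : 0 < e -> exists2 r : R, 0 < r & forall NT N p, (0 < NT)%N -> (0 < N)%N ->
  step R N < r -> `|Mu NT N NT p - mT (nd N p)| <= e.
Proof.
move=> e0; have [tm sm] := hmT_ D.
have [d d0 H] := cell_average (sm 0%N).1 tm e0.
exists d => // NT N p NT0 N0 sd.
suff P q : Mu NT N NT q = 1 / step R N ^+ 2 * \int[leb2 R]_(x in [set x : R * R | `|x - nd N q| <= step R N / 2]) mT x -> `|Mu NT N NT q - mT (nd N q)| <= e.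
  have [k [l [_ _ E]]] := grid_rep (R := R) N0 p.
  rewrite (E _ (@gper_Mu _ D NT N NT)) (E _ (gper_nd N0 tm)); apply: P.
  by rewrite /Md mxg_ord (dsol_terminal (hdsol_ D NT0 N0)).
by move=> ->; exact: H.
Qed.

(** The datum [mT], constant in time, solves the discrete Fokker-Planck equation up to a bounded
residual, so the energy estimate bounds the distance by the time that is left. *)
Lemma M_near_terminal : exists2 K : R, 0 <= K & forall e : R, 0 < e -> exists2 r : R, 0 < r &
  forall NT N n, (0 < NT)%N -> (0 < N)%N -> dt NT < r -> step R N < r -> (n <= NT)%N ->
  avg N (fun p => (Mu NT N n p - mT (nd N p)) ^+ 2) <= e + K * (T - n%:R * dt NT).
Proof.
have [C C0 HU] := U_bounds; have [tm sm] := hmT_ D.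
have [_ [d1 d2]] := sm 2%N.
have dd x i j : derivable (pd i mT) x (evec R j) by have [_ [+ _]] := d2 i; apply.
have cdd i : continuous (pd i (pd i mT)) by have [_ [_ /(_ i)]] := d2 i; case.
have [K0 K00 B0] := torus_bdd1 (cdd 0) (torus_pd 0 (torus_pd 0 tm)).
have [K1 K10 B1] := torus_bdd1 (cdd 1) (torus_pd 1 (torus_pd 1 tm)).
have [Cm Cm0 Hm] := torus_bdd1 (sm 0%N).1 tm.
pose B := beta * (2 * C) `^ (beta - 1).
have bb0 : 0 <= beta by case/andP: hb => b1 _; lra.
have B_0 : 0 <= B by rewrite mulr_ge0 ?powR_ge0.
pose Kc := 16 * B ^+ 2 / nu + 1 + 2 / nu.
have Kc0 : 0 < Kc.
  have h1 : 0 <= 16 * B ^+ 2 / nu by apply: divr_ge0; [apply: mulr_ge0; rewrite ?sqr_ge0|exact: ltW].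
  have h2 : 0 <= 2 / nu by apply: divr_ge0; [|exact: ltW].
  by rewrite /Kc; lra.
pose K2 := K0 + K1 + (K0 + K1).
pose Y := (2 * Cm * B) ^+ 2 + (2 * Cm * B) ^+ 2 + (nu * K2) ^+ 2.
have Y0 : 0 <= Y by rewrite !addr_ge0 ?sqr_ge0.
pose E := expR (2 * Kc * T).
have E0 : 0 < E by exact: expR_gt0.
exists (E * (Kc * Y)); first by rewrite !mulr_ge0 ?(ltW E0) ?(ltW Kc0).
move=> e e0.
have e10 : 0 < Num.min 1 (e / E) by rewrite lt_min ltr01 divr_gt0.
have [r1 r10 HT] := M_terminal e10.
exists (Num.min r1 (2 * Kc)^-1); first by rewrite lt_min r10 invr_gt0 mulr_gt0.
move=> NT N n NT0 N0; rewrite !lt_min => /andP[_ dtr] /andP[sr _] nN.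
have dt0 := dt_gt0 D NT0; have h0 := @step_gt0 R N N0.
pose w q := mT (nd N q).
have pw : gper N w by exact: gper_nd.
pose x k := avg N (fun p => (Mu NT N k p - w p) ^+ 2).
have a12 : 0 <= dt NT * Kc <= 2^-1.
  rewrite mulr_ge0 ?(ltW dt0) ?(ltW Kc0)//=.
  by rewrite -ler_pdivlMr//; apply: le_trans (ltW dtr) _; rewrite invfM.
have step1 k : (0 <= k < NT)%N -> x k <= x k.+1 + dt NT * Kc * (x k + Y).
  move=> /= kN; have [_ HDp _] := HU NT N k.+1 NT0 N0 kN.
  have Bb p l : bb N beta (U NT N k.+1) p l <= B by apply: bb_bound.
  have Bw p l : `|w p * bb N beta (U NT N k.+1) p l| <= Cm * B.
    by rewrite normrM; apply: ler_pM => //; [exact: Hm|rewrite ger0_norm ?bb_ge0].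
  have eqn p : (Mu NT N k.+1 p - w p - (Mu NT N k p - w p)) / dt NT + nu * Lapg N (fun q => Mu NT N k q - w q) p
      + Tr N beta (U NT N k.+1) (fun q => Mu NT N k q - w q) p =
      \sum_i Dm N i (fun q => - Rf N beta (U NT N k.+1) w i q) p + - nu * Lapg N w p.
    rewrite Lapg_B Tr_B.
    have -> : \sum_i Dm N i (fun q => - Rf N beta (U NT N k.+1) w i q) p = - Tr N beta (U NT N k.+1) w p.
      by rewrite /Tr -sumrN; apply: eq_bigr => i _; rewrite /Dm -opprB opprK -mulNr opprB addrC.
    have := @FP_scheme _ D NT N NT0 N0 k p kN.
    move: (Mu NT N k.+1 p) (Mu NT N k p) (Lapg N (Mu NT N k) p) (Lapg N w p) (Tr _ _ _ _ p) (Tr _ _ _ _ p) => z1 z2 z3 z4 z5 z6 E1.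
    have -> : z1 - w p - (z2 - w p) = z1 - z2 by ring.
    have -> : (z1 - z2) / dt NT = - (nu * z3) - z6 by move: E1; move: (_ / dt NT) => *; lra.
    ring.
  have pr i : gper N (fun q => - Rf N beta (U NT N k.+1) w i q).
    by move=> q j; congr (- _); apply: gper_Rf => //; exact: gper_U.
  apply: le_trans (energy_step hb hnu (@gper_U _ D NT N k.+1) (gperB (@gper_Mu _ D NT N k) pw) pr dt0 Bb eqn) _.
  rewrite -/(x k) -/(x k.+1) -/Kc lerD2l; apply: ler_wpM2l; first by case/andP: a12.
  rewrite lerD2l sum2E.
  have R1 i : avg N (fun q => (- Rf N beta (U NT N k.+1) w i q) ^+ 2) <= (2 * Cm * B) ^+ 2.
    rewrite -[leRHS](avg_cst N0); apply: avg_le => q; rewrite sqrrN.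
    have CB : 0 <= 2 * Cm * B by apply: mulr_ge0 => //; exact: mulr_ge0.
    rewrite -real_normK ?num_real// ler_sqr ?nnegrE//.
    apply: le_trans (ler_normB _ _) _; apply: le_trans (lerD (Bw _ _) (Bw _ _)) _.
    by rewrite le_eqVlt; apply/orP; left; apply/eqP; ring.
  have R2 : avg N (fun q => (- nu * Lapg N w q) ^+ 2) <= (nu * K2) ^+ 2.
    rewrite -[leRHS](avg_cst N0); apply: avg_le => q.
    have K20 : 0 <= K2 by rewrite !addr_ge0.
    have nK : 0 <= nu * K2 by rewrite mulr_ge0 ?(ltW hnu).
    rewrite -real_normK ?num_real// ler_sqr ?nnegrE//.
    rewrite normrM normrN (gtr0_norm hnu) ler_pM2l//; apply: Lapg_bound => // y i.
    by elim/ord2P: i; [apply: le_trans (B0 y) _|apply: le_trans (B1 y) _]; lra.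
  by apply: lerD => //; apply: lerD; exact: R1.
have xk0 k : 0 <= x k by apply: avg_ge0 => p; exact: sqr_ge0.
have G := @gronwall R x (fun=> Y) (dt NT * Kc) 0 NT a12 xk0 (fun=> Y0) step1 n nN.
apply: le_trans G _.
rewrite sumr_const_nat.
have EE : expR (2 * (dt NT * Kc) * (NT - n)%:R) <= E.
  rewrite ler_expR -mulrA -[leRHS]mulrA ler_pM2l// mulrAC mulrC ler_pM2l// mulrC.
  rewrite natrB// mulrBl dt_NT// gerBl mulr_ge0 ?(ltW dt0)//.
have tn : dt NT * Kc * (Y *+ (NT - n)) = Kc * Y * (T - n%:R * dt NT).
  by rewrite -[Y *+ _]mulr_natl natrB// -(dt_NT D NT0) -mulrBl; ring.
have Tn : 0 <= T - n%:R * dt NT by rewrite subr_ge0; exact: dt_le.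
have xT : x NT <= e / E.
  apply: (@le_trans _ _ (Num.min 1 (e / E))); last by rewrite ge_min lexx orbT.
  rewrite -[leRHS](avg_cst N0); apply: avg_le => p.
  have := HT NT N p NT0 N0 sr; rewrite -/(w p); move: (Mu NT N NT p - w p) => z hz.
  have z1 : `|z| <= 1 by apply: le_trans hz _; rewrite ge_min lexx.
  rewrite -real_normK ?num_real// expr2; apply: le_trans hz.
  by rewrite ler_piMl.
rewrite tn.
apply: (@le_trans _ _ (E * (e / E + Kc * Y * (T - n%:R * dt NT)))).
  apply: ler_pM => //.
    by apply: addr_ge0 => //; apply: mulr_ge0 => //; apply: mulr_ge0 => //; exact: ltW.
  by rewrite lerD2r.
by rewrite mulrDr [E * (e / E)]mulrC divfK ?gt_eqF// lerD2l !mulrA.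
Qed.

End DiscreteBounds.

(** * Bilinear interpolation *)

Section Bilinear.
Context {R : realType} (N : nat) (N0 : (0 < N)%N).
Implicit Types (z : 'M[R]_N) (x : R * R) (p : int * int).
Local Notation h := (step R N).

Definition corner x : int * int := (Num.floor (x.1 / h), Num.floor (x.2 / h)).

(** A convex combination of the four values for [a] and [b] in [[0, 1]]. *)
Definition bil (a b z00 z10 z01 z11 : R) : R :=
  (1 - a) * (1 - b) * z00 + a * (1 - b) * z10 + (1 - a) * b * z01 + a * b * z11.

Definition frac x : R * R := (x.1 / h - (corner x).1%:~R, x.2 / h - (corner x).2%:~R).

Lemma frac_itv x : 0 <= (frac x).1 <= 1 /\ 0 <= (frac x).2 <= 1.
Proof.
have F (y : R) : 0 <= y - (Num.floor y)%:~R <= 1.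
  have := floor_itv y; rewrite intrD => /andP[h1 h2]; apply/andP; split; lra.
by split; exact: F.
Qed.

Lemma bilinE z x : let p := corner x in
  bilin z x = bil (frac x).1 (frac x).2 (mxg z p) (mxg z (p + ed 0)) (mxg z (p + ed 1)) (mxg z (p + ed 0 + ed 1)).
Proof. by rewrite /bilin /bil /frac /mxg /= !addr0 ?add0r. Qed.

Lemma bil_close (a b y z00 z10 z01 z11 d00 d10 d01 d11 : R) : 0 <= a <= 1 -> 0 <= b <= 1 ->
  `|y - z00| <= d00 -> `|y - z10| <= d10 -> `|y - z01| <= d01 -> `|y - z11| <= d11 ->
  `|y - bil a b z00 z10 z01 z11| <= bil a b d00 d10 d01 d11.
Proof.
move=> /andP[a0 a1] /andP[b0 b1] h00 h10 h01 h11.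
have -> : y - bil a b z00 z10 z01 z11 = bil a b (y - z00) (y - z10) (y - z01) (y - z11) by rewrite /bil; ring.
have a1' : 0 <= 1 - a by rewrite subr_ge0. have b1' : 0 <= 1 - b by rewrite subr_ge0.
rewrite /bil; apply: (le_trans (ler_normD _ _)); apply: lerD; [apply: (le_trans (ler_normD _ _)); apply: lerD; [apply: (le_trans (ler_normD _ _)); apply: lerD|]|]; rewrite normrM ger0_norm ?mulr_ge0//; apply: ler_wpM2l; rewrite ?mulr_ge0//.
Qed.

Lemma bil_le_sum (a b e d00 d10 d01 d11 : R) : 0 <= a <= 1 -> 0 <= b <= 1 ->
  0 <= d00 -> 0 <= d10 -> 0 <= d01 -> 0 <= d11 ->
  bil a b (e + d00) (e + d10) (e + d01) (e + d11) <= e + (d00 + d10 + d01 + d11).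
Proof.
move=> /andP[a0 a1] /andP[b0 b1] h00 h10 h01 h11.
have -> : bil a b (e + d00) (e + d10) (e + d01) (e + d11) =
  e + ((1 - a) * (1 - b) * d00 + a * (1 - b) * d10 + (1 - a) * b * d01 + a * b * d11) by rewrite /bil; ring.
have a1' : 0 <= 1 - a <= 1 by apply/andP; split; lra.
have b1' : 0 <= 1 - b <= 1 by apply/andP; split; lra.
have W (s t d : R) : 0 <= s <= 1 -> 0 <= t <= 1 -> 0 <= d -> s * t * d <= d.
  move=> /andP[s0 s1] /andP[t0 t1] d0; rewrite ler_piMl//.
  by apply: le_trans (_ : s * 1 <= _); [rewrite ler_wpM2l|rewrite mulr1].
by rewrite lerD2l !lerD// W// ?a0 ?b0.
Qed.

Lemma bil_const (a b e : R) : bil a b e e e e = e.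
Proof. by rewrite /bil; ring. Qed.

Lemma corner_near x : [/\ `|x - nd N (corner x)| <= h, `|x - nd N (corner x + ed 0)| <= h,
  `|x - nd N (corner x + ed 1)| <= h & `|x - nd N (corner x + ed 0 + ed 1)| <= h].
Proof.
have h0 := @step_gt0 R N N0.
have F (y : R) : `|y - (Num.floor (y / h))%:~R * h| <= h /\ `|y - (Num.floor (y / h) + 1)%:~R * h| <= h.
  have := floor_itv (y / h); rewrite ler_pdivlMr// ltr_pdivrMr// !intrD !mulrDl mul1r => /andP[h1 h2].
  by split; rewrite ler_norml; apply/andP; split; lra.
have [F1 F2] := F x.1; have [F3 F4] := F x.2.
by split; rewrite prod_norm_le /= ?addr0 ?add0r; apply/andP; split.
Qed.

Lemma corner_sq x (k l : nat) : sq N k l x -> corner x = (k%:Z, l%:Z).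
Proof.
have h0 := @step_gt0 R N N0.
have F (y : R) (j : nat) : y \in `[j%:R * h, j.+1%:R * h[ -> Num.floor (y / h) = j%:Z.
  rewrite in_itv /= => /andP[h1 h2]; apply: floor_def.
  by rewrite intrD ler_pdivlMr// ltr_pdivrMr// -natr1 in h1 h2 *; rewrite h1.
by move=> [/F h1 /F h2]; rewrite /corner h1 h2.
Qed.

End Bilinear.

(** * Consistency of the Hamilton-Jacobi equation and of the coupling *)

Section Consistency.
Context {R : realType} (D : mfg_data R).
Local Notation beta := (beta_ D). Local Notation nu := (nu_ D). Local Notation T := (T_ D).
Local Notation Hc := (Hc_ D). Local Notation u0 := (u0_ D). Local Notation mT := (mT_ D).
Local Notation Phi := (@Phi_ _ D). Local Notation u := (u_ D). Local Notation m := (m_ D).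
Local Notation Phih := (@Phih_ _ D).
Let hb := hbeta_ D. Let hnu := hnu_ D. Let hT := hT_ D. Let hsol := hsol_ D.
Let Cu := sol_C12_u hsol.
Let tu t (ht : 0 <= t <= T) := (sol_periodic hsol ht).1.
Let tm t (ht : 0 <= t <= T) := (sol_periodic hsol ht).2.
Local Notation gr N f t := (fun q : int * int => f t (nd N q)).

Section Interior.
Variables (a b : R).
Hypotheses (ha : 0 < a) (hbT : b < T).

Lemma hjb_consistency (e : R) : 0 < e -> exists2 r : R, 0 < r & forall N (dt t : R) p, (0 < N)%N ->
  step R N < r -> 0 < dt < r -> a <= t -> t + dt <= b ->
  `|(u (t + dt) (nd N p) - u t (nd N p)) / dt - nu * Lapg N (gr N u (t + dt)) p + Gg N beta (gr N u (t + dt)) p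
    - (Phi (law (m (t + dt))) (nd N p) - Hc (nd N p))| <= e.
Proof.
move=> e0; have e3 : 0 < e / 3 by rewrite divr_gt0.
have en : 0 < e / 3 / nu by rewrite divr_gt0.
have [K0 HK0] := bdd_pd Cu tu ha hbT 0; have [K1 HK1] := bdd_pd Cu tu ha hbT 1.
pose K := `|K0| + `|K1| + 1.
have K_0 : 0 < K by rewrite ltr_wpDl// addr_ge0.
have HK t x i : a <= t <= b -> `|pd i (u t) x| <= K.
  move=> tab; rewrite /K -addrA; elim/ord2P: i; [apply: le_trans (HK0 t x tab) _|apply: le_trans (HK1 t x tab) _]; apply: le_trans (ler_norm _) _.
    by rewrite lerDl addr_ge0.
  by rewrite addrCA lerDl addr_ge0.
have K20 : 0 < 2 * K by rewrite mulr_gt0.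
have [d d0 Hd] := nsq_pow_uc hb K20 e3.
have [r1 r10 H1] := Pv_consistent hsol ha hbT d0.
have [r2 r20 H2] := time_consistent Cu tu ha hbT e3.
have [r3 r30 H3] := Lapg_consistent Cu tu ha hbT en.
exists (Num.min r1 (Num.min r2 r3)); first by rewrite !lt_min r10 r20.
move=> N dt t p N0; rewrite !lt_min => /and3P[s1 s2 s3] /andP[dt0 /and3P[t1 t2 t3]] at_ tb.
have tab : a <= t + dt <= b by rewrite tb andbT (le_trans at_)// lerDl ltW.
have E := sol_HJB hsol (nd N p) (inside ha hbT tab).
have A1 : `|(u (t + dt) (nd N p) - u t (nd N p)) / dt - timeD u (t + dt) (nd N p)| <= e / 3.
  by apply: H2; rewrite ?dt0// lexx lerDl ltW.
have A2 : `|nu * Lapg N (gr N u (t + dt)) p - nu * laplacian (u (t + dt)) (nd N p)| <= e / 3.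
  rewrite -mulrBr normrM (gtr0_norm hnu); have := H3 N _ p N0 s3 tab.
  by rewrite ler_pdivlMr// mulrC.
have du x i : derivable (u (t + dt)) x (evec R i) by have [_ + _] := Cu.1 (t + dt) x (inside ha hbT tab); apply.
have A3 : `|Gg N beta (gr N u (t + dt)) p - enorm (grad (u (t + dt)) (nd N p)) `^ beta| <= e / 3.
  rewrite enorm_pow -/(gsq (u (t + dt)) (nd N p)) -(nsq_spv (u (t + dt))).
  apply: Hd.
  - apply: nsq_Pv_bound; first exact: ltW.
    by move=> i q; apply: Dp_bound => // x j; exact: HK.
  - rewrite nsq_spv /gsq exprMn.
    have sq i : pd i (u (t + dt)) (nd N p) ^+ 2 <= K ^+ 2.
      by rewrite -real_normK ?num_real// ler_sqr ?nnegrE ?(ltW K_0)// HK.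
    apply: le_trans (lerD (sq 0) (sq 1)) _; by rewrite -mulr2n -[_ *+ 2]mulr_natl ler_wpM2r ?sqr_ge0// -natrX ler_nat.
  - by apply: H1; rewrite // subrr normr0.
move: A1 A2 A3; rewrite -E /Ham.
move: (_ / dt) (timeD _ _ _) (nu * Lapg _ _ _) (nu * laplacian _ _) (Gg _ _ _ _) (enorm _ `^ _) (Hc _).
move=> z1 z2 z3 z4 z5 z6 z7 A1 A2 A3.
have -> : z1 - z3 + z5 - (z2 - z4 + (z7 + z6) - z7) = (z1 - z2) - (z3 - z4) + (z5 - z6) by ring.
apply: le_trans (ler_normD _ _) _; apply: le_trans (lerD (ler_normB _ _) (lexx _)) _.
have -> : e = e / 3 + e / 3 + e / 3 by field.
by apply: lerD => //; exact: lerD.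
Qed.

(** The hypothesis on the coupling is stated for families indexed by [N]; a matrix given for one
[N] is completed by densities that are equal to one. *)
Let family N (z : 'M[R]_N) (N' : nat) : 'M[R]_N' :=
  if @eqP _ N N' is ReflectT e then eq_rect N (fun k => 'M[R]_k) z N' e else const_mx 1.

Lemma family_eq N (z : 'M[R]_N) : family z N = z.
Proof. by rewrite /family; case: eqP => // e; rewrite (eq_irrelevance e erefl). Qed.

Lemma family_Kh N (z : 'M[R]_N) : Kh z -> forall N', (0 < N')%N -> Kh (family z N').
Proof.
move=> Kz N' N'0; rewrite /family; case: eqP => [e|_]; first by case: _ / e.
split=> [|i j]; last by rewrite mxE.
rewrite (eq_bigr (fun=> N'%:R)) => [|i _]; last first.
  by rewrite (eq_bigr (fun=> 1)) => [|j _]; rewrite ?mxE// sumr_const card_ord.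
rewrite sumr_const card_ord -[_ *+ N']mulr_natr /step.
have : N'%:R != 0 :> R by rewrite pnatr_eq0 -lt0n.
by move=> n0; field.
Qed.

(** On each square the interpolation is a convex combination of the values at the corners, and
each node is a corner of four squares. *)
Lemma L1_distance (e : R) : 0 < e -> exists2 r : R, 0 < r & forall N t t' (z : 'M[R]_N), (0 < N)%N -> step R N < r ->
  a <= t <= b -> a <= t' <= b -> `|t - t'| < r ->
  (\int[leb2 R]_(x in @cell R) `|m t' x - bilin z x| <= e + 4 * avg N (fun p => `|mxg z p - m t (nd N p)|)).
Proof.
move=> e0; have [r r0 Hr] := uc_sol (sol_C12_m hsol) tm ha hbT e0.
exists r => // N t t' z N0 sr tab tab' tt.
pose d p := `|mxg z p - m t (nd N p)|.
have pd : gper N d.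
  by move=> q i; rewrite /d (gper_mxg z) (gper_nd N0 (tm (inside_le ha hbT tab))).
pose c p := e + (d p + d (p + ed 0) + d (p + ed 1) + d (p + ed 0 + ed 1)).
have Ec : avg N c = e + 4 * avg N d.
  have s2 : avg N (fun p => d (p + ed 0 + ed 1)) = avg N d.
    by rewrite -(avg_shiftD (ed 0 + ed 1) pd); apply: eq_avg => p; rewrite addrA.
  by rewrite /c avgD !avgD avg_cst// !avg_shift// s2; ring.
have L : (\int[leb2 R]_(x in @cell R) (`|m t' x - bilin z x|)%:E <= (avg N c)%:E)%E.
  apply: int_cell_le => // k l x skl.
  rewrite bilinE (corner_sq N0 skl) => /=; have [f1 f2] := frac_itv N x.
  have [n1 n2 n3 n4] := corner_near N0 x; rewrite (corner_sq N0 skl) in n1 n2 n3 n4.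
  have P q : `|x - nd N q| <= step R N -> `|m t' x - mxg z q| <= e + d q.
    move=> xq; rewrite -[m t' x - _](subrKA (m t (nd N q))); apply: le_trans (ler_normD _ _) _.
    apply: lerD; last by rewrite /d distrC.
    by rewrite distrC; apply: ltW; apply: Hr => //; rewrite distrC; exact: le_lt_trans xq sr.
  apply: le_trans (bil_close f1 f2 (P _ n1) (P _ n2) (P _ n3) (P _ n4)) _.
  by apply: bil_le_sum => //; rewrite /d normr_ge0.
rewrite -Ec /Rintegral -lee_fin fineK//.
rewrite ge0_fin_numE; first exact: le_lt_trans L (ltry _).
by apply: integral_ge0 => x _; rewrite lee_fin.
Qed.

(** By [L1_distance] closeness in mean at the nodes is closeness of the interpolated density in
[L1], which is the quantity that controls the couplings. *)
Lemma coupling_consistency (e : R) : 0 < e -> exists2 r : R, 0 < r & forall N t t' (z : 'M[R]_N), (0 < N)%N ->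
  step R N < r -> a <= t <= b -> a <= t' <= b -> `|t - t'| < r -> Kh z ->
  avg N (fun p => `|mxg z p - m t (nd N p)|) <= r ->
  forall p, `|mxg (Phih z) p - Phi (law (m t')) (nd N p)| <= e.
Proof.
move=> e0; have [om [com om0 _ omz Hom]] := hPhih4_ D.
have [k k0 Hk] : exists2 k : R, 0 < k & forall r, 0 <= r -> r < k -> om r <= e.
  have /subspace_continuousP /(_ 0 (lexx 0)) := com => /cvgrPdist_lt /(_ e e0).
  rewrite near_withinE => /nbhs_normP [k /= k0 Hk]; exists k => // r r0 rk.
  have rk' : `|0 - r| < k by rewrite sub0r normrN ger0_norm.
  have H : `|om 0 - om r| < e := Hk r rk' r0.
  move: H; rewrite omz sub0r normrN => /ltW; apply: le_trans; exact: ler_norm.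
have k2 : 0 < k / 2 by rewrite divr_gt0.
have [r r0 Hr] := L1_distance k2.
exists (Num.min r (k / 16)); first by rewrite lt_min r0 divr_gt0.
move=> N t t' z N0; rewrite !lt_min => /andP[sr _] tab tab' /andP[tt _] Kz; rewrite le_min => /andP[_ zm].
have dens : is_density (m t') by apply: (sol_density hsol); exact: inside_le tab'.
have I : \int[leb2 R]_(x in @cell R) `|m t' x - bilin z x| < k.
  apply: le_lt_trans (Hr N t t' z N0 sr tab tab' tt) _; move: zm k0; move: (avg _ _) => *; lra.
have tPhi : torus_fun (Phi (law (m t'))) by apply: htPhi_; exact: law_on_torus.
have H (i j : 'I_N) : `|Phih z i j - Phi (law (m t')) (node R N i j)| <= e.
  have := Hom (m t') dens (family z) (family_Kh Kz) N N0 i j; rewrite family_eq distrC => h.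
  apply: le_trans h _; apply: Hk => //.
  by apply: Rintegral_ge0.
move=> p; have [i [j [_ _ E]]] := grid_rep (R := R) N0 p.
by rewrite (E _ (gper_mxg (Phih z))) (E _ (gper_nd N0 tPhi)) mxg_ord; exact: H.
Qed.

End Interior.
End Consistency.

(** * The pairing of the two solutions *)

Lemma young_abs (R : realType) (k x : R) : 0 < k -> `|x| <= k + (4 * k)^-1 * x ^+ 2.
Proof.
move=> k0; have k4 : 0 < 4 * k by rewrite mulr_gt0.
rewrite -(ler_pM2l k4) mulrDr mulVKf ?gt_eqF//.
have := sqr_ge0 (`|x| - 2 * k); rewrite -[x ^+ 2]real_normK ?num_real//; move: `|x| => y; clear => h.
have -> : 4 * k * k + y ^+ 2 = 4 * k * y + (y - 2 * k) ^+ 2 by ring.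
by rewrite lerDl.
Qed.

Section GlobalFacts.
Context {R : realType} (D : mfg_data R).
Local Notation beta := (beta_ D). Local Notation nu := (nu_ D). Local Notation T := (T_ D).
Local Notation Hc := (Hc_ D). Local Notation u0 := (u0_ D). Local Notation mT := (mT_ D).
Local Notation Phi := (@Phi_ _ D). Local Notation u := (u_ D). Local Notation m := (m_ D).
Local Notation Phih := (@Phih_ _ D).
Local Notation dt := (dt D).
Local Notation U := (Ud D). Local Notation Mu := (Md D). Local Notation Fh := (Fd D).
Let hb := hbeta_ D. Let hnu := hnu_ D. Let hT := hT_ D. Let hsol := hsol_ D.
Let tu t (ht : 0 <= t <= T) := (sol_periodic hsol ht).1.
Let tm t (ht : 0 <= t <= T) := (sol_periodic hsol ht).2.

Definition Vx NT N (n : nat) (p : int * int) : R := u (n%:R * dt NT) (nd N p).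
Definition Mx NT N (n : nat) (p : int * int) : R := m (n%:R * dt NT) (nd N p).

Lemma time_in NT n : (0 < NT)%N -> (n <= NT)%N -> 0 <= n%:R * dt NT <= T.
Proof. by move=> NT0 nN; rewrite dt_le// andbT mulr_ge0// ltW// dt_gt0. Qed.

Lemma gper_Vx NT N n : (0 < NT)%N -> (0 < N)%N -> (n <= NT)%N -> gper N (Vx NT N n).
Proof. by move=> NT0 N0 nN; apply: gper_nd => //; apply: tu; exact: time_in. Qed.
Lemma gper_Mx NT N n : (0 < NT)%N -> (0 < N)%N -> (n <= NT)%N -> gper N (Mx NT N n).
Proof. by move=> NT0 N0 nN; apply: gper_nd => //; apply: tm; exact: time_in. Qed.

Lemma uc_u : ucp 0 T u.
Proof. by apply: torus_uc; [apply: within_ccont; exact: (sol_cont_u hsol)|exact: tu]. Qed.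
Lemma uc_m : ucp 0 T m.
Proof. by apply: torus_uc; [apply: within_ccont; exact: (sol_cont_m hsol)|exact: tm]. Qed.

Lemma u_bound : exists2 C : R, 0 < C & forall t x, 0 <= t <= T -> `|u t x| <= C.
Proof.
have [C HC] : bdd 0 T u by apply: torus_bdd; [apply: within_ccont; exact: (sol_cont_u hsol)|exact: tu].
exists (`|C| + 1) => [|t x tT]; first by rewrite ltr_wpDl.
by apply: le_trans (HC t x tT) _; apply: le_trans (ler_norm _) _; rewrite lerDl.
Qed.

Lemma m_bound : exists2 C : R, 0 < C & forall t x, 0 <= t <= T -> C^-1 <= m t x <= C.
Proof.
have cm : ccont 0 T m by apply: within_ccont; exact: (sol_cont_m hsol).
have [C HC] : bdd 0 T m by apply: torus_bdd.
have [C' HC'] : bdd 0 T (fun t x => (m t x)^-1).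
  apply: torus_bdd => [|t tT]; last by apply: (@torus_comp _ (fun y => y^-1)); exact: tm.
  apply: within_ccont; apply/subspace_continuousP => z zT.
  have m0 : 0 < m z.1 z.2 by exact: hm_pos_.
  apply: cvgV; first by rewrite gt_eqF.
  by have /subspace_continuousP := sol_cont_m hsol; apply.
exists (`|C| + `|C'| + 1) => [|t x tT]; first by rewrite ltr_wpDl ?addr_ge0.
have m0 : 0 < m t x by exact: hm_pos_.
apply/andP; split.
  rewrite -[leRHS]invrK lef_pV2 ?posrE ?invr_gt0 ?ltr_wpDl ?addr_ge0//.
  apply: le_trans (ler_norm _) _; apply: le_trans (HC' t x tT) _; apply: le_trans (ler_norm _) _.
  by rewrite -addrA addrCA lerDl addr_ge0.
apply: le_trans (ler_norm _) _; apply: le_trans (HC t x tT) _; apply: le_trans (ler_norm _) _.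
by rewrite -addrA lerDl addr_ge0.
Qed.

Lemma m_int t : 0 <= t <= T -> \int[leb2 R]_(x in @cell R) m t x = 1.
Proof. by move=> tT; have [_ _ _ I] := sol_density hsol tT; rewrite /Rintegral I. Qed.

Lemma Mx_bounds : exists2 C : R, 0 < C & forall NT N n, (0 < NT)%N -> (0 < N)%N -> (n <= NT)%N ->
  (forall p, C^-1 <= Mx NT N n p <= C) /\ avg N (fun p => `|Mu NT N n p - Mx NT N n p|) <= C + 1.
Proof.
have [C C0 HC] := m_bound; exists C => // NT N n NT0 N0 nN.
have B p : C^-1 <= Mx NT N n p <= C by apply: HC; exact: time_in.
split => //.
have [A1 P1] := Mu_density D NT0 N0 nN.
apply: (@le_trans _ _ (avg N (fun p => C + Mu NT N n p))); last by rewrite avgD avg_cst// A1.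
apply: avg_le => p; apply: le_trans (ler_normB _ _) _; rewrite addrC; apply: lerD.
  by have /andP[b1 b2] := B p; rewrite ger0_norm//; apply: le_trans b1; rewrite invr_ge0 ltW.
by rewrite ger0_norm.
Qed.

(** The exact and the discrete densities are both close to [mT]. *)
Lemma near_T (e : R) : 0 < e -> exists2 r : R, 0 < r & forall NT N n, (0 < NT)%N -> (0 < N)%N -> dt NT < r ->
  step R N < r -> (n <= NT)%N -> T - n%:R * dt NT < r -> avg N (fun p => (Mu NT N n p - Mx NT N n p) ^+ 2) <= e.
Proof.
move=> e0; have [K K0 HK] := M_near_terminal D.
have e8 : 0 < e / 8 by rewrite divr_gt0.
have [r1 r10 H1] := HK _ e8.
have e80 : 0 < Num.min 1 (e / 8) by rewrite lt_min ltr01.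
have [r2 r20 H2] := uc_m e80.
have eK : 0 < e / (8 * (K + 1)) by rewrite divr_gt0// mulr_gt0// ltr_wpDl.
exists (Num.min r1 (Num.min r2 (e / (8 * (K + 1))))); first by rewrite !lt_min r10 r20.
move=> NT N n NT0 N0; rewrite !lt_min => /and3P[d1 _ _] /and3P[s1 _ _] nN /and3P[_ t2 t3].
have A := H1 NT N n NT0 N0 d1 s1 nN.
have tT := time_in NT0 nN.
have /andP[_ tT'] := tT.
have B p : (mT (nd N p) - Mx NT N n p) ^+ 2 <= e / 8.
  have := H2 T (n%:R * dt NT) (nd N p) (nd N p).
  rewrite (ltW hT) lexx ger0_norm ?subr_ge0// subrr normr0 => /(_ erefl tT t2 r20).
  rewrite (sol_terminal hsol) -/(Mx NT N n p); move: (mT (nd N p) - _) => z; rewrite lt_min => /andP[z1 z2].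
  rewrite -real_normK ?num_real// expr2; apply: le_trans (ltW z2); rewrite ler_piMl// ltW//.
have KT : K * (T - n%:R * dt NT) <= e / 8.
  apply: (@le_trans _ _ ((K + 1) * (e / (8 * (K + 1))))); last first.
    by rewrite le_eqVlt; apply/orP; left; apply/eqP; field; rewrite gt_eqF// ltr_wpDl.
  by apply: ler_pM => //; [rewrite subr_ge0|rewrite lerDl|exact: ltW].
apply: (@le_trans _ _ (avg N (fun p => 2 * (Mu NT N n p - mT (nd N p)) ^+ 2 + 2 * (e / 8)))).
  apply: avg_le => p; have := B p; move: (Mu NT N n p) (mT (nd N p)) (Mx NT N n p) => x y z h.
  have -> : 2 * (x - y) ^+ 2 + 2 * (e / 8) = (x - z) ^+ 2 + (x - y - (y - z)) ^+ 2 + 2 * (e / 8 - (y - z) ^+ 2) by ring.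
  by rewrite -addrA lerDl addr_ge0 ?sqr_ge0// mulr_ge0// subr_ge0.
rewrite avgD avg_cst// avgZ; move: A KT; move: (avg _ _) (K * _) => *; lra.
Qed.

Section Interior.
Variables (a b : R).
Hypotheses (ha : 0 < a) (hbT : b < T).

Let ab_in t : a <= t <= b -> 0 <= t <= T := inside_le ha hbT (t := t).

(** The nodal values of a density have mean close to one only; the monotonicity of the discrete
coupling concerns elements of [Kh], so they are rescaled. *)
Lemma normalized (e : R) : 0 < e -> exists2 r : R, 0 < r & forall N t, (0 < N)%N -> step R N < r -> a <= t <= b ->
  exists2 z : 'M[R]_N, Kh z & forall p, `|mxg z p - m t (nd N p)| <= e.
Proof.
move=> e0; have [C C0 HC] := m_bound.
have uab : ucp a b m by exact: (uc_sol (sol_C12_m hsol) tm ha hbT).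
pose k := Num.min 2^-1 (e / (2 * C)).
have k0 : 0 < k by rewrite lt_min invr_gt0 ltr0n divr_gt0// mulr_gt0.
have [r r0 Hr] := riemann_ucp uab (fun t tab => tm (ab_in tab)) k0.
exists r => // N t N0 sr tab.
have tT := ab_in tab.
have := Hr N t N0 sr tab; rewrite (m_int tT).
have pm : gper N (fun p => m t (nd N p)) by apply: gper_nd => //; exact: tm.
set S := avg N _ => HS.
have k12 : k <= 2^-1 by rewrite ge_min lexx.
have kC : k <= e / (2 * C) by rewrite ge_min lexx orbT.
have S12 : 2^-1 <= S by move: HS; rewrite ler_norml => /andP[+ _]; lra.
have S0 : 0 < S by apply: lt_le_trans S12; rewrite invr_gt0.
have pz : gper N (fun p => S^-1 * m t (nd N p)) by move=> q i; rewrite pm.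
exists (gmx N (fun p => S^-1 * m t (nd N p))).
  apply/(Kh_avg N0); split.
    by rewrite (eq_avg N (mxg_gmx N0 pz)) avgZ mulVf// gt_eqF.
  by move=> p; rewrite (mxg_gmx N0 pz) mulr_ge0 ?invr_ge0 ?(ltW S0)// ltW// hm_pos_.
move=> p; rewrite (mxg_gmx N0 pz) -[X in _ - X]mul1r -mulrBl normrM.
have /andP[m1 m2] := HC t (nd N p) tT.
have m0 : 0 <= m t (nd N p) by apply: le_trans m1; rewrite invr_ge0 ltW.
rewrite (ger0_norm m0).
have -> : S^-1 - 1 = (1 - S) / S by rewrite mulrBl mul1r mulfV// gt_eqF.
rewrite normrM normfV (gtr0_norm S0) distrC.
apply: (@le_trans _ _ (e / (2 * C) * 2 * C)); last first.
  by rewrite le_eqVlt; apply/orP; left; apply/eqP; field; rewrite gt_eqF.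
apply: ler_pM => //; first by rewrite mulr_ge0// invr_ge0 ltW.
apply: ler_pM => //; [by rewrite invr_ge0 ltW|exact: le_trans HS kC|].
by rewrite -[leRHS]invrK lef_pV2 ?posrE ?invr_gt0.
Qed.

(** The monotonicity of the discrete coupling at the discrete density and at the rescaled exact
one, up to the consistency errors of the coupling and of the Hamilton-Jacobi equation. *)
Lemma coupling_inequality (e : R) : 0 < e -> exists2 r : R, 0 < r & forall NT N n, (0 < NT)%N -> (0 < N)%N -> dt NT < r ->
  step R N < r -> (n < NT)%N -> a <= n%:R * dt NT -> n.+1%:R * dt NT <= b ->
  - e <= avg N (fun p => (Fh NT N n p - Hc (nd N p) -
     ((Vx NT N n.+1 p - Vx NT N n p) / dt NT - nu * Lapg N (Vx NT N n.+1) p + Gg N beta (Vx NT N n.+1) p)) *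
       (Mu NT N n p - Mx NT N n p)).
Proof.
move=> e0; have [C C0 HC] := Mx_bounds; have [C1 C10 HF] := Phih3_grid D.
pose e1 := e / (4 * (C + 1)).
have C4 : 0 < 4 * (C + 1) by rewrite mulr_gt0// ltr_wpDl// ltW.
have e10 : 0 < e1 by rewrite divr_gt0.
pose e2 := e / (4 * (C1 + 1)).
have C14 : 0 < 4 * (C1 + 1) by rewrite mulr_gt0// ltr_wpDl.
have e20 : 0 < e2 by rewrite divr_gt0.
have [r1 r10 H1] := hjb_consistency ha hbT e10.
have [r2 r20 H2] := coupling_consistency ha hbT e10.
have e3 : 0 < Num.min r2 e2 by rewrite lt_min r20.
have [r3 r30 H3] := normalized e3.
exists (Num.min r1 (Num.min r2 r3)); first by rewrite !lt_min r10 r20.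
move=> NT N n NT0 N0; rewrite !lt_min => /and3P[d1 d2 d3] /and3P[s1 s2 s3] nN at_ tb.
have dt0 := dt_gt0 D NT0.
have E : n.+1%:R * dt NT = n%:R * dt NT + dt NT by rewrite -natr1 mulrDl mul1r.
have tab : a <= n%:R * dt NT <= b by rewrite at_ (le_trans _ tb)// E lerDl ltW.
have tab' : a <= n.+1%:R * dt NT <= b by rewrite tb andbT (le_trans at_)// E lerDl ltW.
have [z Kz Hz] := H3 N (n%:R * dt NT) N0 s3 tab.
have tt : `|n%:R * dt NT - n.+1%:R * dt NT| < r2 by rewrite E opprD addrA subrr sub0r normrN gtr0_norm.
have zr : avg N (fun p => `|mxg z p - m (n%:R * dt NT) (nd N p)|) <= r2.
  rewrite -[leRHS](avg_cst N0); apply: avg_le => p; apply: le_trans (Hz p) _; by rewrite ge_min lexx.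
have P1 := H2 N _ _ z N0 s2 tab tab' tt Kz zr.
have tb' : n%:R * dt NT + dt NT <= b by rewrite -E.
have dtr : 0 < dt NT < r1 by rewrite dt0.
have P2 p := H1 N (dt NT) (n%:R * dt NT) p N0 s1 dtr at_ tb'.
have P3 := @Phih2_grid R D N _ _ N0 (dsol_density (hdsol_ D NT0 N0) (ltnW nN)) Kz.
set B := fun p => (Vx NT N n.+1 p - Vx NT N n p) / dt NT - nu * Lapg N (Vx NT N n.+1) p + Gg N beta (Vx NT N n.+1) p.
have P2' p : `|B p - (Phi (law (m (n.+1%:R * dt NT))) (nd N p) - Hc (nd N p))| <= e1.
  by have := P2 p; rewrite -E.
have [_ HE] := HC NT N n NT0 N0 (ltnW nN).
have [FB _] := HF N _ N0 (dsol_density (hdsol_ D NT0 N0) (ltnW nN)).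
have [FB' _] := HF N _ N0 Kz.
have pt p : (Fh NT N n p - mxg (Phih z) p) * (Mu NT N n p - mxg z p) - (2 * C1 * e2 + 2 * e1 * `|Mu NT N n p - Mx NT N n p|) <=
   (Fh NT N n p - Hc (nd N p) - B p) * (Mu NT N n p - Mx NT N n p).
  have q1 : `|(Fh NT N n p - mxg (Phih z) p) * (mxg z p - Mx NT N n p)| <= 2 * C1 * e2.
    rewrite normrM; apply: ler_pM => //.
      apply: le_trans (ler_normB _ _) _; apply: le_trans (lerD (FB p) (FB' p)) _.
      by rewrite -mulr2n -[_ *+ 2]mulr_natl.
    by apply: le_trans (Hz p) _; rewrite ge_min lexx orbT.
  have q2 : `|(mxg (Phih z) p - Hc (nd N p) - B p) * (Mu NT N n p - Mx NT N n p)| <= 2 * e1 * `|Mu NT N n p - Mx NT N n p|.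
    rewrite normrM; apply: ler_wpM2r => //.
    have -> : mxg (Phih z) p - Hc (nd N p) - B p = (mxg (Phih z) p - Phi (law (m (n.+1%:R * dt NT))) (nd N p)) -
       (B p - (Phi (law (m (n.+1%:R * dt NT))) (nd N p) - Hc (nd N p))) by ring.
    apply: le_trans (ler_normB _ _) _; apply: le_trans (lerD (P1 p) (P2' p)) _.
    by rewrite -mulr2n -[_ *+ 2]mulr_natl.
  have -> : (Fh NT N n p - Hc (nd N p) - B p) * (Mu NT N n p - Mx NT N n p) =
     (Fh NT N n p - mxg (Phih z) p) * (Mu NT N n p - mxg z p) + ((Fh NT N n p - mxg (Phih z) p) * (mxg z p - Mx NT N n p) +
      (mxg (Phih z) p - Hc (nd N p) - B p) * (Mu NT N n p - Mx NT N n p)) by ring.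
  rewrite lerD2l; move: q1 q2; rewrite !ler_norml => /andP[q1 _] /andP[q2 _]; rewrite opprD; exact: lerD.
apply: le_trans (avg_le N pt); rewrite avgB avgD avg_cst// avgZ.
have c1 : 2 * C1 * e2 <= e / 2.
  apply: (@le_trans _ _ (2 * (C1 + 1) * e2)); first by rewrite ler_pM2r// ler_pM2l// lerDl.
  by rewrite /e2 le_eqVlt; apply/orP; left; apply/eqP; field; rewrite gt_eqF// ltr_wpDl.
have c2 : 2 * e1 * avg N (fun p => `|Mu NT N n p - Mx NT N n p|) <= e / 2.
  apply: (@le_trans _ _ (2 * e1 * (C + 1))); first by rewrite ler_wpM2l// mulr_ge0// ltW.
  by rewrite /e1 le_eqVlt; apply/orP; left; apply/eqP; field; rewrite gt_eqF// ltr_wpDl// ltW.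
move: P3 c1 c2; rewrite -/(Mu NT N n) -/(Fh NT N n); move: (avg _ _) (avg _ _) => y1 y2.
move: (2 * C1 * e2) (2 * e1 * _) => *; lra.
Qed.

End Interior.
End GlobalFacts.

(** * Convergence of the gradients *)

Lemma sum_nat_sub (R : realType) (F : nat -> R) (n0 n0' n1' n1 : nat) : (n0 <= n0')%N -> (n0' <= n1')%N -> (n1' <= n1)%N ->
  (forall n, (n0 <= n < n1)%N -> 0 <= F n) -> \sum_(n0' <= n < n1') F n <= \sum_(n0 <= n < n1) F n.
Proof.
move=> h0 h1 h2 F0.
have S a b : (n0 <= a)%N -> (b <= n1)%N -> 0 <= \sum_(a <= n < b) F n.
  move=> ha hb; rewrite big_seq; apply: sumr_ge0 => n; rewrite mem_index_iota => /andP[an nb].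
  by apply: F0; rewrite (leq_trans ha an) (leq_trans nb hb).
rewrite (@big_cat_nat _ _ _ n0' n0 n1)//=; last exact: leq_trans h1 h2.
rewrite (@big_cat_nat _ _ _ n1' n0' n1)//=.
have s1 := S n0 n0' (leqnn _) (leq_trans h1 h2); have s2 := S n1' n1 (leq_trans h0 h1) (leqnn _).
by rewrite addrCA lerDl addr_ge0.
Qed.

Lemma steps_around (R : realType) (x d : R) : 0 <= x -> 0 < d -> exists n : nat, n%:R * d <= x < n.+1%:R * d.
Proof.
move=> x0 d0; exists (Num.truncn (x / d)).
have := @truncn_itv R (x / d); rewrite divr_ge0 ?(ltW d0)// => /(_ erefl).
by rewrite ler_pdivlMr// ltr_pdivrMr.
Qed.

Lemma gap_split (R : realType) (z1 z2 z3 z4 z5 e : R) : 0 <= z1 -> - e <= z3 -> z4 <= z5 ->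
  z2 <= z1 + z2 + z3 - z4 + (e + z5).
Proof. by move=> h1 h2 h3; lra. Qed.

Section GradientEstimate.
Context {R : realType} (D : mfg_data R).
Local Notation beta := (beta_ D). Local Notation nu := (nu_ D). Local Notation T := (T_ D).
Local Notation Hc := (Hc_ D). Local Notation u0 := (u0_ D). Local Notation mT := (mT_ D).
Local Notation Phi := (@Phi_ _ D). Local Notation u := (u_ D). Local Notation m := (m_ D).
Local Notation Phih := (@Phih_ _ D).
Local Notation dt := (dt D).
Local Notation U := (Ud D). Local Notation Mu := (Md D). Local Notation Fh := (Fd D).
Local Notation V := (Vx D). Local Notation M := (Mx D).
Let hb := hbeta_ D. Let hnu := hnu_ D. Let hT := hT_ D. Let hsol := hsol_ D.
Let tu t (ht : 0 <= t <= T) := (sol_periodic hsol ht).1.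

(** The divergence is moved to [phi] by summation by parts; as the residuals are small in mean
square only, Young's inequality with a small weight [k] separates them. *)
Lemma avg_resid N (r : 'I_2 -> int * int -> R) (s phi : int * int -> R) (P k : R) : (0 < N)%N ->
  (forall i, gper N (r i)) -> gper N phi -> 0 < k ->
  (forall i p, `|Dp N i phi p| <= P) -> (forall p, `|phi p| <= P) ->
  avg N (fun p => (\sum_i Dm N i (r i) p + s p) * phi p) <=
  P * (3 * k + (4 * k)^-1 * (\sum_i avg N (fun p => r i p ^+ 2) + avg N (fun p => s p ^+ 2))).
Proof.
move=> N0 pr pphi k0 HD Hphi.
have P0 : 0 <= P by apply: le_trans (Hphi (0, 0)).
have B (f g : int * int -> R) : (forall p, `|g p| <= P) -> `|avg N (fun p => f p * g p)| <= P * (k + (4 * k)^-1 * avg N (fun p => f p ^+ 2)).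
  move=> gP; apply: le_trans (avg_norm _ _) _.
  rewrite -avgZ -[X in X + _](avg_cst N0) -avgD -avgZ; apply: avg_le => p.
  rewrite normrM mulrC; apply: ler_pM => //; exact: young_abs.
have -> : avg N (fun p => (\sum_i Dm N i (r i) p + s p) * phi p) =
   - avg N (fun p => r 0 p * Dp N 0 phi p) - avg N (fun p => r 1 p * Dp N 1 phi p) + avg N (fun p => s p * phi p).
  rewrite -!avg_partsN// -!avgD; apply: eq_avg => p; rewrite sum2E; ring.
have := B (r 0) (Dp N 0 phi) (HD 0); have := B (r 1) (Dp N 1 phi) (HD 1); have := B s phi Hphi.
rewrite sum2E !ler_norml.
move: (avg N (fun p => r 0 p * _)) (avg N (fun p => r 1 p * _)) (avg N (fun p => s p * _)).
move: (avg N (fun p => r 0 p ^+ 2)) (avg N (fun p => r 1 p ^+ 2)) (avg N (fun p => s p ^+ 2)) => x1 x2 x3 y1 y2 y3.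
move=> /andP[_ h3] /andP[h2 _] /andP[h1 _].
have -> : P * (3 * k + (4 * k)^-1 * (x1 + x2 + x3)) = P * (k + (4 * k)^-1 * x1) + P * (k + (4 * k)^-1 * x2) + P * (k + (4 * k)^-1 * x3) by ring.
by apply: lerD => //; apply: lerD; rewrite lerNl.
Qed.

Lemma V_lipschitz a b : 0 < a -> b < T -> exists2 L : R, 0 < L & forall NT N n i p, (0 < N)%N ->
  a <= n%:R * dt NT <= b -> `|Dp N i (V NT N n) p| <= L.
Proof.
move=> ha hbT; have Cu := sol_C12_u hsol.
have [K0 HK0] := bdd_pd Cu tu ha hbT 0; have [K1 HK1] := bdd_pd Cu tu ha hbT 1.
exists (`|K0| + `|K1| + 1) => [|NT N n i p N0 tab]; first by rewrite ltr_wpDl// addr_ge0.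
apply: Dp_bound => // [x j|x j].
  by have [_ + _] := Cu.1 _ x (inside ha hbT tab); apply.
rewrite -addrA; elim/ord2P: j; [apply: le_trans (HK0 _ x tab) _|apply: le_trans (HK1 _ x tab) _]; apply: le_trans (ler_norm _) _.
  by rewrite lerDl addr_ge0.
by rewrite addrCA lerDl addr_ge0.
Qed.

(** [U] leaves [u0] at most linearly in time, and [u] is continuous at time zero. *)
Lemma initial_layer (e : R) : 0 < e -> exists2 r : R, 0 < r & forall NT N n p, (0 < NT)%N -> (0 < N)%N ->
  (n <= NT)%N -> n%:R * dt NT < r -> `|U NT N n p - V NT N n p| <= e.
Proof.
move=> e0; have e2 : 0 < e / 2 by rewrite divr_gt0.
have [C C0 HC] := U_bounds D; have [r r0 Hr] := uc_u D e2.
have eC : 0 < e / (2 * (C + 1)) by rewrite divr_gt0// mulr_gt0// ltr_wpDl.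
exists (Num.min r (e / (2 * (C + 1)))); first by rewrite lt_min r0.
move=> NT N n p NT0 N0 nN; rewrite lt_min => /andP[t1 t2].
have [_ _ H] := HC NT N n NT0 N0 nN.
have tT := time_in D NT0 nN; have /andP[t0 _] := tT.
rewrite -[U NT N n p - _](subrKA (u0 (nd N p))) [leRHS](splitr e).
apply: le_trans (ler_normD _ _) _; apply: lerD.
  apply: le_trans (H p) _; apply: (@le_trans _ _ ((C + 1) * (e / (2 * (C + 1))))).
    by apply: ler_pM => //; [rewrite lerDl|exact: ltW].
  by rewrite le_eqVlt; apply/orP; left; apply/eqP; field; rewrite gt_eqF// ltr_wpDl.
rewrite -(sol_initial hsol); apply: ltW; apply: Hr => //; rewrite ?lexx ?(ltW hT) ?subrr ?normr0//.
by rewrite sub0r normrN ger0_norm.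
Qed.

Let convexity_ge0 (L : R) : 0 <= beta * (beta - 1) / 2 * L `^ (beta - 2).
Proof. by case/andP: hb => b1 b2; rewrite !mulr_ge0 ?powR_ge0//; lra. Qed.

(** Sum [mfg_identity] over the steps in a larger interval [[a, b]]: the gap of [Mu] is
nonnegative, that of [M] bounds the gradients from above, and all other terms are small. The
constant of strong convexity is that of the fixed interval [[a', b']], hence it does not depend on
how close [a] and [b] are to the ends. *)
Lemma gradient_sum (a' b' eta : R) : 0 < a' -> a' <= b' -> b' < T -> 0 < eta ->
  exists2 r : R, 0 < r & forall NT N n0' n1', (0 < NT)%N -> (0 < N)%N -> dt NT < r -> step R N < r ->
  (n0' <= n1' <= NT)%N -> a' <= n0'%:R * dt NT -> n1'%:R * dt NT <= b' ->
  dt NT * \sum_(n0' <= n < n1') avg N (fun p => nsq (fun k => Pv N (U NT N n.+1) p k - Pv N (V NT N n.+1) p k)) <= eta.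
Proof.
move=> ha' hab' hbT' eta0.
have [CU CU0 HU] := U_bounds D; have [CM CM0 HM] := Mx_bounds D; have [Cu Cu0 Hu] := u_bound D.
have [L' L'0 HL'] := V_lipschitz ha' hbT'.
pose L1 := CU + L'; have L10 : 0 < L1 by rewrite ltr_wpDl.
pose c' := beta * (beta - 1) / 2 * (2 * L1) `^ (beta - 2).
have c'0 : 0 < c'.
  by case/andP: hb => b1 b2; rewrite /c' !mulr_gt0 ?subr_gt0 ?powR_gt0 ?mulr_gt0//; lra.
(* the constants below make each of the four error terms at most [Q / 4] *)
pose Q := CM^-1 * c' * eta.
have Q0 : 0 < Q by apply: mulr_gt0 => //; apply: mulr_gt0 => //; rewrite invr_gt0.
pose Cphi := CU + Cu; have Cphi0 : 0 < Cphi by rewrite ltr_wpDl.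
(* [a] is so small that the initial layer bounds the pairing at the first step, and [b] so close to
   [T] that the densities agree at the last one; [a', b'] lies in between *)
have q1 : 0 < Q / (4 * (CM + 1)) by rewrite divr_gt0// mulr_gt0// ltr_wpDl// ltW.
have [ra ra0 Ha] := initial_layer q1.
pose a := Num.min (a' / 2) (ra / 2).
have a0 : 0 < a by rewrite lt_min !divr_gt0.
have aa' : a <= a' / 2 by rewrite ge_min lexx.
have ara : a <= ra / 2 by rewrite ge_min lexx orbT.
pose k1 := Q / (8 * Cphi).
have k10 : 0 < k1 by rewrite divr_gt0// mulr_gt0.
have k1e : 0 < 4 * k1 * k1 by apply: mulr_gt0 => //; exact: mulr_gt0.
have [rb rb0 Hb] := near_T D k1e.
pose b := Num.max ((b' + T) / 2) (T - rb / 2).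
have bb' : (b' + T) / 2 <= b by rewrite le_max lexx.
have brb : T - rb / 2 <= b by rewrite le_max lexx orbT.
have bT : b < T by rewrite gt_max; apply/andP; split; clear -D hT hbT' rb0; lra.
have ab : a <= b by clear -D aa' ha' hab' hbT' bb'; lra.
have [L L0 HL] := V_lipschitz a0 bT.
pose L2 := CU + L; have L20 : 0 < L2 by rewrite ltr_wpDl.
pose P := L2 + Cphi.
have P0 : 0 < P by rewrite addr_gt0.
have PT : 0 < 24 * P * (T + 1) by apply: mulr_gt0; [exact: mulr_gt0|rewrite ltr_wpDl// ltW].
pose k := Q / (24 * P * (T + 1)).
have k0 : 0 < k by rewrite divr_gt0.
pose eR := Q * k / (2 * P).
have eR0 : 0 < eR by apply: divr_gt0; exact: mulr_gt0.
have [r1 r10 H1] := fp_consistency hb hsol (@hm_pos_ _ D) hnu a0 bT ab eR0.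
pose eC := Q / (8 * (T + 1)).
have eC0 : 0 < eC by rewrite divr_gt0// mulr_gt0// ltr_wpDl// ltW.
have [r2 r20 H2] := coupling_inequality a0 bT eC0.
pose r := Num.min (Num.min r1 r2) (Num.min (Num.min (ra / 2) (a' / 2)) (Num.min rb (Num.min (rb / 2) ((T - b') / 2)))).
have r0 : 0 < r by rewrite !lt_min r10 r20 !divr_gt0 ?rb0 ?subr_gt0.
exists r => // NT N n0' n1' NT0 N0.
rewrite /r !lt_min => /and3P[/andP[d1 d2] /andP[d3 d4] /and3P[d5 d6 d7]] /and3P[/andP[s1 s2] _ /and3P[s5 _ _]].
move=> /andP[n01' n1N'] an0 n1b.
have dt0 := dt_gt0 D NT0.
have [n0p /andP[A1 A2]] := steps_around (ltW a0) dt0.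
have b_ge0 : 0 <= b by apply: le_trans ab; exact: ltW.
have [n1 /andP[B1 B2]] := steps_around b_ge0 dt0.
pose n0 := n0p.+1.
have S1 (j : nat) : j.+1%:R * dt NT = j%:R * dt NT + dt NT by rewrite -natr1 mulrDl mul1r.
have lt_le (i j : nat) : i%:R * dt NT < j.+1%:R * dt NT -> (i <= j)%N by rewrite ltr_pM2r// ltr_nat ltnS.
have n00' : (n0 <= n0')%N by apply: lt_le; rewrite /n0 !S1; clear -D A1 aa' an0 ha'; lra.
have n11' : (n1' <= n1)%N by apply: lt_le; apply: le_lt_trans B2; clear -D n1b bb' hbT'; lra.
have n1N : (n1 <= NT)%N.
  by apply: lt_le; rewrite S1 dt_NT//; clear -D B1 bT dt0; lra.
have n01 : (n0 <= n1)%N by apply: leq_trans n00' (leq_trans n01' n11').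
have n0N : (n0 <= NT)%N := leq_trans n01 n1N.
have an0' : a <= n0%:R * dt NT by exact: ltW.
have dr1 : 0 < dt NT < r1 by rewrite dt0.
have [r_ [s_ [pr Er Sr]]] := H1 N (dt NT) n0 n1 N0 s1 dr1 n01 an0' B1.
have inab n : (n0 <= n < n1)%N -> [/\ (n < NT)%N, a <= n%:R * dt NT <= b & a <= n.+1%:R * dt NT <= b].
  by move=> hn; have [i1 i2 _] := steps_in_interval dt0 an0' B1 hn; split=> //; case/andP: hn => _ h; exact: leq_trans h n1N.
pose phi n p := U NT N n p - V NT N n p.
pose e n p := Mu NT N n p - M NT N n p.
pose E1 n p := Gg N beta (V NT N n.+1) p - Gg N beta (U NT N n.+1) p - Lin N beta (U NT N n.+1) (fun q => V NT N n.+1 q - U NT N n.+1 q) p.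
pose E2 n p := Gg N beta (U NT N n.+1) p - Gg N beta (V NT N n.+1) p - Lin N beta (V NT N n.+1) (fun q => U NT N n.+1 q - V NT N n.+1 q) p.
pose y n := \sum_i avg N (fun p => r_ n i p ^+ 2) + avg N (fun p => s_ n p ^+ 2).
have phiC n p : (n <= NT)%N -> `|phi n p| <= Cphi.
  move=> nN; have [h1 _ _] := HU NT N n NT0 N0 nN.
  apply: le_trans (ler_normB _ _) _; apply: lerD => //; apply: Hu; exact: time_in.
have DpB n i p : (n <= NT)%N -> a <= n%:R * dt NT <= b -> `|Dp N i (U NT N n) p| <= CU /\ `|Dp N i (V NT N n) p| <= L.
  by move=> nN tab; have [_ h1 _] := HU NT N n NT0 N0 nN; split=> //; exact: HL.
have pU n := @gper_U _ D NT N n.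
have pM n : (n <= NT)%N -> gper N (M NT N n) by move=> nN; exact: gper_Mx.
have pV n : (n <= NT)%N -> gper N (V NT N n) by move=> nN; exact: gper_Vx.
have E1_ge0 n p : (n0 <= n < n1)%N -> 0 <= E1 n p.
  move=> hn; have [nN t1 t2] := inab n hn.
  have LU i q : `|Dp N i (U NT N n.+1) q| <= L2.
    by have [h1 _] := DpB n.+1 i q nN t2; apply: le_trans h1 _; rewrite lerDl ltW.
  have LV i q : `|Dp N i (V NT N n.+1) q| <= L2.
    by have [_ h1] := DpB n.+1 i q nN t2; apply: le_trans h1 _; rewrite lerDr.
  apply: le_trans (Gg_convex hb p (ltW L20) LU LV); by rewrite mulr_ge0 ?nsq_ge0 ?convexity_ge0.
have E2_ge0 n p : (n0 <= n < n1)%N -> 0 <= E2 n p.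
  move=> hn; have [nN t1 t2] := inab n hn.
  have LU i q : `|Dp N i (U NT N n.+1) q| <= L2.
    by have [h1 _] := DpB n.+1 i q nN t2; apply: le_trans h1 _; rewrite lerDl ltW.
  have LV i q : `|Dp N i (V NT N n.+1) q| <= L2.
    by have [_ h1] := DpB n.+1 i q nN t2; apply: le_trans h1 _; rewrite lerDr.
  apply: le_trans (Gg_convex hb p (ltW L20) LV LU); by rewrite mulr_ge0 ?nsq_ge0 ?convexity_ge0.
have M0 n p : (n <= NT)%N -> CM^-1 <= M NT N n p by move=> nN; have [h _] := HM NT N n NT0 N0 nN; case/andP: (h p).
have CMi : 0 < CM^-1 by rewrite invr_gt0.
have step n : (n0 <= n < n1)%N -> dt NT * avg N (fun p => M NT N n p * E2 n p) <=
    avg N (fun p => phi n.+1 p * e n.+1 p) - avg N (fun p => phi n p * e n p) +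
    dt NT * (eC + P * (3 * k + (4 * k)^-1 * y n)).
  move=> hn; have [nN t1 t2] := inab n hn; have nN' := ltnW nN.
  have ID := mfg_identity (pU n.+1) (pV n.+1 nN) (@gper_Mu _ D NT N n) (pM n nN') dt0
    (fun p => @HJB_scheme _ D NT N NT0 N0 n p nN) (fun p => erefl) (fun p => @FP_scheme _ D NT N NT0 N0 n p nN)
    (fun p => Er n p hn).
  have I1 : 0 <= avg N (fun p => Mu NT N n p * E1 n p).
    by apply: avg_ge0 => p; apply: mulr_ge0; [have [_ h] := Mu_density D NT0 N0 nN'; exact: h|exact: E1_ge0].
  have I2 := H2 NT N n NT0 N0 d2 s2 nN (proj1 (andP t1)) (proj2 (andP t2)).
  have HP i p : `|Dp N i (phi n.+1) p| <= P.
    have [h1 h2] := DpB n.+1 i p nN t2.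
    have -> : Dp N i (phi n.+1) p = Dp N i (U NT N n.+1) p - Dp N i (V NT N n.+1) p by rewrite /phi /Dp; ring.
    apply: le_trans (ler_normB _ _) _; apply: le_trans (lerD h1 h2) _.
    by rewrite -/L2 /P lerDl ltW.
  have HP' p : `|phi n.+1 p| <= P by apply: le_trans (phiC _ p nN) _; rewrite /P lerDr ltW.
  have I3 := avg_resid (s_ n) N0 (fun i => pr n i hn) (gperB (pU n.+1) (pV n.+1 nN)) k0 HP HP'.
  move: ID I1 I2 I3; rewrite -/(phi n.+1) -/(phi n).
  rewrite -/(y n).
  move=> ID I1 I2 I3.
  have -> : avg N (fun p => phi n.+1 p * e n.+1 p) - avg N (fun p => phi n p * e n p) = _ := ID (V NT N n).
  rewrite -mulrDr ler_pM2l//.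
  move: I1 I2 I3; rewrite -/(E1 n) -/(E2 n).
  exact: gap_split.
have SUM : dt NT * \sum_(n0 <= n < n1) avg N (fun p => M NT N n p * E2 n p) <=
   avg N (fun p => phi n1 p * e n1 p) - avg N (fun p => phi n0 p * e n0 p) +
   ((n1 - n0)%:R * dt NT) * (eC + P * (3 * k)) + P * (4 * k)^-1 * (dt NT * \sum_(n0 <= n < n1) y n).
  rewrite -(telescope_sumr (fun n => avg N (fun p => phi n p * e n p)) n01) mulr_sumr.
  apply: (@le_trans _ _ (\sum_(n0 <= n < n1) (avg N (fun p => phi n.+1 p * e n.+1 p) - avg N (fun p => phi n p * e n p) +
    dt NT * (eC + P * (3 * k + (4 * k)^-1 * y n))))).
    by rewrite !big_seq; apply: ler_sum => n; rewrite mem_index_iota; exact: step.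
  rewrite big_split /= -addrA lerD2l -mulr_sumr le_eqVlt; apply/orP; left; apply/eqP.
  rewrite (eq_bigr (fun n => (eC + P * (3 * k)) + P * (4 * k)^-1 * y n)); last by move=> n _; ring.
  by rewrite big_split /= sumr_const_nat -mulr_sumr -mulr_natl; ring.
have nT : (n1 - n0)%:R * dt NT <= T + 1.
  rewrite natrB// mulrBl; have : 0 <= n0%:R * dt NT by apply: le_trans an0'; exact: ltW.
  by clear -D B1 bT => ?; lra.
have nT0 : 0 <= (n1 - n0)%:R * dt NT by rewrite mulr_ge0 ?(ltW dt0).
have ebound n : (n <= NT)%N -> avg N (fun p => `|e n p|) <= CM + 1 by move=> nN; have [_ h] := HM NT N n NT0 N0 nN.
have T1 : avg N (fun p => phi n1 p * e n1 p) <= Q / 4.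
  have near1 : T - n1%:R * dt NT < rb by move: B2; rewrite S1; clear -D brb d6 => B2; lra.
  have sq1 := Hb NT N n1 NT0 N0 d5 s5 n1N near1.
  apply: (@le_trans _ _ (Cphi * (k1 + (4 * k1)^-1 * (4 * k1 * k1)))); last first.
    by rewrite /k1 le_eqVlt; apply/orP; left; apply/eqP; field; rewrite !gt_eqF.
  apply: (@le_trans _ _ (Cphi * (k1 + (4 * k1)^-1 * avg N (fun p => e n1 p ^+ 2)))); last first.
    rewrite ler_pM2l// lerD2l; apply: ler_wpM2l => //; rewrite invr_ge0; apply: mulr_ge0 => //; exact: ltW.
  rewrite -avgZ -[X in X + _](avg_cst N0) -avgD -avgZ; apply: avg_le => p.
  apply: le_trans (ler_norm _) _; rewrite normrM; apply: ler_pM => //; [exact: phiC|exact: young_abs].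
have T0 : - avg N (fun p => phi n0 p * e n0 p) <= Q / 4.
  have near0 : n0%:R * dt NT < ra by rewrite /n0 S1; clear -D A1 ara d3; lra.
  apply: (@le_trans _ _ (Q / (4 * (CM + 1)) * avg N (fun p => `|e n0 p|))); last first.
    apply: (@le_trans _ _ (Q / (4 * (CM + 1)) * (CM + 1))).
      by apply: ler_wpM2l; [exact: ltW|exact: ebound].
    by rewrite le_eqVlt; apply/orP; left; apply/eqP; field; rewrite gt_eqF// ltr_wpDl// ltW.
  rewrite -avgN -avgZ; apply: avg_le => p; apply: le_trans (ler_norm _) _; rewrite normrN normrM.
  by apply: ler_wpM2r => //; exact: Ha.
have T2 : ((n1 - n0)%:R * dt NT) * (eC + P * (3 * k)) <= Q / 4.
  apply: (@le_trans _ _ ((T + 1) * (eC + P * (3 * k)))).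
    apply: ler_wpM2r => //; apply: addr_ge0; first exact: ltW.
    by apply: mulr_ge0; [exact: ltW|apply: mulr_ge0 => //; exact: ltW].
  have T10 : 0 < T + 1 by rewrite ltr_wpDl// ltW.
  by rewrite /eC /k le_eqVlt; apply/orP; left; apply/eqP; field; rewrite !gt_eqF.
have T3 : P * (4 * k)^-1 * (dt NT * \sum_(n0 <= n < n1) y n) <= Q / 4.
  apply: (@le_trans _ _ (P * (4 * k)^-1 * eR)).
    apply: ler_wpM2l => //; apply: mulr_ge0; first exact: ltW.
    by rewrite invr_ge0; apply: mulr_ge0 => //; exact: ltW.
  have -> : P * (4 * k)^-1 * eR = Q * 8^-1 by rewrite /eR; field; rewrite !gt_eqF.
  by rewrite ler_pM2l// lef_pV2 ?posrE// ler_nat.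
have TOT : dt NT * \sum_(n0 <= n < n1) avg N (fun p => M NT N n p * E2 n p) <= Q.
  apply: le_trans SUM _; move: T1 T0 T2 T3.
  move: (avg N _) (avg N _) (_ * (eC + _)) (P * (4 * k)^-1 * _); clear -D => *; lra.
have LOW : CM^-1 * c' * (dt NT * \sum_(n0' <= n < n1') avg N (fun p => nsq (fun k => Pv N (U NT N n.+1) p k - Pv N (V NT N n.+1) p k))) <= Q.
  apply: le_trans TOT.
  rewrite mulrCA ler_pM2l// mulr_sumr.
  apply: (@le_trans _ _ (\sum_(n0' <= n < n1') avg N (fun p => M NT N n p * E2 n p))); last first.
    apply: sum_nat_sub => // n hn; have [nN _ _] := inab n hn.
    apply: avg_ge0 => p; apply: mulr_ge0; last exact: E2_ge0.
    by apply: le_trans (M0 n p (ltnW nN)); exact: ltW.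
  rewrite !big_seq; apply: ler_sum => n; rewrite mem_index_iota => hn'.
  have hn : (n0 <= n < n1)%N by case/andP: hn' => h1 h2; rewrite (leq_trans n00' h1) (leq_trans h2 n11').
  have [nN t1 t2] := inab n hn.
  have [_ t2' _] := steps_in_interval dt0 an0 n1b hn'.
  rewrite -avgZ; apply: avg_le => p; rewrite -mulrA.
  apply: ler_pM => //; first by rewrite ltW.
  - by rewrite mulr_ge0 ?nsq_ge0 ?(ltW c'0).
  - exact: M0 (ltnW nN).
  have LU i q : `|Dp N i (U NT N n.+1) q| <= L1.
    by have [h1 _] := DpB n.+1 i q nN t2; apply: le_trans h1 _; rewrite lerDl ltW.
  have LV i q : `|Dp N i (V NT N n.+1) q| <= L1.
    by apply: le_trans (HL' NT N n.+1 i q N0 t2') _; rewrite lerDr.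
  exact: (Gg_convex hb p (ltW L10) LV LU).
by move: LOW; rewrite /Q ler_pM2l// mulr_gt0.
Qed.

End GradientEstimate.

(** * Convergence at the nodes *)

Lemma sum_affine (R : realType) (n n1 : nat) (d W q w : R) (A G : nat -> R) :
  d * \sum_(n <= j < n1) (2 * A j + 2 * (W * (q + w * G j))) =
  2 * (d * \sum_(n <= j < n1) A j) + 2 * W * (q * ((n1 - n)%:R * d)) + 2 * W * (w * (d * \sum_(n <= j < n1) G j)).
Proof.
rewrite (eq_bigr (fun j => 2 * A j + (2 * W * q + 2 * W * w * G j))); last by move=> j _; ring.
by rewrite big_split /= big_split /= sumr_const_nat -!mulr_sumr -[_ *+ _]mulr_natl; ring.
Qed.

Lemma two_sums (R : realType) (A0 A1 a0 a1 b0 b1 s : R) : A0 <= 2 * a0 + 2 * b0 -> A1 <= 2 * a1 + 2 * b1 -> 0 <= s ->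
  A0 + A1 + s <= 2 * (a0 + a1 + s) + 2 * (b0 + b1).
Proof. by move=> h1 h2 h3; lra. Qed.

Lemma two_eighths (R : realType) (e z : R) : z <= e / 8 -> e / 8 + z <= e / 4.
Proof. by move=> h; lra. Qed.

Lemma sum_eighths (R : realType) (e z : R) : 0 < e -> z <= e / 4 -> e / 4 + e / 8 + z + e / 8 <= e.
Proof. by move=> h h'; lra. Qed.

Section UniformConvergence.
Context {R : realType} (D : mfg_data R).
Local Notation beta := (beta_ D). Local Notation nu := (nu_ D). Local Notation T := (T_ D).
Local Notation Hc := (Hc_ D). Local Notation u0 := (u0_ D). Local Notation mT := (mT_ D).
Local Notation Phi := (@Phi_ _ D). Local Notation u := (u_ D). Local Notation m := (m_ D).
Local Notation Phih := (@Phih_ _ D).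
Local Notation dt := (dt D).
Local Notation U := (Ud D). Local Notation Mu := (Md D). Local Notation Fh := (Fd D).
Local Notation V := (Vx D). Local Notation M := (Mx D).
Let hb := hbeta_ D. Let hnu := hnu_ D. Let hT := hT_ D. Let hsol := hsol_ D.

Let S1 NT (j : nat) : j.+1%:R * dt NT = j%:R * dt NT + dt NT.
Proof. by rewrite -natr1 mulrDl mul1r. Qed.

Let lt_le NT (i j : nat) : (0 < NT)%N -> i%:R * dt NT < j.+1%:R * dt NT -> (i <= j)%N.
Proof. by move=> NT0; rewrite ltr_pM2r ?dt_gt0// ltr_nat ltnS. Qed.

Let time_span NT (n0 n1 : nat) : (0 < NT)%N -> (n0 <= n1)%N -> (n1 <= NT)%N -> 0 <= (n1 - n0)%:R * dt NT <= T.
Proof.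
move=> NT0 n01 n1N; rewrite mulr_ge0 ?(ltW (dt_gt0 D NT0))//= natrB// mulrBl.
have h1 := dt_le D NT0 n1N; have h2 : 0 <= n0%:R * dt NT by rewrite mulr_ge0 ?(ltW (dt_gt0 D NT0)).
by apply: le_trans h1; rewrite gerBl.
Qed.

(** The difference of the densities solves the linear equation with the drift of [U], up to the
consistency residual and to the change of drift acting on [M]; [Rf_diff] and [gradient_sum] bound
the latter. The threshold [e1] at the later time does not depend on [a] and [b], because the
Gronwall factor is bounded on [[0, T]]. *)
Lemma energy_estimate (eta : R) : 0 < eta -> exists2 e1 : R, 0 < e1 & forall a b : R, 0 < a -> a <= b -> b < T ->
  exists2 r : R, 0 < r & forall NT N n n1, (0 < NT)%N -> (0 < N)%N -> dt NT < r -> step R N < r ->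
  (n <= n1 <= NT)%N -> a <= n%:R * dt NT -> n1%:R * dt NT <= b ->
  avg N (fun p => (Mu NT N n1 p - M NT N n1 p) ^+ 2) <= e1 ->
  avg N (fun p => (Mu NT N n p - M NT N n p) ^+ 2) <= eta.
Proof.
move=> eta0.
have [C C0 HU] := U_bounds D; have [CM CM0 HM] := Mx_bounds D.
pose B := beta * (2 * C) `^ (beta - 1).
have [b1 b2] := andP hb.
have B_0 : 0 <= B by apply: mulr_ge0; [lra|exact: powR_ge0].
pose Kc := 16 * B ^+ 2 / nu + 1 + 2 / nu.
have Kc0 : 0 < Kc.
  have h1 : 0 <= 16 * B ^+ 2 / nu by apply: divr_ge0; [apply: mulr_ge0; rewrite ?sqr_ge0|exact: ltW].
  have h2 : 0 <= 2 / nu by apply: divr_ge0; [|exact: ltW].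
  by rewrite /Kc; lra.
pose E := expR (2 * Kc * T).
have E0 : 0 < E by exact: expR_gt0.
(* the square of the change of flux is at most [W (q + w2 G)] by [Rf_diff] at [e2], where [G] is the
   squared distance of the gradients; [q] and the bound [g] for the sum of [G] give [Q] each *)
pose W := 32 * beta ^+ 2 * CM ^+ 2.
have W0 : 0 <= W by apply: mulr_ge0; [apply: mulr_ge0|]; rewrite ?sqr_ge0.
pose Q := eta / (4 * E * Kc).
have Q0 : 0 < Q by apply: divr_gt0 => //; apply: mulr_gt0 => //; exact: mulr_gt0.
have T10 : 0 < T + 1 by rewrite ltr_wpDl// ltW.
have W10 : 0 < W + 1 by rewrite ltr_wpDl.
pose q := Q / (2 * (W + 1) * (T + 1)).
have q0 : 0 < q by apply: divr_gt0 => //; apply: mulr_gt0 => //; exact: mulr_gt0.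
pose e2 := q `^ (beta - 1)^-1.
have e20 : 0 < e2 by exact: powR_gt0.
have e2E : e2 `^ (beta - 1) = q.
  by rewrite -powRrM mulVf ?powRr1 ?(ltW q0)// gt_eqF// subr_gt0.
pose w2 := e2 `^ (beta - 2).
have w20 : 0 <= w2 by exact: powR_ge0.
have w210 : 0 < w2 + 1 by rewrite ltr_wpDl.
pose g := Q / (2 * (W + 1) * (w2 + 1)).
have g0 : 0 < g by apply: divr_gt0 => //; apply: mulr_gt0 => //; exact: mulr_gt0.
have Q20 : 0 < Q / 2 by rewrite divr_gt0.
exists (eta / (4 * E)); first by rewrite divr_gt0// mulr_gt0.
move=> a b ha hab hbT.
have [r1 r10 H1] := gradient_sum (D := D) ha hab hbT g0.
have [r2 r20 H2] := fp_consistency hb hsol (@hm_pos_ _ D) hnu ha hbT hab Q20.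
exists (Num.min r1 (Num.min r2 (2 * Kc)^-1)); first by rewrite !lt_min r10 r20 invr_gt0 mulr_gt0.
move=> NT N n n1 NT0 N0; rewrite !lt_min => /and3P[d1 d2 d3] /and3P[s1 s2 _] /andP[nn1 n1N] an n1b xT.
have dt0 := dt_gt0 D NT0.
have dr2 : 0 < dt NT < r2 by rewrite dt0.
have [r_ [s_ [pr Er Sr]]] := H2 N (dt NT) n n1 N0 s2 dr2 nn1 an n1b.
have nn1N : (n <= n1 <= NT)%N by rewrite nn1.
have GR := H1 NT N n n1 NT0 N0 d1 s1 nn1N an n1b.
pose x k := avg N (fun p => (Mu NT N k p - M NT N k p) ^+ 2).
pose G k := avg N (fun p => nsq (fun l => Pv N (U NT N k.+1) p l - Pv N (V NT N k.+1) p l)).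
pose dR k i p := Rf N beta (U NT N k.+1) (M NT N k) i p - Rf N beta (V NT N k.+1) (M NT N k) i p.
pose Y k := 2 * (\sum_i avg N (fun p => r_ k i p ^+ 2) + avg N (fun p => s_ k p ^+ 2)) + 2 * (\sum_i avg N (fun p => dR k i p ^+ 2)).
have sq_ge0 (f : int * int -> R) : 0 <= avg N (fun p => f p ^+ 2) by apply: avg_ge0 => p; exact: sqr_ge0.
have Y0 k : 0 <= Y k.
  rewrite /Y !sum2E.
  by apply: addr_ge0; apply: mulr_ge0 => //; [apply: addr_ge0 => //; apply: addr_ge0|apply: addr_ge0]; exact: sq_ge0.
have kN k : (n <= k < n1)%N -> (k < NT)%N by move=> /andP[_ h]; exact: leq_trans h n1N.
have pU k := @gper_U _ D NT N k.
have pM k : (k <= NT)%N -> gper N (M NT N k) by move=> h; exact: gper_Mx.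
have pV k : (k <= NT)%N -> gper N (V NT N k) by move=> h; exact: gper_Vx.
have MB k p : (k <= NT)%N -> `|M NT N k p| <= CM.
  move=> h; have [h1 _] := HM NT N k NT0 N0 h; have /andP[m1 m2] := h1 p.
  by rewrite ger0_norm//; apply: le_trans m1; rewrite invr_ge0 ltW.
have a12 : 0 <= dt NT * Kc <= 2^-1.
  apply/andP; split; first by apply: mulr_ge0; exact: ltW.
  by rewrite -ler_pdivlMr//; apply: le_trans (ltW d3) _; rewrite invfM.
have step1 k : (n <= k < n1)%N -> x k <= x k.+1 + dt NT * Kc * (x k + Y k).
  move=> hk; have kNT := kN k hk; have [_ HDp _] := HU NT N k.+1 NT0 N0 kNT.
  have Bb p l : bb N beta (U NT N k.+1) p l <= B by apply: bb_bound.
  have eqn p : (Mu NT N k.+1 p - M NT N k.+1 p - (Mu NT N k p - M NT N k p)) / dt NT + nu * Lapg N (fun q => Mu NT N k q - M NT N k q) p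
      + Tr N beta (U NT N k.+1) (fun q => Mu NT N k q - M NT N k q) p =
      \sum_i Dm N i (fun q => - (r_ k i q + dR k i q)) p + - s_ k p.
    rewrite Lapg_B Tr_B.
    have -> : \sum_i Dm N i (fun q => - (r_ k i q + dR k i q)) p =
       - \sum_i Dm N i (r_ k i) p - (Tr N beta (U NT N k.+1) (M NT N k) p - Tr N beta (V NT N k.+1) (M NT N k) p).
      rewrite /Tr -!sumrB -sumrN -sumrB; apply: eq_bigr => i _; rewrite /Dm /dR.
      move: (r_ k i p) (r_ k i (p - ed i)) (Rf _ _ _ _ i p) (Rf _ _ _ _ i (p - ed i)) (Rf _ _ _ _ i p) (Rf _ _ _ _ i (p - ed i)) => *; ring.
    have F1 := @FP_scheme _ D NT N NT0 N0 k p kNT; have F2 := Er k p hk.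
    move: F1 F2; rewrite -/(M NT N k p) -/(M NT N k.+1 p) -/(M NT N k) -/(V NT N k.+1).
    move: (\sum_i Dm N i (r_ k i) p) (s_ k p) (Tr N beta (U NT N k.+1) (Mu NT N k) p) (Tr N beta (U NT N k.+1) (M NT N k) p) (Tr N beta (V NT N k.+1) (M NT N k) p).
    move: (Lapg N (Mu NT N k) p) (Lapg N (M NT N k) p) (Mu NT N k.+1 p) (Mu NT N k p) (M NT N k.+1 p) (M NT N k p) => l1 l2 m1 m2 m3 m4 z1 z2 z3 z4 z5 F1 F2.
    have -> : (m1 - m3 - (m2 - m4)) / dt NT + nu * (l1 - l2) + (z3 - z4) =
      ((m1 - m2) / dt NT + nu * l1 + z3) - ((m3 - m4) / dt NT + nu * l2 + z5) - (z4 - z5) by ring.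
    by rewrite F1 F2; ring.
  have pdR i : gper N (dR k i).
    by apply: gperB; apply: gper_Rf; [exact: pU|exact: pM (ltnW kNT)|exact: pV|exact: pM (ltnW kNT)].
  have pr' i : gper N (fun q => - (r_ k i q + dR k i q)).
    by move=> q' j; rewrite (pr k i hk) pdR.
  apply: le_trans (energy_step hb hnu (pU k.+1) (gperB (@gper_Mu _ D NT N k) (pM k (ltnW kNT))) pr' dt0 Bb eqn) _.
  rewrite -/(x k) -/(x k.+1) -/Kc lerD2l; apply: ler_wpM2l; first by case/andP: a12.
  rewrite lerD2l /Y !sum2E.
  have R1 i : avg N (fun q => (- (r_ k i q + dR k i q)) ^+ 2) <= 2 * avg N (fun p => r_ k i p ^+ 2) + 2 * avg N (fun p => dR k i p ^+ 2).
    rewrite -!avgZ -avgD; apply: avg_le => p; rewrite sqrrN.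
    have := sqr_ge0 (r_ k i p - dR k i p); move: (r_ k i p) (dR k i p) => y z h.
    have -> : 2 * y ^+ 2 + 2 * z ^+ 2 = (y + z) ^+ 2 + (y - z) ^+ 2 by ring.
    by rewrite lerDl.
  have R2 : avg N (fun q => (- s_ k q) ^+ 2) = avg N (fun q => s_ k q ^+ 2) by apply: eq_avg => q'; rewrite sqrrN.
  rewrite R2; have := sq_ge0 (s_ k); move: (R1 0) (R1 1).
  exact: two_sums.
have x0 k : 0 <= x k by exact: sq_ge0.
have nn : (n <= n <= n1)%N by rewrite leqnn.
apply: le_trans (gronwall a12 x0 Y0 step1 nn) _.
have /andP[ts0 tsT] := time_span NT0 nn1 n1N.
have EE : expR (2 * (dt NT * Kc) * (n1 - n)%:R) <= E.
  rewrite ler_expR.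
  have -> : 2 * (dt NT * Kc) * (n1 - n)%:R = 2 * Kc * ((n1 - n)%:R * dt NT) by ring.
  by apply: ler_wpM2l => //; apply: mulr_ge0 => //; exact: ltW.
have SY : dt NT * \sum_(n <= j < n1) Y j <= 3 * Q.
  have Yj j : (n <= j < n1)%N -> Y j <= 2 * (\sum_i avg N (fun p => r_ j i p ^+ 2) + avg N (fun p => s_ j p ^+ 2)) + 2 * (W * (q + w2 * G j)).
    move=> hj; rewrite lerD2l ler_pM2l//.
    have := Rf_diff N0 hb (pU j.+1) (pV j.+1 (kN j hj)) (pM j (ltnW (kN j hj))) e20 (fun p => MB j p (ltnW (kN j hj))).
    by rewrite e2E.
  apply: (@le_trans _ _ (dt NT * \sum_(n <= j < n1) (2 * (\sum_i avg N (fun p => r_ j i p ^+ 2) + avg N (fun p => s_ j p ^+ 2)) + 2 * (W * (q + w2 * G j))))).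
    by rewrite ler_pM2l// !big_seq; apply: ler_sum => j; rewrite mem_index_iota; exact: Yj.
  have -> : dt NT * \sum_(n <= j < n1) (2 * (\sum_i avg N (fun p => r_ j i p ^+ 2) + avg N (fun p => s_ j p ^+ 2)) + 2 * (W * (q + w2 * G j))) =
    2 * (dt NT * \sum_(n <= j < n1) (\sum_i avg N (fun p => r_ j i p ^+ 2) + avg N (fun p => s_ j p ^+ 2))) +
    2 * W * (q * ((n1 - n)%:R * dt NT)) + 2 * W * (w2 * (dt NT * \sum_(n <= j < n1) G j)).
    exact: sum_affine.
  have P1 : 2 * W * (q * ((n1 - n)%:R * dt NT)) <= Q.
    apply: (@le_trans _ _ (2 * (W + 1) * (q * (T + 1)))).
      apply: ler_pM.
      - by apply: mulr_ge0.
      - by apply: mulr_ge0 => //; exact: ltW.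
      - by rewrite ler_pM2l// lerDl.
      - by rewrite ler_pM2l//; apply: le_trans tsT _; rewrite lerDl.
    by rewrite /q le_eqVlt; apply/orP; left; apply/eqP; field; rewrite !gt_eqF.
  have P2 : 2 * W * (w2 * (dt NT * \sum_(n <= j < n1) G j)) <= Q.
    have GS0 : 0 <= dt NT * \sum_(n <= j < n1) G j.
      apply: mulr_ge0; first exact: ltW.
      by apply: sumr_ge0 => j _; apply: avg_ge0 => p; exact: nsq_ge0.
    apply: (@le_trans _ _ (2 * (W + 1) * ((w2 + 1) * g))).
      apply: ler_pM.
      - by apply: mulr_ge0.
      - by apply: mulr_ge0.
      - by rewrite ler_pM2l// lerDl.
      - by apply: ler_pM => //; rewrite lerDl.
    by rewrite /g le_eqVlt; apply/orP; left; apply/eqP; field; rewrite !gt_eqF.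
  have -> : 3 * Q = 2 * (Q / 2) + Q + Q by field.
  by apply: lerD => //; apply: lerD => //; rewrite ler_pM2l.
have SY0 : 0 <= \sum_(n <= j < n1) Y j by apply: sumr_ge0.
apply: (@le_trans _ _ (E * (eta / (4 * E) + Kc * (3 * Q)))).
  apply: ler_pM; [exact: expR_ge0| |exact: EE|].
    apply: addr_ge0; first exact: x0.
    by apply: mulr_ge0 => //; case/andP: a12.
  apply: lerD => //.
  have -> : dt NT * Kc * \sum_(n <= j < n1) Y j = Kc * (dt NT * \sum_(n <= j < n1) Y j) by ring.
  by rewrite ler_pM2l.
by rewrite /Q le_eqVlt; apply/orP; left; apply/eqP; field; rewrite !gt_eqF.
Qed.

(** Start the energy estimate at a time [b] close to [T], where [near_T] gives the smallness. *)
Lemma M_sup (a eta : R) : 0 < a -> 0 < eta -> exists2 r : R, 0 < r & forall NT N n, (0 < NT)%N -> (0 < N)%N ->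
  dt NT < r -> step R N < r -> (n <= NT)%N -> a <= n%:R * dt NT ->
  avg N (fun p => (Mu NT N n p - M NT N n p) ^+ 2) <= eta.
Proof.
move=> ha eta0; have [e1 e10 H1] := energy_estimate eta0.
have e20 : 0 < Num.min e1 eta by rewrite lt_min e10.
have [rb rb0 Hb] := near_T D e20.
have near NT N n : (0 < NT)%N -> (0 < N)%N -> dt NT < rb -> step R N < rb -> (n <= NT)%N -> T - n%:R * dt NT < rb ->
    avg N (fun p => (Mu NT N n p - M NT N n p) ^+ 2) <= e1 /\ avg N (fun p => (Mu NT N n p - M NT N n p) ^+ 2) <= eta.
  by move=> h1 h2 h3 h4 h5 h6; have := Hb NT N n h1 h2 h3 h4 h5 h6; rewrite le_min => /andP.
have [Ta|aT] := leP T a.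
  exists rb => // NT N n NT0 N0 dr sr nN an.
  have tn : T - n%:R * dt NT < rb by apply: le_lt_trans rb0; rewrite subr_le0; exact: le_trans an.
  by have [] := near NT N n NT0 N0 dr sr nN tn.
pose b := Num.max a (T - rb / 2).
have bT : b < T by rewrite gt_max aT ltrBlDr ltrDl divr_gt0.
have ab : a <= b by rewrite le_max lexx.
have brb : T - rb / 2 <= b by rewrite le_max lexx orbT.
have [r r0 Hr] := H1 a b ha ab bT.
exists (Num.min r (rb / 2)); first by rewrite lt_min r0 divr_gt0.
move=> NT N n NT0 N0; rewrite !lt_min => /andP[d1 d2] /andP[s1 s2] nN an.
have dt0 := dt_gt0 D NT0.
have d3 : dt NT < rb by lra.
have s3 : step R N < rb by lra.
have [tn|tn] := ltP (T - n%:R * dt NT) rb; first by have [] := near NT N n NT0 N0 d3 s3 nN tn.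
have b0 : 0 <= b by apply: le_trans ab; exact: ltW.
have [n1 /andP[B1 B2]] := steps_around b0 dt0.
have nn1 : (n <= n1)%N by apply: (lt_le NT0); apply: le_lt_trans B2; lra.
have n1N : (n1 <= NT)%N by apply: (lt_le NT0); rewrite S1 dt_NT//; clear -D B1 bT dt0; lra.
have n1T : T - n1%:R * dt NT < rb by move: B2; rewrite S1; lra.
have [x1 _] := near NT N n1 NT0 N0 d3 s3 n1N n1T.
by apply: (Hr NT N n n1) => //; rewrite nn1.
Qed.

(** Up to the time [a] by [initial_layer], then on [[a, b]] by comparison with the exact solution,
whose coupling is close by [M_sup]; after [b] both functions stay close to the slice [u t0], a
barrier. *)
Lemma U_sup (eta : R) : 0 < eta -> exists2 r : R, 0 < r & forall NT N n p, (0 < NT)%N -> (0 < N)%N ->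
  dt NT < r -> step R N < r -> (n <= NT)%N -> `|U NT N n p - V NT N n p| <= eta.
Proof.
move=> eta0.
have e80 : 0 < eta / 8 by rewrite divr_gt0.
have [ra ra0 Ha] := initial_layer D e80.
have [d d0 Hd] := uc_u D e80.
(* [u] varies by at most [eta / 8] after the time [T - dd], where the barrier is taken; during
   the time [c] the solution moves away from the barrier by at most [eta / 8] *)
pose dd := Num.min d T / 2.
have dd0 : 0 < dd by rewrite divr_gt0// lt_min d0.
have ddd : dd < d.
  have : Num.min d T <= d by rewrite ge_min lexx.
  by rewrite /dd; lra.
have ddT : dd < T.
  have : Num.min d T <= T by rewrite ge_min lexx orbT.
  by rewrite /dd; move: hT; lra.
pose t0 := T - dd.
have t00 : 0 < t0 by rewrite subr_gt0.
have t0T : t0 < T by rewrite ltrBlDr ltrDl.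
have t0in : 0 < t0 < T by rewrite t00.
have [C C0 HC] := U_barrier (D := D) t0in.
have C80 : 0 < 8 * (C + 1) by rewrite mulr_gt0// ltr_wpDl.
pose c := eta / (8 * (C + 1)).
have c0 : 0 < c by rewrite divr_gt0.
have Cc : C * c <= eta / 8.
  apply: (@le_trans _ _ ((C + 1) * c)); first by rewrite ler_pM2r// lerDl.
  by rewrite /c le_eqVlt; apply/orP; left; apply/eqP; field; rewrite gt_eqF// ltr_wpDl.
pose a := Num.min (ra / 2) (t0 / 2).
have a0 : 0 < a by rewrite lt_min !divr_gt0.
have ara : a <= ra / 2 by rewrite ge_min lexx.
have at0 : a <= t0 / 2 by rewrite ge_min lexx orbT.
pose b := Num.max t0 (T - c).
have bT : b < T by rewrite gt_max t0T ltrBlDr ltrDl.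
have bt0 : t0 <= b by rewrite le_max lexx.
have bc : T - c <= b by rewrite le_max lexx orbT.
have T10 : 0 < T + 1 by rewrite ltr_wpDl// ltW.
pose e6 := eta / (16 * (T + 1)).
have e60 : 0 < e6 by rewrite divr_gt0// mulr_gt0.
have [r1 r10 H1] := hjb_consistency (D := D) a0 bT e60.
have [r2 r20 H2] := coupling_consistency (D := D) a0 bT e60.
pose k := r2 / 2.
have k0 : 0 < k by rewrite divr_gt0.
have kk0 : 0 < 4 * k * k by apply: mulr_gt0 => //; exact: mulr_gt0.
have [r3 r30 H3] := M_sup a0 kk0.
pose r := Num.min (Num.min r1 (Num.min r2 r3)) (Num.min (Num.min (ra / 2) (t0 / 2)) (Num.min c d)).
have r0 : 0 < r by rewrite !lt_min r10 r20 r30 c0 d0 !divr_gt0.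
exists r => // NT N n p NT0 N0.
rewrite /r !lt_min => /andP[/and3P[d1 d2 d3] /and3P[/andP[d4 d5] d6 d7]] /andP[/and3P[s1 s2 s3] _] nN.
have dt0 := dt_gt0 D NT0.
have [n0p /andP[A1 A2]] := steps_around (ltW a0) dt0.
pose n0 := n0p.+1.
have b0 : 0 <= b by apply: le_trans bt0; exact: ltW.
have [n1 /andP[B1 B2]] := steps_around b0 dt0.
rewrite S1 in A2; rewrite S1 in B2.
have n1N : (n1 <= NT)%N by apply: (lt_le NT0); rewrite S1 dt_NT//; clear -D B1 bT dt0; lra.
have n0ra : n0%:R * dt NT < ra by rewrite /n0 S1; clear -D A1 d4 ara; lra.
have n01 : (n0 <= n1)%N by apply: (lt_le NT0); rewrite /n0 !S1; clear -D A1 B2 at0 bt0 d5; lra.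
have Eini j q : (j <= n0)%N -> `|U NT N j q - V NT N j q| <= eta / 8.
  move=> jn0; apply: Ha => //; first exact: leq_trans jn0 (leq_trans n01 n1N).
  by apply: le_lt_trans n0ra; rewrite ler_pM2r// ler_nat.
have an0 : a <= n0%:R * dt NT by rewrite /n0 S1 ltW.
have pU j := @gper_U _ D NT N j.
have pV j : (j <= NT)%N -> gper N (V NT N j) by move=> h; exact: gper_Vx.
pose B j q := (V NT N j.+1 q - V NT N j q) / dt NT - nu * Lapg N (V NT N j.+1) q + Gg N beta (V NT N j.+1) q.
have AB j q : (n0 <= j < n1)%N -> `|Fh NT N j q - Hc (nd N q) - B j q| <= 2 * e6.
  move=> hj; have [t1 t2 E] := steps_in_interval dt0 an0 B1 hj.
  have jN : (j < NT)%N by case/andP: hj => _ h; exact: leq_trans h n1N.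
  have tt : `|j%:R * dt NT - j.+1%:R * dt NT| < r2 by rewrite E opprD addrA subrr sub0r normrN gtr0_norm.
  have zr : avg N (fun p => `|Mu NT N j p - m (j%:R * dt NT) (nd N p)|) <= r2.
    apply: (@le_trans _ _ (k + (4 * k)^-1 * avg N (fun p => (Mu NT N j p - M NT N j p) ^+ 2))).
      rewrite -avgZ -[X in X + _](avg_cst N0) -avgD; apply: avg_le => i; exact: young_abs.
    have h := H3 NT N j NT0 N0 d3 s3 (ltnW jN) (proj1 (andP t1)).
    apply: (@le_trans _ _ (k + (4 * k)^-1 * (4 * k * k))).
      by rewrite lerD2l; apply: ler_wpM2l => //; rewrite invr_ge0; apply: mulr_ge0 => //; exact: ltW.
    by rewrite mulKf ?gt_eqF ?mulr_gt0// /k -splitr.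
  have P1 := H2 N _ _ (md_ D NT N j) N0 s2 t1 t2 tt (dsol_density (hdsol_ D NT0 N0) (ltnW jN)) zr q.
  have dr : 0 < dt NT < r1 by rewrite dt0.
  have tb : j%:R * dt NT + dt NT <= b by rewrite -E; case/andP: t2.
  have P2 := H1 N (dt NT) (j%:R * dt NT) q N0 s1 dr (proj1 (andP t1)) tb.
  rewrite -E -/(B j q) in P2.
  have -> : Fh NT N j q - Hc (nd N q) - B j q = (Fh NT N j q - Phi (law (m (j.+1%:R * dt NT))) (nd N q)) -
     (B j q - (Phi (law (m (j.+1%:R * dt NT))) (nd N q) - Hc (nd N q))) by ring.
  apply: le_trans (ler_normB _ _) _; apply: le_trans (lerD P1 P2) _.
  by rewrite -mulr2n -[_ *+ 2]mulr_natl.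
have Eint j q : (n0 <= j <= n1)%N -> `|U NT N j q - V NT N j q| <= eta / 4.
  move=> hj.
  have HU' i z : (n0 <= i < n1)%N -> (U NT N i.+1 z - U NT N i z) / dt NT - nu * Lapg N (U NT N i.+1) z + Gg N beta (U NT N i.+1) z = Fh NT N i z - Hc (nd N z).
    by move=> /andP[_ h]; apply: HJB_scheme => //; exact: leq_trans h n1N.
  have per i : (n0 < i <= n1)%N -> gper N (U NT N i) /\ gper N (V NT N i).
    by move=> /andP[_ h]; split=> //; apply: pV; exact: leq_trans h n1N.
  have per' i : (n0 < i <= n1)%N -> gper N (V NT N i) /\ gper N (U NT N i) by move=> /per [].
  have h1 := @scheme_compare _ _ N0 _ _ hb hnu (U NT N) (V NT N) _ B (dt NT) (2 * e6) (eta / 8) n0 n1 dt0 per HU' (fun i z _ => erefl).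
  have h2 := @scheme_compare _ _ N0 _ _ hb hnu (V NT N) (U NT N) B _ (dt NT) (2 * e6) (eta / 8) n0 n1 dt0 per' (fun i z _ => erefl) HU'.
  have tj : eta / 8 + (j - n0)%:R * dt NT * (2 * e6) <= eta / 4.
    have jN : (j <= NT)%N by case/andP: hj => _ h; exact: leq_trans h n1N.
    have /andP[j1 j2] := time_span NT0 (proj1 (andP hj)) jN.
    have : (j - n0)%:R * dt NT * (2 * e6) <= eta / 8.
      apply: (@le_trans _ _ ((T + 1) * (2 * e6))).
        by apply: ler_wpM2r; [rewrite mulr_ge0// ltW|apply: le_trans j2 _; rewrite lerDl].
      by rewrite /e6 le_eqVlt; apply/orP; left; apply/eqP; field; rewrite gt_eqF.
    exact: two_eighths.
  rewrite ler_norml lerNl opprB; apply/andP; split; apply: le_trans tj.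
    apply: h2 => // [i z hi|z].
      by apply: le_trans (AB i z hi); rewrite distrC ler_norm.
    by apply: le_trans (Eini n0 z (leqnn _)); rewrite distrC ler_norm.
  apply: h1 => // [i z hi|z].
    by apply: le_trans (AB i z hi); rewrite ler_norm.
  by apply: le_trans (Eini n0 z (leqnn _)); rewrite ler_norm.
have e8e : eta / 8 <= eta by rewrite ler_pdivrMr// ler_peMr ?ler1n// ltW.
have e4e : eta / 4 <= eta by rewrite ler_pdivrMr// ler_peMr ?ler1n// ltW.
have [nn0|n0n] := leqP n n0; first exact: le_trans (Eini n p nn0) e8e.
have [nn1|n1n] := leqP n n1; first by apply: le_trans (Eint n p _) e4e; rewrite (ltnW n0n).
have inT j : (j <= NT)%N -> 0 <= j%:R * dt NT <= T by exact: time_in.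
have t0T' : 0 <= t0 <= T by rewrite !ltW.
have D1 q : `|U NT N n1 q - u t0 (nd N q)| <= eta / 4 + eta / 8.
  rewrite -[_ - u t0 _](subrKA (V NT N n1 q)); apply: le_trans (ler_normD _ _) _; apply: lerD.
    by apply: Eint; rewrite n01 leqnn.
  apply: ltW; apply: Hd; [exact: inT|by []|idtac|by rewrite subrr normr0].
  rewrite ltr_norml; apply/andP; split; rewrite /t0 in bt0 *; have /andP[_ h] := inT _ n1N; clear -D h B2 bt0 d7 ddd; lra.
have hn : (n1 <= n <= NT)%N by rewrite (ltnW n1n).
have D2 := HC NT N n n1 _ p NT0 N0 hn D1.
have tn : (n - n1)%:R * dt NT <= 2 * c.
  rewrite natrB ?(ltnW n1n)// mulrBl; have /andP[_ h] := inT _ nN; clear -D h B2 bc d6; lra.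
have D3 : C * ((n - n1)%:R * dt NT) <= eta / 4.
  apply: (@le_trans _ _ (C * (2 * c))); first exact: ler_wpM2l.
  by rewrite mulrCA (_ : eta / 4 = 2 * (eta / 8)) ?ler_pM2l//; field.
have D4 : `|u t0 (nd N p) - V NT N n p| <= eta / 8.
  apply: ltW; apply: Hd => //; [exact: inT| |by rewrite subrr normr0].
  have tb : b < n%:R * dt NT.
    by apply: lt_le_trans B2 _; rewrite -S1 ler_pM2r// ler_nat.
  rewrite distrC ltr_norml; apply/andP; split; have /andP[_ h] := inT _ nN; rewrite /t0 in bt0 *; clear -D h tb bt0 ddd; lra.
rewrite -[U NT N n p - _](subrKA (u t0 (nd N p))); apply: le_trans (ler_normD _ _) _.
by apply: le_trans (lerD D2 D4) _; exact: sum_eighths.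
Qed.

End UniformConvergence.

(** * Square norms bounded by coverings *)

Section CoveringNorm.
Context d (X : measurableType d) (R : realType) (mu : {measure set X -> \bar R}).
Variables (I : finType) (A : I -> set X) (D : set X).
Hypotheses (mD : measurable D) (mA : forall i, measurable (A i)).

(** The bound needs no measurability of [f]. *)
Lemma L2_cover_le (f : X -> \bar R) (s : I -> R) (B : R) : 0 <= B -> (forall i, 0 <= s i) ->
  (forall x, D x -> exists2 i, A i x & (`|f x| <= (s i)%:E)%E) ->
  (\sum_i (s i ^+ 2)%:E * mu (A i) <= (B ^+ 2)%:E)%E ->
  ('N[mu]_2%:E [f \_ D] <= B%:E)%E.
Proof.
move=> B0 s0 fs sB; rewrite unlock /=.
have -> : (fun x => `|(f \_ D) x| `^ 2)%E = (fun x => `|f x| `^ 2)%E \_ D.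
  by apply/funext => x; rewrite /patch; case: ifP => // _; rewrite abse0 poweR0r.
rewrite -integral_mkcond.
have -> : B%:E = ((B ^+ 2)%:E `^ 2^-1)%E.
  by rewrite poweR_EFin -powR_mulrn// -powRrM mulfV// powRr1.
have i0 : (0 <= \int[mu]_(x in D) `|f x| `^ 2)%E by apply: integral_ge0 => x _; exact: poweR_ge0.
apply: gt0_ler_poweR; rewrite ?invr_ge0// ?in_itv/= ?andbT ?leey ?i0//.
  by rewrite lee_fin sqr_ge0.
apply: le_trans sB; apply: int_cover_le => // [i|x _|x Dx]; [exact: sqr_ge0|exact: poweR_ge0|].
have [i Aix fi] := fs x Dx; exists i => //.
have -> : (s i ^+ 2)%:E = ((s i)%:E `^ 2)%E by rewrite poweR_EFin powR_mulrn.
apply: gt0_ler_poweR; rewrite ?in_itv/= ?andbT ?leey ?abse_ge0//.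
by rewrite lee_fin s0.
Qed.

End CoveringNorm.

Section CellNorms.
Context {R : realType}.

Lemma L2_norm_le N (F : R * R -> R) (c : int * int -> R) : (0 < N)%N ->
  (forall (k l : 'I_N) x, sq N k l x -> F x ^+ 2 <= c (k%:Z, l%:Z)) ->
  (L2_norm F ^+ 2 <= (avg N c)%:E)%E.
Proof.
move=> N0 Fc; have h0 : 0 < step R N by exact: step_gt0.
have c0 (k l : 'I_N) : 0 <= c (k%:Z, l%:Z).
  have sx : sq N k l (k%:R * step R N, l%:R * step R N).
    by split; rewrite /= in_itv /= lexx ltr_pM2r// ltr_nat ltnSn.
  by apply: le_trans (Fc k l _ sx); exact: sqr_ge0.
have a0 : 0 <= avg N c.
  by apply: mulr_ge0; [exact: sqr_ge0|apply: sumr_ge0 => k _; apply: sumr_ge0 => l _; exact: c0].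
suff : (L2_norm F <= (Num.sqrt (avg N c))%:E)%E.
  move=> h; have -> : (avg N c)%:E = ((Num.sqrt (avg N c))%:E ^+ 2)%E.
    by rewrite expe2 -EFinM -expr2 sqr_sqrtr.
  rewrite !expe2; apply: lee_pmul => //; exact: Lnorm_ge0.
apply: (@L2_cover_le _ _ _ (leb2 R) _ (fun kl : 'I_N * 'I_N => sq N kl.1 kl.2) _ _ _ _
   (fun kl => Num.sqrt (c (kl.1%:Z, kl.2%:Z)))) => //.
- exact: measurable_cell.
- by move=> kl; exact: measurable_sq.
- move=> x cx; have [k [l skl]] := cell_sq N0 cx; exists (k, l) => //=.
  by rewrite lee_fin -sqrtr_sqr ler_wsqrtr//; exact: Fc skl.
- rewrite sqr_sqrtr// /avg mulr_sumr le_eqVlt; apply/orP; left; apply/eqP.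
  under [X in _ = X%:E]eq_bigr do rewrite mulr_sumr.
  rewrite pair_big /= -sumEFin; apply: eq_bigr => -[k l] _ /=.
  by rewrite leb2_sq// sqr_sqrtr// -EFinM mulrC.
Qed.

(** Any pair of weak derivatives gives an upper bound for the infimum. *)
Lemma W12_norm_le (f g1 g2 : R * R -> R) (a0 a1 a2 : R) : 0 <= a0 -> 0 <= a1 -> 0 <= a2 ->
  weak_pd 0 f g1 -> weak_pd 1 f g2 ->
  (L2_norm f ^+ 2 <= a0%:E)%E -> (L2_norm g1 ^+ 2 <= a1%:E)%E -> (L2_norm g2 ^+ 2 <= a2%:E)%E ->
  (W12_norm f <= (Num.sqrt (a0 + a1 + a2))%:E)%E.
Proof.
move=> h0 h1 h2 w1 w2 l0 l1 l2; apply: le_trans (ereal_inf_lbound _) _.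
  by exists g1, g2; split; [exact: w1|exact: w2|reflexivity].
have s0 : (0 <= L2_norm f ^+ 2 + L2_norm g1 ^+ 2 + L2_norm g2 ^+ 2)%E.
  by rewrite !adde_ge0// sqre_ge0.
have a0' : 0 <= a0 + a1 + a2 by rewrite !addr_ge0.
rewrite (_ : (Num.sqrt (a0 + a1 + a2))%:E = ((a0 + a1 + a2)%:E `^ 2^-1)%E); last first.
  by rewrite poweR_EFin powR12_sqrt.
apply: gt0_ler_poweR; rewrite ?invr_ge0// ?in_itv/= ?andbT ?leey ?s0//.
  by rewrite lee_fin a0'.
by rewrite !EFinD !leeD.
Qed.

Lemma W12_norm_ge0 (f : R * R -> R) : (0 <= W12_norm f)%E.
Proof. by apply: le_ereal_inf_tmp => _ [g1 [g2 [_ _ ->]]]; exact: poweR_ge0. Qed.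

End CellNorms.

(** * Gradients of the bilinear interpolation *)

Section Interpolation1D.
Context {R : realType}.
Implicit Types (w : int -> R) (y s : R).

(** Piecewise linear interpolation of a sequence at the integers. *)
Definition lin w y : R :=
  (1 - (y - (Num.floor y)%:~R)) * w (Num.floor y) + (y - (Num.floor y)%:~R) * w (Num.floor y + 1).

Lemma frac_le y : 0 <= y - (Num.floor y)%:~R < 1.
Proof. by have := floor_itv y; rewrite intrD => /andP[h1 h2]; apply/andP; split; lra. Qed.

Lemma floor_def_int y (j : int) : j%:~R <= y < (j + 1)%:~R -> Num.floor y = j.
Proof. exact: floor_def. Qed.

Lemma lin_bound w y C : (forall j, `|w j| <= C) -> `|lin w y| <= C.
Proof.
move=> wC; have := frac_le y; rewrite /lin; move: (y - _) (w _) (w _) (wC (Num.floor y)) (wC (Num.floor y + 1)) => a z z' h1 h2 /andP[a0 a1].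
move: h1 h2; rewrite !ler_norml => /andP[h1 h2] /andP[h3 h4]; apply/andP; split; nra.
Qed.

Lemma lin_slope w y s : 0 <= s < 1 - (y - (Num.floor y)%:~R) ->
  lin w (y + s) - lin w y = s * (w (Num.floor y + 1) - w (Num.floor y)).
Proof.
move=> /andP[s0 s1]; have /andP[h1 h2] := frac_le y.
have E : Num.floor (y + s) = Num.floor y.
  by apply: floor_def_int; rewrite intrD; apply/andP; split; lra.
by rewrite /lin E; ring.
Qed.

(** At most one integer is crossed, and the slopes on both sides are at most [L]. *)
Lemma lin_lip w y s L : 0 <= s <= 1 -> (forall j, `|w (j + 1) - w j| <= L) -> `|lin w (y + s) - lin w y| <= L * s.
Proof.
move=> /andP[s0 s1] wL; have /andP[h1 h2] := frac_le y.
have [lt|ge] := ltP s (1 - (y - (Num.floor y)%:~R)).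
  by rewrite lin_slope ?s0// normrM (ger0_norm s0) mulrC ler_wpM2r.
have E : Num.floor (y + s) = Num.floor y + 1.
  by apply: floor_def_int; rewrite !intrD; apply/andP; split; lra.
rewrite /lin E intrD; move: (wL (Num.floor y)) (wL (Num.floor y + 1)) h1 h2 ge.
move: (w _) (w _) (w _) (Num.floor y)%:~R => c a b j; rewrite !ler_norml => /andP[k1 k2] /andP[k3 k4] h1 h2 ge.
have -> : (1 - (y + s - (j + 1%:~R))) * b + (y + s - (j + 1%:~R)) * c - ((1 - (y - j)) * a + (y - j) * b) =
  (y - j - (1 - s)) * (c - b) + (1 - (y - j)) * (b - a) by ring.
move: k1 k2 k3 k4; move: (c - b) (b - a) => p q k1 k2 k3 k4.
have : 0 <= y - j - (1 - s) by lra.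
have : 0 <= 1 - (y - j) by lra.
have -> : L * s = L * (y - j - (1 - s)) + L * (1 - (y - j)) by ring.
by move: (y - j - (1 - s)) (1 - (y - j)) => A B B0 A0; apply/andP; split; nra.
Qed.

Lemma lin_period w y (N : nat) : (forall j, w (j + N%:Z) = w j) -> lin w (y + N%:R) = lin w y.
Proof.
move=> wN; have E : Num.floor (y + N%:R) = Num.floor y + N%:Z.
  apply: floor_def_int; rewrite !intrD; have /andP[h1 h2] := frac_le y.
  by rewrite -!pmulrn; apply/andP; split; lra.
have E1 : w (Num.floor y + N%:Z + 1) = w (Num.floor y + 1) by rewrite -addrA (addrC N%:Z) addrA wN.
have E2 : y + N%:R - (Num.floor y + N%:Z)%:~R = y - (Num.floor y)%:~R by rewrite intrD -pmulrn; ring.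
by rewrite /lin E E2 E1 wN.
Qed.

Lemma linB w w' y : lin (fun j => w j - w' j) y = lin w y - lin w' y.
Proof. by rewrite /lin; ring. Qed.

Lemma linZ c w y : lin (fun j => c * w j) y = c * lin w y.
Proof. by rewrite /lin; ring. Qed.

End Interpolation1D.

Section InterpolationGradient.
Context {R : realType} (N : nat) (N0 : (0 < N)%N).
Local Notation h := (step R N).
Implicit Types (z : 'M[R]_N) (x : R * R).
Let h0 : 0 < h. Proof. exact: step_gt0. Qed.

Lemma bilin_lin0 z x : bilin z x = lin (fun j => lin (fun k => mxg z (j, k)) (x.2 / h)) (x.1 / h).
Proof. by rewrite /bilin /lin /mxg /=; ring. Qed.

Lemma bilin_lin1 z x : bilin z x = lin (fun k => lin (fun j => mxg z (j, k)) (x.1 / h)) (x.2 / h).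
Proof. by rewrite /bilin /lin /mxg /=; ring. Qed.

(** The right derivative of the interpolation in the direction [i], which exists everywhere. *)
Definition dbil (i : 'I_2) z x : R :=
  if i == 0 then lin (fun k => Dp N 0 (mxg z) (Num.floor (x.1 / h), k)) (x.2 / h)
  else lin (fun j => Dp N 1 (mxg z) (j, Num.floor (x.2 / h))) (x.1 / h).

Lemma shift0 x s : (x + s *: evec R 0).1 / h = x.1 / h + s / h /\ (x + s *: evec R 0).2 = x.2.
Proof. by split; rewrite /= /GRing.scale /= ?mulr1 ?mulr0 ?addr0 ?mulrDl. Qed.

Lemma shift1 x s : (x + s *: evec R 1).2 / h = x.2 / h + s / h /\ (x + s *: evec R 1).1 = x.1.
Proof. by split; rewrite /= /GRing.scale /= ?mulr1 ?mulr0 ?addr0 ?mulrDl. Qed.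

Lemma dbil0E z x : dbil 0 z x = h^-1 * (lin (fun k => mxg z (Num.floor (x.1 / h) + 1, k)) (x.2 / h) -
  lin (fun k => mxg z (Num.floor (x.1 / h), k)) (x.2 / h)).
Proof.
rewrite /dbil /= -linB -linZ; congr (lin _ _); apply/funext => k.
by rewrite /Dp ed0 mulrC; congr (_ * (mxg z (_, _) - _)); rewrite addr0.
Qed.

Lemma dbil1E z x : dbil 1 z x = h^-1 * (lin (fun j => mxg z (j, Num.floor (x.2 / h) + 1)) (x.1 / h) -
  lin (fun j => mxg z (j, Num.floor (x.2 / h))) (x.1 / h)).
Proof.
rewrite /dbil /= -linB -linZ; congr (lin _ _); apply/funext => k.
by rewrite /Dp ed1 mulrC; congr (_ * (mxg z (_, _) - _)); rewrite addr0.
Qed.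

Lemma bilin_slope i z x : exists2 s0 : R, 0 < s0 & forall s, 0 <= s < s0 ->
  bilin z (x + s *: evec R i) - bilin z x = s * dbil i z x.
Proof.
have sl (y : R) : 0 < h * (1 - (y / h - (Num.floor (y / h))%:~R)) /\
    forall s, 0 <= s < h * (1 - (y / h - (Num.floor (y / h))%:~R)) -> 0 <= s / h < 1 - (y / h - (Num.floor (y / h))%:~R).
  split; first by have /andP[_ f1] := frac_le (y / h); rewrite mulr_gt0// subr_gt0.
  by move=> s /andP[sp s1]; apply/andP; split; [by apply: divr_ge0 => //; exact: ltW|rewrite ltr_pdivrMr// mulrC].
elim/ord2P: i.
- have [p1 p2] := sl x.1; exists (h * (1 - (x.1 / h - (Num.floor (x.1 / h))%:~R))) => // s hs.
  have [e1 e2] := shift0 x s; rewrite !bilin_lin0 e1 e2 lin_slope; last exact: p2.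
  by rewrite dbil0E mulrA.
- have [p1 p2] := sl x.2; exists (h * (1 - (x.2 / h - (Num.floor (x.2 / h))%:~R))) => // s hs.
  have [e1 e2] := shift1 x s; rewrite !bilin_lin1 e1 e2 lin_slope; last exact: p2.
  by rewrite dbil1E mulrA.
Qed.

Lemma shift_ed0 (j k : int) : (j, k) + ed 0 = (j + 1, k).
Proof. by rewrite ed0; congr (_, _); rewrite addr0. Qed.

Lemma shift_ed1 (j k : int) : (j, k) + ed 1 = (j, k + 1).
Proof. by rewrite ed1; congr (_, _); rewrite addr0. Qed.

(** Short steps cross at most one grid line; longer ones are divided into short ones. *)
Lemma bilin_lip i z x s L : 0 <= s -> (forall p, `|Dp N i (mxg z) p| <= L) ->
  `|bilin z (x + s *: evec R i) - bilin z x| <= L * s.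
Proof.
move=> s0 zL.
have dL (y : R) (w : int -> int -> R) : (forall j k, `|w (j + 1) k - w j k| <= L * h) ->
    forall j, `|lin (w (j + 1)) y - lin (w j) y| <= L * h.
  by move=> H j; rewrite -linB; apply: lin_bound => k; exact: H.
have d1 p : `|mxg z (p + ed i) - mxg z p| <= L * h.
  by have := zL p; rewrite /Dp normrM normfV (gtr0_norm h0) ler_pdivrMr.
have small s' y : 0 <= s' <= h -> `|bilin z (y + s' *: evec R i) - bilin z y| <= L * s'.
  move=> /andP[a1 a2]; have a3 : 0 <= s' / h <= 1 by apply/andP; split; [apply: divr_ge0 => //; exact: ltW|rewrite ler_pdivrMr ?mul1r].
  have -> : L * s' = L * h * (s' / h) by rewrite mulrACA mulfV ?gt_eqF// mulr1.
  clear zL s0 s; move: d1; elim/ord2P: i => d1.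
  - have [e1 e2] := shift0 y s'; rewrite !bilin_lin0 e1 e2; apply: lin_lip => //.
    by apply: (dL _ (fun j k => mxg z (j, k))) => j k; have := d1 (j, k); rewrite shift_ed0.
  - have [e1 e2] := shift1 y s'; rewrite !bilin_lin1 e1 e2; apply: lin_lip => //.
    by apply: (dL _ (fun j k => mxg z (k, j))) => j k; have := d1 (k, j); rewrite shift_ed1.
have big (n : nat) : forall s', 0 <= s' <= n%:R * h -> `|bilin z (x + s' *: evec R i) - bilin z x| <= L * s'.
  elim: n => [|n IHn] s' /andP[a1 a2].
    have -> : s' = 0 by apply/eqP; rewrite eq_le a1 andbT; move: a2; rewrite mul0r.
    by rewrite (scale0r (evec R i)) addr0 subrr normr0 mulr0.
  have [le|gt] := leP s' h; first by apply: small; rewrite a1.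
  have b1 : 0 <= s' - h <= n%:R * h by move: a2; rewrite -natr1 mulrDl mul1r => a2; apply/andP; split; lra.
  have E : x + s' *: evec R i = x + (s' - h) *: evec R i + h *: evec R i by rewrite -addrA -scalerDl subrK.
  have -> : L * s' = L * h + L * (s' - h) by ring.
  rewrite E; apply: le_trans (ler_distD (bilin z (x + (s' - h) *: evec R i)) _ _) _.
  by apply: lerD; [apply: small; rewrite lexx ltW|exact: IHn].
apply: (big (Num.truncn (s / h)).+1); rewrite s0 /= -ler_pdivrMr// ltW//.
exact: truncnS_gt.
Qed.

Lemma bilin_cont z : continuous (bilin z).
Proof.
have [L L0 HL] : exists2 L : R, 0 < L & forall i p, `|Dp N i (mxg z) p| <= L.
  have [p Hp] := grid_argmax N0 (gper_comp2 (fun a b => `|a| + `|b|) (gper_Dp 0 (gper_mxg z)) (gper_Dp 1 (gper_mxg z))).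
  exists (`|Dp N 0 (mxg z) p| + `|Dp N 1 (mxg z) p| + 1) => [|i q]; first by rewrite ltr_wpDl// addr_ge0.
  apply: le_trans (_ : `|Dp N 0 (mxg z) q| + `|Dp N 1 (mxg z) q| <= _); last by apply: le_trans (Hp q) _; rewrite lerDl.
  by elim/ord2P: i; rewrite ?lerDl ?lerDr.
have LL i x (s : R) : `|bilin z (x + s *: evec R i) - bilin z x| <= L * `|s|.
  have [s0|/ltW s0] := leP 0 s; first by rewrite (ger0_norm s0); exact: (bilin_lip x s0 (HL i)).
  have := @bilin_lip i z (x + s *: evec R i) (- s) L; rewrite oppr_ge0 => /(_ s0 (HL i)).
  have E : x + s *: evec R i + - s *: evec R i = x by rewrite -addrA -(scalerDl (evec R i)) subrr (scale0r (evec R i)) addr0.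
  by rewrite E distrC (ler0_norm s0).
move=> x; apply/(@cvgrPdist_lt _ _ _ (nbhs x)) => e e0.
near=> y.
have xy : `|x - y| < e / (2 * L) by near: y; apply: cvgr_dist_lt; [exact: cvg_id|exact: divr_gt0 (mulr_gt0 _ _)].
move: xy; rewrite prod_norm_lt /= => /andP[h1 h2].
have E : x = y + (x.1 - y.1) *: evec R 0 + (x.2 - y.2) *: evec R 1.
  by rewrite [LHS]surjective_pairing [RHS]surjective_pairing; congr pair; rewrite /= /GRing.scale /=; ring.
have A1 := LL 0 y (x.1 - y.1); have A2 := LL 1 (y + (x.1 - y.1) *: evec R 0) (x.2 - y.2).
rewrite {1}E; apply: le_lt_trans (ler_distD (bilin z (y + (x.1 - y.1) *: evec R 0)) _ _) _.
have -> : e = L * (e / (2 * L)) + L * (e / (2 * L)) by field; rewrite gt_eqF.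
by apply: ltrD; [apply: le_lt_trans A2 _|apply: le_lt_trans A1 _]; rewrite ltr_pM2l.
Unshelve. all: by end_near. Qed.

Lemma bilin_torus z : torus_fun (bilin z).
Proof.
move=> x; have hN : h^-1 = N%:R by rewrite invrK.
have pz j k i : mxg z ((j, k) + ed i *+ N) = mxg z (j, k) by exact: gper_mxg.
have e0 : ed 0 *+ N = (N%:Z, 0) by rewrite ed0; elim: (N) => //= n IH; rewrite mulrS IH intS.
have e1 : ed 1 *+ N = (0, N%:Z) by rewrite ed1; elim: (N) => //= n IH; rewrite mulrS IH intS.
split.
- rewrite !bilin_lin0 /= addr0 (mulrDl _ 1) mul1r hN lin_period// => j.
  by congr (lin _ _); apply/funext => k; rewrite -(pz j k 0) e0; congr (mxg z (_, _)); rewrite addr0.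
- rewrite !bilin_lin1 /= addr0 (mulrDl _ 1) mul1r hN lin_period// => k.
  by congr (lin _ _); apply/funext => j; rewrite -(pz j k 1) e1; congr (mxg z (_, _)); rewrite addr0.
Qed.

End InterpolationGradient.

(** * Weak derivatives by difference quotients *)

Section WeakDerivatives.
Context {R : realType}.
Implicit Types (f g : R * R -> R) (x : R * R).

Lemma cvg_norm_le (a : nat -> R) (l C : R) : a @ \oo --> l -> (forall k, `|a k| <= C) -> `|l| <= C.
Proof.
move=> al aC; have h : (fun k => `|a k|) @ \oo --> `|l| by exact: cvg_norm.
rewrite -(cvg_lim _ h)//; apply: limr_le; first by apply/cvg_ex; exists `|l|.
by near=> k; exact: aC.
Unshelve. all: by end_near. Qed.

Lemma cell_bounded_cvg (F : nat -> R * R -> R) g C :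
  (forall k, measurable_fun [set: mplane R] (F k : mplane R -> measurableTypeR R)) ->
  (forall k x, `|F k x| <= C) -> (forall x, (fun k => F k x) @ \oo --> g x) ->
  (fun k => \int[leb2 R]_(x in @cell R) F k x) @ \oo --> \int[leb2 R]_(x in @cell R) g x.
Proof.
move=> mF FC Fg.
have mcell : measurable (@cell R : set (mplane R)) by exact: measurable_cell.
have mg : measurable_fun [set: mplane R] (g : mplane R -> measurableTypeR R).
  by apply: (@measurable_fun_cvg _ _ _ _ F) => // x _; exact: Fg.
have gC x : `|g x| <= C.
  by apply: cvg_norm_le (Fg x) _ => k; exact: FC.
have [] // := @dominated_convergence _ _ _ (leb2 R) (@cell R) mcell
    (fun n x => (F n x)%:E) (fun x => (g x)%:E) (fun=> C%:E).
- by move=> n; apply: measurable_funTS; apply/measurable_EFinP; exact: mF.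
- by apply: measurable_funTS; apply/measurable_EFinP.
- by apply: aeW => x _; apply: cvg_EFin; [near=> n|exact: Fg].
- apply/integrableP; split; first exact: measurable_cst.
  by rewrite integral_cst//= leb2_cell mule1 ltry.
- by apply: aeW => x n _; rewrite lee_fin.
move=> _ _ H.
have ig : (leb2 R).-integrable (@cell R) (EFin \o g).
  by apply: bounded_integrable_cell => //; exists C.
have E : (\int[leb2 R]_(x in @cell R) (g x)%:E = (\int[leb2 R]_(x in @cell R) g x)%:E)%E.
  by rewrite /Rintegral fineK//; exact: integrable_fin_num.
move: H; rewrite E => H; exact: (@fine_cvg _ _ _ _ _ _ H).
Unshelve. all: by end_near. Qed.

Lemma nd_edn N p i n : nd N (p + ed i *+ n) = nd N p + (n%:R * step R N) *: evec R i :> R * R.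
Proof.
elim: n => [|n IH]; first by rewrite mulr0n addr0 mul0r (scale0r (evec R i)) addr0.
by rewrite mulrSr addrA nd_ed IH -addrA -(scalerDl (evec R i)) -natr1 mulrDl mul1r.
Qed.

Lemma torus_translate f a : torus_fun f -> torus_fun (fun x => f (x + a)).
Proof. by move=> tf x; have [h1 h2] := tf (x + a); split; rewrite addrAC. Qed.

Lemma cont_translate f a : continuous f -> continuous (fun x => f (x + a)).
Proof.
move=> cf x; apply: (@cvg_comp _ _ _ (fun y : R * R => y + a) f); last exact: cf.
by apply: cvgD; [exact: cvg_id|exact: cvg_cst].
Qed.

(** The translation permutes the nodes of every grid whose number of subdivisions is a multiple of
[k + 1], so the Riemann sums agree. *)
Lemma int_translate i f (k : nat) : continuous f -> torus_fun f ->
  \int[leb2 R]_(x in @cell R) f (x + k.+1%:R^-1 *: evec R i) = \int[leb2 R]_(x in @cell R) f x.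
Proof.
move=> cf tf; apply/eqP; rewrite -subr_eq0 -normr_le0; apply/ler_addgt0Pl => e e0; rewrite addr0.
have cf' := @cont_translate f (k.+1%:R^-1 *: evec R i) cf; have tf' := @torus_translate f (k.+1%:R^-1 *: evec R i) tf.
have e2 : 0 < e / 2 by exact: divr_gt0.
have [d1 d10 H1] := riemann_uc cf tf e2; have [d2 d20 H2] := riemann_uc cf' tf' e2.
have d0 : 0 < Num.min d1 d2 by rewrite lt_min d10.
have [n n0 nd_] := step_small d0.
have N0 : (0 < k.+1 * n)%N by rewrite muln_gt0.
have sN : step R (k.+1 * n) < Num.min d1 d2.
  apply: le_lt_trans nd_; rewrite /step lef_pV2 ?posrE ?ltr0n// ler_nat.
  by rewrite leq_pmull.
move: sN; rewrite lt_min => /andP[s1 s2].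
have := H1 _ N0 s1; have := H2 _ N0 s2.
have -> : avg (k.+1 * n) (fun p => f (nd (k.+1 * n) p + k.+1%:R^-1 *: evec R i)) = avg (k.+1 * n) (fun p => f (nd (k.+1 * n) p)).
  rewrite -(avg_shiftD (ed i *+ n) (gper_nd N0 tf)); apply: eq_avg => p; rewrite nd_edn.
  by congr (f (_ + _ *: _)); rewrite /step natrM invfM mulrCA mulfV ?mulr1// pnatr_eq0 -lt0n.
move: (avg _ _) (Rintegral _ _ _) (Rintegral _ _ _) => a b c.
by rewrite !ler_norml => /andP[h1 h2] /andP[h3 h4]; apply/andP; split; lra.
Qed.

(** Translation invariance moves the forward difference quotients of [f] at step [1 / (k + 1)] to
backward ones of the test function; both sides converge boundedly. *)
Lemma weak_pd_quotient i f g (L : R) : continuous f -> torus_fun f ->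
  (forall (k : nat) x, `|f (x + k.+1%:R^-1 *: evec R i) - f x| <= L * k.+1%:R^-1) ->
  (forall x, (fun k : nat => k.+1%:R * (f (x + k.+1%:R^-1 *: evec R i) - f x)) @ \oo --> g x) ->
  weak_pd i f g.
Proof.
move=> cf tf fL fg.
pose s k : R := k.+1%:R^-1; have s0 k : 0 < s k by rewrite invr_gt0 ltr0n.
have ks k : k.+1%:R * s k = 1 by rewrite mulfV.
pose q k x := k.+1%:R * (f (x + s k *: evec R i) - f x).
have cq k : continuous (q k).
  by move=> x; apply: cvgM; [exact: cvg_cst|apply: cvgB; [exact: cont_translate|exact: cf]].
have mq k : measurable_fun [set: mplane R] (q k : mplane R -> measurableTypeR R).
  exact: continuous_measurable2.
have qL k x : `|q k x| <= L.
  by rewrite normrM ger0_norm// -ler_pdivlMl// mulrC; exact: fL.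
have mg : measurable_fun [set: mplane R] (g : mplane R -> measurableTypeR R).
  by apply: (@measurable_fun_cvg _ _ _ _ q) => // x _; exact: fg.
have gL x : `|g x| <= L.
  by apply: cvg_norm_le (fg x) _ => k; exact: qL.
split.
- have tg a : (forall x, f (x + a) = f x) -> forall x, g (x + a) = g x.
    move=> fa x; have := fg (x + a).
    have -> : (fun k : nat => k.+1%:R * (f (x + a + k.+1%:R^-1 *: evec R i) - f (x + a))) =
      (fun k : nat => k.+1%:R * (f (x + k.+1%:R^-1 *: evec R i) - f x)).
      by apply/funext => k; rewrite (addrAC x) !fa.
    by move=> h1; exact: (cvg_unique _ h1 (fg x)).
  by move=> x; split; apply: tg => y; have [] := tf y.
- exact: cont_integrable.
- by apply: bounded_integrable_cell => //; exists L.
move=> phi tphi sphi.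
have [cphi [dphi cpd]] : continuous phi /\ (forall x i, derivable phi x (evec R i)) /\ forall i, continuous (pd i phi).
  by have [h1 [h2 h3]] := sphi 1%N; split=> //; split=> // j; have [] := h3 j.
have [B B0 HB] := torus_bdd1 cphi tphi.
have [Bf Bf0 HBf] := torus_bdd1 cf tf.
have [P P0 HP] := C1_lipschitz tphi (sphi 1%N).
pose r k x := k.+1%:R * (phi (x - s k *: evec R i) - phi x).
have cr k : continuous (r k).
  by move=> x; apply: cvgM; [exact: cvg_cst|apply: cvgB; [exact: cont_translate|exact: cphi]].
have A1 : (fun k => \int[leb2 R]_(x in @cell R) (q k x * phi x)) @ \oo --> \int[leb2 R]_(x in @cell R) (g x * phi x).
  apply: (@cell_bounded_cvg _ _ (L * B)) => [k|k x|x].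
  - by apply: continuous_measurable2 => x; apply: cvgM; [exact: cq|exact: cphi].
  - by rewrite normrM; apply: ler_pM.
  - by apply: cvgM; [exact: fg|exact: cvg_cst].
have A2 : (fun k => \int[leb2 R]_(x in @cell R) (f x * r k x)) @ \oo --> \int[leb2 R]_(x in @cell R) (f x * - pd i phi x).
  apply: (@cell_bounded_cvg _ _ (Bf * P)) => [k|k x|x].
  - by apply: continuous_measurable2 => x; apply: cvgM; [exact: cf|exact: cr].
  - rewrite normrM; apply: ler_pM => //.
    rewrite normrM ger0_norm// -ler_pdivlMl// mulrC distrC.
    by have := HP (x - s k *: evec R i) i (s k) (ltW (s0 k)); rewrite subrK.
  - apply: cvgM; first exact: cvg_cst.
    apply/(@cvgrPdist_lt _ _ _ \oo) => e e0.
    have [d d0 Hd] := derive_eps (dphi x i) e0.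
    have : \forall k \near \oo, s k < d.
      have := @cvg_harmonic R; move/(@cvgrPdist_lt _ _ _ \oo)/(_ d d0); apply: filterS => k /=.
      by rewrite sub0r normrN gtr0_norm.
    apply: filterS => k sd.
    have := Hd (- s k); rewrite oppr_eq0 gt_eqF// normrN gtr0_norm// => /(_ isT sd).
    congr (`|_| < _).
    rewrite /r /pd /s invrN invrK scaleNr; ring.
have E k : \int[leb2 R]_(x in @cell R) (q k x * phi x) = \int[leb2 R]_(x in @cell R) (f x * r k x).
  have mcell : measurable (@cell R : set (mplane R)) by exact: measurable_cell.
  pose F x := f x * phi (x - s k *: evec R i).
  have cF : continuous F by move=> x; apply: cvgM; [exact: cf|exact: cont_translate].
  have tF : torus_fun F.
    by have t2 := @torus_translate phi (- (s k *: evec R i)) tphi; move=> x; rewrite /F; have [-> ->] := tf x; have [-> ->] := t2 x.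
  have cG : continuous (fun x => f x * phi x) by move=> x; apply: cvgM; [exact: cf|exact: cphi].
  have tG : torus_fun (fun x => f x * phi x) by move=> x; have [-> ->] := tf x; have [-> ->] := tphi x.
  have I1 : \int[leb2 R]_(x in @cell R) (q k x * phi x) =
    k.+1%:R * (\int[leb2 R]_(x in @cell R) F (x + s k *: evec R i) - \int[leb2 R]_(x in @cell R) (f x * phi x)).
    rewrite -RintegralB//; last 2 first.
    - by apply: cont_integrable; [exact: cont_translate|exact: torus_translate].
    - exact: cont_integrable.
    rewrite -RintegralZl//; last first.
      apply: cont_integrable; first by move=> x; apply: cvgB; [exact: cont_translate|exact: cG].
      by move=> x; have [-> ->] := torus_translate (s k *: evec R i) tF x; have [-> ->] := tG x.
    by apply: eq_Rintegral => x _; rewrite /q /F addrK; ring.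
  have I2 : \int[leb2 R]_(x in @cell R) (f x * r k x) =
    k.+1%:R * (\int[leb2 R]_(x in @cell R) F x - \int[leb2 R]_(x in @cell R) (f x * phi x)).
    rewrite -RintegralB//; last 2 first.
    - exact: cont_integrable.
    - exact: cont_integrable.
    rewrite -RintegralZl//; last first.
      apply: cont_integrable; first by move=> x; apply: cvgB; [exact: cF|exact: cG].
      by move=> x; have [-> ->] := tF x; have [-> ->] := tG x.
    by apply: eq_Rintegral => x _; rewrite /r /F; ring.
  by rewrite I1 I2 int_translate.
have A3 : (fun k => \int[leb2 R]_(x in @cell R) (q k x * phi x)) @ \oo --> \int[leb2 R]_(x in @cell R) (f x * - pd i phi x).
  by rewrite (_ : (fun k => _) = (fun k => \int[leb2 R]_(x in @cell R) (f x * r k x))); last by apply/funext => k; exact: E.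
rewrite (cvg_unique _ A1 A3).
rewrite -[LHS]opprK; congr (- _); rewrite -mulN1r -RintegralZl//.
- by apply: eq_Rintegral => x _; ring.
- exact: measurable_cell.
- apply: cont_integrable; first by move=> x; apply: cvgM; [exact: cf|exact: cpd].
  by have tp := torus_pd i tphi; move=> x; have [-> ->] := tf x; have [-> ->] := tp x.
Unshelve. all: by end_near. Qed.

End WeakDerivatives.

(** * Space-time interpolation *)

Section TimeSlabs.
Context {R : realType} (T : R) (NT : nat) (T0 : 0 < T) (NT0 : (0 < NT)%N).
Local Notation dt := (T / NT%:R).
Implicit Types (t : R) (x : R * R).

Let dt0 : 0 < dt. Proof. by rewrite divr_gt0 ?ltr0n. Qed.
Let dtN : NT%:R * dt = T. Proof. by rewrite mulrCA mulfV ?mulr1// pnatr_eq0 -lt0n. Qed.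

Lemma slab_exists t : 0 <= t < T -> exists2 n, (n < NT)%N & n%:R * dt <= t < n.+1%:R * dt.
Proof.
move=> /andP[t0 tT]; exists (Num.truncn (t / dt)).
  rewrite -(ltr_nat R); apply: le_lt_trans (_ : t / dt < _).
    by rewrite truncn_le divr_ge0// ltW.
  by rewrite ltr_pdivrMr// dtN.
apply/andP; split; first by rewrite -ler_pdivlMr// truncn_le divr_ge0// ltW.
by rewrite -ltr_pdivrMr// truncnS_gt.
Qed.

Lemma trilin_slab t n : n%:R * dt <= t < n.+1%:R * dt -> exists2 c : R, 0 <= c <= 1 &
  forall N (v : nat -> 'M[R]_N) x, trilin T NT v t x = (1 - c) * bilin (v n) x + c * bilin (v n.+1) x.
Proof.
move=> /andP[h1 h2]; have E : Num.truncn (t / dt) = n.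
  by apply: truncn_def; rewrite ler_pdivlMr// h1 ltr_pdivrMr.
exists (t / dt - n%:R); last by move=> N v x; rewrite /trilin E.
rewrite subr_ge0 ler_pdivlMr// h1 /= lerBlDr addrC natr1 ler_pdivrMr//; exact: ltW.
Qed.

(** At [t = T] the index of the time step is [NT], and the value at the step [NT + 1] has weight
zero. *)
Lemma trilin_final N (v : nat -> 'M[R]_N) x : trilin T NT v T x = bilin (v NT) x.
Proof.
have E : T / dt = NT%:R by rewrite -{1}dtN mulfK ?gt_eqF.
by rewrite /trilin E natrK subrr subr0 mul1r mul0r addr0.
Qed.

Lemma measurable_slab n : measurable (`[n%:R * dt, n.+1%:R * dt[%classic : set (measurableTypeR R)).
Proof. exact: measurable_itv. Qed.

Lemma leb1_slab n : leb1 R `[n%:R * dt, n.+1%:R * dt[%classic = dt%:E.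
Proof.
transitivity (lebesgue_measure (`[n%:R * dt, n.+1%:R * dt[%classic : set R)); first by [].
rewrite lebesgue_measure_itv /= lte_fin ltr_pM2r// ltr_nat ltnSn -EFinB.
by rewrite -mulrBl -natrB// subSnn mul1r.
Qed.

Lemma L2W12_le (f : R -> R * R -> R) (S : nat -> R) (B : R) : 0 <= B -> (forall n, 0 <= S n) ->
  (forall n t, (n < NT)%N -> n%:R * dt <= t < n.+1%:R * dt -> 0 < t < T -> (W12_norm (f t) <= (Num.sqrt (S n))%:E)%E) ->
  dt * \sum_(0 <= n < NT) S n <= B ^+ 2 -> (L2W12_norm T f <= B%:E)%E.
Proof.
move=> B0 S0 fS SB.
apply: (@L2_cover_le _ _ _ (leb1 R) _ (fun n : 'I_NT => `[n%:R * dt, n.+1%:R * dt[%classic) _ _ _ _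
   (fun n => Num.sqrt (S n))) => //.
- rewrite (_ : [set t | _] = `]0, T[%classic); first exact: measurable_itv.
  by apply/seteqP; split => t /=; rewrite in_itv.
- move=> t tT; have /andP[t0 t1] := tT.
  have [|n nN nt] := @slab_exists t; first by rewrite ltW.
  exists (Ordinal nN); first by rewrite /= in_itv.
  by rewrite gee0_abs ?W12_norm_ge0//; exact: fS nt tT.
- apply: le_trans (_ : _ <= (dt * \sum_(0 <= n < NT) S n)%:E)%E _; last by rewrite lee_fin.
  rewrite big_mkord mulr_sumr -sumEFin le_eqVlt; apply/orP; left; apply/eqP; apply: eq_bigr => n _.
  by rewrite sqr_sqrtr// leb1_slab EFinM muleC.
Qed.

Lemma L2_TQ_le N (f : R -> R * R -> R) (c : nat -> int * int -> R) (B : R) : (0 < N)%N -> 0 <= B ->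
  (forall n (k l : 'I_N) t x, (n < NT)%N -> n%:R * dt <= t < n.+1%:R * dt -> sq N k l x -> f t x ^+ 2 <= c n (k%:Z, l%:Z)) ->
  dt * \sum_(0 <= n < NT) avg N (c n) <= B ^+ 2 -> (L2_norm_TQ T f <= B%:E)%E.
Proof.
move=> N0 B0 fc cB; have h0 : 0 < step R N by exact: step_gt0.
have c0 (n : 'I_NT) (k l : 'I_N) : 0 <= c n (k%:Z, l%:Z).
  have sx : sq N k l (k%:R * step R N, l%:R * step R N).
    by split; rewrite /= in_itv /= lexx ltr_pM2r// ltr_nat ltnSn.
  apply: le_trans (fc n k l (n%:R * dt) _ (ltn_ord n) _ sx); first exact: sqr_ge0.
  by rewrite lexx ltr_pM2r// ltr_nat ltnSn.
pose A (i : 'I_NT * ('I_N * 'I_N)) : set (measurableTypeR R * mplane R) :=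
  `[i.1%:R * dt, i.1.+1%:R * dt[%classic `*` sq N i.2.1 i.2.2.
have mA i : measurable (A i) by apply: measurableX; [exact: measurable_slab|exact: measurable_sq].
apply: (@L2_cover_le _ _ _ (leb3 R) _ A _ _ _ _ (fun i => Num.sqrt (c i.1 (i.2.1%:Z, i.2.2%:Z)))) => //.
- rewrite (_ : [set z : R * (R * R) | _] = `]0, T[%classic `*` (@cell R)); last first.
    by apply/seteqP; split => -[t x] /=; rewrite in_itv.
  apply: measurableX; [exact: measurable_itv|exact: measurable_cell].
- move=> [t x] [/= tT cx]; have /andP[t0 t1] := tT.
  have [|n nN nt] := @slab_exists t; first by rewrite ltW.
  have [k [l skl]] := cell_sq N0 cx.
  exists (Ordinal nN, (k, l)); first by split => //=; rewrite in_itv.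
  by rewrite lee_fin -sqrtr_sqr ler_wsqrtr//; exact: fc nt skl.
- apply: le_trans (_ : _ <= (dt * \sum_(0 <= n < NT) avg N (c n))%:E)%E _; last by rewrite lee_fin.
  rewrite big_mkord mulr_sumr -sumEFin le_eqVlt; apply/orP; left; apply/eqP.
  transitivity (\sum_(n < NT) \sum_(kl : 'I_N * 'I_N) ((dt * (step R N ^+ 2 * c n (kl.1%:Z, kl.2%:Z)))%:E))%E.
    rewrite pair_big /=; apply: eq_bigr => -[n [k l]] _ /=.
    rewrite sqr_sqrtr// /leb3 /A product_measure2E//; last exact: measurable_sq.
    rewrite [X in (_ * (X * _))%E]leb1_slab [X in (_ * (_ * X))%E]leb2_sq// -!EFinM; congr EFin; ring.
  apply: eq_bigr => n _; rewrite /avg sumEFin; congr EFin.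
  by rewrite -mulr_sumr -mulr_sumr pair_big.
Qed.

(** Outside a block of time steps a crude bound suffices if the remaining time is short. *)
Lemma time_sum_split (F : nat -> R) (K : R) (n0 n1 : nat) : (n0 <= n1 <= NT)%N ->
  (forall n, (n < NT)%N -> F n <= K) ->
  dt * \sum_(0 <= n < NT) F n <= dt * \sum_(n0 <= n < n1) F n + K * (n0%:R * dt + (T - n1%:R * dt)).
Proof.
move=> /andP[h01 h1N] FK.
have blk i j : (i <= j <= NT)%N -> \sum_(i <= n < j) F n <= K * (j - i)%:R.
  move=> /andP[ij jN]; rewrite mulr_natr -sumr_const_nat big_nat [leRHS]big_nat.
  by apply: ler_sum => n /andP[_ nj]; apply: FK; exact: leq_trans nj jN.
rewrite (big_cat_nat (n := n1))//= (big_cat_nat (n := n0) (p := n1))//=.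
have B1 := blk 0 n0; have B2 := blk n1 NT; rewrite subn0 in B1.
have {}B1 := B1 (leq_trans h01 h1N); have {}B2 : \sum_(n1 <= n < NT) F n <= K * (NT - n1)%:R by apply: B2; rewrite h1N leqnn.
move: B1 B2; move: (\sum_(0 <= n < n0) F n) (\sum_(n0 <= n < n1) F n) (\sum_(n1 <= n < NT) F n) => a b c B1 B2.
have -> : T - n1%:R * dt = (NT - n1)%:R * dt by rewrite natrB// mulrBl dtN.
apply: (@le_trans _ _ (dt * (K * n0%:R + b + K * (NT - n1)%:R))).
  by rewrite ler_pM2l// lerD// lerD2r.
by rewrite le_eqVlt; apply/orP; left; apply/eqP; ring.
Qed.

End TimeSlabs.

Section SquareConvexity.
Context {R : realType}.

Lemma sq_convex (c y a b : R) : 0 <= c <= 1 ->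
  (y - ((1 - c) * a + c * b)) ^+ 2 <= (y - a) ^+ 2 + (y - b) ^+ 2.
Proof.
move=> /andP[c0 c1].
have -> : y - ((1 - c) * a + c * b) = (1 - c) * (y - a) + c * (y - b) by ring.
move: (y - a) (y - b) => A B.
have c2 : 0 <= 1 - c by rewrite subr_ge0.
have : 0 <= c * (1 - c) * (A - B) ^+ 2 by apply: mulr_ge0; [exact: mulr_ge0|exact: sqr_ge0].
have : 0 <= c * A ^+ 2 by apply: mulr_ge0 => //; exact: sqr_ge0.
have : 0 <= (1 - c) * B ^+ 2 by apply: mulr_ge0 => //; exact: sqr_ge0.
by rewrite !expr2 => h1 h2 h3; nra.
Qed.

Lemma lin_sq (w : int -> R) (y s : R) : let j := Num.floor s in
  (y - lin w s) ^+ 2 <= (y - w j) ^+ 2 + (y - w (j + 1)) ^+ 2.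
Proof. by have /andP[h1 h2] := frac_le s; apply: sq_convex; rewrite h1 ltW. Qed.

Lemma bilin_sq N (z : 'M[R]_N) (x : R * R) (y : R) : let p := corner N x in
  (y - bilin z x) ^+ 2 <= (y - mxg z p) ^+ 2 + (y - mxg z (p + ed 0)) ^+ 2 +
    ((y - mxg z (p + ed 1)) ^+ 2 + (y - mxg z (p + ed 0 + ed 1)) ^+ 2).
Proof.
rewrite /= bilin_lin1 /corner.
apply: le_trans (lin_sq _ _ _) _; apply: lerD.
  by apply: le_trans (lin_sq _ _ _) _; rewrite shift_ed0.
by apply: le_trans (lin_sq _ _ _) _; rewrite shift_ed0 !shift_ed1.
Qed.

Lemma dbil_sq N (z : 'M[R]_N) i (x : R * R) (y : R) : let p := corner N x in
  (y - dbil i z x) ^+ 2 <= (y - Dp N i (mxg z) p) ^+ 2 + (y - Dp N i (mxg z) (p + ed (1 - i))) ^+ 2.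
Proof.
elim/ord2P: i => /=; rewrite /corner /dbil /=.
- by rewrite subr0 shift_ed1; exact: lin_sq.
- by rewrite subrr shift_ed0; exact: lin_sq.
Qed.

Lemma bilin_near N (z : 'M[R]_N) (x : R * R) (y e : R) : (0 < N)%N ->
  (forall p, `|x - nd N p| <= step R N -> `|y - mxg z p| <= e) -> `|y - bilin z x| <= e.
Proof.
move=> N0 H; have [c1 c2 c3 c4] := corner_near N0 x; have [f1 f2] := frac_itv N x.
rewrite bilinE; apply: le_trans (bil_close f1 f2 (H _ c1) (H _ c2) (H _ c3) (H _ c4)) _.
by rewrite bil_const.
Qed.

End SquareConvexity.

(** * Convergence in norm *)

Section ConvergenceInNorm.
Context {R : realType} (D : mfg_data R).
Local Notation beta := (beta_ D). Local Notation nu := (nu_ D). Local Notation T := (T_ D).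
Local Notation u0 := (u0_ D). Local Notation mT := (mT_ D).
Local Notation u := (u_ D). Local Notation m := (m_ D).
Local Notation dt := (dt D).
Local Notation U := (Ud D). Local Notation Mu := (Md D).
Local Notation V := (Vx D). Local Notation M := (Mx D).
Local Notation uh := (fun NT N => trilin T NT (ud_ D NT N)).
Local Notation mh := (fun NT N => trilin T NT (md_ D NT N)).
Let hT := hT_ D. Let hsol := hsol_ D.

Lemma slab_close NT n n' t : (0 < NT)%N -> n%:R * dt NT <= t < n.+1%:R * dt NT -> n' = n \/ n' = n.+1 ->
  `|t - n'%:R * dt NT| <= dt NT.
Proof.
move=> NT0; have d0 := dt_gt0 D NT0; rewrite -natr1 mulrDl mul1r.
by move=> /andP[h1 h2] [->|->]; rewrite ?(natr1 n) -?natr1 ?mulrDl ?mul1r ler_norml; apply/andP; split; lra.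
Qed.

Lemma uh_sup (e : R) : 0 < e -> exists2 r : R, 0 < r & forall NT N t x, (0 < NT)%N -> (0 < N)%N ->
  dt NT < r -> step R N < r -> 0 <= t <= T -> `|u t x - uh NT N t x| <= e.
Proof.
move=> e0; have e2 : 0 < e / 2 by exact: divr_gt0.
have [r1 r10 H1] := U_sup D e2; have [r2 r20 H2] := uc_u D e2.
exists (Num.min r1 r2); first by rewrite lt_min r10.
move=> NT N t x NT0 N0; rewrite !lt_min => /andP[d1 d2] /andP[s1 s2] ht.
have near n : (n <= NT)%N -> `|t - n%:R * dt NT| <= dt NT -> `|u t x - bilin (ud_ D NT N n) x| <= e.
  move=> nN tn; apply: bilin_near => // p xp.
  apply: le_trans (ler_distD (V NT N n p) _ _) _.
  have -> : e = e / 2 + e / 2 by field.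
  apply: lerD; last by rewrite distrC; exact: H1.
  by apply/ltW/H2 => //; [exact: time_in|exact: le_lt_trans tn d2|exact: le_lt_trans xp s2].
have /andP[t0 tT] := ht.
move: tT; rewrite le_eqVlt => /predU1P[tE|tT].
  by subst t; rewrite (trilin_final hT NT0); apply: near => //; rewrite dt_NT// subrr normr0 ltW// dt_gt0.
have [|n nN nt] := slab_exists hT NT0 (t := t); first by rewrite t0.
have [c c01 ->] := trilin_slab hT NT0 nt.
have A := near n (ltnW nN) (slab_close NT0 nt (or_introl erefl)).
have B := near n.+1 nN (slab_close NT0 nt (or_intror erefl)).
move: A B c01; move: (bilin _ _) (bilin _ _) (u t x) => a b y.
rewrite !ler_norml => /andP[a1 a2] /andP[b1 b2] /andP[c0 c1]; apply/andP; split; nra.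
Qed.

Lemma sup_norm_cvg : vanishes_as_steps_to_0 T (fun NT N => sup_norm_TQ T (fun t x => uh NT N t x - u t x)).
Proof.
move=> e e0; have [r r0 H] := uh_sup (divr_gt0 e0 (ltr0n _ 2)).
exists r => // NT N NT0 N0 d s; apply: (@le_lt_trans _ _ (e / 2)%:E); last by rewrite lte_fin ltr_pdivrMr// ltr_pMr// ltr1n.
apply: ub_ereal_sup => _ [t [x [ht ->]]]; rewrite lee_fin distrC; exact: H.
Qed.

(** The interpolations of the discrete solutions are uniformly Lipschitz, and [u] is their uniform
limit. This bounds the gradient of [u] up to the times [0] and [T], where the regularity of the
classical solution gives no control. *)
Lemma u_pd_bound : exists2 C : R, 0 <= C & (forall t x i, 0 < t < T -> `|pd i (u t) x| <= C) /\
  (forall NT N n i p, (0 < NT)%N -> (0 < N)%N -> (n <= NT)%N -> `|Dp N i (U NT N n) p| <= C).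
Proof.
have [C C0 HC] := U_bounds D; exists C => //; split; last first.
  by move=> NT N n i p NT0 N0 nN; have [_ H _] := HC NT N n NT0 N0 nN; exact: H.
move=> t x i ht; have ht' : 0 <= t <= T by case/andP: ht => h1 h2; rewrite !ltW.
have lip (s : R) : 0 <= s -> `|u t (x + s *: evec R i) - u t x| <= C * s.
  move=> s0; apply/ler_addgt0Pl => e e0; have e2 : 0 < e / 2 by exact: divr_gt0.
  have [r r0 H] := uh_sup e2.
  have [N N0 sN] := step_small r0.
  have [NT NT0 sNT] := step_small (divr_gt0 r0 hT).
  have dr : dt NT < r by move: sNT; rewrite /step ltr_pdivlMr// mulrC.
  have L : `|uh NT N t (x + s *: evec R i) - uh NT N t x| <= C * s.
    have bl n : (n <= NT)%N -> `|bilin (ud_ D NT N n) (x + s *: evec R i) - bilin (ud_ D NT N n) x| <= C * s.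
      by move=> nN; apply: bilin_lip => // p; have [_ Q _] := HC NT N n NT0 N0 nN; exact: Q.
    have [|n nN nt] := slab_exists hT NT0 (t := t); first by case/andP: ht => h1 ->; rewrite ltW.
    have [c /andP[c0 c1] E] := trilin_slab hT NT0 nt; rewrite /= !E.
    have := bl n (ltnW nN); have := bl n.+1 nN.
    move: (bilin _ _) (bilin _ _) (bilin _ _) (bilin _ _) (C * s) => a b c' d k.
    by rewrite !ler_norml => /andP[a1 a2] /andP[b1 b2]; apply/andP; split; nra.
  have := H NT N t x NT0 N0 dr sN ht'; have := H NT N t (x + s *: evec R i) NT0 N0 dr sN ht'.
  move: L; rewrite /=; move: (trilin _ _ _ _ _) (trilin _ _ _ _ _) (u t _) (u t _) (C * s) => a b c d k.
  by rewrite !ler_norml => /andP[a1 a2] /andP[b1 b2] /andP[d1 d2]; apply/andP; split; lra.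
have dx : derivable (u t) x (evec R i) by have [_ h _] := (sol_C12_u hsol).1 t x ht; exact: h.
apply: cvg_norm_le (derive_seq dx) _ => k.
rewrite normrM ger0_norm// -ler_pdivlMl// mulrC; exact: lip.
Qed.

Lemma sq_split (y z w o : R) : `|y - z| <= o -> (y - w) ^+ 2 <= 2 * o ^+ 2 + 2 * (w - z) ^+ 2.
Proof.
move=> yz; have : (y - z) ^+ 2 <= o ^+ 2.
  by rewrite -(real_normK (num_real (y - z))) ler_pXn2r ?nnegrE// (le_trans _ yz).
have : 0 <= (y - z + (w - z)) ^+ 2 by exact: sqr_ge0.
have -> : y - w = y - z - (w - z) by ring.
by move: (y - z) (w - z) => a b; rewrite !expr2; nra.
Qed.

(** At early times, where [M_sup] does not apply, boundedness suffices. *)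
Lemma M_bounded : exists2 K : R, 0 <= K & exists2 r : R, 0 < r & forall NT N n, (0 < NT)%N -> (0 < N)%N ->
  dt NT < r -> step R N < r -> (n <= NT)%N -> avg N (fun p => (Mu NT N n p - M NT N n p) ^+ 2) <= K.
Proof.
have [K K0 H] := M_near_terminal D; have [r r0 Hr] := H 1 ltr01.
have [C C0 HC] := m_bound D.
exists (2 * (1 + K * T) + 2 * (2 * C) ^+ 2).
  apply: addr_ge0; apply: mulr_ge0 => //; last exact: sqr_ge0.
  by apply: addr_ge0 => //; apply: mulr_ge0 => //; exact: ltW.
exists r => // NT N n NT0 N0 d s nN.
have h1 := Hr NT N n NT0 N0 d s nN.
have mTC x : `|mT x| <= C.
  have TT : 0 <= T <= T by rewrite lexx ltW.
  rewrite -(sol_terminal hsol); have /andP[c1 c2] := HC T x TT.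
  by rewrite ger0_norm//; apply: le_trans c1; rewrite invr_ge0 ltW.
have MC p : `|M NT N n p| <= C.
  have /andP[a b] := HC (n%:R * dt NT) (nd N p) (time_in _ NT0 nN).
  by rewrite ger0_norm//; apply: le_trans a; rewrite invr_ge0 ltW.
apply: (@le_trans _ _ (avg N (fun p => 2 * (Mu NT N n p - mT (nd N p)) ^+ 2 + 2 * (2 * C) ^+ 2))).
  apply: avg_le => p; move: (mTC (nd N p)) (MC p); move: (Mu _ _ _ _) (M _ _ _ _) (mT _) => a b c c1 c2.
  have : `|c - b| <= 2 * C by apply: le_trans (ler_normB _ _) _; rewrite mulr_natl mulr2n lerD.
  by rewrite distrC => c3; rewrite -(sqrrN (a - b)) opprB [leRHS]addrC; exact: sq_split.
rewrite avgD avgZ avg_cst// lerD2r ler_pM2l//.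
apply: le_trans h1 _; rewrite lerD2l ler_wpM2l// lerBlDr lerDl.
by have /andP[] := @time_in _ D NT n NT0 nN.
Qed.

Let count_le NT (i j : nat) : (0 < NT)%N -> i%:R * dt NT <= j%:R * dt NT -> (i <= j)%N.
Proof. by move=> NT0; rewrite ler_pM2r ?ler_nat// dt_gt0. Qed.

Lemma block_sum_le NT (F : nat -> R) (e : R) (n0 n1 : nat) : (0 < NT)%N -> (n0 <= n1 <= NT)%N -> 0 <= e ->
  (forall n, (n0 <= n < n1)%N -> F n <= e) -> dt NT * \sum_(n0 <= n < n1) F n <= T * e.
Proof.
move=> NT0 /andP[h1 h2] e0 Fe; have d0 := dt_gt0 D NT0.
apply: (@le_trans _ _ (dt NT * (e * (n1 - n0)%:R))).
  rewrite ler_pM2l// mulr_natr -sumr_const_nat big_nat [leRHS]big_nat.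
  by apply: ler_sum => n; exact: Fe.
rewrite mulrCA mulrC; apply: ler_wpM2r => //; rewrite -(dt_NT D NT0) mulrC ler_pM2r// ler_nat.
by apply: leq_trans h2; exact: leq_subr.
Qed.

Lemma density_budget (o eta q K a : R) : 0 < q -> 0 <= K -> 0 < a -> o = Num.min 1 (q / (64 * T)) -> eta = q / (64 * T) ->
  a <= q / (64 * (K + 1)) -> T * (16 * o ^+ 2 + 16 * eta) + (16 * o ^+ 2 + 16 * K) * (2 * a) <= q.
Proof.
move=> q0 K0 a0 oE -> ha.
have o1 : o <= 1 by rewrite oE ge_min lexx.
have oq : o <= q / (64 * T) by rewrite oE ge_min lexx orbT.
have o0 : 0 <= o by rewrite oE le_min ler01 divr_ge0// ?mulr_ge0// ltW.
have oo : o ^+ 2 <= o by rewrite expr2 ler_piMr.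
have A1 : T * (16 * o ^+ 2 + 16 * (q / (64 * T))) <= q / 2.
  have -> : q / 2 = T * (16 * (q / (64 * T)) + 16 * (q / (64 * T))) by field; rewrite gt_eqF.
  by rewrite ler_pM2l// lerD2r ler_pM2l// (le_trans oo).
have A2 : (16 * o ^+ 2 + 16 * K) * (2 * a) <= q / 2.
  have K1 : 0 < K + 1 by rewrite ltr_wpDl.
  apply: (@le_trans _ _ (16 * (K + 1) * (2 * (q / (64 * (K + 1)))))).
    apply: ler_pM; [|by apply: mulr_ge0 => //; exact: ltW| |by rewrite ler_pM2l].
    - by apply: addr_ge0; apply: mulr_ge0 => //; exact: sqr_ge0.
    - by rewrite mulrDr addrC lerD2l ler_pM2l// (le_trans oo).
  by rewrite le_eqVlt; apply/orP; left; apply/eqP; field; rewrite gt_eqF.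
rewrite [leRHS](_ : q = q / 2 + q / 2); last by field.
exact: lerD.
Qed.

(** Early times contribute little because they are few; the budget of the constants is
[density_budget]. *)
Lemma L2_norm_cvg : vanishes_as_steps_to_0 T (fun NT N => L2_norm_TQ T (fun t x => mh NT N t x - m t x)).
Proof.
move=> e e0; pose q := (e / 2) ^+ 2; have q0 : 0 < q by apply: exprn_gt0; exact: divr_gt0.
have [K K0 [rK rK0 HK]] := M_bounded.
pose eta := q / (64 * T); have eta0 : 0 < eta by apply: divr_gt0 => //; exact: mulr_gt0.
pose o := Num.min 1 eta; have o0 : 0 < o by rewrite lt_min ltr01.
have K1 : 0 < K + 1 by rewrite ltr_wpDl.
have [a [a0 aq aT]] : exists a : R, [/\ 0 < a, a <= q / (64 * (K + 1)) & a <= T / 4].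
  exists (Num.min (q / (64 * (K + 1))) (T / 4)); rewrite !ge_min !lexx orbT; split=> //.
  by rewrite lt_min !divr_gt0// mulr_gt0.
have [r2 r20 H2] := uc_m D o0.
have [r3 r30 H3] := M_sup D a0 eta0.
exists (Num.min (Num.min rK r2) (Num.min r3 a)); first by rewrite !lt_min a0 rK0 r20 r30.
move=> NT N NT0 N0; rewrite !lt_min => /andP[/andP[d1 d2] /andP[d3 d4]] /andP[/andP[s1 s2] /andP[s3 _]].
have dt0 := dt_gt0 D NT0.
pose g n p := (Mu NT N n p - M NT N n p) ^+ 2.
pose A n := avg N (g n).
have gp n : (n <= NT)%N -> gper N (g n).
  by move=> nN; apply: (gper_comp2 (fun a b => (a - b) ^+ 2)); [exact: gper_Mu|exact: gper_Mx].
pose Q n p := 4 * (2 * o ^+ 2) + 2 * (g n p + g n (p + ed 0) + (g n (p + ed 1) + g n (p + ed 0 + ed 1))).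
have avgQ n : (n <= NT)%N -> avg N (Q n) = 8 * o ^+ 2 + 8 * A n.
  move=> nN; have E : avg N (fun p => g n (p + ed 0 + ed 1)) = A n.
    by rewrite /A -(avg_shiftD (ed 0 + ed 1) (gp n nN)); apply: eq_avg => p; rewrite addrA.
  rewrite /Q avgD avg_cst// avgZ !avgD !avg_shift//; try exact: gp.
  by rewrite E -/(A n); ring.
apply: (@le_lt_trans _ _ (e / 2)%:E); last by rewrite lte_fin ltr_pdivrMr// ltr_pMr// ltr1n.
apply: (@L2_TQ_le _ T NT hT NT0 N _ (fun n p => Q n p + Q n.+1 p) (e / 2) N0); first by rewrite divr_ge0 ?ltW.
  move=> n k l t x nN nt skl; have [c c01 E] := trilin_slab hT NT0 nt.
  have ht : 0 <= t <= T.
    case/andP: nt => h1 h2; apply/andP; split; first by apply: le_trans h1; apply: mulr_ge0 => //; exact: ltW.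
    by apply: le_trans (ltW h2) _; exact: dt_le.
  have one n' : (n' <= NT)%N -> `|t - n'%:R * dt NT| <= dt NT ->
      (m t x - bilin (md_ D NT N n') x) ^+ 2 <= Q n' (k%:Z, l%:Z).
    move=> nN' tn; have [c1 c2 c3 c4] := corner_near N0 x.
    have cl p : `|x - nd N p| <= step R N -> (m t x - Mu NT N n' p) ^+ 2 <= 2 * o ^+ 2 + 2 * g n' p.
      move=> xp; apply: sq_split; apply/ltW/H2 => //; [exact: time_in|exact: le_lt_trans tn d2|exact: le_lt_trans xp s2].
    apply: le_trans (bilin_sq _ _ _) _; rewrite /= -(corner_sq N0 skl) /Q.
    move: (cl _ c1) (cl _ c2) (cl _ c3) (cl _ c4); rewrite /Md.
    move: (2 * o ^+ 2) (_ ^+ 2) (_ ^+ 2) (_ ^+ 2) (_ ^+ 2) (g _ _) (g _ _) (g _ _) (g _ _) => *; lra.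
  rewrite E -sqrrN opprB; apply: le_trans (sq_convex _ _ _ c01) _.
  by apply: lerD; apply: one => //; [exact: ltnW|exact: (slab_close NT0 nt (or_introl erefl))|exact: (slab_close NT0 nt (or_intror erefl))].
pose F n := 16 * o ^+ 2 + 8 * (A n + A n.+1).
rewrite (eq_big_nat _ _ (F2 := F)); last first.
  by move=> n /andP[_ nN]; rewrite avgD !avgQ// ?(ltnW nN)// /F; ring.
have [n /andP[na an]] := steps_around (ltW a0) dt0.
have n0a : n.+1%:R * dt NT <= 2 * a by rewrite -natr1 mulrDl mul1r (mulr_natl a 2) mulr2n; exact: (lerD na (ltW d4)).
have n0N : (n.+1 <= NT)%N.
  by apply: (count_le NT0); rewrite dt_NT//; apply: le_trans n0a _; lra.
apply: le_trans (time_sum_split hT NT0 (F := F) (K := 16 * o ^+ 2 + 16 * K) (n0 := n.+1) (n1 := NT) _ _) _.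
- by rewrite n0N leqnn.
- move=> j jN; rewrite /F lerD2l.
  have := HK NT N j NT0 N0 d1 s1 (ltnW jN); have := HK NT N j.+1 NT0 N0 d1 s1 jN.
  by rewrite -/(g j) -/(g j.+1) -/(A j) -/(A j.+1); move: (A j) (A j.+1) => *; lra.
rewrite dt_NT// subrr addr0.
apply: le_trans (_ : T * (16 * o ^+ 2 + 16 * eta) + (16 * o ^+ 2 + 16 * K) * (2 * a) <= _); last first.
  exact: density_budget.
apply: lerD; last first.
  by apply: ler_wpM2l => //; apply: addr_ge0; apply: mulr_ge0 => //; exact: sqr_ge0.
apply: block_sum_le => //; first by rewrite n0N leqnn.
  by apply: addr_ge0; apply: mulr_ge0 => //; [exact: sqr_ge0|exact: ltW].
move=> j /andP[nj jN]; rewrite /F lerD2l.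
have aj k : (n.+1 <= k)%N -> a <= k%:R * dt NT.
  by move=> h; apply: le_trans (ltW an) _; rewrite ler_pM2r// ler_nat.
have := H3 NT N j NT0 N0 d3 s3 (ltnW jN) (aj _ nj); have := H3 NT N j.+1 NT0 N0 d3 s3 jN (aj _ (leqW nj)).
by rewrite -/(g j) -/(g j.+1) -/(A j) -/(A j.+1); move: (A j) (A j.+1) => *; lra.
Qed.

End ConvergenceInNorm.

Section ConvergenceW12.
Context {R : realType} (D : mfg_data R).
Local Notation beta := (beta_ D). Local Notation T := (T_ D).
Local Notation u := (u_ D).
Local Notation dt := (dt D).
Local Notation U := (Ud D).
Local Notation V := (Vx D).
Local Notation uh := (fun NT N => trilin T NT (ud_ D NT N)).
Let hT := hT_ D. Let hsol := hsol_ D.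
Let tu t (ht : 0 <= t <= T) := (sol_periodic hsol ht).1.

Let ltT t : 0 < t < T -> 0 <= t <= T.
Proof. by move=> /andP[h1 h2]; rewrite !ltW. Qed.

Lemma weak_pd_error NT N n t c i : (0 < NT)%N -> (0 < N)%N -> (n < NT)%N -> 0 <= c <= 1 -> 0 < t < T ->
  weak_pd i (fun x => (1 - c) * bilin (ud_ D NT N n) x + c * bilin (ud_ D NT N n.+1) x - u t x)
    (fun x => (1 - c) * dbil i (ud_ D NT N n) x + c * dbil i (ud_ D NT N n.+1) x - pd i (u t) x).
Proof.
move=> NT0 N0 nN /andP[c0 c1] ht; have [C C0 [HC1 HC2]] := u_pd_bound D.
have dx x : derivable (u t) x (evec R i) by have [_ h _] := (sol_C12_u hsol).1 t x ht; exact: h.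
have cb z : continuous (@bilin R N z) by exact: bilin_cont.
have tb z : torus_fun (@bilin R N z) by exact: bilin_torus.
have cu : continuous (u t) by exact: (ucp_continuous (uc_u D) (ltT ht)).
pose s (k : nat) : R := k.+1%:R^-1; have s0 k : 0 < s k by rewrite invr_gt0 ltr0n.
apply: (@weak_pd_quotient _ i _ _ (C + C)).
- move=> x; apply: cvgB; last exact: cu.
  by apply: cvgD; apply: cvgM; try exact: cvg_cst; exact: cb.
- have tt := tu (ltT ht).
  by move=> x; have [-> ->] := tt x; have [-> ->] := tb (ud_ D NT N n) x; have [-> ->] := tb (ud_ D NT N n.+1) x.
- move=> k x; rewrite -/(s k).
  have B j : (j <= NT)%N -> `|bilin (ud_ D NT N j) (x + s k *: evec R i) - bilin (ud_ D NT N j) x| <= C * s k.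
    by move=> jN; apply: bilin_lip => // [|p]; [exact: ltW|exact: HC2].
  have A : `|u t (x + s k *: evec R i) - u t x| <= C * s k.
    have [y _ ->] := line_MVT (s0 k) (fun y _ => dx (x + y *: evec R i)).
    by rewrite normrM (gtr0_norm (s0 k)) ler_pM2r//; exact: HC1.
  have := B n (ltnW nN); have := B n.+1 nN; move: A; rewrite (mulrDl C C).
  move: (C * s k) (u t _) (u t _) (bilin _ _) (bilin _ _) (bilin _ _) (bilin _ _) => L a b d d' f f'.
  rewrite !ler_norml => /andP[h1 h2] /andP[h3 h4] /andP[h5 h6]; apply/andP; split; nra.
- move=> x.
  have Bc z : (fun k : nat => k.+1%:R * (bilin z (x + k.+1%:R^-1 *: evec R i) - bilin z x)) @ \oo --> @dbil R N i z x.
    have [r r0 Hr] := bilin_slope N0 i z x.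
    apply: cvg_near_cst.
    have : \forall k \near \oo, s k < r.
      have := @cvg_harmonic R; move/(@cvgrPdist_lt _ _ _ \oo)/(_ r r0); apply: filterS => k /=.
      by rewrite sub0r normrN gtr0_norm.
    apply: filterS => k sk; rewrite -/(s k) Hr ?sk ?ltW//.
    by rewrite mulrA mulfV// mul1r.
  have Uc := derive_seq (dx x).
  rewrite (_ : (fun k : nat => _) = (fun k : nat =>
    (1 - c) * (k.+1%:R * (bilin (ud_ D NT N n) (x + k.+1%:R^-1 *: evec R i) - bilin (ud_ D NT N n) x)) +
    c * (k.+1%:R * (bilin (ud_ D NT N n.+1) (x + k.+1%:R^-1 *: evec R i) - bilin (ud_ D NT N n.+1) x)) -
    k.+1%:R * (u t (x + k.+1%:R^-1 *: evec R i) - u t x))); last first.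
    apply/funext => k; move: (u t _) (u t _) (bilin _ _) (bilin _ _) (bilin _ _) (bilin _ _) => *; ring.
  apply: cvgB; last exact: Uc.
  by apply: cvgD; apply: cvgM; try exact: cvg_cst; exact: Bc.
Qed.

Lemma W12_slab NT N n t (e : R) (c : 'I_2 -> nat -> int * int -> R) : (0 < NT)%N -> (0 < N)%N -> (n < NT)%N ->
  n%:R * dt NT <= t < n.+1%:R * dt NT -> 0 < t < T -> (forall x, `|u t x - uh NT N t x| <= e) ->
  (forall i n', n' = n \/ n' = n.+1 -> gper N (c i n') /\ forall x p, `|x - nd N p| <= step R N ->
     (pd i (u t) x - Dp N i (U NT N n') p) ^+ 2 <= c i n' p) ->
  (W12_norm (fun x => (uh NT N t x - u t x)%R) <=
    (Num.sqrt (e ^+ 2 + 2 * (avg N (c 0 n) + avg N (c 0 n.+1)) + 2 * (avg N (c 1 n) + avg N (c 1 n.+1)))%R)%:E)%E.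
Proof.
move=> NT0 N0 nN nt ht He Hc; have [s s01 E] := trilin_slab hT NT0 nt.
have h0 : 0 <= step R N by apply: ltW; exact: step_gt0.
pose f x := (1 - s) * bilin (ud_ D NT N n) x + s * bilin (ud_ D NT N n.+1) x - u t x.
have fE : (fun x => uh NT N t x - u t x) = f by apply/funext => x; rewrite /= E.
have cpos i n' : n' = n \/ n' = n.+1 -> forall p, 0 <= c i n' p.
  move=> hn p; apply: le_trans (sqr_ge0 _) ((Hc i n' hn).2 (nd N p) p _).
  by rewrite subrr normr0.
have apos i : 0 <= 2 * (avg N (c i n) + avg N (c i n.+1)).
  by apply: mulr_ge0 => //; apply: addr_ge0; apply: avg_ge0; apply: cpos; [left|right].
have G i : (L2_norm (fun x => (1 - s) * dbil i (ud_ D NT N n) x + s * dbil i (ud_ D NT N n.+1) x - pd i (u t) x)%R ^+ 2 <=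
    (2 * (avg N (c i n) + avg N (c i n.+1)))%R%:E)%E.
  have [pn Hn] := Hc i n (or_introl erefl); have [pn' Hn'] := Hc i n.+1 (or_intror erefl).
  have -> : 2 * (avg N (c i n) + avg N (c i n.+1)) =
      avg N (fun p => (c i n p + c i n (p + ed (1 - i))) + (c i n.+1 p + c i n.+1 (p + ed (1 - i)))).
    by rewrite !avgD !avg_shift//; ring.
  apply: L2_norm_le => // k l x skl; have [c1 c2 c3 _] := corner_near N0 x.
  have cl j : `|x - nd N (corner N x + ed j)| <= step R N by elim/ord2P: j.
  rewrite -sqrrN opprB; apply: le_trans (sq_convex _ _ _ s01) _.
  rewrite -(corner_sq N0 skl); apply: lerD; apply: le_trans (dbil_sq _ _ _ _) _; apply: lerD.
  - exact: Hn.
  - exact: Hn (cl _).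
  - exact: Hn'.
  - exact: Hn' (cl _).
rewrite fE; apply: W12_norm_le; [exact: sqr_ge0|exact: apos|exact: apos| | | |exact: (G 0)|exact: (G 1)].
- exact: weak_pd_error.
- exact: weak_pd_error.
- rewrite -(avg_cst N0 (e ^+ 2)); apply: L2_norm_le => // k l x _.
  rewrite -fE -(real_normK (num_real (_ - _))) distrC ler_pXn2r ?nnegrE//; exact: le_trans (He x).
Qed.

Lemma gradient_budget (o q C a : R) : 0 < q -> 0 <= C -> 0 < a -> o = Num.min 1 (q / (64 * T)) ->
  a <= q / (160 * (1 + 32 * C ^+ 2)) ->
  T * (o ^+ 2 + 16 * o ^+ 2) + 16 * (q / 64) + (o ^+ 2 + 32 * C ^+ 2) * (5 * a) <= q.
Proof.
move=> q0 C0 a0 oE ha.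
have o1 : o <= 1 by rewrite oE ge_min lexx.
have oq : o <= q / (64 * T) by rewrite oE ge_min lexx orbT.
have o0 : 0 <= o by rewrite oE le_min ler01 divr_ge0// ?mulr_ge0// ltW.
have oo : o ^+ 2 <= o by rewrite expr2 ler_piMr.
have C2 : 0 <= C ^+ 2 by exact: sqr_ge0.
have A1 : T * (o ^+ 2 + 16 * o ^+ 2) <= 17 * q / 64.
  have -> : 17 * q / 64 = T * (17 * (q / (64 * T))) by field; rewrite gt_eqF.
  rewrite ler_pM2l//; apply: le_trans (_ : 17 * o ^+ 2 <= _); first by rewrite le_eqVlt; apply/orP; left; apply/eqP; ring.
  by rewrite ler_pM2l// (le_trans oo).
have A2 : (o ^+ 2 + 32 * C ^+ 2) * (5 * a) <= q / 32.
  have K1 : 0 < 1 + 32 * C ^+ 2 by apply: ltr_wpDr => //; exact: mulr_ge0.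
  apply: (@le_trans _ _ ((1 + 32 * C ^+ 2) * (5 * (q / (160 * (1 + 32 * C ^+ 2)))))).
    apply: ler_pM; [|by apply: mulr_ge0 => //; exact: ltW| |by rewrite ler_pM2l].
    - by apply: addr_ge0; [exact: sqr_ge0|exact: mulr_ge0].
    - by rewrite lerD2r (le_trans oo).
  by rewrite le_eqVlt; apply/orP; left; apply/eqP; field; rewrite gt_eqF.
move: A1 A2; move: (T * _) ((o ^+ 2 + _) * _) => x y A1 A2; lra.
Qed.

Lemma sum_two_gradients (d c : R) (G : nat -> R) n0 n1 :
  d * \sum_(n0 <= n < n1) (c + 8 * (G n + G n.+1)) =
  d * \sum_(n0 <= n < n1) c + 8 * (d * \sum_(n0 <= n < n1) G n + d * \sum_(n0 <= n < n1) G n.+1).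
Proof. by rewrite big_split /= -mulr_sumr big_split /=; ring. Qed.

(** The gradients are close in mean square on [[a, T - a]] by [gradient_sum], and bounded on the
rest. *)
Lemma L2W12_norm_cvg : vanishes_as_steps_to_0 T (fun NT N => L2W12_norm T (fun t x => uh NT N t x - u t x)).
Proof.
move=> e e0; pose q := (e / 2) ^+ 2; have q0 : 0 < q by apply: exprn_gt0; exact: divr_gt0.
have [C C0 [HC1 HC2]] := u_pd_bound D.
pose o := Num.min 1 (q / (64 * T)); have oE : o = Num.min 1 (q / (64 * T)) by [].
have o0 : 0 < o by rewrite oE lt_min ltr01 /= divr_gt0// mulr_gt0.
clearbody o.
have K1 : 0 < 1 + 32 * C ^+ 2 by apply: ltr_wpDr => //; apply: mulr_ge0 => //; exact: sqr_ge0.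
have [a [a0 aq aT]] : exists a : R, [/\ 0 < a, a <= q / (160 * (1 + 32 * C ^+ 2)) & a <= T / 8].
  exists (Num.min (q / (160 * (1 + 32 * C ^+ 2))) (T / 8)); rewrite !ge_min !lexx orbT; split=> //.
  by rewrite lt_min !divr_gt0// mulr_gt0.
have bT : T - a < T by rewrite ltrBlDr ltrDl.
have ab : a <= T - a by move: hT aT; lra.
have Cu := sol_C12_u hsol.
have o2 : 0 < o / 2 by exact: divr_gt0.
have [r1 r10 H1] := uh_sup D o0.
have [r2 r20 H2] := uc_pd Cu tu a0 bT 0 o2.
have [r3 r30 H3] := uc_pd Cu tu a0 bT 1 o2.
have [r4 r40 H4] := Dp_consistent Cu tu a0 bT o2.
have [r5 r50 H5] := gradient_sum a0 ab bT (divr_gt0 q0 (ltr0n _ 64)).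
exists (Num.min (Num.min r1 (Num.min r2 r3)) (Num.min (Num.min r4 r5) a)).
  by rewrite !lt_min r10 r20 r30 r40 r50 a0.
move=> NT N NT0 N0; rewrite !lt_min.
move=> /andP[/andP[d1 /andP[d2 d3]] /andP[/andP[_ d5] d6]] /andP[/andP[s1 /andP[s2 s3]] /andP[/andP[s4 s5] _]].
have dt0 := dt_gt0 D NT0.
have clE NT' i j : (0 < NT')%N -> i%:R * dt NT' <= j%:R * dt NT' -> (i <= j)%N.
  by move=> h; rewrite ler_pM2r ?ler_nat// dt_gt0.
have dS n : n.+1%:R * dt NT = n%:R * dt NT + dt NT by rewrite -natr1 mulrDl mul1r.
have da : dt NT < a by [].
have [k /andP[ka ak]] := steps_around (ltW a0) dt0.
have b0 : 0 <= T - a by rewrite subr_ge0 (le_trans aT)// ler_pdivrMr// ler_peMr ?ler1n// ltW.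
have [n1 /andP[nb bn]] := steps_around b0 dt0.
have k1a : a <= k.+1%:R * dt NT by exact: ltW.
have k2a : k.+2%:R * dt NT <= 3 * a by rewrite !dS; move: ka da; move: (k%:R * dt NT) (dt NT); clear -D => x y *; lra.
have n1a : T - n1%:R * dt NT <= 2 * a by move: bn da; rewrite dS; move: (n1%:R * dt NT) (dt NT); clear -D => x y *; lra.
have kn : (k.+2 <= n1)%N.
  apply: (clE NT _ _ NT0); move: k2a n1a aT; move: (_ * dt NT) (_ * dt NT); clear -D a0 => x y *; lra.
have n1N : (n1 <= NT)%N.
  by apply: (clE NT _ _ NT0); rewrite dt_NT//; apply: le_trans nb _; rewrite ltW.
pose G n := avg N (fun p => nsq (fun k => Pv N (U NT N n) p k - Pv N (V NT N n) p k)).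
have G0 n : 0 <= G n by apply: avg_ge0 => p; exact: nsq_ge0.
pose F n := if (k.+2 <= n < n1)%N then o ^+ 2 + 16 * o ^+ 2 + 8 * (G n + G n.+1) else o ^+ 2 + 32 * C ^+ 2.
(* the minimum with the crude bound makes this bound valid for all steps, on the block too *)
pose S n := if (n < NT)%N then Num.min (F n) (o ^+ 2 + 32 * C ^+ 2) else 0.
have Cge : 0 <= o ^+ 2 + 32 * C ^+ 2 by apply: addr_ge0; [exact: sqr_ge0|apply: mulr_ge0 => //; exact: sqr_ge0].
have F0 n : 0 <= F n.
  rewrite /F; case: ifP => // _; apply: addr_ge0; first by apply: addr_ge0; [exact: sqr_ge0|apply: mulr_ge0 => //; exact: sqr_ge0].
  by apply: mulr_ge0 => //; apply: addr_ge0; exact: G0.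
have S0 n : 0 <= S n by rewrite /S; case: ifP => // _; rewrite le_min F0.
have pU n : gper N (U NT N n) by exact: gper_U.
have slabN n n' : (n < NT)%N -> n' = n \/ n' = n.+1 -> (n' <= NT)%N by move=> h [->|->] //; exact: ltnW.
apply: (@le_lt_trans _ _ (e / 2)%:E); last by rewrite lte_fin ltr_pdivrMr// ltr_pMr// ltr1n.
apply: (L2W12_le hT NT0 _ S0); first by rewrite divr_ge0 ?ltW.
  move=> n t nN nt ht; have He x : `|u t x - uh NT N t x| <= o by exact: (H1 NT N t x NT0 N0 d1 s1 (ltT ht)).
  have coarse : (W12_norm (fun x => (uh NT N t x - u t x)%R) <= (Num.sqrt (o ^+ 2 + 32 * C ^+ 2)%R)%:E)%E.
    apply: le_trans (W12_slab (c := fun _ _ _ => (C + C) ^+ 2) NT0 N0 nN nt ht He _) _.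
      move=> i n' hn; split=> // x p _; rewrite -(real_normK (num_real (_ - _))) ler_pXn2r ?nnegrE ?addr_ge0//.
      by apply: le_trans (ler_normB _ _) _; apply: lerD; [exact: HC1|exact: HC2 (slabN _ _ nN hn)].
    rewrite lee_fin !avg_cst// le_eqVlt; apply/orP; left; apply/eqP; congr (Num.sqrt _); ring.
  rewrite /S nN; case: (leP (F n) _) => // _; rewrite /F; case: ifP => // /andP[kn0 nn1].
  pose c (i : 'I_2) n' p := 2 * o ^+ 2 + 2 * (Dp N i (fun q => U NT N n' q - V NT N n' q) p) ^+ 2.
  have pV n' : n' = n \/ n' = n.+1 -> gper N (V NT N n') by move=> hn; apply: gper_Vx => //; exact: slabN hn.
  have tab n' : n' = n \/ n' = n.+1 -> a <= n'%:R * dt NT <= T - a.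
    move=> hn; have [h1 h2] : (k.+1 <= n')%N /\ (n' <= n1)%N.
      by case: hn => ->; split=> //; [exact: ltnW|exact: ltnW|exact: leqW (ltnW kn0)].
    apply/andP; split; [apply: le_trans k1a _|apply: le_trans nb]; by rewrite ler_pM2r// ler_nat.
  have ta : a <= t <= T - a.
    case/andP: nt => h1 h2; apply/andP; split.
      by apply: le_trans h1; case/andP: (tab n (or_introl erefl)).
    by apply: le_trans (ltW h2) _; case/andP: (tab n.+1 (or_intror erefl)).
  have pc i n' : n' = n \/ n' = n.+1 -> gper N (c i n').
    move=> hn; apply: (gper_comp2 (fun x _ => 2 * o ^+ 2 + 2 * x ^+ 2) (w := fun=> 0)) => //.
    by apply: gper_Dp; apply: gperB; [exact: pU|exact: pV].
  apply: le_trans (W12_slab (c := c) NT0 N0 nN nt ht He _) _.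
    move=> i n' hn; split; first exact: pc.
    move=> x p xp; rewrite /c.
    have -> : Dp N i (fun q => U NT N n' q - V NT N n' q) p = Dp N i (U NT N n') p - Dp N i (V NT N n') p.
      by rewrite /Dp -mulrBl; congr (_ * _); ring.
    apply: sq_split; have [D1 _] := H4 N (n'%:R * dt NT) i p N0 s4 (tab n' hn).
    apply: le_trans (ler_distD (pd i (u (n'%:R * dt NT)) (nd N p)) _ _) _.
    have -> : o = o / 2 + o / 2 by field.
    apply: lerD; last by rewrite distrC; exact: D1.
    have tn : `|t - n'%:R * dt NT| <= dt NT by exact: (slab_close NT0 nt hn).
    clear D1; elim/ord2P: i; apply: ltW.
      by apply: H2 => //; [exact: tab|exact: le_lt_trans tn d2|exact: le_lt_trans xp s2].
    by apply: H3 => //; [exact: tab|exact: le_lt_trans tn d3|exact: le_lt_trans xp s3].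
  rewrite lee_fin ler_wsqrtr// -addrA -addrA lerD2l.
  have cE n' : n' = n \/ n' = n.+1 -> avg N (c 0 n') + avg N (c 1 n') <= 4 * o ^+ 2 + 4 * G n'.
    move=> hn; have := Dp_diff_Pv (pU n') (pV n' hn); rewrite sum2E -/(G n').
    rewrite /c !avgD !avg_cst// !avgZ; move: (avg _ _) (avg _ _) (G n') (o ^+ 2); clear -D => x y g z h; lra.
  move: (cE n (or_introl erefl)) (cE n.+1 (or_intror erefl)).
  move: (avg _ (c 0 n)) (avg _ (c 1 n)) (avg _ (c 0 n.+1)) (avg _ (c 1 n.+1)) (G n) (G n.+1) (o ^+ 2); clear -D => *; lra.
apply: le_trans (time_sum_split hT NT0 (F := S) (K := o ^+ 2 + 32 * C ^+ 2) (n0 := k.+2) (n1 := n1) _ _) _.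
- by rewrite kn.
- by move=> n nN; rewrite /S nN ge_min lexx orbT.
apply: le_trans (_ : T * (o ^+ 2 + 16 * o ^+ 2) + 16 * (q / 64) + (o ^+ 2 + 32 * C ^+ 2) * (5 * a) <= _); last exact: gradient_budget.
apply: lerD; last first.
  by apply: ler_wpM2l => //; move: k2a n1a; move: (_ * dt NT) (_ - _); clear -D => x y *; lra.
have GS : dt NT * \sum_(k.+1 <= n < n1) G n.+1 <= q / 64.
  by apply: (H5 NT N k.+1 n1) => //; rewrite (ltnW kn).
have GS1 : \sum_(k.+2 <= n < n1) G n.+1 <= \sum_(k.+1 <= n < n1) G n.+1.
  exact: sum_nat_sub.
have GS2 : \sum_(k.+2 <= n < n1) G n <= \sum_(k.+1 <= n < n1) G n.+1.
  rewrite big_add1; apply: sum_nat_sub => //; last exact: leq_pred.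
  by rewrite -ltnS (leq_trans kn)// leqSpred.
apply: (@le_trans _ _ (dt NT * \sum_(k.+2 <= n < n1) (o ^+ 2 + 16 * o ^+ 2) +
   8 * (dt NT * \sum_(k.+2 <= n < n1) G n + dt NT * \sum_(k.+2 <= n < n1) G n.+1))).
  rewrite -sum_two_gradients ler_pM2l// big_nat [leRHS]big_nat.
  apply: ler_sum => n kn1; rewrite /S (leq_trans _ n1N); last by case/andP: kn1.
  by rewrite ge_min /F kn1 lexx.
apply: lerD.
  apply: block_sum_le => //; first by rewrite kn.
  by apply: addr_ge0; [exact: sqr_ge0|apply: mulr_ge0 => //; exact: sqr_ge0].
have : dt NT * \sum_(k.+2 <= n < n1) G n <= q / 64 by apply: le_trans GS; rewrite ler_pM2l.
have : dt NT * \sum_(k.+2 <= n < n1) G n.+1 <= q / 64 by apply: le_trans GS; rewrite ler_pM2l.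
by move: (dt NT * _) (dt NT * _) (q / 64); clear -D => x y z *; lra.
Qed.

End ConvergenceW12.

Theorem theorem4 (R : realType) (beta nu T : R)
    (hbeta : 1 < beta < 2) (hnu : 0 < nu) (hT : 0 < T)
    (Hc : R * R -> R) (hHc : torus_fun Hc /\ is_Ck 1 Hc)
    (u0 mT : R * R -> R)
    (hu0 : torus_fun u0 /\ smooth u0)
    (hmT : torus_fun mT /\ smooth mT)
    (hmT_density : is_density mT)
    (hmT_pos : exists2 c : R, 0 < c & forall x, c <= mT x)
    (Phi : probability (mplane R) R -> R * R -> R)
    (hPhi_monotone : monotone_coupling Phi)
    (hPhi_smoothing : smoothing_coupling Phi)
    (u m : R -> R * R -> R)
    (hsol : classical_solution T nu beta Hc u0 mT Phi u m)
    (hm_pos : forall t x, 0 <= t <= T -> 0 < m t x)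
    (Phih : forall N : nat, 'M[R]_N -> 'M[R]_N)
    (hPhih1 : Phih1 Phih) (hPhih2 : Phih2 Phih)
    (hPhih3 : Phih3 Phih) (hPhih4 : Phih4 Phih Phi)
    (ud md : forall NT N : nat, nat -> 'M[R]_N)
    (hdsol : forall NT N : nat, (0 < NT)%N -> (0 < N)%N ->
       discrete_solution Hc beta nu T u0 mT (Phih N) NT (ud NT N) (md NT N)) :
  let uh := fun NT N => trilin T NT (ud NT N) in
  let mh := fun NT N => trilin T NT (md NT N) in
  [/\ vanishes_as_steps_to_0 T (fun NT N =>
        sup_norm_TQ T (fun t x => uh NT N t x - u t x)),
      vanishes_as_steps_to_0 T (fun NT N =>
        L2W12_norm T (fun t x => uh NT N t x - u t x)) &
      vanishes_as_steps_to_0 T (fun NT N =>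
        L2_norm_TQ T (fun t x => mh NT N t x - m t x))].
Proof.
pose D := MfgData hbeta hnu hT hHc hu0 hmT hsol hm_pos (let: And4 h _ _ _ := hPhi_smoothing in h)
  hPhih2 hPhih3 hPhih4 hdsol.
split; [exact: (sup_norm_cvg D)|exact: (L2W12_norm_cvg D)|exact: (L2_norm_cvg D)].
Qed.
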